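(* Let $K$ be a number field with discriminant $\mathrm{disc}(K)$. Then there exists a finite set $\Sigma_K$ of powers of primes $\ell$ dividing $2\cdot\mathrm{disc}(K)$ such that for every elliptic curve $E/K$ and for every prime power $\ell^k>1$ with $\ell^k\notin\Sigma_K$, the torsion closure $T_{E/K}$ has infinite $\ell^k$-rank.
   Context: For an elliptic curve $E$ over a number field $K$, the torsion closure $T_{E/K}=\prod_{\mathfrak{p}\le\infty}T_\mathfrak{p}$ is the product over all finite and infinite primes $\mathfrak{p}$ of $K$ of the following finite groups: for $\mathfrak{p}$ finite, $T_\mathfrak{p}=E(K_\mathfrak{p})^{\mathrm{tor}}$ is the (finite) torsion subgroup of the group of points over the completion $K_\mathfrak{p}$; for $\mathfrak{p}$ real such that the discriminant $\Delta_E$ of $E$ is positive under the real embedding $\mathfrak{p}:K\to\mathbf{R}$, $T_\mathfrak{p}=\mathbf{Z}/2\mathbf{Z}$; for all other $\mathfrak{p}$, $T_\mathfrak{p}=1$. $\ell^k$-rank: every group $T$ that is a countable product of finite abelian groups has a standard representation $T\cong\prod_{\ell\text{ prime}}\prod_{k=1}^\infty(\mathbf{Z}/\ell^k\mathbf{Z})^{e(\ell^k)}$, where each exponent $e(\ell^k)$ is either a non-negative integer or countably infinite (then written $\omega$, with $(\mathbf{Z}/\ell^k\mathbf{Z})^\omega$ denoting the group of all functions $\mathbf{Z}_{>0}\to\mathbf{Z}/\ell^k\mathbf{Z}$). The exponents are invariants of $T$; $e(\ell^k)$ is called the $\ell^k$-rank of $T$. (It is finite if and only if $T[\ell^k]/(T[\ell^{k-1}]+\ell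 T[\ell^{k+1}])$ has finite dimension over $\mathbf{F}_\ell$, and it then equals that dimension.) *)

(* Defs.v *)
From HB Require Import structures.
From mathcomp Require Import all_boot all_order all_algebra all_field.
From mathcomp Require Import ring.
From mathcomp Require Import boolp classical_sets functions reals.
From mathcomp Require Import complex.

Set Implicit Arguments.
Unset Strict Implicit.
Unset Printing Implicit Defensive.

Import Order.TTheory GRing.Theory Num.Theory.
Local Open Scope ring_scope.

Section Discriminant.
Variable K : fieldExtType rat.

Definition trace (x : K) : rat :=
  let b := vbasis {:K} in \tr (\matrix_(i, j) coord b j (x * b`_i)).

Definition integral_basis (b : (\dim {:K}).-tuple K) : Prop :=
  basis_of {:K} b /\
  forall x : K, integralOver (intr : int -> K) x <->
    exists c : 'I_(\dim {:K}) -> int, x = \sum_(i < \dim {:K}) b`_i *~ c i.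

(* An integral basis exists and [d] does not depend on it, so the default
   value [0] is never used. *)
Definition disc : int :=
  xget 0 [set d : int | exists2 b, integral_basis b &
    d%:~R = \det (\matrix_(i < \dim {:K}, j < \dim {:K}) trace (b`_i * b`_j))].

End Discriminant.

(* A finite prime of K is a class of equivalent non-trivial non-archimedean
   valuations of K; it is represented by its unique normalized member
   [ord : K^* ->> Z].  The equation [ord 0 = 0] is a mere convention (the order
   of 0 should be +oo), which makes each prime occur exactly once in the type. *)
Record finite_prime (K : fieldType) := FinitePrime {
  ord :> K -> int;
  ord0 : ord 0 = 0;
  ordM : forall x y, x != 0 -> y != 0 -> ord (x * y) = ord x + ord y;
  ordD : forall x y, x != 0 -> y != 0 -> x + y != 0 ->
    Num.min (ord x) (ord y) <= ord (x + y);
  ord_uniformizer : exists2 x, x != 0 & ord x = 1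
}.

Section Completion.
Variables (K : fieldType) (p : finite_prime K).

Definition ord_ge (n : int) (x : K) : bool := (x == 0) || (n <= p x).

Lemma ord_ge0 n : ord_ge n 0.
Proof. by rewrite /ord_ge eqxx. Qed.

Lemma ord_geW m n x : m <= n -> ord_ge n x -> ord_ge m x.
Proof.
by move=> mn /orP[/eqP->|nx]; rewrite /ord_ge ?eqxx ?(le_trans mn nx) ?orbT.
Qed.

Lemma ord_geD n x y : ord_ge n x -> ord_ge n y -> ord_ge n (x + y).
Proof.
rewrite /ord_ge; have [->|x0] := eqVneq x 0; first by rewrite add0r.
have [->|y0] := eqVneq y 0; first by rewrite addr0 (negPf x0).
have [//|xy0 /= nx ny] := eqVneq (x + y) 0.
by apply: le_trans (ordD p x0 y0 xy0); rewrite le_min nx.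
Qed.

Lemma ord1 : p 1 = 0.
Proof.
have /esym := ordM p (oner_neq0 K) (oner_neq0 K).
by rewrite mulr1 -[RHS]addr0 => /addrI.
Qed.

Lemma ordN1 : p (-1) = 0.
Proof.
have n0 : -1 != 0 :> K by rewrite oppr_eq0 oner_eq0.
have := ordM p n0 n0; rewrite mulrNN mulr1 ord1 => /esym/eqP.
by rewrite -mulr2n mulrn_eq0 => /eqP.
Qed.

Lemma ordN x : p (- x) = p x.
Proof.
have [->|x0] := eqVneq x 0; first by rewrite oppr0.
by rewrite -mulN1r ordM ?oppr_eq0 ?oner_eq0 // ordN1 add0r.
Qed.

Lemma ord_geN n x : ord_ge n (- x) = ord_ge n x.
Proof. by rewrite /ord_ge oppr_eq0 ordN. Qed.

Lemma ord_geB n x y : ord_ge n x -> ord_ge n y -> ord_ge n (x - y).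
Proof. by move=> nx ny; apply: ord_geD; rewrite ?ord_geN. Qed.

Lemma ord_geM m n x y : ord_ge m x -> ord_ge n y -> ord_ge (m + n) (x * y).
Proof.
rewrite /ord_ge mulf_eq0; have [//|x0] := eqVneq x 0.
have [//|y0 /= mx ny] := eqVneq y 0.
by rewrite ordM // lerD.
Qed.

Lemma ordV x : x != 0 -> p x^-1 = - p x.
Proof.
move=> x0; have := ordM p x0 (invr_neq0 x0).
by rewrite divff // ord1 => /esym/eqP; rewrite addrC addr_eq0 => /eqP.
Qed.

Definition cauchy : {pred nat -> K} := fun u =>
  `[< forall n : int, exists N : nat, forall i j : nat,
        (N <= i)%N -> (N <= j)%N -> ord_ge n (u i - u j) >].

Lemma cauchy_bounded u : u \in cauchy ->
  exists (m : int) (N : nat), forall i : nat, (N <= i)%N -> ord_ge m (u i).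
Proof.
move=> /asboolP /(_ 0)[N uN]; exists (Num.min 0 (p (u N))), N => i Ni.
rewrite -[u i](subrK (u N)); apply: ord_geD.
  by apply: ord_geW (uN _ _ Ni (leqnn _)); rewrite ge_min lexx.
by rewrite /ord_ge ge_min lexx !orbT.
Qed.

Lemma cauchy_subring : subring_closed cauchy.
Proof.
split.
- by apply/asboolP => n; exists 0%N => i j _ _; rewrite subrr ord_ge0.
- move=> u v /asboolP uC /asboolP vC; apply/asboolP => n.
  have [[N uN] [M vM]] := (uC n, vC n); exists (maxn N M) => i j.
  rewrite !geq_max => /andP[Ni Mi] /andP[Nj Mj].
  rewrite [X in ord_ge n X](_ : _ = (u i - u j) - (v i - v j)).
    by apply: ord_geB; [exact: uN | exact: vM].
  by rewrite addrfctE opprfctE; ring.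
- move=> u v uC vC; have [mu [Nu uB]] := cauchy_bounded uC.
  have [mv [Nv vB]] := cauchy_bounded vC.
  move: uC vC => /asboolP uC /asboolP vC; apply/asboolP => n.
  have [[N uN] [M vM]] := (uC (n - mv), vC (n - mu)).
  exists (maxn (maxn N M) (maxn Nu Nv)) => i j.
  rewrite !geq_max => /andP[/andP[Ni Mi] /andP[Nui Nvi]].
  move=> /andP[/andP[Nj Mj] /andP[Nuj Nvj]].
  rewrite [X in ord_ge n X](_ : _ = u i * (v i - v j) + (u i - u j) * v j).
    apply: ord_geD.
      by rewrite -(subrKC mu n); apply: ord_geM; [exact: uB | exact: vM].
    by rewrite -(subrK mv n); apply: ord_geM; [exact: uN | exact: vB].
  by rewrite mulrfctE; ring.
Qed.

HB.instance Definition _ :=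
  GRing.isSubringClosed.Build (nat -> K) cauchy cauchy_subring.

Record cauchy_seq := CauchySeq { seq_fun :> nat -> K; _ : seq_fun \in cauchy }.

HB.instance Definition _ := [isSub for seq_fun].
HB.instance Definition _ := [Choice of cauchy_seq by <:].
HB.instance Definition _ := [SubChoice_isSubComNzRing of cauchy_seq by <:].

Definition null_seq : {pred cauchy_seq} := fun u =>
  `[< forall n : int, exists N : nat, forall i : nat,
        (N <= i)%N -> ord_ge n (u i) >].

Lemma null_seq_ideal : idealr_closed null_seq.
Proof.
split.
- by apply/asboolP => n; exists 0%N => i _; rewrite ord_ge0.
- apply/negP => /asboolP /(_ 1)[N /(_ N (leqnn _)) h].
  have : ord_ge 1 1 by exact: h.
  by rewrite /ord_ge oner_eq0 ord1.
- move=> a u v /asboolP uN /asboolP vN; apply/asboolP => n.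
  have [m [Na aB]] := cauchy_bounded (valP a).
  have [[N uM] [M vM]] := (uN (n - m), vN n).
  exists (maxn Na (maxn N M)) => i; rewrite !geq_max => /and3P[Nai Ni Mi].
  apply: (@ord_geD n (a i * u i) (v i)); last exact: vM.
  by rewrite -(subrKC m n); apply: ord_geM; [exact: aB | exact: uM].
Qed.

HB.instance Definition _ := isIdealr.Build cauchy_seq null_seq null_seq_ideal.

Lemma completion_inv_subproof (x : {ideal_quot null_seq}) :
  exists y, x != 0 -> y * x = 1.
Proof.
have [->|x0] := eqVneq x 0; first by exists 0.
elim/quotW: x x0 => u; rewrite -(rmorph0 (\pi_{ideal_quot null_seq}%qT)).
rewrite -Quotient.idealrBE subr0 => /asboolPn/existsNP[n uN].
have [N uC] := asboolP _ (valP u) n.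
have [i0 Ni0 ui0] : exists2 i0, (N <= i0)%N & ~~ ord_ge n (u i0).
  by apply: contrapT => h; apply: uN; exists N => i Ni; apply/negPn/negP => ui;
     apply: h; exists i.
have ord_u i : (N <= i)%N -> u i != 0 /\ p (u i) < n.
  move=> Ni; have : ~~ ord_ge n (u i).
    apply: contra ui0 => ui; rewrite -[u i0](subrK (u i)).
    by apply: ord_geD ui; exact: uC.
  by rewrite /ord_ge negb_or -ltNge => /andP[].
have inv_u i : (N <= i)%N -> ord_ge (- n) (u i)^-1.
  move=> /ord_u[ui0' ui]; rewrite /ord_ge ordV // lerN2 (ltW ui) orbT.
  by [].
have wC : (fun i => (u i)^-1) \in cauchy.
  apply/asboolP => t; have [M uM] := asboolP _ (valP u) (t + n + n).
  exists (maxn N M) => i j; rewrite !geq_max => /andP[Ni Mi] /andP[Nj Mj].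
  have [[ui _] [uj _]] := (ord_u i Ni, ord_u j Nj).
  rewrite (_ : _ - _ = (u j - u i) * (u i)^-1 * (u j)^-1); last first.
    by field; rewrite ui uj.
  rewrite (_ : t = (t + n + n) + - n + - n); last by ring.
  by do 2?[apply: ord_geM; last exact: inv_u]; exact: uM.
exists (\pi_{ideal_quot null_seq}%qT (CauchySeq wC)) => _.
rewrite -rmorphM -(rmorph1 (\pi_{ideal_quot null_seq}%qT)).
apply/eqP; rewrite -Quotient.idealrBE; apply/asboolP => t; exists N => i Ni.
apply: (@ord_geW t t ((u i)^-1 * u i - 1)) => //.
by rewrite mulVf ?subrr ?ord_ge0 //; have [] := ord_u i Ni.
Qed.

Definition completion := {ideal_quot null_seq}.
HB.instance Definition _ := GRing.ComNzRing.on completion.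

Definition completion_inv (x : completion) : completion :=
  if x == 0 then 0 else sval (cid (completion_inv_subproof x)).

Lemma completion_mulVf (x : completion) : x != 0 -> completion_inv x * x = 1.
Proof.
by move=> x0; rewrite /completion_inv ifN //; case: cid => y /= /(_ x0).
Qed.

Lemma completion_inv0 : completion_inv 0 = 0.
Proof. by rewrite /completion_inv ifT. Qed.

HB.instance Definition _ := GRing.ComNzRing_isField.Build completion
  completion_mulVf completion_inv0.

Lemma const_cauchy (x : K) : (fun=> x) \in cauchy.
Proof. by apply/asboolP => n; exists 0%N => i j _ _; rewrite subrr ord_ge0. Qed.

Definition to_completion (x : K) : completion :=
  (\pi_{ideal_quot null_seq} (CauchySeq (const_cauchy x)))%qT.

Lemma to_completion_is_zmod : zmod_morphism to_completion.
Proof.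
move=> x y; rewrite /to_completion -rmorphB; congr (\pi_ _ _)%qT.
exact: val_inj.
Qed.

Lemma to_completion_is_monoid : monoid_morphism to_completion.
Proof.
split; first by rewrite -[RHS](rmorph1 (\pi_{ideal_quot null_seq}%qT));
  congr (\pi_ _ _)%qT; exact: val_inj.
move=> x y; rewrite /to_completion -rmorphM; congr (\pi_ _ _)%qT.
exact: val_inj.
Qed.

HB.instance Definition _ :=
  GRing.isZmodMorphism.Build K completion to_completion to_completion_is_zmod.
HB.instance Definition _ := GRing.isMonoidMorphism.Build K completion
  to_completion to_completion_is_monoid.

End Completion.

(* An infinite prime is represented by its archimedean absolute value, so that
   conjugate complex embeddings give the same prime. *)
Record infinite_prime (R : realType) (K : fieldType) := InfinitePrime {
  absv :> K -> R;
  absvP : exists sigma : {rmorphism K -> R[i]},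
    forall x, absv x = complex.Re `|sigma x|
}.

Record weierstrass (F : Type) := Weierstrass {
  ca1 : F; ca2 : F; ca3 : F; ca4 : F; ca6 : F
}.

Definition map_weierstrass (F L : Type) (f : F -> L) (W : weierstrass F) :=
  Weierstrass (f (ca1 W)) (f (ca2 W)) (f (ca3 W)) (f (ca4 W)) (f (ca6 W)).

Section Points.
Variables (F : fieldType) (W : weierstrass F).
Local Notation a1 := (ca1 W).
Local Notation a2 := (ca2 W).
Local Notation a3 := (ca3 W).
Local Notation a4 := (ca4 W).
Local Notation a6 := (ca6 W).

Definition discriminant : F :=
  let b2 := a1 ^+ 2 + 4 * a2 in
  let b4 := 2 * a4 + a1 * a3 in
  let b6 := a3 ^+ 2 + 4 * a6 in
  let b8 := a1 ^+ 2 * a6 + 4 * a2 * a6 - a1 * a3 * a4 + a2 * a3 ^+ 2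
            - a4 ^+ 2 in
  - b2 ^+ 2 * b8 - 8 * b4 ^+ 3 - 27 * b6 ^+ 2 + 9 * b2 * b4 * b6.

(* [None] is the point at infinity *)
Definition on_curve (P : option (F * F)) : bool :=
  if P is Some (x, y)
  then y ^+ 2 + a1 * x * y + a3 * y == x ^+ 3 + a2 * x ^+ 2 + a4 * x + a6
  else true.

Definition slope (x1 y1 x2 y2 : F) : F :=
  if x1 == x2
  then (3 * x1 ^+ 2 + 2 * a2 * x1 + a4 - a1 * y1) / (2 * y1 + a1 * x1 + a3)
  else (y2 - y1) / (x2 - x1).

Definition add_coords (P Q : option (F * F)) : option (F * F) :=
  match P, Q with
  | None, _ => Q
  | _, None => P
  | Some (x1, y1), Some (x2, y2) =>
    if (x1 == x2) && (y1 + y2 + a1 * x2 + a3 == 0) then None else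
    let lam := slope x1 y1 x2 y2 in
    let x3 := lam ^+ 2 + a1 * lam - a2 - x1 - x2 in
    let y3 := - (lam + a1) * x3 - (y1 - lam * x1) - a3 in
    Some (x3, y3)
  end.

Lemma add_on_curve P Q : on_curve P -> on_curve Q -> on_curve (add_coords P Q).
Proof.
case: P => [[x1 y1]|//]; case: Q => [[x2 y2]|//] /eqP e1 /eqP e2.
rewrite /add_coords /slope; case: eqVneq => [e12|n12] /=; last first.
  have d0 : x2 - x1 != 0 by rewrite subr_eq0 eq_sym.
  set lam := _ / _; have lamE : y2 = y1 + lam * (x2 - x1).
    by rewrite /lam divfK // addrC subrK.
  move: lam lamE => lam y2E; subst y2; rewrite -subr_eq0.
  set x3 := _ - x2; set y3 := _ - a3; apply/eqP/(mulfI d0); rewrite mulr0.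
  transitivity
    ((x3 - x1) * ((y1 + lam * (x2 - x1)) ^+ 2
        + a1 * x2 * (y1 + lam * (x2 - x1)) + a3 * (y1 + lam * (x2 - x1))
        - (x2 ^+ 3 + a2 * x2 ^+ 2 + a4 * x2 + a6))
     + (x2 - x3) * (y1 ^+ 2 + a1 * x1 * y1 + a3 * y1
        - (x1 ^+ 3 + a2 * x1 ^+ 2 + a4 * x1 + a6))).
    by rewrite /y3 /x3; ring.
  by rewrite e1 e2 !subrr !mulr0 addr0.
subst x2; case: ifPn => //= n0.
have y12 : y1 = y2.
  have /eqP : (y1 - y2) * (y1 + y2 + a1 * x1 + a3) = 0.
    by rewrite -[RHS](subrr (y1 ^+ 2 + a1 * x1 * y1 + a3 * y1)) {2}e1 -e2; ring.
  by rewrite mulf_eq0 (negPf n0) orbF subr_eq0 => /eqP.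
subst y2; set lam := _ / _.
have lamE : lam * (2 * y1 + a1 * x1 + a3)
            = 3 * x1 ^+ 2 + 2 * a2 * x1 + a4 - a1 * y1.
  by rewrite /lam divfK //; move: n0; congr (_ != _); ring.
move: lam lamE => lam lamE; rewrite -subr_eq0.
set x3 := _ - x1; set y3 := _ - a3; apply/eqP.
transitivity
  ((y1 ^+ 2 + a1 * x1 * y1 + a3 * y1
     - (x1 ^+ 3 + a2 * x1 ^+ 2 + a4 * x1 + a6))
   + (x3 - x1) * (lam * (2 * y1 + a1 * x1 + a3)
     - (3 * x1 ^+ 2 + 2 * a2 * x1 + a4 - a1 * y1))).
  by rewrite /y3 /x3; ring.
by rewrite e1 lamE !subrr mulr0 addr0.
Qed.

Record point := Point { coords :> option (F * F); _ : on_curve coords }.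
HB.instance Definition _ := [isSub for coords].

Definition point_add (P Q : point) : point :=
  Point (add_on_curve (valP P) (valP Q)).

Definition point_zero : point := @Point None isT.

Definition point_torsion : set point :=
  [set P | exists2 n : nat, (0 < n)%N &
    iter n (point_add P) point_zero = point_zero].

End Points.

Record elliptic_curve (F : fieldType) := EllipticCurve {
  ec_model :> weierstrass F;
  ec_smooth : discriminant ec_model != 0
}.

Section TorsionClosure.
Variables (R : realType) (K : fieldExtType rat) (E : elliptic_curve K).

Definition local_points (p : finite_prime K) : Type :=
  point (map_weierstrass (@to_completion K p) E).

Definition real_positive (p : infinite_prime R K) : Prop :=
  exists tau : {rmorphism K -> R},
    (forall x, p x = `|tau x|) /\ 0 < tau (discriminant E).

(* The torsion closure is a subset of the following product; at an infinite
   prime the local factor is all of Z/2Z or only its zero element. *)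
Definition adelic_product : Type :=
  ((forall p : finite_prime K, local_points p)
   * (infinite_prime R K -> 'Z_2))%type.

Definition adelic_add (x y : adelic_product) : adelic_product :=
  (fun p => point_add (x.1 p) (y.1 p), fun p => x.2 p + y.2 p).

Definition torsion_closure : set adelic_product :=
  [set x | (forall p, point_torsion (x.1 p)) /\
           (forall p, ~ real_positive p -> x.2 p = 0)].

End TorsionClosure.

(* the prime powers [l ^ k > 1], as pairs [(l, k)] *)
Definition prime_power := {q : nat * nat | prime q.1 && (0 < q.2)%N}.
Definition pp_prime (q : prime_power) : nat := (val q).1.
Definition pp_exp (q : prime_power) : nat := (val q).2.

(* [Some n] stands for the finite exponent n, [None] for omega *)
Definition exponent := option nat.

Definition exponent_index (r : exponent) : Type :=
  if r is Some n then 'I_n else nat.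

Definition standard_group (e : prime_power -> exponent) : Type :=
  forall q : prime_power, exponent_index (e q) -> 'Z_(pp_prime q ^ pp_exp q).

(* [(T, add)], for a subset [T] of [G], is a group isomorphic to the standard
   group with exponents [e].  No group axioms are assumed of [add]: they hold on
   [T] because [phi] transports them from a product of cyclic groups. *)
Definition standard_representation (G : Type) (add : G -> G -> G) (T : set G)
    (e : prime_power -> exponent) : Prop :=
  exists phi : G -> standard_group e,
    set_bij T setT phi /\
    forall x y, T x -> T y ->
      T (add x y) /\ forall q i, phi (add x y) q i = phi x q i + phi y q i.

Definition rank_is (G : Type) (add : G -> G -> G) (T : set G)
    (q : prime_power) (r : exponent) : Prop :=
  exists2 e, standard_representation add T e & e q = r.

Definition infinite_rank (G : Type) (add : G -> G -> G) (T : set G)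
    (q : prime_power) : Prop := rank_is add T q None.

(* Main.v *)
(* If E(K_P) has no cyclic factor of order l^k then full l^k-torsion over K_P
   forces full l^(k+1)-torsion.  So let L be K(E[l^k]) and M be K(E[l^(k+1)]).
   Off a finite set of (l, k) an automorphism of algC fixing L moves M: if l does
   not divide 2 disc(K), it is a power of one whose determinant on E[l], given by
   the Weil pairing, is not a square.  Counting ideals with weights 1/norm gives
   infinitely many primes of L not split completely in M: otherwise pairs of
   ideals of L would lift to so many ideals of M that the sum over M would exceed
   its logarithmic upper bound.  Each gives a prime P with E[l^k] in E(K_P) but
   not E[l^(k+1)], which contributes Z/l^k to the torsion closure.  The torsion
   of E(K_P) is finite because torsion points have bounded denominators and
   distinct ones stay apart P-adically. *)
Require Import Defs.
From HB Require Import structures.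
From mathcomp Require Import all_boot all_order all_algebra all_field.
From mathcomp Require Import ring lra zify.
From mathcomp Require Import boolp.

Set Implicit Arguments.
Unset Strict Implicit.
Unset Printing Implicit Defensive.

Import Order.TTheory GRing.Theory Num.Theory.
Local Open Scope ring_scope.

(** The counting takes the place of a density theorem. An ideal of L is seen only as a pair (m, t)
    with m squarefree and m dividing f(t), where f is the minimal polynomial of an integral
    generator of L: a product of primes of degree one over distinct rational primes. Such pairs can
    be counted inside Z[x]/f with determinants and pigeonholes alone. If almost all of these primes
    had two lifts to M, a coprime pair of ideals would be coded by a single ideal of M, the first
    lift marking one member and the second lift the other; the square of a logarithm would then be
    bounded by a logarithm. The finite set of exceptions must not depend on E. The automorphism is
    therefore chosen by its action on roots of unity, which involves only K and l, and then raised
    to a power that kills its action on E[l] or E[l^2]. A determinant that is not a square modulo l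
    makes the power l^2 - 1 sufficient; this is prime to l, so a nontrivial action on roots of unity
    of order l^2 can survive. For the finitely many other l the power is a factorial, and the action
    survives only from a level that is bounded in terms of K and l. *)

Local Notation red p := (map_poly (intr : int -> 'F_p)).
Local Notation size_leD := (leq_trans (size_polyD _ _)).

(** * The group law, through ideals of the coordinate ring *)

Definition short (F : fieldType) (a b : F) : weierstrass F :=
  Weierstrass 0 0 0 a b.

HB.instance Definition _ (F : fieldType) (W : weierstrass F) :=
  [Choice of point W by <:].

Definition cubic (F : fieldType) (a b : F) : {poly F} := 'X^3 + a *: 'X + b%:P.

(** The pair (u, v) stands for u + v y in R[x, y]/(y^2 - c). The argument [c], absent from the
    underlying type, selects the multiplication. *)
Definition crd (R : comNzRingType) (c : {poly R}) : Type := ({poly R} * {poly R})%type.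
HB.instance Definition _ (R : comNzRingType) (c : {poly R}) :=
  GRing.Zmodule.on (crd c).

Section CoordinateRing.
Variables (R : comNzRingType) (c : {poly R}).
Implicit Types f g : crd c.

Definition crd_one : crd c := (1, 0).
Definition crd_mul f g : crd c :=
  (f.1 * g.1 + c * (f.2 * g.2), f.1 * g.2 + f.2 * g.1).

Lemma crd_mulA : associative crd_mul.
Proof. by move=> [u v] [u' v'] [u'' v'']; congr pair; rewrite /=; ring. Qed.
Lemma crd_mulC : commutative crd_mul.
Proof. by move=> [u v] [u' v']; congr pair; rewrite /=; ring. Qed.
Lemma crd_mul1 : left_id crd_one crd_mul.
Proof. by move=> [u v]; congr pair; rewrite /=; ring. Qed.
Lemma crd_mulDl : left_distributive crd_mul +%R.
Proof. by move=> [u v] [u' v'] [u'' v'']; congr pair; rewrite /=; ring. Qed.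
Lemma crd_one_neq0 : crd_one != 0.
Proof. by rewrite xpair_eqE oner_eq0. Qed.

HB.instance Definition _ := GRing.Zmodule_isComNzRing.Build (crd c)
  crd_mulA crd_mulC crd_mul1 crd_mulDl crd_one_neq0.

Definition crdX (p : {poly R}) : crd c := (p, 0).
Definition crdY : crd c := (0, 1).
Definition crd_conj f : crd c := (f.1, - f.2).
Definition crd_norm f : {poly R} := f.1 ^+ 2 - c * f.2 ^+ 2.
Definition crd_eval (x y : R) f : R := f.1.[x] + y * f.2.[x].

Lemma crdM f g : f * g = (f.1 * g.1 + c * (f.2 * g.2), f.1 * g.2 + f.2 * g.1) :> crd c.
Proof. by []. Qed.
Lemma crdD f g : f + g = (f.1 + g.1, f.2 + g.2) :> crd c.
Proof. by []. Qed.
Lemma crdN f : - f = (- f.1, - f.2) :> crd c.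
Proof. by []. Qed.

Lemma crdX_is_zmod : zmod_morphism crdX.
Proof. by move=> p q; rewrite /crdX crdD crdN /= oppr0 addr0. Qed.
Lemma crdX_is_monoid : monoid_morphism crdX.
Proof. by split=> // p q; rewrite /crdX crdM /= !(mulr0, mul0r, addr0). Qed.
HB.instance Definition _ :=
  GRing.isZmodMorphism.Build {poly R} (crd c) crdX crdX_is_zmod.
HB.instance Definition _ :=
  GRing.isMonoidMorphism.Build {poly R} (crd c) crdX crdX_is_monoid.

Lemma crdYY : crdY * crdY = crdX c.
Proof. by rewrite crdM /crdX /=; congr pair; ring. Qed.

Lemma crd_conj_is_zmod : zmod_morphism crd_conj.
Proof. by move=> [u v] [u' v']; rewrite /crd_conj !crdD !crdN /=; congr pair; ring. Qed.
Lemma crd_conj_is_monoid : monoid_morphism crd_conj.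
Proof.
split; first by rewrite /crd_conj /= oppr0.
by move=> [u v] [u' v']; rewrite /crd_conj !crdM /=; congr pair; ring.
Qed.
HB.instance Definition _ :=
  GRing.isZmodMorphism.Build (crd c) (crd c) crd_conj crd_conj_is_zmod.
HB.instance Definition _ :=
  GRing.isMonoidMorphism.Build (crd c) (crd c) crd_conj crd_conj_is_monoid.

Lemma crd_conjK f : crd_conj (crd_conj f) = f.
Proof. by case: f => u v; rewrite /crd_conj /= opprK. Qed.
Lemma crd_conjX p : crd_conj (crdX p) = crdX p.
Proof. by rewrite /crd_conj /crdX /= oppr0. Qed.
Lemma crd_conjY : crd_conj crdY = - crdY.
Proof. by rewrite /crd_conj /crdY crdN /= oppr0. Qed.
Lemma crd_mul_conj f : f * crd_conj f = crdX (crd_norm f).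
Proof. by case: f => u v; rewrite crdM /crdX /crd_norm /=; congr pair; ring. Qed.
Lemma crd_normM f g : crd_norm (f * g) = crd_norm f * crd_norm g.
Proof. by case: f => u v; case: g => u' v'; rewrite crdM /crd_norm /=; ring. Qed.
Lemma crd_normX p : crd_norm (crdX p) = p ^+ 2.
Proof. by rewrite /crd_norm /=; ring. Qed.
Lemma crd_norm1 : crd_norm (1 : crd c) = 1.
Proof. by rewrite -[1]/(crdX 1) crd_normX expr1n. Qed.
Lemma crd_norm_conj f : crd_norm (crd_conj f) = crd_norm f.
Proof. by rewrite /crd_norm /= sqrrN. Qed.

Lemma crd_evalX x y p : crd_eval x y (crdX p) = p.[x].
Proof. by rewrite /crd_eval /= horner0 mulr0 addr0. Qed.
Lemma crd_evalY x y : crd_eval x y crdY = y.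
Proof. by rewrite /crd_eval /= horner0 hornerC mulr1 add0r. Qed.
Lemma crd_evalM x y f g : y ^+ 2 = c.[x] ->
  crd_eval x y (f * g) = crd_eval x y f * crd_eval x y g.
Proof. by move=> e; rewrite /crd_eval crdM /= !(hornerD, hornerM) -e; ring. Qed.
Lemma crd_evalD x y f g : crd_eval x y (f + g) = crd_eval x y f + crd_eval x y g.
Proof. by rewrite /crd_eval crdD /= !hornerD; ring. Qed.
Lemma crd_evalN x y f : crd_eval x y (- f) = - crd_eval x y f.
Proof. by rewrite /crd_eval crdN /= !hornerN; ring. Qed.
Lemma crd_eval1 x y : crd_eval x y (1 : crd c) = 1.
Proof. by rewrite -[1]/(crdX 1) crd_evalX hornerC. Qed.
Lemma crd_eval_conj x y f : crd_eval x y (crd_conj f) = crd_eval x (- y) f.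
Proof. by rewrite /crd_eval /= hornerN; ring. Qed.
Lemma crd_evalXn x y f n : y ^+ 2 = c.[x] -> crd_eval x y (f ^+ n) = crd_eval x y f ^+ n.
Proof.
move=> e; elim: n => [|n IH]; first by rewrite !expr0 crd_eval1.
by rewrite !exprS crd_evalM // IH.
Qed.
Lemma crd_eval_norm x y f : y ^+ 2 = c.[x] ->
  crd_eval x y f * crd_eval x (- y) f = (crd_norm f).[x].
Proof. by move=> e; rewrite -crd_eval_conj -crd_evalM // crd_mul_conj crd_evalX. Qed.

End CoordinateRing.

Section CoordinateDomain.
Variables (F : fieldType) (a b : F).
Local Notation c := (cubic a b).
Local Notation crd := (crd c).
Local Notation cX := (crdX c).

Lemma cubicE x : c.[x] = x ^+ 3 + a * x + b.
Proof. by rewrite /cubic !hornerE. Qed.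
Lemma size_cubic : size c = 4%N.
Proof.
rewrite /cubic -addrA size_polyDl ?size_polyXn //.
apply: leq_ltn_trans (size_polyD _ _) _; rewrite gtn_max size_polyC.
by rewrite (leq_ltn_trans (size_scale_leq _ _)) ?size_polyX // ltnS; case: eqP.
Qed.
Lemma lead_cubic : lead_coef c = 1.
Proof.
by rewrite lead_coefE size_cubic /cubic !coefE /= !mulr0 !addr0.
Qed.
Lemma cubic_neq0 : c != 0.
Proof. by rewrite -size_poly_eq0 size_cubic. Qed.

Lemma size_sqr (p : {poly F}) : p != 0 -> size (p ^+ 2) = (size p).*2.-1.
Proof. by move=> p0; rewrite expr2 size_mul // addnn. Qed.

(* pole order at infinity: y has order 3 and x has order 2 *)
Lemma size_crd_norm (f : crd) : f != 0 ->
  size (crd_norm f) = if f.2 == 0 then (size f.1).*2.-1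
    else maxn (size f.1).*2.-1 (size f.2).*2.+2.
Proof.
case: f => u v; rewrite xpair_eqE /crd_norm /=.
have [->|v0] := eqVneq v 0.
  rewrite andbT => u0; rewrite expr0n mulr0 subr0 size_sqr //.
move=> _; have sv : size (c * v ^+ 2) = (size v).*2.+2.
  rewrite size_mul ?cubic_neq0 ?expf_neq0 // size_cubic size_sqr //.
  by move: v0; rewrite -size_poly_gt0; case: (size v) => // n _; lia.
have [->|u0] := eqVneq u 0; first by rewrite expr0n sub0r size_polyN sv size_poly0.
have su : size (u ^+ 2) = (size u).*2.-1.
  exact: size_sqr.
have [l|l|e] := ltngtP (size (u ^+ 2)) (size (c * v ^+ 2)).
- rewrite addrC size_polyDl ?size_polyN //; rewrite -su -sv; exact/esym/maxn_idPr/ltnW.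
- rewrite size_polyDl ?size_polyN //; rewrite -su -sv; exact/esym/maxn_idPl/ltnW.
- exfalso; move: e u0; rewrite su sv -size_poly_gt0; clear; move: (size u) (size v) => m n; lia.
Qed.

(** The degree of u^2 is even and that of c v^2 is odd, so the two terms of the norm cannot cancel.
    This makes the coordinate ring an integral domain. *)
Lemma crd_norm_eq0 (f : crd) : (crd_norm f == 0) = (f == 0).
Proof.
apply/idP/idP => [|/eqP->]; last by rewrite /crd_norm /=; apply/eqP; ring.
apply: contraLR => f0; rewrite -size_poly_eq0 size_crd_norm //.
case: f f0 => u v; rewrite xpair_eqE /=; case: (eqVneq v 0) => [_|_ _]; last by rewrite -lt0n leq_max orbT.
by rewrite andbT -size_poly_gt0; case: (size u).
Qed.

Lemma crdX_inj : injective cX.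
Proof. by move=> p q [->]. Qed.
Lemma crdX_eq0 p : (cX p == 0) = (p == 0).
Proof. by rewrite -(rmorph0 cX) (inj_eq crdX_inj). Qed.
Lemma crdX_lreg p (f : crd) : p != 0 -> cX p * f = 0 -> f = 0.
Proof.
case: f => u v p0; rewrite crdM /= => -[]; rewrite !(mul0r, mulr0, addr0).
by move=> /eqP; rewrite mulf_eq0 (negPf p0) => /eqP-> /eqP; rewrite mulf_eq0 (negPf p0) => /eqP->.
Qed.
Lemma crd_lreg (f g : crd) : f != 0 -> f * g = 0 -> g = 0.
Proof.
move=> f0 /(congr1 (fun h => crd_conj f * h)); rewrite mulr0 mulrA [_ * f]mulrC crd_mul_conj.
by apply: crdX_lreg; rewrite crd_norm_eq0.
Qed.
Lemma crd_mulI (f g h : crd) : f != 0 -> f * g = f * h -> g = h.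
Proof.
move=> f0 e; apply/eqP; rewrite -subr_eq0; apply/eqP/(crd_lreg f0).
by rewrite mulrBr e subrr.
Qed.
Lemma crd_mulf_neq0 (f g : crd) : f != 0 -> g != 0 -> f * g != 0.
Proof. by move=> f0; apply: contra_neq; exact: crd_lreg. Qed.

End CoordinateDomain.

Record scurve (F : fieldType) := SCurve {
  sa : F; sb : F;
  s_char : 2 != 0 :> F;
  s_disc : 4 * sa ^+ 3 + 27 * sb ^+ 2 != 0 }.

(** An alias that keeps the smooth curve [E] visible in the type; the group structure is declared on
    it. *)
Definition spoint (F : fieldType) (E : scurve F) := point (short (sa E) (sb E)).
HB.instance Definition _ (F : fieldType) (E : scurve F) :=
  Choice.on (spoint E).

Section Ideals.
Variables (F : fieldType) (E : scurve F).
Local Notation a := (sa E).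
Local Notation b := (sb E).
Local Notation c := (cubic a b).
Local Notation crd := (crd c).
Local Notation cX := (crdX c).
Local Notation Y := (crdY c).
Local Notation pt := (spoint E).
Implicit Types (P Q : pt) (D : seq pt) (f g : crd).

Definition pt0 : pt := point_zero _.

Lemma on_short x y : on_curve (short a b) (Some (x, y)) = (y ^+ 2 == c.[x]).
Proof. by rewrite /= cubicE !mul0r !addr0. Qed.

Lemma opp_on_curve (P : option (F * F)) : on_curve (short a b) P ->
  on_curve (short a b) (omap (fun q => (q.1, - q.2)) P).
Proof. by case: P => [[x y]|] //; rewrite !on_short /= sqrrN. Qed.

Definition popp P : pt := Point (opp_on_curve (valP P)).

Lemma poppK P : popp (popp P) = P.
Proof. by apply: val_inj; case: P => [[[x y]|] oP] //=; rewrite opprK. Qed.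

Definition xpoly P : {poly F} := if val P is Some (x, _) then 'X - x%:P else 1.
Definition genX P : crd := cX (xpoly P).
Definition genY P : crd := if val P is Some (_, y) then Y - cX y%:P else 0.

Lemma xpoly_neq0 P : xpoly P != 0.
Proof. by rewrite /xpoly; case: (val P) => [[x y]|]; rewrite ?polyXsubC_eq0 ?oner_eq0. Qed.
Lemma xpoly_opp P : xpoly (popp P) = xpoly P.
Proof. by case: P => [[[x y]|] oP]. Qed.
Lemma genX_inf P : val P = None -> genX P = 1.
Proof. by rewrite /genX /xpoly => ->; rewrite rmorph1. Qed.
Lemma genX_opp P : genX (popp P) = genX P.
Proof. by rewrite /genX xpoly_opp. Qed.
Lemma conj_genX P : crd_conj (genX P) = genX (popp P).
Proof. by rewrite genX_opp crd_conjX. Qed.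
Lemma conj_genY P : crd_conj (genY P) = - genY (popp P).
Proof.
case: P => [[[x y]|] oP]; rewrite /genY /= ?rmorph0 ?oppr0 //.
by rewrite rmorphB /= crd_conjX crd_conjY polyCN rmorphN /= opprK opprD.
Qed.

(* [inI [:: P1; ...; Pn]] is the product of the ideals of the points Pi,
   that of the point at infinity being the whole ring. *)
Fixpoint inI D (f : crd) : Prop :=
  if D is P :: D' then
    exists u v, [/\ inI D' u, inI D' v & f = genX P * u + genY P * v]
  else True.

Lemma inI0 D : inI D 0.
Proof. by elim: D => //= P D IH; exists 0, 0; split=> //; rewrite !mulr0 addr0. Qed.
Lemma inID D f g : inI D f -> inI D g -> inI D (f + g).
Proof.
elim: D f g => //= P D IH f g [u [v [Du Dv ->]]] [u' [v' [Du' Dv' ->]]].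
exists (u + u'), (v + v'); split; [exact: IH|exact: IH|]; ring.
Qed.
Lemma inIMl D h f : inI D f -> inI D (h * f).
Proof.
elim: D f => //= P D IH f [u [v [Du Dv ->]]].
exists (h * u), (h * v); split; [exact: IH|exact: IH|]; ring.
Qed.
Lemma inIN D f : inI D f -> inI D (- f).
Proof. by rewrite -mulN1r; exact: inIMl. Qed.
Lemma inIB D f g : inI D f -> inI D g -> inI D (f - g).
Proof. by move=> Df /inIN; exact: inID. Qed.
Lemma inIX P D f : inI D f -> inI (P :: D) (genX P * f).
Proof. by move=> Df; exists f, 0; split=> //; [exact: inI0 | ring]. Qed.
Lemma inIY P D f : inI D f -> inI (P :: D) (genY P * f).
Proof. by move=> Df; exists 0, f; split=> //; [exact: inI0 | ring]. Qed.
Lemma inI_mono P D D' : (forall f, inI D f -> inI D' f) ->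
  forall f, inI (P :: D) f -> inI (P :: D') f.
Proof. by move=> h f [u [v [/h Du /h Dv ->]]]; exists u, v. Qed.
Lemma inI_tail P D f : inI (P :: D) f -> inI D f.
Proof. by move=> [u [v [Du Dv ->]]]; apply: inID; apply: inIMl. Qed.
Lemma inI_swap P Q D f : inI (P :: Q :: D) f -> inI (Q :: P :: D) f.
Proof.
move=> [_ [_ [[u [v [Du Dv ->]]] [u' [v' [Du' Dv' ->]]] ->]]].
exists (genX P * u + genY P * u'), (genX P * v + genY P * v').
split; [by exists u, u' | by exists v, v' | ring].
Qed.

Lemma inI_cat D D' f g : inI D f -> inI D' g -> inI (D ++ D') (f * g).
Proof.
elim: D f => [|P D IH] f /=; first by move=> _; exact: inIMl.
move=> [u [v [Du Dv ->]]] Dg; exists (u * g), (v * g).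
split; [exact: IH|exact: IH|]; ring.
Qed.

Lemma inI_shift P D D' f : inI (D ++ P :: D') f <-> inI (P :: D ++ D') f.
Proof.
elim: D f => //= Q D IH f; split.
  by move=> h; apply: inI_swap; move: h; apply: inI_mono => g /IH.
by move=> /inI_swap; apply: inI_mono => g /IH.
Qed.

Lemma inI_perm D D' f : perm_eq D D' -> inI D f -> inI D' f.
Proof.
elim: D D' f => [|P D IH] D' f.
  by move=> /perm_size /esym/eqP; rewrite size_eq0 => /eqP->.
move=> pDD'; have PD' : P \in D' by rewrite -(perm_mem pDD') mem_head.
case/splitPr: PD' pDD' => D1 D2 pDD' Df; apply/inI_shift.
move: Df; apply: inI_mono => g; apply: IH.
by move: pDD'; rewrite perm_sym -cat1s perm_catCA /= perm_cons perm_sym.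
Qed.

(** The norm is recorded because its degree shows the order of the pole of f at infinity, on which
    the injectivity of P -> class of P rests. *)
Definition principal D := exists f, [/\ inI D f,
  (forall g, inI D g -> exists h, g = f * h) &
  exists2 k, k != 0 & crd_norm f = k *: \prod_(P <- D) xpoly P].

Lemma principal_perm D D' : perm_eq D D' -> principal D -> principal D'.
Proof.
move=> pD [f [Df dvf [k k0 Nf]]]; exists f; split.
- exact: inI_perm Df.
- by move=> g Dg; apply: dvf; apply: inI_perm Dg; rewrite perm_sym.
- by exists k => //; rewrite Nf (perm_big _ pD).
Qed.

Lemma principal_cat D D' : principal D -> principal D' -> principal (D ++ D').
Proof.
move=> [f [Df dvf [k k0 Nf]]] [f' [Df' dvf' [k' k0' Nf']]]; exists (f * f'); split.
- exact: inI_cat.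
(* The product ideal lies in f' times the ideal of D, by induction on D from the empty list. *)
- move=> g; suff: inI (D ++ D') g -> exists2 h, inI D h & g = f' * h.
    by move=> h /h[g' /dvf[h' ->] ->]; exists h'; ring.
  clear -dvf'; elim: D g => [|P D IH] g /= Dg; first by have [h ->] := dvf' _ Dg; exists h.
  have [u [v [/IH[h Dh ->] /IH[h' Dh' ->] ->]]] := Dg. exists (genX P * h + genY P * h'); last by ring. by exists h, h'.
- exists (k * k'); first by rewrite mulf_neq0.
  by rewrite crd_normM Nf Nf' big_cat /= -scalerAl -scalerAr scalerA.
Qed.

Lemma inI_conj D f : inI D f -> inI (map popp D) (crd_conj f).
Proof.
elim: D f => //= P D IH f [u [v [Du Dv ->]]].
exists (crd_conj u), (- crd_conj v); split; [exact: IH | exact/inIN/IH |].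
by rewrite rmorphD !rmorphM /= conj_genX conj_genY mulrN mulNr.
Qed.

Lemma principal_opp D : principal D -> principal (map popp D).
Proof.
move=> [f [Df dvf [k k0 Nf]]]; exists (crd_conj f); split.
- exact: inI_conj.
- move=> g /inI_conj; rewrite -map_comp (eq_map (g := id)) ?map_id => [/dvf[h e]|P /=]; last exact: poppK.
  by exists (crd_conj h); rewrite -[g]crd_conjK e rmorphM.
- exists k => //; rewrite crd_norm_conj Nf big_map; congr (_ *: _).
  by apply: eq_bigr => P _; rewrite xpoly_opp.
Qed.

(** The identity that expresses 4a^3 + 27b^2 through the cubic and its derivative, divided by this
    discriminant. *)
Lemma bezout_cubic : exists u v : {poly F}, u * c + v * c^`() = 1.
Proof.
pose d := 4 * a ^+ 3 + 27 * b ^+ 2; have d0 : d != 0 by exact: s_disc.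
exists (d^-1 *: (27%:R *: b%:P - 18%:R *: (a *: 'X))).
exists (d^-1 *: (6%:R *: (a *: 'X ^+ 2) - 9%:R *: (b *: 'X) + (4%:R * a ^+ 2)%:P)).
rewrite -!scalerAl -scalerDr -[RHS](_ : d^-1 *: d%:P = 1); last first.
  by rewrite -mul_polyC -polyCM mulVf.
congr (_ *: _); rewrite /cubic !derivE -!mul_polyC /d !polyCD !polyCM.
by ring.
Qed.

Lemma cubic_sub x : exists2 q : {poly F}, c - (c.[x])%:P = ('X - x%:P) * q & q.[x] = c^`().[x].
Proof.
exists ('X ^+ 2 + x *: 'X + (x ^+ 2 + a)%:P).
  rewrite cubicE /cubic -!mul_polyC !polyCD !polyCM ?polyC_exp; ring.
by rewrite /cubic !derivE /= !(hornerE, hornerMn).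
Qed.

(** The ideals of P and -P multiply to the ideal generated by x - x_P: this is what makes -P the
    inverse of P among ideal classes. *)
Lemma inI_cancel P D f : inI (P :: popp P :: D) f <->
  exists2 g, inI D g & f = genX P * g.
Proof.
case: P => [[[x y]|] oP]; last first.
  split=> [|[g Dg ->]].
    move=> [_ [_ [[u [v [Du Dv ->]]] [u' [v' [Du' Dv' ->]]] ->]]]. by exists u => //; rewrite !genX_inf // /genY /=; ring.
  by apply: inIX; rewrite -[g]mul1r -(genX_inf (P := popp (Point oP))) //; exact: inIX.
set P := Point oP; have yc : y ^+ 2 = c.[x] by move: (oP); rewrite on_short => /eqP.
have [q qE qx] := cubic_sub x.
have gYY : genY P * genY (popp P) = genX P * cX q.
  rewrite /genX /xpoly /= -rmorphM -qE rmorphB /= -yc /genY /= polyCN rmorphN rmorphXn /=. by rewrite -crdYY !rmorphXn /=; ring.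
have gX : genX (popp P) = genX P by rewrite genX_opp.
split.
  move=> [_ [_ [[u [v [Du Dv ->]]] [u' [v' [Du' Dv' ->]]] ->]]]. exists (genX P * u + genY (popp P) * v + genY P * u' + cX q * v').
    by do !apply: inID; apply: inIMl.
  rewrite gX; apply/eqP; rewrite -subr_eq0; apply/eqP. transitivity ((genY P * genY (popp P) - genX P * cX q) * v'); first by ring.
  by rewrite gYY subrr mul0r.
move=> [g Dg ->].
(* The four elements generate the unit ideal. If y is not 0, the elements Y - y and Y + y differ by
   the unit 2y. If y = 0, then q(x) is the derivative of the cubic at x, which is not 0, so q is
   invertible modulo X - x. *)
have [u [v [w [z e]]]] : exists u v w z : crd,
    1 = u * genX P + v * genY P + w * genY (popp P) + z * cX q.
  have [y0|y0] := eqVneq y 0.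
    have qx0 : q.[x] != 0.
      apply/eqP => q0; have [u [v /(congr1 (fun p => p.[x]))]] := bezout_cubic.
      rewrite hornerD !hornerM -qx q0 -yc y0 hornerC expr0n /= !mulr0 addr0. by move=> /esym/eqP; rewrite oner_eq0.
    have /factor_theorem[r qr] : root (q - q.[x]%:P) x.
      by rewrite /root !hornerE subrr.
    exists (- cX ((q.[x])^-1%:P * r)), 0, 0, (cX (q.[x])^-1%:P). have e : (q.[x])^-1%:P * q = (q.[x])^-1%:P * (r * ('X - x%:P)) + 1.
      by rewrite -qr mulrBr -polyCM mulVf // polyC1 subrK.
    transitivity (cX ((q.[x])^-1%:P * q - (q.[x])^-1%:P * (r * ('X - x%:P)))).
      by rewrite e addrC addKr rmorph1.
    by rewrite /genX /xpoly /= rmorphB !rmorphM /=; ring.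
  exists 0, (- cX (y *+ 2)^-1%:P), (cX (y *+ 2)^-1%:P), 0. rewrite /genY /= !mul0r !add0r addr0 polyCN rmorphN /=.
  transitivity (cX ((y *+ 2)^-1%:P * (y *+ 2)%:P)).
    rewrite -polyCM mulVf ?polyC1 ?rmorph1 // -[y *+ 2]mulr_natr mulf_neq0 //; exact: s_char.
  by rewrite polyCMn rmorphM rmorphMn /=; ring.
have -> : genX P * g = u * (genX P * (genX P * g)) + v * (genX P * (genY P * g))
  + w * (genX P * (genY (popp P) * g)) + z * (genY P * (genY (popp P) * g)).
  transitivity (1 * (genX P * g)); first by ring.
  rewrite {1}e [in RHS](mulrA (genY P)) gYY; ring.
apply: inID; first apply: inID; first apply: inID; apply: inIMl.
- by apply: inIX; rewrite -gX; exact: inIX.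
- by apply: inI_swap; rewrite -gX; apply: inIX; exact: inIY.
- by apply: inIX; exact: inIY.
- by apply: inIY; exact: inIY.
Qed.

Lemma principal_cancel P D : principal (P :: popp P :: D) <-> principal D.
Proof.
have g0 : genX P != 0 by rewrite /genX crdX_eq0 xpoly_neq0.
split=> [[f [Df dvf [k k0 Nf]]]|[f [Df dvf [k k0 Nf]]]].
  have [g Dg fg] := (inI_cancel P D f).1 Df; subst f; exists g; split=> //.
    move=> h Dh; have [|t] := dvf (genX P * h); first by apply/inI_cancel; exists h. by rewrite -mulrA => /crd_mulI -> //; exists t.
  exists k => //; apply: (mulfI (x := xpoly P ^+ 2)); first by rewrite expf_neq0 // xpoly_neq0.
  by rewrite -[X in X * _](crd_normX c) -crd_normM Nf !big_cons xpoly_opp expr2 -[in RHS]scalerAr mulrA.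
exists (genX P * f); split.
- by apply/inI_cancel; exists f.
- by move=> g /inI_cancel[h /dvf[t ->] ->]; exists t; ring.
- by exists k => //; rewrite crd_normM Nf crd_normX !big_cons xpoly_opp expr2 -[in LHS]scalerAr mulrA.
Qed.

Lemma principal_nil : principal [::].
Proof.
exists 1; split=> //; first by move=> g _; exists g; rewrite mul1r.
by exists 1; rewrite ?oner_eq0 // crd_norm1 big_nil scale1r.
Qed.

End Ideals.

Section Lines.
Variables (F : fieldType) (E : scurve F).
Local Notation a := (sa E).
Local Notation b := (sb E).
Local Notation c := (cubic a b).
Local Notation crd := (crd c).
Local Notation cX := (crdX c).
Local Notation Y := (crdY c).
Local Notation pt := (spoint E).
Implicit Types (P Q A B : pt) (D : seq pt) (f g : crd).

Definition inP P f := exists u v, f = genX P * u + genY P * v.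

Lemma inP_mul P D f g : inP P f -> inI D g -> inI (P :: D) (f * g).
Proof.
move=> [u [v ->]] Dg; exists (u * g), (v * g); split; try exact: inIMl.
by rewrite mulrDl !mulrA.
Qed.

Lemma inP_genX P : inP P (genX P).
Proof. by exists 1, 0; ring. Qed.

Lemma four_neq0 : 4 != 0 :> F.
Proof. by rewrite (_ : 4 = 2 * 2) ?mulf_neq0 ?s_char //; ring. Qed.

Lemma crdX_lin (lam mu x : F) :
  lam *: 'X + mu%:P - (lam * x + mu)%:P = lam%:P * ('X - x%:P).
Proof. by rewrite -mul_polyC polyCD polyCM; ring. Qed.

(** The function l = y - m(x) of a line generates the product of the ideals of its three
    intersections. Coincidences among A, B, Z are allowed, so chords and tangents are treated
    together. *)
Lemma principal_line (A B Z : pt) x1 x2 x3 (lam mu : F) :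
  let m := (lam *: 'X + mu%:P : {poly F}) in
  val A = Some (x1, m.[x1]) -> val B = Some (x2, m.[x2]) ->
  val Z = Some (x3, m.[x3]) ->
  c - m ^+ 2 = ('X - x1%:P) * ('X - x2%:P) * ('X - x3%:P) ->
  principal [:: A; B; Z].
Proof.
move=> m eA eB eZ cm; pose l : crd := Y - cX m; exists l.
have gY P x : val P = Some (x, m.[x]) -> genY P = l + cX lam%:P * genX P.
  move=> e; rewrite /genX /genY /xpoly e -rmorphM -(crdX_lin lam mu) /l rmorphB /=. have -> : m.[x] = lam * x + mu by rewrite !hornerE.
  by rewrite -/m; ring.
have lP P x : val P = Some (x, m.[x]) -> inP P l.
  by move=> e; exists (- cX lam%:P), 1; rewrite (gY _ _ e); ring.
have [[lA lB] lZ] := (lP _ _ eA, lP _ _ eB, lP _ _ eZ).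
have [[gA gB] gZ] := (inP_genX A, inP_genX B, inP_genX Z).
have I3 f g h : inP A f -> inP B g -> inP Z h -> inI [:: A; B; Z] (f * (g * h)).
  by move=> hf hg hh; apply: inP_mul => //; apply: inP_mul => //; rewrite -[h]mulr1; exact: inP_mul.
have uvw : genX A * genX B * genX Z = cX (c - m ^+ 2).
  by rewrite cm /genX /xpoly eA eB eZ !rmorphM.
have ll : l * crd_conj l = - (genX A * genX B * genX Z).
  rewrite uvw /l rmorphB /= crd_conjX crd_conjY rmorphB /= rmorphXn /= -crdYY; ring.
have lbar : crd_conj l = - l - cX (2 * m).
  by rewrite /l rmorphB /= crd_conjX crd_conjY rmorphM /= rmorphMn rmorph1; ring.
split.
(* To put l into the product ideal, 1 is written as a combination of m^2 and of products of two
   factors among xA, xB, xZ. Differentiating c = m^2 + xA xB xZ turns the Bezout relation into such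
   an expression for 1 - t, where t = 2 lam be m; then 1 = (1 + t)(1 - t) + t^2, and t^2 is a
   multiple of m^2. *)
- have [al [be bez]] := bezout_cubic E.
  pose xA := ('X - x1%:P) : {poly F}; pose xB := ('X - x2%:P) : {poly F}. pose xZ := ('X - x3%:P) : {poly F}.
  have c' : c^`() = lam%:P * m * 2 + (xA * xB + xB * xZ + xA * xZ).
    rewrite -[c](subrK (m ^+ 2)) derivD cm !derivM /xA /xB /xZ !derivXsubC. by rewrite /m !derivE /= -mul_polyC; ring.
  pose t := lam%:P * be * m * 2.
  have e1 : 1 = (1 + t) * (al * m ^+ 2 + al * (xA * xB * xZ)
      + be * (xA * xB + xB * xZ + xA * xZ)) + t ^+ 2.
    have : 1 - t = al * (m ^+ 2 + xA * xB * xZ) + be * (xA * xB + xB * xZ + xA * xZ).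
      rewrite -{1}bez c' -[c in al * c](subrK (m ^+ 2)) cm /t /xA /xB /xZ; ring.
    by move=> e; rewrite -mulrDr -e /t; ring.
  (* Since l + [crd_conj l] is -2m, the element 4 l m^2 expands into l^3 and multiples of l
     [crd_conj l], which is minus the product of the three [genX]. *)
  have Ilm : inI [:: A; B; Z] (l * cX (m ^+ 2)).
    have -> : l * cX (m ^+ 2) = cX (4^-1)%:P * (l * (l * l)
       - cX 2 * (l * (genX A * genX B * genX Z)) - crd_conj l * (genX A * (genX B * genX Z))).
      transitivity (cX (4^-1)%:P * (l * (l + crd_conj l) ^+ 2)).
        rewrite lbar; transitivity (cX (4^-1 * 4)%:P * (l * cX (m ^+ 2))).
          by rewrite mulVf ?four_neq0 // rmorph1 mul1r.
        by rewrite polyCM !(rmorphM, rmorphXn, rmorphMn, rmorph1) /=; ring.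
      have e3 : genX A * genX B * genX Z = - (l * crd_conj l) by rewrite ll opprK.
      by rewrite (mulrA (genX A)) !e3 rmorphMn rmorph1; ring.
    apply: inIMl; apply: inIB; first apply: inIB.
    - exact: I3.
    - by apply: inIMl; apply: inIMl; rewrite -mulrA; exact: I3.
    - by apply: inIMl; exact: I3.
  have -> : l = cX ((1 + t) * al) * (l * cX (m ^+ 2))
     + cX ((1 + t) * al) * l * (genX A * (genX B * genX Z))
     + cX ((1 + t) * be) * (genX A * (genX B * l) + l * (genX B * genX Z) + genX A * (l * genX Z))
     + cX (lam%:P * be * 2) ^+ 2 * (l * cX (m ^+ 2)).
    move/(congr1 (fun p => l * cX p)): e1; rewrite rmorph1 mulr1 => e1. rewrite [LHS]e1 /genX /xpoly eA eB eZ -/xA -/xB -/xZ /t.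
    by rewrite !(rmorphD, rmorphM, rmorphXn, rmorph1, rmorphMn) /=; ring.
  by do !apply: inID; apply: inIMl => //; do ?apply: inID; exact: I3.
(* Modulo l each [genY] is a multiple of [genX], so only l and the product of the [genX] remain as
   generators, and that product is itself a multiple of l. *)
- have red D f : (forall P, P \in D -> genY P = l + cX lam%:P * genX P) ->
      inI D f -> exists h r, f = l * h + (\prod_(P <- D) genX P) * r.
    elim: D f => [|P D IH] f gD /=; first by move=> _; exists 0, f; rewrite big_nil; ring. move=> [u [v [Du Dv ->]]].
    have gD' Q : Q \in D -> genY Q = l + cX lam%:P * genX Q.
      by move=> QD; apply: gD; rewrite inE QD orbT.
    have [[h [r ->]] [h' [r' ->]]] := (IH _ gD' Du, IH _ gD' Dv). rewrite (gD P) ?mem_head // big_cons.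
    exists (genX P * h + (l + cX lam%:P * genX P) * h' + (\prod_(P <- D) genX P) * r'). by exists (r + cX lam%:P * r'); ring.
  move=> f /red[P|h [r ->]].
    by rewrite !inE => /or3P[]/eqP->; [exact: gY eA|exact: gY eB|exact: gY eZ].
  exists (h - crd_conj l * r); rewrite !big_cons big_nil mulr1 mulrA mulrBr mulrA ll. by rewrite mulNr opprK.
- exists (- 1); first by rewrite oppr_eq0 oner_eq0.
  rewrite !big_cons big_nil /xpoly eA eB eZ mulr1 mulrA -cm /l /crd_norm /=. by rewrite scaleN1r; ring.
Qed.

Lemma inI_inf P D f : val P = None -> inI (P :: D) f <-> inI D f.
Proof.
move=> P0; split=> [|Df]; last first.
  by exists f, 0; split=> //; [exact: inI0 | rewrite (genX_inf P0); ring].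
move=> [u [v [Du Dv ->]]]; rewrite (genX_inf P0) /genY P0 mul1r mul0r addr0 //.
Qed.

Lemma principal_inf P D : val P = None -> principal (P :: D) <-> principal D.
Proof.
move=> P0; split=> -[f [Df dvf [k k0 Nf]]]; exists f.
  split; first by apply/(inI_inf _ _ P0).
    by move=> g Dg; apply: dvf; apply/(inI_inf _ _ P0).
  by exists k => //; rewrite Nf big_cons /xpoly P0 mul1r.
split; first by apply/(inI_inf _ _ P0).
  by move=> g /(inI_inf _ _ P0); exact: dvf.
by exists k => //; rewrite Nf big_cons /xpoly P0 mul1r.
Qed.

Lemma principal_pair P : principal [:: P; popp P].
Proof. by apply/principal_cancel; exact: principal_nil. Qed.

Lemma val_popp P : val (popp P) = omap (fun q => (q.1, - q.2)) (val P).
Proof. by []. Qed.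

Lemma line_factor (lam mu x1 x2 : F) (m := lam *: 'X + mu%:P : {poly F}) :
  let x3 := lam ^+ 2 - x1 - x2 in
  let p := a - 2 * lam * mu - (x1 * x2 + x1 * x3 + x2 * x3) in
  p = 0 -> m.[x1] ^+ 2 = c.[x1] ->
  c - m ^+ 2 = ('X - x1%:P) * ('X - x2%:P) * ('X - x3%:P).
Proof.
move=> x3 p p0; rewrite /m cubicE !hornerE => e.
have q0 : b - mu ^+ 2 + x1 * x2 * x3 = 0.
  transitivity ((x1 ^+ 3 + a * x1 + b - (lam * x1 + mu) ^+ 2) - p * x1).
    by rewrite /p /x3; ring.
  by rewrite p0 e mul0r subr0 subrr.
apply/eqP; rewrite -subr_eq0; apply/eqP.
transitivity (p%:P * 'X + (b - mu ^+ 2 + x1 * x2 * x3)%:P); last first.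
  by rewrite p0 q0 mul0r addr0.
rewrite /p /x3 /cubic -!mul_polyC !(polyCD, polyCN, polyCM, polyC_exp).
by ring.
Qed.

Lemma principal_add A B : principal [:: A; B; popp (point_add A B)].
Proof.
case: A => [[[x1 y1]|] oA]; last first.
  apply/principal_inf => //; have -> : point_add (Point oA) B = B by exact: val_inj. exact: principal_pair.
case: B => [[[x2 y2]|] oB]; last first.
  set A := Point oA; have -> : point_add A (Point oB) = A by exact: val_inj.
  apply: (principal_perm (D := [:: Point oB; A; popp A])); last first.
    by apply/principal_inf => //; exact: principal_pair.
  exact: (permEl (perm_catCA [:: _] [:: _] [:: _])).
set A := Point oA; set B := Point oB.
have e1 : y1 ^+ 2 = c.[x1] by move: (oA); rewrite on_short => /eqP.
have e2 : y2 ^+ 2 = c.[x2] by move: (oB); rewrite on_short => /eqP.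
have vAB : val (point_add A B) = add_coords (short a b) (Some (x1, y1)) (Some (x2, y2)) by [].
case: (boolP ((x1 == x2) && (y1 + y2 + 0 * x2 + 0 == 0))) => opp.
  have vO : val (popp (point_add A B)) = None by rewrite val_popp vAB /= opp. have BE : B = popp A.
    apply: val_inj; move: opp => /andP[/eqP x12]; rewrite mul0r !addr0 addr_eq0 => /eqP y12. by rewrite /= y12 x12 opprK.
  rewrite BE in vO *; apply/(principal_cancel A [:: _])/(principal_inf [::] vO). exact: principal_nil.
pose lam := slope (short a b) x1 y1 x2 y2.
pose mu := y1 - lam * x1; pose m := lam *: 'X + mu%:P : {poly F}.
pose x3 := lam ^+ 2 - x1 - x2.
have vZ : val (popp (point_add A B)) = Some (x3, m.[x3]).
  rewrite val_popp vAB /= (negPf opp) /= -/lam mul0r addr0 !subr0 -/x3.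
  have y3 x : - (- lam * x - (y1 - lam * x1)) = m.[x] by rewrite /m hornerD hornerZ hornerX hornerC /mu; ring. by rewrite addr0 y3.
have m1 : m.[x1] = y1 by rewrite /m hornerD hornerZ hornerX hornerC /mu; ring.
have [m2 p0] : m.[x2] = y2 /\ a - 2 * lam * mu - (x1 * x2 + x1 * x3 + x2 * x3) = 0.
  move: opp; rewrite mul0r !addr0 /m hornerD hornerZ hornerX hornerC /mu /x3 /lam /slope /=. rewrite !mul0r !mulr0 !mul0r !addr0 subr0.
  move: e1 e2; rewrite !cubicE => e1 e2; have [x12|x12] /= := eqVneq x1 x2.
    move=> opp; rewrite -x12 in e2 opp *. have y12 : y2 = y1.
      have : (y2 - y1) * (y1 + y2) = 0.
        by transitivity (y2 ^+ 2 - y1 ^+ 2); [ring | rewrite e1 e2 subrr].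
      by move/eqP; rewrite mulf_eq0 (negPf opp) orbF subr_eq0 => /eqP.
    rewrite y12; have y20 : 2 * y1 != 0.
      by move: opp; rewrite y12; congr (_ != _); ring.
    set la := _ / _; have laE : la * (2 * y1) = 3 * x1 ^+ 2 + a by rewrite /la divfK. split; first by ring.
    by transitivity (3 * x1 ^+ 2 + a - la * (2 * y1)); [ring | rewrite laE subrr].
  have d0 : x2 - x1 != 0 by rewrite subr_eq0 eq_sym.
  move=> _; set la := _ / _; have laE : y2 = y1 + la * (x2 - x1) by rewrite /la divfK //; ring.
  move: (la) laE => {}la laE; split; first by rewrite laE; ring. apply: (mulIf d0); rewrite mul0r.
  transitivity ((x2 ^+ 3 + a * x2 + b - y2 ^+ 2) - (x1 ^+ 3 + a * x1 + b - y1 ^+ 2)).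
    by rewrite laE; ring.
  by rewrite e1 e2 !subrr.
apply: (@principal_line _ _ _ x1 x2 x3 lam mu); rewrite -/m ?m1 ?m2 //.
by apply: line_factor => //; rewrite -/m m1.
Qed.

(** The norm of the generator has degree at most 2, while a term in y would give it degree at least
    3. So the generator is a polynomial in x, its norm is a square, and P and Q have the same
    x-coordinate. The case Q = -P != P is excluded by the y-coefficient of an element of the
    ideal. *)
Lemma principal_two P Q : principal [:: P; popp Q] -> P = Q.
Proof.
move=> [f [Df dvf [k k0]]]; rewrite !big_cons big_nil mulr1 => Nf.
have f0 : f != 0.
  by rewrite -crd_norm_eq0 Nf scaler_eq0 (negPf k0) mulf_neq0 ?xpoly_neq0.
have sN : size (crd_norm f) = (size (xpoly P) + size (xpoly Q)).-1.
  by rewrite Nf size_scale // size_mul ?xpoly_neq0 // xpoly_opp.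
have sx (R : pt) : size (xpoly R) = if val R is Some _ then 2 else 1.
  by rewrite /xpoly; case: (val R) => [[x y]|]; rewrite ?size_XsubC ?size_poly1.
have f2 : f.2 = 0.
  apply/eqP; apply: contraT => f2; move: sN; rewrite size_crd_norm // (negPf f2) !sx.
  have : (4 <= (size f.2).*2.+2)%N by move: f2; rewrite -size_poly_gt0; case: (size _).
  by move=> s; case: (val P) => [?|]; case: (val Q) => [?|] /= e;
    move: (leq_trans s (leq_maxr (size f.1).*2.-1 _)); rewrite e.
have sN2 := sN; rewrite size_crd_norm // f2 eqxx !sx in sN2.
case: P Q Df dvf Nf sN sN2 => [[[x y]|] oP] [[[x' y']|] oQ] /= Df dvf Nf sN sN2; last 1 first.
- exact: val_inj.
- have f1 : f = cX f.1 by rewrite /crdX -f2; case: (f).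
  have NX : f.1 ^+ 2 = k *: (('X - x%:P) * ('X - x'%:P)) by rewrite -(crd_normX c) -f1 Nf. have xx : x' = x.
    have : root (f.1 ^+ 2) x by rewrite NX rootZ // rootM root_XsubC eqxx.
    rewrite rootE horner_exp expf_eq0 /= => /factor_theorem[q qE]. move: NX; rewrite qE [RHS]scalerAr [RHS]mulrC => NX.
    have : q * q * ('X - x%:P) = k *: ('X - x'%:P).
      apply: (mulIf (x := 'X - x%:P)); first by rewrite polyXsubC_eq0. by rewrite -NX; ring.
    move=> /(congr1 (fun p => p.[x])); rewrite !hornerE subrr mulr0 => /esym/eqP. by rewrite mulf_eq0 (negPf k0) subr_eq0 => /eqP->.
  subst x'; have [yy|] := eqVneq y' y; first by subst y'; exact: val_inj.
  move=> yy; have y'N : y' = - y.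
    move: (oP) (oQ); rewrite !on_short => /eqP<- /eqP/esym/eqP; rewrite eqf_sqr eq_sym (negPf yy) /=. by move=> /eqP->; rewrite opprK.
  have : root (f.1 ^+ 2) x by rewrite NX rootZ // rootM root_XsubC eqxx. rewrite rootE horner_exp expf_eq0 /= => /eqP f1x.
  have [|h h0] := dvf (genY (Point oP) * (genY (popp (Point oQ)) * 1)).
    exact: (@inIY F E (Point oP) [:: popp (Point oQ)] _ (@inIY F E (popp (Point oQ)) [::] 1 I)).
  suff y0 : y = 0 by exfalso; move: yy; rewrite y'N y0 oppr0 eqxx.
  clear Df dvf; move: h0; rewrite /genY /= y'N opprK mulr1 f1 => /(congr1 snd).
  rewrite crdM /= !(mul0r, addr0, subr0, mulr1, oppr0, add0r, sub0r, mul1r).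
  move=> /(congr1 (fun p => p.[x])); rewrite !hornerE f1x mul0r => /eqP.
  by rewrite -opprD oppr_eq0 -mulr2n -mulr_natr mulf_eq0 (negPf (s_char E)) orbF => /eqP.
- by case: (size f.1) sN2 => [|[|n]].
- by case: (size f.1) sN2 => [|[|n]].
Qed.

(** Each group law below follows from this: one list is found that both sides complete to a
    principal divisor. *)
Lemma principal_uniq D P Q : principal (P :: D) -> principal (Q :: D) -> P = Q.
Proof.
move=> pP pQ; apply: principal_two.
have {pP pQ} := principal_cat pP (principal_opp pQ).
have -> : map (@popp F E) (Q :: D) = popp Q :: map (@popp F E) D by [].
elim: D => //= R D IH pr; apply: IH; apply/(principal_cancel R).
apply: principal_perm pr; rewrite -!cat_cons.
apply/permP => p; rewrite /= !count_cat /=; lia.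
Qed.

Lemma principal_opp_add A B : principal [:: popp A; popp B; point_add A B].
Proof. by have := principal_opp (principal_add A B); rewrite /= poppK. Qed.

Lemma paddC : commutative (@point_add F (short a b)).
Proof.
move=> A B; apply: (@principal_uniq [:: popp A; popp B]).
  by apply: principal_perm (principal_opp_add A B); apply/permP => p /=; lia.
by apply: principal_perm (principal_opp_add B A); apply/permP => p /=; lia.
Qed.

Lemma padd0 : left_id (pt0 E) (@point_add F (short a b)).
Proof. by move=> A; exact: val_inj. Qed.

Lemma paddN : left_inverse (pt0 E) (@popp F E) (@point_add F (short a b)).
Proof.
move=> A; apply: (@principal_uniq [:: A; popp A]).
  have := principal_opp_add (popp A) A; rewrite poppK. by apply: principal_perm; apply/permP => p /=; lia.
by apply/(principal_inf _ (P := pt0 E)) => //; exact: principal_pair.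
Qed.

Lemma paddA : associative (@point_add F (short a b)).
Proof.
move=> A B C; apply: (@principal_uniq [:: popp A; popp B; popp C]).
  apply/(principal_cancel (point_add B C)).
  apply: principal_perm (principal_cat (principal_opp_add B C) (principal_opp_add A (point_add B C))). by apply/permP => p /=; lia.
apply/(principal_cancel (point_add A B)).
apply: principal_perm (principal_cat (principal_opp_add A B) (principal_opp_add (point_add A B) C)).
by apply/permP => p /=; lia.
Qed.

End Lines.

HB.instance Definition _ (F : fieldType) (E : scurve F) :=
  GRing.isZmodule.Build (spoint E) (@paddA F E) (@paddC F E) (@padd0 F E) (@paddN F E).

(** * Translation of functions by a point *)

Local Notation hE := (hornerD, hornerN, hornerX, hornerC, hornerZ, hornerM, hornerXn, horner_exp, hornerMn).
Section Translation.
Variables (F : fieldType) (E : scurve F).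
Local Notation a := (sa E).
Local Notation b := (sb E).
Local Notation c := (cubic a b).
Local Notation crd := (crd c).
Local Notation cX := (crdX c).
Local Notation Y := (crdY c).
Local Notation pt := (spoint E).
Implicit Types (P Q X R : pt) (D N f g : crd).

Lemma spoint_on P x y : val P = Some (x, y) -> y ^+ 2 = c.[x].
Proof. by move=> e; have := valP P; rewrite e on_short => /eqP. Qed.

Lemma poppE P : popp P = - P.
Proof. by []. Qed.
Lemma val_pt0 : val (0 : pt) = None.
Proof. by []. Qed.
Lemma val_opp P : val (- P) = omap (fun q => (q.1, - q.2)) (val P).
Proof. by []. Qed.
Lemma point_eq0 P : (P == 0) = ~~ isSome (val P).
Proof. by rewrite -val_eqE /=; case: (val P). Qed.
Lemma point_xyP P : P != 0 -> exists x y, val P = Some (x, y).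
Proof. by rewrite point_eq0; case: (val P) => // -[x y] _; exists x, y. Qed.

(** The slope may be any fraction N / D that satisfies the chord equation and, when x = r, the
    tangent equation. This covers both (y - s)/(x - r) and (x^2 + r x + r^2 + a)/(y + s), each of
    which is usable where the other degenerates. *)
Lemma val_add P Q x y r s (D N : F) : val P = Some (x, y) -> val Q = Some (r, s) ->
  P != - Q -> D != 0 -> N * (x - r) = D * (y - s) ->
  (x = r -> N * (2 * y) = D * (3 * x ^+ 2 + a)) ->
  let x3 := (N / D) ^+ 2 - x - r in
  val (P + Q) = Some (x3, - (N / D * (x3 - r) + s)).
Proof.
move=> eP eQ nPQ D0 e1 e2 x3.
have -> : val (P + Q) = add_coords (short a b) (val P) (val Q) by [].
rewrite eP eQ /= !mul0r !addr0.
have op : ~~ ((x == r) && (y + s == 0)).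
  apply: contra nPQ => /andP[/eqP xr]; rewrite addr_eq0 => /eqP ys. by apply/eqP/val_inj; rewrite val_opp eP eQ /= xr ys.
rewrite (negPf op).
have lam : slope (short a b) x y r s = N / D.
  rewrite /slope /= !mul0r !mulr0 !mul0r !addr0 subr0. have [xr|xr] := eqVneq x r; last first.
    have d0 : r - x != 0 by rewrite subr_eq0 eq_sym. apply: (mulIf d0); rewrite divfK //; apply: (mulfI D0).
    rewrite mulrA (mulrC D (N / D)) divfK // -opprB mulrN -e1; ring.
  have ys : y = s.
    have : y ^+ 2 == s ^+ 2 by rewrite (spoint_on eP) (spoint_on eQ) xr.
    rewrite eqf_sqr => /orP[/eqP//|/eqP ys]; move: op; rewrite xr eqxx ys /=. by rewrite addNr eqxx.
  have y0 : 2 * y != 0.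
    by move: op; rewrite xr eqxx -ys /=; congr (_ != _); ring.
  apply: (mulIf y0); rewrite divfK //; apply: (mulfI D0). by rewrite mulrA (mulrC D (N / D)) divfK // e2.
rewrite lam subr0; congr (Some (pair _ _)); rewrite -/x3.
have line : y = s + N / D * (x - r).
  apply: (mulfI D0); rewrite mulrDr mulrA (mulrC D (N / D)) divfK // e1; ring.
by rewrite line; ring.
Qed.

(** As functions of P, [shiftX] is D^2 x(P + R) and [shiftY] is D^3 y(P + R), for R = (r, s). *)
Definition shiftX (r : F) D N : crd := N ^+ 2 - cX ('X + r%:P) * D ^+ 2.
Definition shiftY (r s : F) D N : crd :=
  - (cX s%:P * D ^+ 3 + N * (shiftX r D N - cX r%:P * D ^+ 2)).

(* [n] bounds the order of the pole of [f] at infinity *)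
Definition pole n f := ((size f.1).*2 <= n.+2)%N && ((size f.2).*2 <= n.-1)%N.

(* D^n times the function [P |-> f (P + (r, s))], if N/D is the slope of the
   line through P and (r, s) *)
Definition shift (n : nat) f r s D N : crd :=
  \sum_(i < size f.1) cX (f.1`_i)%:P * (D ^+ (n - i.*2) * shiftX r D N ^+ i)
  + \sum_(j < size f.2) cX (f.2`_j)%:P *
      (D ^+ (n - j.*2.+3) * shiftX r D N ^+ j * shiftY r s D N).

Lemma pole_norm n f : pole n f = (size (crd_norm f) <= n.+1)%N.
Proof.
rewrite /pole; have [->|f0] := eqVneq f 0.
  have -> : crd_norm (0 : crd) = 0 by apply/eqP; rewrite crd_norm_eq0. by rewrite /= size_poly0.
rewrite size_crd_norm //; case: f f0 => u v /= f0.
have [v0|v0] := eqVneq v 0.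
  rewrite v0 size_poly0 andbT; have : u != 0 by move: f0; rewrite v0 xpair_eqE eqxx andbT.
  by rewrite -size_poly_gt0; case: (size u) => // m _; rewrite doubleS /= !ltnS.
rewrite geq_max; move: v0; rewrite -size_poly_gt0.
case: (size v) => // k _; congr andb; first by case: (size u) => // m; rewrite doubleS /= !ltnS.
by case: n => // n; rewrite !doubleS /= !ltnS.
Qed.

Definition evalp f P := if val P is Some (x, y) then crd_eval x y f else 0.

Lemma evalpE f P x y : val P = Some (x, y) -> evalp f P = crd_eval x y f.
Proof. by rewrite /evalp => ->. Qed.
Lemma evalpM f g P : evalp (f * g) P = evalp f P * evalp g P.
Proof.
rewrite /evalp; case e: (val P) => [[x y]|]; last by rewrite mulr0.
by rewrite crd_evalM // (spoint_on e).
Qed.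
Lemma evalpD f g P : evalp (f + g) P = evalp f P + evalp g P.
Proof. by rewrite /evalp; case: (val P) => [[x y]|]; rewrite ?addr0 ?crd_evalD. Qed.
Lemma evalpX p P : P != 0 -> evalp (cX p) P = p.[if val P is Some (x, _) then x else 0].
Proof. by move=> /point_xyP[x [y e]]; rewrite (evalpE _ e) e crd_evalX. Qed.
Lemma evalpZ k f P : evalp (cX k%:P * f) P = k * evalp f P.
Proof.
rewrite evalpM; have [->|P0] := eqVneq P 0; first by rewrite /evalp val_pt0 !mulr0.
by rewrite evalpX // hornerC.
Qed.

Lemma eval_sum x y (I : finType) (G : I -> crd) :
  crd_eval x y (\sum_i G i) = \sum_i crd_eval x y (G i).
Proof.
apply: (big_morph (crd_eval x y)) => [f g|]; first exact: crd_evalD.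
by rewrite /crd_eval /= !horner0 mulr0 addr0.
Qed.

Lemma eval_shift n f P Q x y r s D N : pole n f ->
  val P = Some (x, y) -> val Q = Some (r, s) ->
  P != - Q -> crd_eval x y D != 0 ->
  crd_eval x y N * (x - r) = crd_eval x y D * (y - s) ->
  (x = r -> crd_eval x y N * (2 * y) = crd_eval x y D * (3 * x ^+ 2 + a)) ->
  evalp (shift n f r s D N) P = crd_eval x y D ^+ n * evalp f (P + Q).
Proof.
move=> pf eP eQ nPQ D0 e1 e2; have yc := spoint_on eP.
rewrite (evalpE _ eP) (evalpE _ (val_add eP eQ nPQ D0 e1 e2)).
set d := crd_eval x y D in D0 *; set k := crd_eval x y N.
set x3 := _ - r; set y3 := - _.
have eX : crd_eval x y (shiftX r D N) = d ^+ 2 * x3.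
  rewrite /shiftX crd_evalD crd_evalN crd_evalM // crd_evalX !crd_evalXn // -/d -/k. by rewrite !hE /x3; field.
have eY : crd_eval x y (shiftY r s D N) = d ^+ 3 * y3.
  rewrite /shiftY crd_evalN crd_evalD !crd_evalM // crd_evalD crd_evalN eX !crd_evalM //.
  by rewrite !crd_evalX -/d -/k !hornerC /y3; field.
have /andP[p1 p2] := pf.
rewrite /shift crd_evalD !eval_sum /crd_eval !horner_coef mulrDr; congr (_ + _).
  rewrite mulr_sumr; apply: eq_bigr => i _; rewrite -/(crd_eval x y _).
  rewrite !crd_evalM // crd_evalX hornerC !crd_evalXn // eX -/d exprMn -exprM. have -> : d ^+ n = d ^+ (n - i.*2) * d ^+ (2 * i).
    by rewrite -!exprD; congr (_ ^+ _); move: p1; have := ltn_ord i; rewrite -!muln2; lia.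
  ring.
rewrite mulrCA !mulr_sumr; apply: eq_bigr => j _; rewrite -/(crd_eval x y _).
rewrite !crd_evalM // crd_evalX hornerC !crd_evalXn // eX eY -/d exprMn -exprM.
have -> : d ^+ n = d ^+ (n - j.*2.+3) * d ^+ (2 * j) * d ^+ 3.
  rewrite -!exprD; congr (_ ^+ _); move: p2; have := ltn_ord j; rewrite -!muln2; lia.
ring.
Qed.

Lemma val_genX P x y : val P = Some (x, y) -> genX P = cX ('X - x%:P).
Proof. by rewrite /genX /xpoly => ->. Qed.
Lemma val_genY P x y : val P = Some (x, y) -> genY P = Y - cX y%:P.
Proof. by rewrite /genY => ->. Qed.

Lemma inI_exp k Q f n : inI (nseq k Q) f -> inI (nseq (k * n) Q) (f ^+ n).
Proof.
move=> h; elim: n => [|n IH]; first by rewrite muln0 expr0.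
by rewrite mulnS exprS nseqD; apply: inI_cat.
Qed.

Lemma inI_leq k n Q f : (k <= n)%N -> inI (nseq n Q) f -> inI (nseq k Q) f.
Proof.
move=> /subnK <-; elim: (n - k)%N f => // m IH f; rewrite addSn /=.
by move=> /inI_tail; exact: IH.
Qed.

(** With [genX Q] and [genY Q] for D and N, [shiftX] lies in the square and [shiftY] in the cube of
    the ideal of Q, so every term of [shift] has weight at least n. *)
Lemma inI_shift_mul n f Q r s : val Q = Some (r, s) -> pole n f ->
  inI (nseq n Q) (shift n f r s (genX Q) (genY Q)).
Proof.
move=> eQ /andP[p1 p2].
have gX1 : inI (nseq 1 Q) (genX Q) by rewrite -[genX Q]mulr1; exact: (@inIX _ _ Q [::]).
have gY1 : inI (nseq 1 Q) (genY Q) by rewrite -[genY Q]mulr1; exact: (@inIY _ _ Q [::]).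
have X2 : inI (nseq 2 Q) (shiftX r (genX Q) (genY Q)).
  by apply: inIB; first exact: (inI_exp 2 gY1); apply/inIMl; exact: (inI_exp 2 gX1).
have Y3 : inI (nseq 3 Q) (shiftY r s (genX Q) (genY Q)).
  apply/inIN/inID; first by apply/inIMl; exact: (inI_exp 3 gX1).
  apply: (@inI_cat _ _ (nseq 1 Q) (nseq 2 Q)) => //; apply: inIB => //; apply/inIMl. exact: (inI_exp 2 gX1).
have S (I : finType) (G : I -> crd) : (forall i, inI (nseq n Q) (G i)) -> inI (nseq n Q) (\sum_i G i).
  by move=> h; apply: big_ind => //; [exact: inI0|exact: inID].
apply: inID; apply: S => i; apply: inIMl.
  apply: (@inI_leq _ (1 * (n - i.*2) + 2 * i)%N); first lia. by rewrite nseqD; apply: inI_cat; exact: inI_exp.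
apply: (@inI_leq _ (1 * (n - i.*2.+3) + 2 * i + 3)%N); first lia.
rewrite nseqD; apply: inI_cat => //; rewrite nseqD; apply: inI_cat; exact: inI_exp.
Qed.

(** A pole of order at most 2h at infinity with leading coefficient k; the part in y has order at
    most 2h - 1. *)
Definition epole h (k : F) f :=
  [/\ (size f.1 <= h.+1)%N, (size f.2 <= h.-1)%N & f.1`_h = k].

Lemma epoleD h k k' f g : epole h k f -> epole h k' g -> epole h (k + k') (f + g).
Proof.
move=> [a1 a2 <-] [b1 b2 <-]; split; last by rewrite crdD coefD.
  by rewrite size_leD // geq_max a1.
by rewrite size_leD // geq_max a2.
Qed.

Lemma epole_sum h (I : finType) (k : I -> F) (G : I -> crd) :
  (forall i, epole h (k i) (G i)) -> epole h (\sum_i k i) (\sum_i G i).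
Proof.
move=> hG; apply: (big_ind2 (epole h)) => // [|x f y g hx hy]; last exact: epoleD.
by split; rewrite /= ?size_poly0 ?coef0.
Qed.

Lemma coefM_top (p q : {poly F}) m n : (size p <= m.+1)%N -> (size q <= n.+1)%N ->
  (p * q)`_(m + n) = p`_m * q`_n.
Proof.
move=> sp sq; rewrite coefM.
have mn : (m < (m + n).+1)%N by rewrite ltnS leq_addr.
rewrite (bigD1 (Ordinal mn)) //= addKn big1 ?addr0 // => i ni.
have [im|mi] := ltnP i m.
  by rewrite [q`_ _]nth_default ?mulr0 // (leq_trans sq) //; lia.
rewrite [p`_ _]nth_default ?mul0r // (leq_trans sp) // ltn_neqAle mi andbT.
by apply: contra ni => /eqP e; apply/eqP/val_inj.
Qed.

Lemma epoleM h h' k k' f g : epole h k f -> epole h' k' g -> epole (h + h') (k * k') (f * g).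
Proof.
move=> [a1 a2 <-] [b1 b2 <-].
have s2 : (size (c * (f.2 * g.2))%R <= h + h')%N.
  have [f0|f0] := eqVneq f.2 0; first by rewrite f0 mul0r mulr0 size_poly0.
  have [g0|g0] := eqVneq g.2 0; first by rewrite g0 !mulr0 size_poly0.
  rewrite size_mul ?cubic_neq0 ?mulf_neq0 // size_cubic size_mul //.
  by move: f0 g0 a2 b2; rewrite -!size_poly_gt0; clear; move: (size f.2) (size g.2) => u v; lia.
have sM (p q : {poly F}) i j : (size p <= i.+1)%N -> (size q <= j)%N -> (size (p * q)%R <= i + j)%N.
  move=> hp hq; have [->|q0] := eqVneq q 0; first by rewrite mulr0 size_poly0.
  have [->|p0] := eqVneq p 0; first by rewrite mul0r size_poly0.
  by rewrite size_mul //; move: p0 hp hq; rewrite -size_poly_gt0; clear; move: (size p) (size q) => u v; lia.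
have s22 (p q : {poly F}) i j : (size p <= i.+1)%N -> (size q <= j.-1)%N -> (size (p * q)%R <= (i + j).-1)%N.
  move=> hp hq; have [->|q0] := eqVneq q 0; first by rewrite mulr0 size_poly0.
  rewrite (leq_trans (sM _ _ _ _ hp hq)) //; move: q0 hq; rewrite -size_poly_gt0. by clear; move: (size q) => v; lia.
split=> /=.
- rewrite size_leD // geq_max -addnS sM //= addnS.
  exact: leqW.
- rewrite size_leD // geq_max s22 //=.
  by rewrite mulrC addnC s22.
- by rewrite coefD coefM_top // [X in _ + X]nth_default ?addr0.
Qed.

Lemma epoleXn h k f n : epole h k f -> epole (h * n) (k ^+ n) (f ^+ n).
Proof.
move=> hf; elim: n => [|n IH]; last by rewrite mulnS !exprS; exact: epoleM.
by rewrite muln0 !expr0; split; rewrite /= ?size_poly1 ?size_poly0 // coefC.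
Qed.

Lemma epoleC k : epole 0 k (cX k%:P).
Proof. by split; rewrite /= ?size_poly0 ?coefC // size_polyC leq_b1. Qed.

(** As P tends to infinity the translate tends to f(Q), while D^n has a pole of order 2n with
    leading coefficient 1. *)
Lemma epole_shift n f Q r s : val Q = Some (r, s) -> pole n f ->
  epole n (evalp f Q) (shift n f r s (genX Q) (genY Q)).
Proof.
move=> eQ /andP[p1 p2]; rewrite (evalpE _ eQ) (val_genX eQ) (val_genY eQ).
have eD : epole 1 1 (cX ('X - r%:P)).
  by split; rewrite /= ?size_XsubC ?size_poly0 // coefB coefX coefC subr0.
pose xx : {poly F} := r *: 'X^2 + (a + r ^+ 2) *: 'X + (b + s ^+ 2 - r ^+ 3)%:P.
(* The x^3 in y^2 cancels against x D^2, which lowers the pole of [shiftX] from order 6 to order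
   4. *)
have XE : shiftX r (cX ('X - r%:P)) (Y - cX s%:P) = (xx, (- (2 * s))%:P).
  rewrite /shiftX -!rmorphXn -!rmorphM /crdX /crdY !(crdN, crdD, crdM, expr2) /=.
  congr pair; rewrite /xx /cubic -?mul_polyC !(polyCD, polyCN, polyCM); ring.
have eX : epole 2 r (shiftX r (cX ('X - r%:P)) (Y - cX s%:P)).
  rewrite XE; split=> /=.
  - apply/leq_sizeP => j j3; rewrite /xx !coefE; move: j j3; do 3?[case=> //] => j _.
    by rewrite /= !mulr0 !addr0.
  - by rewrite size_polyC leq_b1.
  - by rewrite /xx !coefE /= mulr1 mulr0 !addr0.
pose yx : {poly F} := s *: 'X^3 + (3 * r * s) *: 'X^2 + (3 * a * s) *: 'X
  + (s * (3 * b + s ^+ 2 - r ^+ 3))%:P.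
pose yy : {poly F} := - ((a + 3 * r ^+ 2) *: 'X + (b + 3 * s ^+ 2 - 2 * r ^+ 3)%:P).
have YE : shiftY r s (cX ('X - r%:P)) (Y - cX s%:P) = (yx, yy).
  rewrite /shiftY XE -!rmorphXn -!rmorphM /crdX /crdY !(crdN, crdD, crdM, expr2) /=.
  congr pair; rewrite /xx /yx /yy /cubic -?mul_polyC !(polyCD, polyCN, polyCM); ring.
have eY : epole 3 s (shiftY r s (cX ('X - r%:P)) (Y - cX s%:P)).
  rewrite YE; split=> /=.
  - apply/leq_sizeP => j j3; rewrite /yx !coefE; move: j j3; do 4?[case=> //] => j _.
    by rewrite /= !mulr0 !addr0.
  - apply/leq_sizeP => j j3; rewrite /yy !coefE; move: j j3; do 2?[case=> //] => j _.
    by rewrite /= !mulr0 !addr0 oppr0.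
  - by rewrite /yx !coefE /= mulr1 !mulr0 !addr0.
rewrite /shift /crd_eval !horner_coef mulr_sumr; apply: epoleD; apply: epole_sum => i.
  have e := epoleM (epoleC f.1`_i) (epoleM (epoleXn (n - i.*2) eD) (epoleXn i eX)).
  move: e; rewrite expr1n mul1r; congr epole; rewrite add0n mul1n. by have := ltn_ord i; move: p1; rewrite -muln2; lia.
have e := epoleM (epoleC f.2`_i) (epoleM (epoleM (epoleXn (n - i.*2.+3) eD) (epoleXn i eX)) eY).
move: e; rewrite expr1n mul1r (mulrC (r ^+ i)) mulrCA; congr epole.
by rewrite add0n mul1n; have := ltn_ord i; move: p2; rewrite -muln2; lia.
Qed.

End Translation.

(** * Sections of the line bundle of nO over the algebraic numbers *)

Section Sections.
Variable E : scurve algC.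
Local Notation F := algC.
Local Notation a := (sa E).
Local Notation b := (sb E).
Local Notation c := (cubic a b).
Local Notation crd := (crd c).
Local Notation cX := (crdX c).
Local Notation Y := (crdY c).
Local Notation pt := (spoint E).
Local Notation inI := (@inI _ E).
Implicit Types (P Q X R S : pt) (f g w v : crd).

Lemma poly_zero_off (p q : {poly F}) : q != 0 ->
  (forall x, q.[x] != 0 -> p.[x] = 0) -> p = 0.
Proof.
move=> q0 h; apply/eqP; apply: contraT => p0.
have pq0 : p * q != 0 by rewrite mulf_neq0.
have /allP H : all (root (p * q)) [seq i%:R | i <- iota 0 (size (p * q))].
  apply/allP => _ /mapP[i _ ->]; rewrite rootE hornerM. by have [->|/h->] := eqVneq q.[i%:R] 0; rewrite ?mulr0 ?mul0r.
have := max_poly_roots pq0 (introT allP H).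
rewrite map_inj_uniq ?iota_uniq ?size_map ?size_iota ?ltnn; first by move=> /(_ isT).
by move=> i j /eqP; rewrite eqr_nat => /eqP.
Qed.

Lemma point_at (x : F) : exists P y, val P = Some (x, y).
Proof.
have h : on_curve (short a b) (Some (x, sqrtC c.[x])) by rewrite on_short sqrtCK.
by exists (Point h), (sqrtC c.[x]).
Qed.

Lemma crd_eq_off f g (q : {poly F}) : q != 0 ->
  (forall P x y, val P = Some (x, y) -> q.[x] != 0 -> evalp f P = evalp g P) -> f = g.
Proof.
move=> q0 h; apply/eqP; rewrite -subr_eq0 -crd_norm_eq0; apply/eqP.
apply: (poly_zero_off q0) => x qx; have [P [y eP]] := point_at x.
rewrite -(crd_eval_norm _ (spoint_on eP)) crd_evalD crd_evalN.
by rewrite -!(evalpE _ eP) (h _ _ _ eP qx) subrr mul0r.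
Qed.

Lemma generic_point (s : seq pt) : exists P, P \notin s.
Proof.
pose xs := [seq if val P is Some (x, _) then x else 0 | P <- s].
pose q : {poly F} := \prod_(x <- xs) ('X - x%:P).
have [x qx] : exists x, q.[x] != 0.
  apply: contrapT => /forallNP h; have : q != 0 by rewrite prodf_seq_neq0; apply/allP => z _; rewrite polyXsubC_eq0.
  move=> /eqP; apply; apply: (@poly_zero_off q 1) => [|x _]; first exact: oner_neq0. by apply/eqP/negPn/negP/h.
have [P [y eP]] := point_at x; exists P; apply: contra qx => Ps.
rewrite -[_ == 0]/(root q x) root_prod_XsubC; apply/mapP; exists P => //; by rewrite eP.
Qed.

(** The divisor of w is n(Q) - n(O): this is the function attached to a point Q with nQ = 0. *)
Definition gen n Q w := [/\ inI (nseq n Q) w,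
  (forall g, inI (nseq n Q) g -> exists h, g = w * h) &
  exists2 k, k != 0 & crd_norm w = k *: xpoly Q ^+ n].

(** By induction on j, the divisor (-jQ) + j(Q) is principal; for j = n the first point is at
    infinity and drops out. *)
Lemma gen_exists n Q : Q *+ n = 0 -> exists w, gen n Q w.
Proof.
move=> nQ; suff : principal (nseq n Q).
  by case=> w [Iw dw [k k0 Nw]]; exists w; split=> //; exists k => //; rewrite Nw big_nseq iter_mulr_1.
have h j : principal (- (Q *+ j) :: nseq j Q).
  elim: j => [|j IH]; first by apply/principal_inf => //; exact: principal_nil. apply/(principal_cancel (Q *+ j)).
  apply: principal_perm (principal_cat IH (principal_add (Q *+ j) Q)). rewrite -[point_add _ _]/(Q *+ j + Q) -mulrSr.
  pose A : pt := - (Q *+ j); pose B : pt := Q *+ j; pose C : pt := - (Q *+ j.+1).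
  change (perm_eq ((A :: nseq j Q) ++ [:: B; Q; C]) [:: B, A, C & nseq j.+1 Q]).
  by move: A B C => A B C; apply/permP => p; rewrite !count_cat /=; lia.
have := h n; rewrite nQ => /principal_inf; apply; by rewrite val_opp.
Qed.

Lemma gen_conj n Q w : gen n Q w -> gen n (- Q) (crd_conj w).
Proof.
have conj' R f : inI (nseq n R) f -> inI (nseq n (- R)) (crd_conj f).
  by move=> /inI_conj; rewrite map_nseq.
case=> Iw dw [k k0 Nw]; split; first exact: conj'.
  move=> g /conj'; rewrite opprK => /dw[h e]. by exists (crd_conj h); rewrite -[LHS]crd_conjK e rmorphM.
by exists k => //; rewrite crd_norm_conj Nw -poppE xpoly_opp.
Qed.

(* non-vanishing at P of f, seen as a section of the line bundle of nO *)
Definition nz n f P :=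
  if P == 0 then size (crd_norm f) == n.+1 else evalp f P != 0.

Lemma nzE n f P : P != 0 -> nz n f P = (evalp f P != 0).
Proof. by rewrite /nz => /negPf->. Qed.

Lemma norm_root f P x y : val P = Some (x, y) ->
  (crd_norm f).[x] = evalp f P * evalp f (- P).
Proof.
move=> e; have e' : val (- P) = Some (x, - y) by rewrite val_opp e.
by rewrite (evalpE _ e) (evalpE _ e') crd_eval_norm // (spoint_on e).
Qed.

Lemma norm_const f : (size (crd_norm f) <= 1)%N -> exists k, f = cX k%:P.
Proof.
rewrite -pole_norm => /andP[/= s1 s2].
have : (size f.1 <= 1)%N by move: s1; case: (size f.1) => [|[]].
move=> /size1_polyC e1; exists f.1`_0.
have e2 : f.2 = 0 by apply/eqP; rewrite -size_poly_eq0; move: s2; case: (size f.2).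
by rewrite /crdX -e1 -e2; case: (f).
Qed.

Lemma xpoly_val P x y : val P = Some (x, y) -> xpoly P = 'X - x%:P.
Proof. by rewrite /xpoly => ->. Qed.

Lemma inI_vanish Q f : Q != 0 -> inI [:: Q] f -> evalp f Q = 0.
Proof.
move=> /point_xyP[x [y e]] [u [v [_ _ ->]]]; rewrite (evalpE _ e).
have yc := spoint_on e.
rewrite (val_genX e) (val_genY e) crd_evalD !crd_evalM // crd_evalX crd_evalD crd_evalN.
by rewrite crd_evalX crd_evalY hornerC hornerD hornerN hornerX hornerC !subrr !mul0r addr0.
Qed.

Lemma gen_nz n Q w P : (0 < n)%N -> gen n Q w -> nz n w P = (P != Q).
Proof.
move=> n0 [Iw dw [k k0 Nw]]; have [Q0|Q0] := eqVneq Q 0.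
  subst Q; rewrite /xpoly val_pt0 expr1n in Nw.
  have Nw1 : size (crd_norm w) = 1%N by rewrite Nw size_scale // size_poly1. rewrite /nz; have [P0|P0] := eqVneq P 0.
    by rewrite Nw1; case: (n) n0.
  have [j wj] := norm_const (eq_leq Nw1); rewrite wj evalpX // hornerC. suff -> : j != 0 by [].
  apply/eqP => j0; move: Nw1; rewrite wj j0 polyC0 rmorph0. by rewrite (eqP (_ : crd_norm (0 : crd) == 0)) ?crd_norm_eq0 // size_poly0.
have [x [y eQ]] := point_xyP Q0.
have [->|P0] := eqVneq P 0.
  rewrite /nz eqxx Nw (xpoly_val eQ) size_scale // size_exp_XsubC eqxx. by rewrite eq_sym Q0.
rewrite nzE //; have [x' [y' eP]] := point_xyP P0.
have [->|PQ] := eqVneq P Q.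
  apply/negbTE/negPn/eqP/inI_vanish => //; apply: (@inI_leq _ _ 1 n) => //.
have [PQ'|PQ'] := eqVneq P (- Q); last first.
  have : (crd_norm w).[x'] != 0.
    rewrite Nw hornerZ mulf_neq0 // horner_exp expf_neq0 // (xpoly_val eQ). rewrite hornerD hornerN hornerX hornerC subr_eq0.
    apply: contra PQ' => /eqP xx; subst x'. have : y' ^+ 2 == y ^+ 2 by rewrite (spoint_on eP) (spoint_on eQ).
    rewrite eqf_sqr => /orP[/eqP yy|/eqP yy]; last by apply/eqP/val_inj; rewrite val_opp eP eQ yy.
    by case/eqP: PQ; apply: val_inj; rewrite eP eQ yy.
  by rewrite (norm_root _ eP) mulf_eq0 negb_or => /andP[].
(* The power (y - y_Q)^n is a multiple of w, so a zero of w at P = -Q would give y_P = y_Q, hence P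
   = Q. *)
have [|h e] := dw (genY Q ^+ n).
  rewrite -[n in nseq n Q]mul1n; apply: inI_exp; rewrite -[genY Q]mulr1; exact: (@inIY _ _ Q [::]).
apply/eqP => w0; have : evalp (genY Q ^+ n) P = 0 by rewrite e evalpM w0 mul0r.
rewrite (evalpE _ eP) crd_evalXn ?(spoint_on eP) // => /eqP.
rewrite expf_eq0 n0 /= (val_genY eQ) crd_evalD crd_evalN crd_evalY crd_evalX hornerC subr_eq0.
move=> /eqP yy; case/eqP: PQ; apply: val_inj; rewrite eP eQ -yy.
by move: eP; rewrite PQ' val_opp eQ => -[->].
Qed.

Lemma epole_conj h (k : F) f : epole h k f -> epole h k (crd_conj f).
Proof. by case=> *; split; rewrite //= size_polyN. Qed.

Lemma epole_norm h (k : F) f : epole h k f ->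
  (size (crd_norm f) <= h.*2.+1)%N /\ (size (crd_norm f) == h.*2.+1) = (k != 0).
Proof.
move=> e; have := epoleM e (epole_conj e); rewrite crd_mul_conj addnn => -[/= s _ ck].
split=> //; rewrite eqn_leq s /=; apply/idP/idP => [s'|k0].
  apply/eqP => k0; move: ck; rewrite k0 mulr0 -[h.*2]/(h.*2.+1.-1).
  have <- : size (crd_norm f) = h.*2.+1 by apply/eqP; rewrite eqn_leq s s'.
  rewrite -lead_coefE => /eqP; rewrite lead_coef_eq0 => /eqP N0. by move: s'; rewrite N0 size_poly0.
rewrite ltnNge; apply: contra k0 => s'; have : k * k == 0 by rewrite -ck nth_default.
by rewrite mulf_eq0 orbb.
Qed.

Lemma xpoly_opp' P : xpoly (- P) = xpoly P.
Proof. exact: xpoly_opp. Qed.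

Lemma size_normM f g : f != 0 -> g != 0 ->
  size (crd_norm (f * g)) = (size (crd_norm f) + size (crd_norm g)).-1.
Proof. by move=> f0 g0; rewrite crd_normM size_mul ?crd_norm_eq0. Qed.

Lemma gen_neq0 n Q w : gen n Q w -> w != 0.
Proof.
case=> _ _ [k k0 Nw]; rewrite -crd_norm_eq0 Nw scaler_eq0 (negPf k0) /=.
by rewrite expf_neq0 // xpoly_neq0.
Qed.

(** The translate of f by R has its pole moved to -R; the zero of order n of w at -R absorbs it, and
    g is again a section of the bundle of nO. *)
Definition Tr n R w f g := pole n g /\
  forall P, P != 0 -> P != - R -> evalp g P = evalp w P * evalp f (P + R).

Lemma Tr_exists n R w f : (0 < n)%N -> gen n (- R) w -> pole n f ->
  exists g, Tr n R w f g /\ nz n g 0 = nz n f R.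
Proof.
move=> n0 gw pf; have [R0|R0] := eqVneq R 0.
  subst R; have [_ _ [k k0 Nw]] := gw.
  rewrite oppr0 /xpoly val_pt0 expr1n in Nw.
  have [j wj] : exists j, w = cX j%:P by apply: norm_const; rewrite Nw size_scale // size_poly1.
  have j0 : j != 0 by apply: contraNneq (gen_neq0 gw) => j0; rewrite wj j0 polyC0 rmorph0. exists (w * f); split; [split|].
  - by rewrite pole_norm crd_normM wj crd_normX -polyC_exp mul_polyC size_scale ?expf_neq0 // -pole_norm.
  - by move=> P P0 _; rewrite evalpM addr0.
  - by rewrite /nz eqxx crd_normM wj crd_normX -polyC_exp mul_polyC size_scale ?expf_neq0.
have [r [s eR]] := point_xyP R0.
have gw' := gen_conj gw; rewrite opprK in gw'.
have [_ _ [k k0 Nw]] := gw; rewrite xpoly_opp' (xpoly_val eR) in Nw.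
set wb := crd_conj w in gw'; have [Iwb dwb _] := gw'.
have wb0 := gen_neq0 gw'; have w0 := gen_neq0 gw.
pose D := genX R; pose N := genY R.
(* Phi is D^n times the translate of f. Since D = x - r has divisor (R) + (-R) - 2(O), its n-th
   power is w wb up to a constant; Phi is divisible by wb because wb generates the n-th power of the
   ideal of R, and the quotient is g up to a constant. *)
have [h Ph] := dwb _ (inI_shift_mul eR pf); rewrite -/D -/N in Ph.
set Phi := shift n f r s D N in Ph.
have ep : epole n (evalp f R) Phi := epole_shift eR pf.
have [sP sPn] := epole_norm ep.
pose g := cX k%:P * h; exists g.
have gE : wb * g = cX k%:P * Phi by rewrite Ph mulrCA.
have wwb : w * wb = cX (k%:P * ('X - r%:P) ^+ n).
  by rewrite crd_mul_conj Nw mul_polyC.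
have sw : size (crd_norm wb) = n.+1.
  by rewrite crd_norm_conj Nw size_scale // size_exp_XsubC.
have sg : size (crd_norm Phi) = if g == 0 then 0 else (n + size (crd_norm g))%N.
  have -> : size (crd_norm Phi) = size (crd_norm (wb * g)).
    by rewrite gE crd_normM crd_normX -polyC_exp mul_polyC size_scale // expf_neq0.
  case: eqP => [->|/eqP g0]; last by rewrite size_normM // sw. by rewrite mulr0; apply/eqP; rewrite size_poly_eq0 crd_norm_eq0.
have zn : size (crd_norm (0 : crd)) = 0 by apply/eqP; rewrite size_poly_eq0 crd_norm_eq0.
have pg : pole n g.
  rewrite pole_norm; move: sP; rewrite sg; case: eqP => [->|_]; first by rewrite zn. by rewrite -addnn -addnS leq_add2l.
have P1 P x y : val P = Some (x, y) -> x != r -> evalp g P = evalp w P * evalp f (P + R).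
  move=> eP xr; have yc := spoint_on eP. have PR : P != - R.
    by apply: contra xr => /eqP PR; move: eP; rewrite PR val_opp eR => -[->].
  have Dx : crd_eval x y D = x - r.
    by rewrite /D (val_genX eR) crd_evalX hornerD hornerN hornerX hornerC.
  have Nx : crd_eval x y N = y - s.
    by rewrite /N (val_genY eR) crd_evalD crd_evalN crd_evalX crd_evalY hornerC.
  have xr0 : x - r != 0 by rewrite subr_eq0. have := @eval_shift _ _ n f P R x y r s D N pf eP eR PR; rewrite Dx Nx -/Phi => eS.
  have {}eS := eS xr0 (mulrC _ _) _. have {}eS : evalp Phi P = (x - r) ^+ n * evalp f (P + R).
    by apply: eS => e; rewrite e eqxx in xr.
  have wwbP : evalp w P * evalp wb P = k * (x - r) ^+ n.
    rewrite -evalpM wwb evalpX ?point_eq0 ?eP // hornerM hornerC horner_exp. by rewrite hornerD hornerN hornerX hornerC.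
  have wbP : evalp wb P != 0.
    by apply: contraTneq (mulf_neq0 k0 (expf_neq0 n xr0)) => e; rewrite -wwbP e mulr0 eqxx.
  apply: (mulfI wbP); rewrite -evalpM gE evalpZ eS mulrA -wwbP; ring.
split; last first.
  rewrite (nzE n f R0) -sPn sg /nz eqxx; have [->|_] := eqVneq g 0; first by rewrite zn. by rewrite -addnn -addnS eqn_add2l.
split=> // P P0 PR; have [x [y eP]] := point_xyP P0.
have [xr|xr] := eqVneq x r; last exact: P1 eP xr.
subst x; have PR' : P = R.
  have : y ^+ 2 == s ^+ 2 by rewrite (spoint_on eP) (spoint_on eR).
  rewrite eqf_sqr => /orP[/eqP e|/eqP e]; first by apply: val_inj; rewrite eP eR e.
  by case/eqP: PR; apply: val_inj; rewrite val_opp eP eR e.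
subst P; move: eP; rewrite eR => -[e]; subst y.
(* the slope of the line through R and a point near R, without the factor x - r *)
pose D' : crd := Y + cX s%:P; pose N' : crd := cX ('X^2 + r *: 'X + (r ^+ 2 + a)%:P).
have yc := spoint_on eR.
have s0 : 2 * s != 0.
  rewrite mulf_neq0 ?pnatr_eq0 //; apply: contra PR => /eqP s0. by apply/eqP/val_inj; rewrite val_opp eR /= s0 oppr0.
have D'x x y : crd_eval x y D' = y + s.
  by rewrite crd_evalD crd_evalY crd_evalX hornerC.
have N'x x y : crd_eval x y N' = x ^+ 2 + r * x + (r ^+ 2 + a).
  by rewrite crd_evalX !(hornerD, hornerZ, hornerXn, hornerX, hornerC).
pose Phi' := shift n f r s D' N'.
(* Both forms of the slope describe the same translate; the identity is tested where y^2 != s^2, so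
   that neither denominator vanishes. *)
have id1 : D' ^+ n * Phi = cX (('X - r%:P) ^+ n) * Phi'.
  apply: (@crd_eq_off _ _ (c - (s ^+ 2)%:P)).
    rewrite -size_poly_eq0 size_polyDl ?size_cubic //. by rewrite size_polyN size_polyC; case: eqP.
  move=> P x y eP; rewrite hornerD hornerN hornerC -(spoint_on eP) subr_eq0 eqf_sqr negb_or. move=> /andP[ys ys']. have xr : x != r.
    apply/eqP => e; subst x; have : y ^+ 2 == s ^+ 2 by rewrite (spoint_on eP) yc. by rewrite eqf_sqr (negPf ys) (negPf ys').
  have PR' : P != - R.
    by apply: contra xr => /eqP PR'; move: eP; rewrite PR' val_opp eR => -[->].
  have Dx : crd_eval x y D = x - r.
    by rewrite /D (val_genX eR) crd_evalX hornerD hornerN hornerX hornerC.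
  have Nx : crd_eval x y N = y - s.
    by rewrite /N (val_genY eR) crd_evalD crd_evalN crd_evalX crd_evalY hornerC.
  have xr0 : x - r != 0 by rewrite subr_eq0. have ys0 : y + s != 0 by rewrite addr_eq0.
  have eS : evalp Phi P = (x - r) ^+ n * evalp f (P + R).
    rewrite -Dx; apply: (eval_shift pf eP eR PR'); rewrite ?Dx ?Nx //; first exact: mulrC. by move=> e; rewrite e eqxx in xr.
  have eS' : evalp Phi' P = (y + s) ^+ n * evalp f (P + R).
    rewrite -(D'x x y); apply: (eval_shift pf eP eR PR'); rewrite ?D'x ?N'x //; last first.
      by move=> e; rewrite e eqxx in xr.
    have := spoint_on eP; have := spoint_on eR; rewrite !cubicE => e1 e2. transitivity (y ^+ 2 - s ^+ 2); last ring.
    by rewrite e1 e2; ring.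
  rewrite !evalpM eS eS' (evalpE _ eP) crd_evalXn ?(spoint_on eP) // D'x.
  rewrite evalpX ?point_eq0 ?eP // horner_exp hornerD hornerN hornerX hornerC; ring.
have id2 : D' ^+ n * g = w * Phi'.
  apply: (crd_mulI wb0); transitivity (cX k%:P * (D' ^+ n * Phi)).
    by rewrite mulrCA gE; ring.
  transitivity (cX (k%:P * ('X - r%:P) ^+ n) * Phi'); first by rewrite id1 rmorphM mulrA.
  by rewrite -wwb; ring.
have eS' : evalp Phi' R = (s + s) ^+ n * evalp f (R + R).
  rewrite -(D'x r s); apply: (eval_shift pf eR eR PR); rewrite ?D'x ?N'x //.
  - by move: s0; congr (_ != _); ring.
  - by rewrite !subrr !mulr0.
  - by move=> _; ring.
move/(congr1 (fun z => evalp z R)): id2; rewrite (evalpM _ g) (evalpM w) eS' (evalpE (D' ^+ n) eR).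
rewrite crd_evalXn // D'x [RHS]mulrCA => /mulfI; apply.
by rewrite expf_neq0 //; move: s0; congr (_ != _); ring.
Qed.

Lemma Tr_off n R w f g g' : Tr n R w f g -> Tr n R w f g' -> g = g'.
Proof.
move=> [_ h] [_ h']; apply: (@crd_eq_off _ _ (xpoly R)); first exact: xpoly_neq0.
move=> P x y eP xR; rewrite h ?h' // ?point_eq0 ?eP //.
all: by apply: contra xR => /eqP e; move: eP; rewrite e val_opp /xpoly;
  case: (val R) => // -[x' y'] [<- _]; rewrite hornerD hornerN hornerX hornerC subrr.
Qed.

Lemma Tr_nz0 n R w f g : (0 < n)%N -> gen n (- R) w -> pole n f ->
  Tr n R w f g -> nz n g 0 = nz n f R.
Proof. by move=> n0 gw pf T; have [g' [T' <-]] := Tr_exists n0 gw pf; rewrite (Tr_off T T'). Qed.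

Lemma gen_pole n Q w : gen n Q w -> pole n w.
Proof.
case=> _ _ [k k0 Nw]; rewrite pole_norm Nw size_scale // /xpoly.
by case: (val Q) => [[x y]|]; rewrite ?size_exp_XsubC // expr1n size_poly1.
Qed.

Lemma crd_eq_offs f g (s : seq pt) :
  (forall P, P != 0 -> P \notin s -> evalp f P = evalp g P) -> f = g.
Proof.
move=> h; apply: (@crd_eq_off _ _ (\prod_(P <- s) xpoly P)).
  by rewrite prodf_seq_neq0; apply/allP => P _; rewrite xpoly_neq0.
move=> P x y eP q0; apply: h; first by rewrite point_eq0 eP.
apply: contra q0 => Ps; rewrite horner_prod prodf_seq_eq0; apply/hasP; exists P => //=.
by rewrite (xpoly_val eP) hornerD hornerN hornerX hornerC subrr.
Qed.

(** The case P = -R is not visible in [Tr]. Translating g back by -R gives a constant multiple of f,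
    and the behaviour of this back translate at O is that of g at -R. *)
Lemma Tr_nz n R w f g : (0 < n)%N -> gen n (- R) w -> pole n f -> Tr n R w f g ->
  forall P, nz n g P = nz n f (P + R).
Proof.
move=> n0 gw pf T P.
have [->|P0] := eqVneq P 0; first by rewrite add0r (Tr_nz0 n0 gw pf T).
have [pg gE] := T.
have [PR|PR] := eqVneq P (- R); last first.
  rewrite !nzE //; last by rewrite addr_eq0. rewrite gE // mulf_eq0 negb_or -(nzE n w P0) (gen_nz _ n0 gw) PR //.
have R0 : R != 0 by rewrite -oppr_eq0 -PR.
subst P; rewrite addNr.
have gw' : gen n (- - R) (crd_conj w) by exact: gen_conj.
set w' := crd_conj w in gw'.
have Rw' P : P != 0 -> P != R -> evalp w' P != 0.
  by move=> P0' PR; rewrite -(nzE n w' P0') (gen_nz _ n0 gw') opprK.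
have [psi [Tpsi _]] := Tr_exists n0 gw' (gen_pole gw).
have key f1 g1 g2 : Tr n R w f1 g1 -> Tr n (- R) w' g1 g2 -> g2 = psi * f1.
  move=> [_ h1] [_ h2]; apply: (@crd_eq_offs _ _ [:: R]) => Q Q0; rewrite inE => QR. have QR' : Q - R != 0 by rewrite subr_eq0.
  rewrite evalpM h2 ?opprK // h1 //; last by rewrite -addr_eq0 addrNK. by rewrite addrNK; case: Tpsi => _ ->; rewrite ?opprK // mulrA.
have [psi1 [k psiE]] : psi != 0 /\ exists k, psi = cX k%:P.
  have psi0 : psi != 0.
    have [Q] := generic_point [:: 0; R; - R; R + R]; rewrite !inE !negb_or. move=> /and4P[Q0 QR QR' QRR].
    apply/eqP => e; case: Tpsi => _ /(_ Q Q0); rewrite opprK => /(_ QR). have -> : evalp psi Q = 0.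
      by rewrite e /evalp; case: (val Q) => // -[x y]; rewrite /crd_eval /= !horner0 mulr0 addr0.
    move/esym/eqP; rewrite mulf_eq0 (negPf (Rw' _ Q0 QR)) /=. have QR0 : Q - R != 0 by rewrite subr_eq0.
    by apply/negP; rewrite -(nzE n w QR0) (gen_nz _ n0 gw) -addr_eq0 addrNK.
  (* Translating w forth and back gives psi w, whose pole has order at most n; as w already has a
     pole of order n, psi has none and is constant. *)
  split=> //; apply: norm_const. have [g1 [T1 _]] := Tr_exists n0 gw (gen_pole gw). have [g2 [T2 _]] := Tr_exists n0 gw' T1.1.
  have := T2.1; rewrite (key _ _ _ T1 T2) pole_norm size_normM ?(gen_neq0 gw) //. have -> : size (crd_norm w) = n.+1.
    by apply/eqP; have := gen_nz 0 n0 gw; rewrite /nz eqxx [0 == _]eq_sym oppr_eq0 R0.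
  by rewrite addnS /= -addn1 addnC leq_add2l.
have [g2 [T2 z2]] := Tr_exists n0 gw' pg.
rewrite -z2 (key _ _ _ T T2) psiE /nz eqxx crd_normM crd_normX -polyC_exp mul_polyC size_scale //.
by rewrite expf_neq0 //; apply: contraNneq psi1 => k0; rewrite psiE k0 polyC0 rmorph0.
Qed.

Lemma norm_of_nz n Q v x y : val Q = Some (x, y) -> pole n v ->
  (forall P, nz n v P = (P != Q)) -> exists2 k, k != 0 & crd_norm v = k *: ('X - x%:P) ^+ n.
Proof.
move=> eQ pv nzv; have Q0 : Q != 0 by rewrite point_eq0 eQ.
have s : size (crd_norm v) = n.+1 by apply/eqP; have := nzv 0; rewrite /nz eqxx [0 == _]eq_sym Q0.
have N0 : crd_norm v != 0 by rewrite -size_poly_eq0 s.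
exists (lead_coef (crd_norm v)); first by rewrite lead_coef_eq0.
have [rs e] := closed_field_poly_normal (crd_norm v).
have srs : size rs = n.
  by move: s; rewrite e size_scale ?lead_coef_eq0 // size_prod_XsubC => -[].
rewrite [LHS]e; congr (_ *: _); rewrite -srs.
have : all (pred1 x) rs.
  apply/allP => z zrs /=; apply: contraT => zx. have : root (crd_norm v) z by rewrite e rootZ ?lead_coef_eq0 // root_prod_XsubC.
  have [P [t eP]] := point_at z; rewrite rootE (norm_root _ eP) mulf_eq0. have P0 : P != 0 by rewrite point_eq0 eP.
  have PQ : P != Q by apply: contra zx => /eqP e'; move: eP; rewrite e' eQ => -[->]. have PQ' : - P != Q.
    by apply: contra zx => /eqP e'; move: eQ; rewrite -e' val_opp eP => -[->].
  have := nzv P; rewrite nzE // PQ => /negPf-> /=. by have := nzv (- P); rewrite nzE ?oppr_eq0 // PQ' => /negPf->.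
by move/all_pred1P => {1}->; rewrite big_nseq iter_mulr_1.
Qed.

Lemma crd_dvdX (f : crd) P x y : val P = Some (x, y) -> P != - P ->
  evalp f P = 0 -> evalp f (- P) = 0 -> exists g, f = cX ('X - x%:P) * g.
Proof.
move=> eP PP; have eP' : val (- P) = Some (x, - y) by rewrite val_opp eP.
rewrite (evalpE _ eP) (evalpE _ eP') /crd_eval => e1 e2.
have y0 : y != 0.
  by apply: contra PP => /eqP y0; apply/eqP/val_inj; rewrite eP eP' y0 oppr0.
have f1 : f.1.[x] = 0.
  have : 2 * f.1.[x] = 0.
    transitivity ((f.1.[x] + y * f.2.[x]) + (f.1.[x] + - y * f.2.[x])); first ring.
    by rewrite e1 e2 addr0.
  by move/eqP; rewrite mulf_eq0 pnatr_eq0 => /eqP.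
move/eqP: e1; rewrite f1 add0r mulf_eq0 (negPf y0) => /factor_theorem[q2 q2E].
have /factor_theorem[q1 q1E] : root f.1 x by apply/eqP.
exists ((q1, q2) : crd); rewrite crdM /= !(mul0r, mulr0, addr0).
by rewrite (mulrC _ q1) (mulrC _ q2) -q1E -q2E; case: (f).
Qed.

(** For finite Q the products of v and of w with the conjugate of w are both constants times (x -
    x_Q)^n, so v and w are proportional. *)
Lemma section_uniq n Q w v : (0 < n)%N -> gen n Q w -> pole n v ->
  (forall P, nz n v P = (P != Q)) -> exists2 k, k != 0 & v = cX k%:P * w.
Proof.
move=> n0 gw pv nzv; have [Q0|Q0] := eqVneq Q 0.
  subst Q; have v0 : v != 0.
    apply/eqP => v0; have [P] := generic_point [:: 0]; rewrite inE => P0.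
    have := nzv P; rewrite P0 nzE // v0 /evalp; case: (val P) => [[x y]|]; rewrite ?eqxx //.
    by rewrite /crd_eval /= !horner0 mulr0 addr0 eqxx.
  have [j vj] : exists j, v = cX j%:P.
    apply: norm_const; rewrite leqNgt; apply/negP => s. have /closed_rootP[z] : size (crd_norm v) != 1%N by rewrite neq_ltn s orbT.
    have [P [t eP]] := point_at z; rewrite rootE (norm_root _ eP) mulf_eq0. have P0 : P != 0 by rewrite point_eq0 eP.
    have := nzv P; rewrite nzE // P0 => /negPf-> /=. by have := nzv (- P); rewrite nzE ?oppr_eq0 // P0 => /negPf->.
  have [_ _ [k k0 Nw]] := gw; rewrite /xpoly val_pt0 expr1n in Nw.
  have [i wi] : exists j, w = cX j%:P by apply: norm_const; rewrite Nw size_scale // size_poly1.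
  have i0 : i != 0 by apply: contraNneq (gen_neq0 gw) => i0; rewrite wi i0 polyC0 rmorph0.
  have j0 : j != 0 by apply: contraNneq v0 => j0; rewrite vj j0 polyC0 rmorph0.
  by exists (j / i); rewrite ?mulf_neq0 ?invr_eq0 // vj wi -rmorphM -polyCM divfK.
have [x [y eQ]] := point_xyP Q0.
have [k k0 Nv] := norm_of_nz eQ pv nzv.
have [_ _ [k' k'0]] := gw; rewrite (xpoly_val eQ) => Nw.
have w0 := gen_neq0 gw; set d := 'X - x%:P in Nv Nw.
have d0 : d != 0 by rewrite polyXsubC_eq0.
have cd0 j : cX (d ^+ j) != 0 by rewrite crdX_eq0 expf_neq0.
have v0 : v != 0 by rewrite -crd_norm_eq0 Nv scaler_eq0 (negPf k0) expf_neq0.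
pose wb := crd_conj w; pose vb := crd_conj v.
have wwb : w * wb = cX (k'%:P * d ^+ n) by rewrite crd_mul_conj Nw mul_polyC.
have vvb : v * vb = cX (k%:P * d ^+ n) by rewrite crd_mul_conj Nv mul_polyC.
(* The factors d = x - x_Q are extracted one at a time. If Q != -Q, the cofactor vanishes at both
   points above x_Q. If Q = -Q, then y = 0 and c = d c1 with c1 not vanishing at x_Q, and the norm
   shows that d divides both parts of the cofactor. *)
have step j : (j <= n)%N -> exists f, v * wb = cX (d ^+ j) * f.
  elim: j => [|j IH] jn; first by exists (v * wb); rewrite expr0 rmorph1 mul1r.
  have [f fE] := IH (ltnW jn); suff [h hE] : exists h, f = cX d * h.
    by exists h; rewrite exprSr rmorphM fE hE mulrA.
  have fw : f * w = cX (k'%:P * d ^+ (n - j)) * v.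
    apply: (crd_mulI (cd0 j)); rewrite mulrA -fE -mulrA (mulrC wb) wwb. by rewrite -[in LHS](subnK (ltnW jn)) exprD !rmorphM /=; ring.
  have fv : f * vb = cX (k%:P * d ^+ (n - j)) * wb.
    apply: (crd_mulI (cd0 j)); rewrite mulrA -fE mulrAC vvb. by rewrite -[in LHS](subnK (ltnW jn)) exprD !rmorphM /=; ring.
  have dn : exists m, (n - j)%N = m.+1 by exists (n - j.+1)%N; rewrite subnSK. have [m mE] := dn; rewrite mE in fw fv.
  have dQ P : P = Q \/ P = - Q -> evalp (cX d) P = 0.
    move=> PQ; have [t eP] : exists t, val P = Some (x, t).
      by case: PQ => ->; [exists y | exists (- y); rewrite val_opp eQ].
    by rewrite (evalpE _ eP) crd_evalX hornerD hornerN hornerX hornerC subrr.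
  have wn : - Q != Q -> evalp w (- Q) != 0.
    by move=> QQ; rewrite -(nzE n) ?oppr_eq0 // (gen_nz _ n0 gw).
  have vn : - Q != Q -> evalp vb Q != 0.
    move=> QQ; have : evalp v (- Q) != 0 by rewrite -(nzE n) ?oppr_eq0 // nzv.
    have eQ' : val (- Q) = Some (x, - y) by rewrite val_opp eQ. by rewrite (evalpE _ eQ) (evalpE _ eQ') crd_eval_conj.
  have [QQ|QQ] := eqVneq (- Q) Q; last first.
    apply: (crd_dvdX eQ); first by rewrite eq_sym.
      move/(congr1 (fun z => evalp z Q)): fv; rewrite exprS !rmorphM !evalpM (dQ Q (or_introl erefl)).
      by rewrite mul0r mulr0 mul0r => /eqP; rewrite mulf_eq0 (negPf (vn QQ)) orbF => /eqP.
    move/(congr1 (fun z => evalp z (- Q))): fw; rewrite exprS !rmorphM !evalpM (dQ (- Q) (or_intror erefl)).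
    by rewrite mul0r mulr0 mul0r => /eqP; rewrite mulf_eq0 (negPf (wn QQ)) orbF => /eqP.
  have y0 : y = 0.
    have : - y = y by move: QQ => /(congr1 val); rewrite val_opp eQ => -[].
    move/eqP; rewrite eq_sym -addr_eq0 -mulr2n -mulr_natr mulf_eq0 pnatr_eq0 orbF => /eqP//.
  have cx : c.[x] = 0 by rewrite -(spoint_on eQ) y0 expr0n. have [/factor_theorem[c1 c1E] c1x] : root c x /\ c^`().[x] != 0.
    split; first by apply/eqP. have [u [u' /(congr1 (fun p => p.[x]))]] := bezout_cubic E.
    rewrite hornerD !hornerM cx mulr0 add0r hornerC => e. by apply/eqP => e'; move: e; rewrite e' mulr0 => /esym/eqP; rewrite oner_eq0.
  rewrite -/d in c1E; have {}c1x : c1.[x] != 0.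
    move: c1x; rewrite c1E derivM /d derivXsubC mulr1 hornerD hornerM. by rewrite hornerD hornerN hornerX hornerC subrr mulr0 add0r.
  have [q Nf] : exists q, crd_norm f = d * (d * q).
    exists ((k * k') *: d ^+ (m + m)). apply: (mulfI (x := d ^+ j ^+ 2)); first by rewrite expf_neq0 // expf_neq0.
    rewrite -[X in X * _ = _](crd_normX c) -crd_normM -fE crd_normM crd_norm_conj Nv Nw -!mul_polyC.
    rewrite -(subnK (ltnW jn)) mE polyCM !exprD !exprS; ring.
  move: Nf; rewrite /crd_norm c1E => Nf. have /factor_theorem[u uE] : root f.1 x.
    rewrite rootE -sqrf_eq0 -horner_exp -[f.1 ^+ 2](subrK (c1 * d * f.2 ^+ 2)) Nf.
    by rewrite hornerD !hornerM /d !(hornerD, hornerN, hornerX, hornerC) subrr !(mul0r, mulr0) addr0.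
  rewrite -/d in uE. have /factor_theorem[u' u'E] : root f.2 x.
    have : d * (d * u ^+ 2 - c1 * f.2 ^+ 2) = d * (d * q) by rewrite -Nf uE; ring.
    move/(mulfI d0)/(congr1 (fun p => p.[x])); rewrite hornerD hornerN !hornerM.
    rewrite /d !(hornerD, hornerN, hornerX, hornerC) subrr !mul0r add0r => /eqP. by rewrite oppr_eq0 !mulf_eq0 (negPf c1x) orbb.
  exists ((u, u') : crd); rewrite crdM /= !(mul0r, mulr0, addr0). by rewrite (mulrC _ u) (mulrC _ u') -uE -u'E; case: (f).
have [f fE] := step n (leqnn n).
have [j fj] : exists j, f = cX j%:P.
  apply: norm_const; have : crd_norm f = (k * k')%:P.
    apply: (mulfI (x := d ^+ n ^+ 2)); first by rewrite !expf_neq0.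
    rewrite -[X in X * _ = _](crd_normX c) -crd_normM -fE crd_normM crd_norm_conj Nv Nw -!mul_polyC polyCM; ring.
  by move=> ->; rewrite size_polyC leq_b1.
exists (j / k').
  rewrite mulf_neq0 ?invr_eq0 //; apply/eqP => j0. have wb0 : wb != 0 by rewrite -crd_norm_eq0 crd_norm_conj crd_norm_eq0.
  by have := crd_mulf_neq0 v0 wb0; rewrite fE fj j0 polyC0 rmorph0 mulr0 eqxx.
apply: (crd_mulI (f := wb)); first by rewrite -crd_norm_eq0 crd_norm_conj crd_norm_eq0.
rewrite mulrC fE fj [RHS]mulrCA [wb * w]mulrC wwb -!rmorphM mulrA -polyCM divfK //.
by rewrite mulrC.
Qed.

End Sections.

From mathcomp Require Import spectral.

(** * The Weil pairing as a commutator of translations *)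

Section WeilPairing.
Variable E : scurve algC.
Local Notation F := algC.
Local Notation a := (sa E).
Local Notation b := (sb E).
Local Notation c := (cubic a b).
Local Notation crd := (crd c).
Local Notation cX := (crdX c).
Local Notation Y := (crdY c).
Local Notation pt := (spoint E).
Local Notation inI := (@inI _ E).
Implicit Types (P Q X R S T : pt) (f g w v : crd).

Lemma tors_opp n Q : Q *+ n = 0 -> (- Q) *+ n = 0.
Proof. by move=> h; rewrite mulNrn h oppr0. Qed.
Lemma tors_add n Q R : Q *+ n = 0 -> R *+ n = 0 -> (Q + R) *+ n = 0.
Proof. by move=> h h'; rewrite mulrnDl h h' addr0. Qed.

(* the composite of two translation operators is again one, up to a scalar *)
Lemma gen_comp n R S wR wS wRS : (0 < n)%N -> R *+ n = 0 -> S *+ n = 0 ->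
  gen n (- R) wR -> gen n (- S) wS -> gen n (- (R + S)) wRS ->
  exists2 k, k != 0 & forall P, P \notin [:: 0; - R; - S; - (R + S)] ->
    evalp wR P * evalp wS (P + R) = k * evalp wRS P.
Proof.
move=> n0 nR nS gR gS gRS.
have [v [Tv _]] := Tr_exists n0 gR (gen_pole gS).
have [|k k0 vE] := section_uniq n0 gRS Tv.1.
  move=> P; rewrite (Tr_nz n0 gR (gen_pole gS) Tv) (gen_nz _ n0 gS). by congr negb; rewrite -[LHS]subr_eq0 -[RHS]subr_eq0 !opprK addrA.
exists k => // P; rewrite !inE !negb_or => /and4P[P0 PR _ _].
by rewrite -(Tv.2 _ P0 PR) vE evalpZ.
Qed.

Definition wgen n Q : crd :=
  if pselect (exists w, gen n Q w) is left h then sval (cid h) else 0.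

Lemma wgenP n Q : Q *+ n = 0 -> gen n Q (wgen n Q).
Proof.
move=> nQ; rewrite /wgen; case: pselect => [h|]; last by case; exact: gen_exists.
by case: (cid h).
Qed.

(** The scalar e measures how far the translation operators of R and S are from commuting. The
    excluded P are those where one of the values is taken at infinity or is 0. *)
Definition is_weil n R S (e : F) := forall P, P \notin [:: 0; - R; - S; - (R + S)] ->
  evalp (wgen n (- R)) P * evalp (wgen n (- S)) (P + R)
  = e * (evalp (wgen n (- S)) P * evalp (wgen n (- R)) (P + S)).

Lemma weil_exists n R S : (0 < n)%N -> R *+ n = 0 -> S *+ n = 0 -> exists e, is_weil n R S e.
Proof.
move=> n0 nR nS.
have gR := wgenP (tors_opp nR); have gS := wgenP (tors_opp nS).
have gRS := wgenP (tors_opp (tors_add nR nS)).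
have [k k0 h] := gen_comp n0 nR nS gR gS gRS.
have gSR : gen n (- (S + R)) (wgen n (- (R + S))) by rewrite (addrC S R).
have [k' k'0 h'] := gen_comp n0 nS nR gS gR gSR.
exists (k / k') => P nP; rewrite h // h'; first by rewrite mulrA divfK.
move: nP; rewrite !inE (addrC R S); do 4![case: eqP => //=].
Qed.

Definition weil n R S : F :=
  if pselect (exists e, is_weil n R S e) is left h then sval (cid h) else 0.

Lemma weilP n R S : (0 < n)%N -> R *+ n = 0 -> S *+ n = 0 -> is_weil n R S (weil n R S).
Proof.
move=> n0 nR nS; rewrite /weil; case: pselect => [h|]; last by case; exact: weil_exists.
by case: (cid h).
Qed.

Section Pairing.
Variables (n : nat) (n0 : (0 < n)%N).
Local Notation w := (fun R => evalp (wgen n (- R))).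

Lemma wgen_neq0 R P : R *+ n = 0 -> P != 0 -> P != - R -> w R P != 0.
Proof. by move=> nR P0 PR; rewrite -(nzE n) // (gen_nz _ n0 (wgenP (tors_opp nR))). Qed.

(** Up to the scalar k, the operator of S + T is the composite of those of S and T, so its
    commutator with the operator of R is a product. P avoids all points where a value involved is at
    infinity or is 0. *)
Lemma weil_add R S T : R *+ n = 0 -> S *+ n = 0 -> T *+ n = 0 ->
  weil n R (S + T) = weil n R S * weil n R T.
Proof.
move=> nR nS nT; have nST := tors_add nS nT.
have gS := wgenP (tors_opp nS); have gT := wgenP (tors_opp nT).
have gST := wgenP (tors_opp nST).
have [k k0 hST] := gen_comp n0 nS nT gS gT gST.
pose bad := [:: 0; - R; - S; - T; - (S + T); - (R + S); - (R + T); - (R + (S + T))].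
have [P] := generic_point bad; rewrite !inE !negb_or.
case/and5P=> P0 PR PS PT /and4P[PST PRS PRT PRST].
have aux A B : P != - (A + B) -> P + A != - B by rewrite -!addr_eq0 addrA.
have aux0 A : P != - A -> P + A != 0 by rewrite -addr_eq0.
have P1 : P \notin [:: 0; - R; - (S + T); - (R + (S + T))] by rewrite !inE !negb_or; apply/and4P.
have P2 : P \notin [:: 0; - R; - S; - (R + S)] by rewrite !inE !negb_or; apply/and4P.
have P3 : P + S \notin [:: 0; - R; - T; - (R + T)].
  by rewrite !inE !negb_or; apply/and4P; split; [exact: aux0|apply: aux; rewrite addrC|exact: aux|
    apply: aux; rewrite addrCA].
have P4 : P \notin [:: 0; - S; - T; - (S + T)] by rewrite !inE !negb_or; apply/and4P.
have P5 : P + R \notin [:: 0; - S; - T; - (S + T)].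
  by rewrite !inE !negb_or; apply/and4P; split; [exact: aux0|exact: aux|exact: aux|exact: aux].
have e1 := weilP n0 nR nST P1; have e2 := weilP n0 nR nS P2.
have e3 := weilP n0 nR nT P3; have h1 := hST _ P4; have h2 := hST _ P5.
have nz1 : w (S + T) P * w R (P + (S + T)) != 0.
  by rewrite mulf_neq0 ?wgen_neq0 ?aux0 // aux // addrC.
apply: (mulIf nz1); apply: (mulfI k0).
rewrite -e1; transitivity (w R P * (k * w (S + T) (P + R))); first ring.
rewrite -h2 mulrA e2; transitivity (weil n R S * w S P * (w R (P + S) * w T (P + S + R))).
  by rewrite (addrAC P R S); ring.
rewrite e3 -addrA; transitivity (weil n R S * weil n R T * ((w S P * w T (P + S)) * w R (P + (S + T)))).
  ring.
by rewrite h1; ring.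
Qed.

Lemma weil_neq0 R S : R *+ n = 0 -> S *+ n = 0 -> weil n R S != 0.
Proof.
move=> nR nS; have [P nP] := generic_point [:: 0; - R; - S; - (R + S)].
have := weilP n0 nR nS nP; move: nP; rewrite !inE !negb_or => /and4P[P0 PR PS PRS] e.
apply/eqP => e0; move/eqP: e; rewrite e0 mul0r mulf_eq0 (negPf (wgen_neq0 nR P0 PR)) /=.
apply/negP/wgen_neq0 => //; first by rewrite addr_eq0.
by rewrite -addr_eq0 -addrA addr_eq0.
Qed.

Lemma weilrr R : R *+ n = 0 -> weil n R R = 1.
Proof.
move=> nR; have [P nP] := generic_point [:: 0; - R; - R; - (R + R)].
have := weilP n0 nR nR nP; move: nP; rewrite !inE !negb_or => /and4P[P0 PR PS PRS] /esym e.
rewrite -[RHS](divff (x := w R P * w R (P + R))).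
  by rewrite -[X in X / _]e mulfK // mulf_neq0 ?wgen_neq0 // ?addr_eq0 // -addr_eq0 -addrA addr_eq0.
by rewrite mulf_neq0 ?wgen_neq0 // ?addr_eq0 // -addr_eq0 -addrA addr_eq0.
Qed.

Lemma weilC R S : R *+ n = 0 -> S *+ n = 0 -> weil n R S * weil n S R = 1.
Proof.
move=> nR nS; have [P nP] := generic_point [:: 0; - R; - S; - (R + S)].
have e1 := weilP n0 nR nS nP.
have nP' : P \notin [:: 0; - S; - R; - (S + R)].
  by move: nP; rewrite !inE (addrC S R) !negb_or => /and4P[? ? ? ?]; apply/and4P.
have e2 := weilP n0 nS nR nP'.
move: nP; rewrite !inE !negb_or => /and4P[P0 PR PS PRS].
have nz1 : w R P * w S (P + R) != 0.
  by rewrite mulf_neq0 ?wgen_neq0 // ?addr_eq0 // -addr_eq0 -addrA addr_eq0.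
by apply: (mulIf nz1); rewrite mul1r {2}e1 e2; ring.
Qed.

Lemma weilr0 R : R *+ n = 0 -> weil n R 0 = 1.
Proof.
move=> nR; have n0' : (0 : pt) *+ n = 0 by rewrite mul0rn.
have := weil_add nR n0' n0'; rewrite addr0 => e.
by apply: (mulIf (weil_neq0 nR n0')); rewrite mul1r -e.
Qed.

Lemma tors_muln Q i : Q *+ n = 0 -> (Q *+ i) *+ n = 0.
Proof. by move=> h; rewrite mulrnAC h mul0rn. Qed.

Lemma weil_mulr R S i : R *+ n = 0 -> S *+ n = 0 -> weil n R (S *+ i) = weil n R S ^+ i.
Proof.
move=> nR nS; elim: i => [|i IH]; first by rewrite mulr0n weilr0.
by rewrite mulrS exprS weil_add ?IH // tors_muln.
Qed.

Lemma weil_unity R S : R *+ n = 0 -> S *+ n = 0 -> weil n R S ^+ n = 1.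
Proof. by move=> nR nS; rewrite -weil_mulr // nS weilr0. Qed.

End Pairing.

Section Nondegenerate.
Variables (n : nat) (n0 : (0 < n)%N).
(** A function u + v y has a pole of order at most n when u has at most [d1] and v at most [d2]
    coefficients; [d1] + [d2] is n, the dimension of the space of sections. *)
Let d1 := (n.+2)./2.
Let d2 := (n.-1)./2.
Let dec (r : 'rV[F]_(d1 + d2)) : crd := (rVpoly (lsubmx r), rVpoly (rsubmx r)).
Let enc (f : crd) : 'rV[F]_(d1 + d2) := row_mx (poly_rV f.1) (poly_rV f.2).

Let pole_dec r : pole n (dec r).
Proof.
apply/andP; split; rewrite -geq_half_double; first exact: size_poly.
exact: size_poly.
Qed.

Let encK f : pole n f -> dec (enc f) = f.
Proof.
case: f => u v /andP[/=]; rewrite -!geq_half_double => su sv.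
by rewrite /dec /enc row_mxKl row_mxKr /= !poly_rV_K.
Qed.

Let decK r : enc (dec r) = r.
Proof. by rewrite /enc /dec /= !rVpolyK hsubmxK. Qed.

Let dec_sum (I : finType) (k : I -> F) (r : I -> 'rV_(d1 + d2)) P :
  evalp (dec (\sum_i k i *: r i)) P = \sum_i k i * evalp (dec (r i)) P.
Proof.
have D r1 r2 : evalp (dec (r1 + r2)) P = evalp (dec r1) P + evalp (dec r2) P.
  rewrite -evalpD; congr evalp; rewrite /dec !linearD //.
have Z j r1 : evalp (dec (j *: r1)) P = j * evalp (dec r1) P.
  rewrite -evalpZ; congr evalp; rewrite /dec !linearZ /= crdM /= !(mul0r, mulr0, addr0). by rewrite !mul_polyC.
have dec0 : evalp (dec 0) P = 0.
  by rewrite -(scale0r (0 : 'rV_(d1 + d2))) Z mul0r.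
rewrite (big_morph (fun r => evalp (dec r) P) D dec0); apply: eq_bigr => i _; exact: Z.
Qed.

Let trf R f : crd := if pselect (exists g, Tr n R (wgen n (- R)) f g) is left h then sval (cid h) else 0.

Let trP R f : R *+ n = 0 -> pole n f -> Tr n R (wgen n (- R)) f (trf R f).
Proof.
move=> nR pf; rewrite /trf; case: pselect => [h|]; first by case: (cid h).
have [g [Tg _]] := Tr_exists n0 (wgenP (tors_opp nR)) pf.
by case; exists g.
Qed.

Let mx R : 'M[F]_(d1 + d2) := \matrix_(i < d1 + d2) enc (trf R (dec (delta_mx 0 i))).

Let mxE' R (r : 'rV_(d1 + d2)) : R *+ n = 0 -> Tr n R (wgen n (- R)) (dec r) (dec (r *m mx R)).
Proof.
move=> nR; split; first exact: pole_dec.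
move=> P P0 PR; rewrite mulmx_sum_row dec_sum.
rewrite {2}[r]row_sum_delta dec_sum mulr_sumr; apply: eq_bigr => i _.
have T := trP nR (pole_dec (delta_mx 0 i)).
by rewrite rowK encK ?T.1 // (T.2 _ P0 PR) mulrCA.
Qed.

(** If the pairing is 1, the translation matrices commute and have a common eigenvector f. The zeros
    of f are stable under translation by S and T, so they contain a translate of H. The norm of f
    has at most n roots, each below at most two points, and O may be one more zero. The bound 2n + 1
    obtained in this way is the origin of the loss of a factor 2 when l = 2. *)
Lemma weil_nondegenerate S T (H : seq pt) : S *+ n = 0 -> T *+ n = 0 ->
  weil n S T = 1 -> uniq H -> (forall h, h \in H -> exists i j, h = S *+ i + T *+ j) ->
  (size H <= n.*2.+1)%N.
Proof.
move=> nS nT e1 uH HST.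
have comm : mx S *m mx T = mx T *m mx S.
  apply/row_matrixP => i; rewrite !rowE !mulmxA. set r := delta_mx 0 i; rewrite -[LHS]decK -[RHS]decK; congr enc.
  have T1 := mxE' r nS; have T2 := mxE' (r *m mx S) nT. have T3 := mxE' r nT; have T4 := mxE' (r *m mx T) nS.
  apply: (@crd_eq_offs _ _ _ [:: - S; - T; - (S + T)]) => P P0. rewrite !inE !negb_or => /and3P[PS PT PST].
  have PST' : P + S != - T by rewrite -addr_eq0 -addrA addr_eq0.
  have PTS' : P + T != - S by rewrite -addr_eq0 -addrA (addrC T) addr_eq0. have PS0 : P + S != 0 by rewrite addr_eq0.
  have PT0 : P + T != 0 by rewrite addr_eq0. rewrite T2.2 // T1.2 // T4.2 // T3.2 // addrAC !mulrA; congr (_ * _).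
  have := weilP n0 nS nT (P := P); rewrite !inE !negb_or P0 PS PT PST => /(_ isT) ->. by rewrite e1 mul1r.
have d0 : (0 < d1 + d2)%N by rewrite addn_gt0.
have [v v0 /andP[/sub_rVP[lS vS] /sub_rVP[lT vT]]] := common_eigenvector2 d0 comm.
pose f := dec v; have f0 : f != 0.
  apply: contra v0 => /eqP f0; rewrite -[v]decK -/f f0 /enc /= !linear0 row_mx0 //.
have pf : pole n f := pole_dec v.
have inv R l : R *+ n = 0 -> v *m mx R = l *: v -> forall P, nz n f (P + R) = nz n f P.
  move=> nR vR P; have TR := mxE' v nR; rewrite vR in TR. have lf : dec (l *: v) = cX l%:P * f.
    rewrite /f /dec !linearZ /= crdM /= !(mul0r, mulr0, addr0). by rewrite !mul_polyC.
  rewrite -(Tr_nz n0 (wgenP (tors_opp nR)) pf TR) lf. have l0 : l != 0.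
    apply: contraNneq f0 => l0; rewrite lf l0 polyC0 rmorph0 mul0r in TR.
    apply/eqP; apply: (@crd_eq_offs _ _ _ [:: R; R + R]) => Q Q0; rewrite !inE negb_or => /andP[QR QRR].
    have QR0 : Q - R != 0 by rewrite subr_eq0. have QR1 : Q - R != - R by rewrite -addr_eq0 addrNK.
    have := TR.2 (Q - R) QR0 QR1; rewrite addrNK. have ev0 Z : evalp (0 : crd) Z = 0.
      by rewrite /evalp; case: (val Z) => // -[x y]; rewrite /crd_eval /= !horner0 mulr0 addr0.
    move/esym/eqP; rewrite !ev0 mulf_eq0 => /orP[|/eqP//]. by rewrite (negPf (wgen_neq0 n0 nR QR0 QR1)).
  rewrite /nz; case: ifP => _; last by rewrite evalpZ mulf_eq0 (negPf l0).
  by rewrite crd_normM crd_normX -polyC_exp mul_polyC size_scale // expf_neq0.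
have invn R l i P : R *+ n = 0 -> v *m mx R = l *: v -> nz n f (P + R *+ i) = nz n f P.
  move=> nR vR; elim: i => [|i IH]; first by rewrite mulr0n addr0. by rewrite mulrSr addrA (inv _ _ nR vR).
(* A zero exists: at infinity if the pole has order less than n, otherwise above a root of the norm,
   whose degree is then n > 0. *)
have [P zP] : exists P, ~~ nz n f P.
  have [z0|z0] := boolP (nz n f 0); last by exists 0. have /closed_rootP[x] : size (crd_norm f) != 1%N.
    by move: z0; rewrite /nz eqxx => /eqP->; rewrite eqSS -lt0n.
  have [P [y eP]] := point_at E x; rewrite rootE (norm_root _ eP) mulf_eq0. have P0 : P != 0 by rewrite point_eq0 eP.
  by case/orP=> z; [exists P|exists (- P)]; rewrite nzE ?oppr_eq0 // negbK.
have zH h : h \in H -> ~~ nz n f (P + h).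
  by move=> /HST[i [j ->]]; rewrite addrA (invn _ _ _ _ nT vT) (invn _ _ _ _ nS vS).
pose Z := [seq P + h | h <- H]; pose Z' := [seq Q <- Z | Q != 0].
have uZ : uniq Z by rewrite map_inj_uniq // => ? ? /addrI.
have sZ : (size H <= (size Z').+1)%N.
  rewrite -(size_map (+%R P)) -/Z -(count_predC (fun Q => Q != 0) Z) size_filter -addn1 leq_add2l.
  rewrite (eq_count (a2 := pred1 0)) => [|Q]; last by rewrite /= negbK. by rewrite count_uniq_mem // leq_b1.
apply: (leq_trans sZ); rewrite ltnS.
pose xc Q := if val Q is Some (x, _) then x else 0 : F.
pose lift x : pt := sval (cid (point_at E x)).
have liftE x : exists y, val (lift x) = Some (x, y) by rewrite /lift; case: cid.
pose rs := undup [seq xc Q | Q <- Z'].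
have srs : (size rs <= n)%N.
  have N0 : crd_norm f != 0 by rewrite crd_norm_eq0.
  rewrite -ltnS; apply: (leq_trans (max_poly_roots N0 _ (undup_uniq _))); last by rewrite -pole_norm.
  apply/allP => x; rewrite mem_undup => /mapP[Q]; rewrite mem_filter => /andP[Q0 QZ] ->.
  have [x' [y eQ]] := point_xyP Q0; rewrite /xc eQ rootE (norm_root _ eQ). have : ~~ nz n f Q by move: QZ => /mapP[h /zH zh ->].
  by rewrite nzE // negbK => /eqP->; rewrite mul0r.
apply: (@leq_trans (size ([seq lift x | x <- rs] ++ [seq - lift x | x <- rs]))); last first.
  by rewrite size_cat !size_map addnn leq_double.
apply: uniq_leq_size; first exact: filter_uniq.
move=> Q QZ'; have QZ := QZ'; move: QZ'; rewrite mem_filter => /andP[Q0 _].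
have [x [y eQ]] := point_xyP Q0; have [y' eL] := liftE x.
have xrs : x \in rs by rewrite mem_undup; apply/mapP; exists Q; rewrite // /xc eQ.
have : y ^+ 2 == y' ^+ 2 by rewrite (spoint_on eQ) (spoint_on eL).
rewrite mem_cat eqf_sqr => /orP[/eqP yy|/eqP yy]; apply/orP; [left|right]; apply/mapP; exists x => //;
  by apply: val_inj; rewrite ?val_opp eQ eL yy.
Qed.

End Nondegenerate.

End WeilPairing.

(** * Points under field homomorphisms; Galois equivariance of the pairing *)

Section PointMap.
Variables (F L : fieldType) (f : {rmorphism F -> L}).

Lemma map_on_curve (W : weierstrass F) (P : option (F * F)) : on_curve W P ->
  on_curve (map_weierstrass f W) (omap (fun q => (f q.1, f q.2)) P).
Proof.
by case: P => [[x y]|] //= /eqP e; rewrite -!rmorphXn -!rmorphM -!rmorphD /= e.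
Qed.

Lemma map_add_coords (W : weierstrass F) (P Q : option (F * F)) :
  omap (fun q => (f q.1, f q.2)) (add_coords W P Q) =
  add_coords (map_weierstrass f W) (omap (fun q => (f q.1, f q.2)) P)
    (omap (fun q => (f q.1, f q.2)) Q).
Proof.
case: P => [[x1 y1]|] //; case: Q => [[x2 y2]|] //=.
rewrite -(rmorphM f) -!(rmorphD f) (fmorph_eq0 f) (inj_eq (fmorph_inj f)).
have slopeE : f (slope W x1 y1 x2 y2) = slope (map_weierstrass f W) (f x1) (f y1) (f x2) (f y2).
  rewrite /slope (inj_eq (fmorph_inj f)); case: eqP => _ /=.
    by rewrite fmorph_div; congr (_ / _); ring.
  by rewrite fmorph_div !rmorphB.
case: ifP => //= _; rewrite -slopeE.
by congr (Some (pair _ _)); ring.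
Qed.

Variables (E : scurve F) (E' : scurve L).
Hypotheses (fa : sa E' = f (sa E)) (fb : sb E' = f (sb E)).

Lemma short_map : short (sa E') (sb E') = map_weierstrass f (short (sa E) (sb E)).
Proof. by rewrite /short /map_weierstrass /= rmorph0 fa fb. Qed.

Lemma pmap_subproof (P : spoint E) :
  on_curve (short (sa E') (sb E')) (omap (fun q => (f q.1, f q.2)) (val P)).
Proof. by rewrite short_map; exact/map_on_curve/valP. Qed.

Definition pmap (P : spoint E) : spoint E' := Point (pmap_subproof P).

Lemma val_pmap P : val (pmap P) = omap (fun q => (f q.1, f q.2)) (val P).
Proof. by []. Qed.

Lemma pmapD P Q : pmap (P + Q) = pmap P + pmap Q.
Proof.
apply: val_inj; rewrite val_pmap -[val (P + Q)]/(add_coords _ (val P) (val Q)).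
rewrite -[val (pmap P + pmap Q)]/(add_coords _ (val (pmap P)) (val (pmap Q))).
by rewrite map_add_coords; congr add_coords; rewrite short_map.
Qed.

Lemma pmap0 : pmap 0 = 0.
Proof. exact: val_inj. Qed.

Lemma pmap_inj : injective pmap.
Proof.
move=> P Q /(congr1 val); rewrite !val_pmap => e; apply: val_inj.
case: (val P) (val Q) e => [[x y]|] [[x' y']|] //= [/fmorph_inj-> /fmorph_inj->] //.
Qed.

Lemma pmap_eq0 P : (pmap P == 0) = (P == 0).
Proof. by rewrite -pmap0 (inj_eq pmap_inj). Qed.

Lemma pmapN P : pmap (- P) = - pmap P.
Proof. by apply/eqP; rewrite -addr_eq0 -pmapD addNr pmap0. Qed.

Lemma pmapMn P n : pmap (P *+ n) = pmap P *+ n.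
Proof. by elim: n => [|n IH]; rewrite ?pmap0 // !mulrS pmapD IH. Qed.

End PointMap.

Section WeilGalois.
Variables (s : {rmorphism algC -> algC}) (E : scurve algC).
Hypotheses (sfa : sa E = s (sa E)) (sfb : sb E = s (sb E)).
Local Notation c := (cubic (sa E) (sb E)).
Local Notation sp := (pmap sfa sfb).
Variables (n : nat) (n0 : (0 < n)%N).

Definition crd_map (f : crd c) : crd c := (map_poly s f.1, map_poly s f.2).

Lemma map_cubic : map_poly s c = c.
Proof.
by rewrite /cubic !rmorphD /= map_polyXn map_polyZ map_polyX map_polyC /= -sfa -sfb.
Qed.

Lemma crd_norm_map f : crd_norm (crd_map f) = map_poly s (crd_norm f).
Proof. by rewrite /crd_norm /= !expr2 rmorphB !rmorphM /= map_cubic. Qed.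

Lemma evalp_map f P : evalp (crd_map f) (sp P) = s (evalp f P).
Proof.
rewrite /evalp val_pmap; case: (val P) => [[x y]|] /=; last by rewrite rmorph0.
by rewrite /crd_eval /= !horner_map rmorphD rmorphM.
Qed.

Lemma nz_map f P : nz n (crd_map f) (sp P) = nz n f P.
Proof.
rewrite /nz pmap_eq0 crd_norm_map size_map_poly; case: ifP => // _.
by rewrite evalp_map fmorph_eq0.
Qed.

Lemma pmap_surj (Q : spoint E) : exists P, Q = sp P.
Proof.
have h : on_curve (short (sa E) (sb E)) (omap (fun q => (algC_invaut s q.1, algC_invaut s q.2)) (val Q)).
  have := map_on_curve (algC_invaut s) (valP Q); rewrite /map_weierstrass /= rmorph0.
  have -> : algC_invaut s (sa E) = sa E by rewrite {1}sfa algC_autK.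
  by have -> : algC_invaut s (sb E) = sb E by rewrite {1}sfb algC_autK.
exists (Point h); apply: val_inj; rewrite val_pmap /=.
by case: (val Q) => [[x y]|] //=; rewrite !algC_invautK.
Qed.

(** [wgen] is an arbitrary choice and need not commute with s; its conjugate has the right zeros, so
    [section_uniq] makes the two proportional. *)
Lemma wgen_map Q : Q *+ n = 0 ->
  exists2 k, k != 0 & crd_map (wgen n Q) = crdX c k%:P * wgen n (sp Q).
Proof.
move=> nQ; apply: (section_uniq n0).
- by apply: wgenP; rewrite -pmapMn nQ pmap0.
- by rewrite pole_norm crd_norm_map size_map_poly -pole_norm; exact/gen_pole/wgenP.
- move=> P; have [P' ->] := pmap_surj P.
  by rewrite nz_map (gen_nz _ n0 (wgenP nQ)) (inj_eq (@pmap_inj _ _ _ _ _ sfa sfb)).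
Qed.

Lemma weil_map R S : R *+ n = 0 -> S *+ n = 0 -> weil n (sp R) (sp S) = s (weil n R S).
Proof.
move=> nR nS.
have [nR' nS'] : sp R *+ n = 0 /\ sp S *+ n = 0 by rewrite -!pmapMn nR nS !pmap0.
have [k k0 wR] := wgen_map (tors_opp nR); have [k' k'0 wS] := wgen_map (tors_opp nS).
have [P nP] := generic_point [:: 0; - R; - S; - (R + S)].
have e1 := congr1 s (weilP n0 nR nS nP).
have nP' : sp P \notin [:: 0; - sp R; - sp S; - (sp R + sp S)].
  move: nP; rewrite !inE !negb_or => /and4P[P0 PR PS PRS].
  by rewrite -pmapD -!pmapN pmap_eq0 !(inj_eq (@pmap_inj _ _ _ _ _ sfa sfb)); apply/and4P.
have e2 := weilP n0 nR' nS' nP'.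
move: e1; rewrite !rmorphM -!evalp_map wR wS !evalpZ !pmapD !pmapN => e1.
move: nP'; rewrite !inE !negb_or => /and4P[P0 PR PS PRS].
have nz1 : evalp (wgen n (- sp S)) (sp P) * evalp (wgen n (- sp R)) (sp P + sp S) != 0.
  by rewrite mulf_neq0 // wgen_neq0 // ?addr_eq0 // -addr_eq0 -addrA (addrC (sp S)) addr_eq0.
apply: (mulIf nz1); rewrite -e2; apply: (mulfI (mulf_neq0 k0 k'0)).
transitivity (k * evalp (wgen n (- sp R)) (sp P) * (k' * evalp (wgen n (- sp S)) (sp P + sp R))).
  by ring.
by rewrite e1; ring.
Qed.

End WeilGalois.

Lemma horner_nat (R : nzRingType) (n : nat) (x : R) : (n%:R : {poly R}).[x] = n%:R.
Proof. by rewrite -polyC_natr hornerC. Qed.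

(** * Polynomials for the x-coordinate of nP *)

Section MulPoly.
Variables (F : fieldType) (a b : F).
Implicit Types A B : {poly F}.

(* For points P, Q with x-coordinates x and A/B, the x-coordinates of P + Q and
   P - Q are the roots of mpD Z^2 - 2 mpS Z + mpP. *)
Definition mpD A B := (A - 'X * B) ^+ 2.
Definition mpS A B := (A + 'X * B) * ('X * A + a%:P * B) + 2 * b%:P * B ^+ 2.
Definition mpP A B := ('X * A - a%:P * B) ^+ 2 - 4 * b%:P * B * (A + 'X * B).

(* x(nP) = A_n / B_n at index n - 1; the pair holds indices n and n + 1 *)
Fixpoint mulpoly2 n : ({poly F} * {poly F}) * ({poly F} * {poly F}) :=
  if n is n'.+1 then
    let: ((A', B'), (A, B)) := mulpoly2 n' in
    ((A, B), (mpP A B %/ A', mpD A B %/ B'))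
  else (('X, 1), (('X ^+ 2 - a%:P) ^+ 2 - 8 * b%:P * 'X, 4 * cubic a b)).

Definition mulA n := (mulpoly2 n.-1).1.1.
Definition mulB n := (mulpoly2 n.-1).1.2.

Lemma mulpoly2E n : mulpoly2 n = ((mulA n.+1, mulB n.+1), (mulA n.+2, mulB n.+2)).
Proof.
rewrite /mulA /mulB /=; case: (mulpoly2 n) => [[A' B'] [A B]] //.
Qed.

Lemma mulA1 : mulA 1 = 'X. Proof. by []. Qed.
Lemma mulB1 : mulB 1 = 1. Proof. by []. Qed.
Lemma mulA2 : mulA 2 = ('X ^+ 2 - a%:P) ^+ 2 - 8 * b%:P * 'X. Proof. by []. Qed.
Lemma mulB2 : mulB 2 = 4 * cubic a b. Proof. by []. Qed.
Lemma mulA3 n : mulA n.+3 = mpP (mulA n.+2) (mulB n.+2) %/ mulA n.+1.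
Proof. by rewrite {1}/mulA -[n.+3.-1]/(n.+1.+1) /= mulpoly2E. Qed.
Lemma mulB3 n : mulB n.+3 = mpD (mulA n.+2) (mulB n.+2) %/ mulB n.+1.
Proof. by rewrite {1}/mulB -[n.+3.-1]/(n.+1.+1) /= mulpoly2E. Qed.

End MulPoly.

Section MulPolyMap.
Variables (F L : fieldType) (f : {rmorphism F -> L}) (a b : F).
Lemma map_mulpoly n : map_poly f (mulA a b n) = mulA (f a) (f b) n /\
  map_poly f (mulB a b n) = mulB (f a) (f b) n.
Proof.
suff h k : [/\ map_poly f (mulA a b k.+1) = mulA (f a) (f b) k.+1,
    map_poly f (mulB a b k.+1) = mulB (f a) (f b) k.+1,
    map_poly f (mulA a b k.+2) = mulA (f a) (f b) k.+2 &
    map_poly f (mulB a b k.+2) = mulB (f a) (f b) k.+2].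
  by case: n => [|n]; [have [] := h 0%N | have [] := h n].
elim: k => [|k [e1 e2 e3 e4]].
  rewrite !mulA1 !mulB1 !mulA2 !mulB2 map_polyX rmorph1; split=> //.
    by rewrite -(map_polyX f) -!(map_polyC f); ring.
  by rewrite /cubic -!mul_polyC -(map_polyX f) -!(map_polyC f); ring.
rewrite !mulA3 !mulB3 !map_divp -e1 -e2 -e3 -e4; split=> //; congr (_ %/ _).
  by rewrite /mpP -(map_polyX f) -!(map_polyC f); ring.
by rewrite /mpD -(map_polyX f); ring.
Qed.
End MulPolyMap.

Section MulPolySpec.
Variable F : fieldType.
Variable E : scurve F.
Local Notation a := (sa E).
Local Notation b := (sb E).
Local Notation c := (cubic a b).
Local Notation pt := (spoint E).
Local Notation mA := (mulA a b).
Local Notation mB := (mulB a b).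
Local Notation mD := (@mpD F).
Local Notation mS := (mpS a b).
Local Notation mP := (mpP a b).
Local Notation hE := (hornerD, hornerN, hornerX, hornerC, hornerZ, hornerM, hornerXn, horner_exp, horner_nat, hornerMn).

(** The map x(P) -> x(nP) has degree n^2, and the leading coefficient n^2 of the denominator
    reflects that multiplication by n is n to first order near O. *)
Definition good n := [/\ mA n \is monic, size (mA n) = (n ^ 2).+1,
  size (mB n) = (n ^ 2)%N, lead_coef (mB n) = (n ^ 2)%:R & coprimep (mA n) (mB n)].

Definition mul_rel n := [/\ mB n * mB n.+2 = mD (mA n.+1) (mB n.+1),
  mA n * mA n.+2 = mP (mA n.+1) (mB n.+1) &
  mA n * mB n.+2 + mA n.+2 * mB n = 2 * mS (mA n.+1) (mB n.+1)].

Definition mul_spec n := [/\ good n, good n.+1 & mul_rel n].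

Lemma no_common_root x : c.[x] = 0 -> (x ^+ 2 - a) ^+ 2 - 8 * b * x = 0 -> False.
Proof.
move=> cx e; have [u [v /(congr1 (fun p => p.[x]))]] := bezout_cubic E.
rewrite hornerD !hornerM cx mulr0 add0r hornerC.
have -> : c^`().[x] = 0.
  (* Modulo c the square of its derivative is (x^2 - a)^2 - 8bx, so a common root would be a double
     root of c. *)
  apply/eqP; rewrite -sqrf_eq0; apply/eqP; move: cx; rewrite cubicE => cx.
  transitivity ((x ^+ 2 - a) ^+ 2 - 8 * b * x + 8 * x * (x ^+ 3 + a * x + b)).
    by rewrite /cubic !derivE !hE; ring.
  by rewrite e cx mulr0 addr0.
by rewrite mulr0 => /esym/eqP; rewrite oner_eq0.
Qed.

End MulPolySpec.

Section SpecMap.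
Variables (F L : fieldType) (f : {rmorphism F -> L}) (E : scurve F) (E' : scurve L).
Hypotheses (fa : sa E' = f (sa E)) (fb : sb E' = f (sb E)).

(** Identities, degrees and coprimality are preserved and reflected by a field embedding. This
    carries the specification from algC down to K and up to its completions. *)
Lemma mul_spec_map n : mul_spec E' n <-> mul_spec E n.
Proof.
have gd m : good E' m <-> good E m.
  have [eA eB] := map_mulpoly f (sa E) (sb E) m; rewrite /good fa fb -eA -eB map_monic !size_map_poly.
  rewrite lead_coef_map coprimep_map -(rmorph_nat f).
  by split=> -[? ? ? /eqP h ?]; split=> //; apply/eqP; move: h; rewrite (inj_eq (fmorph_inj f)).
have rel : mul_rel E' n <-> mul_rel E n.
  have [eA eB] := map_mulpoly f (sa E) (sb E) n; have [eA1 eB1] := map_mulpoly f (sa E) (sb E) n.+1.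
  have [eA2 eB2] := map_mulpoly f (sa E) (sb E) n.+2.
  rewrite /mul_rel fa fb -eA -eB -eA1 -eB1 -eA2 -eB2 /mpD /mpS /mpP -(map_polyX f) -!(map_polyC f).
  have inj := map_inj_poly (fmorph_inj f) (rmorph0 f). split=> -[h1 h2 h3]; split; try apply: inj.
  - by transitivity (map_poly f (mulB (sa E) (sb E) n) * map_poly f (mulB (sa E) (sb E) n.+2)); [ring | rewrite h1; ring].
  - by transitivity (map_poly f (mulA (sa E) (sb E) n) * map_poly f (mulA (sa E) (sb E) n.+2)); [ring | rewrite h2; ring].
  - by rewrite rmorphD !rmorphM h3; ring.
  - by rewrite -rmorphM h1; ring.
  - by rewrite -rmorphM h2; ring.
  - by rewrite -!rmorphM -rmorphD h3; ring.
by split=> -[? ? ?]; split; [apply/gd|apply/gd|apply/rel|apply/gd|apply/gd|apply/rel].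
Qed.
End SpecMap.

Section MulPolyC.
Variable E : scurve algC.
Local Notation F := algC.
Local Notation a := (sa E).
Local Notation b := (sb E).
Local Notation c := (cubic a b).
Local Notation pt := (spoint E).
Local Notation mA := (mulA a b).
Local Notation mB := (mulB a b).
Local Notation mD := (@mpD F).
Local Notation mS := (mpS a b).
Local Notation mP := (mpP a b).
Local Notation hE := (hornerD, hornerN, hornerX, hornerC, hornerZ, hornerM, hornerXn, horner_exp, horner_nat, hornerMn).

Local Notation good := (good E).
Local Notation mul_rel := (mul_rel E).

Lemma coprime_roots (p q : {poly F}) : (forall x, p.[x] = 0 -> q.[x] = 0 -> False) -> coprimep p q.
Proof.
move=> h; rewrite coprimep_def; apply: contraT => /closed_rootP[x].
rewrite root_gcd => /andP[/eqP px /eqP qx]; case: (h x px qx).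
Qed.

Lemma size_monic_sum (p q : {poly F}) : p \is monic -> (size q < size p)%N ->
  p + q \is monic /\ size (p + q) = size p.
Proof.
by move=> pm qp; rewrite monicE lead_coefDl // size_polyDl // -monicE.
Qed.

(** The last hypothesis says that (A_n : B_n) is a root of the quadratic form attached to A_(n+1),
    B_(n+1). Since A_n and B_n are coprime they divide the outer coefficients, and the quotients are
    the other root. *)
Lemma mul_step n : (0 < n)%N -> good n -> good n.+1 ->
  mD (mA n.+1) (mB n.+1) * mA n ^+ 2 - 2 * mS (mA n.+1) (mB n.+1) * mA n * mB n
   + mP (mA n.+1) (mB n.+1) * mB n ^+ 2 = 0 ->
  mul_rel n /\ good n.+2.
Proof.
case: n => // n _; set A' := mA n.+1; set B' := mB n.+1; set A := mA n.+2; set B := mB n.+2.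
move=> [mA' sA' sB' lB' co'] [mA_ sA_ sB_ lB_ co_] th.
have B'0 : B' != 0 by rewrite -size_poly_eq0 sB' expn_eq0.
have A'0 : A' != 0 by rewrite monic_neq0.
have B0 : B != 0 by rewrite -size_poly_eq0 sB_ expn_eq0.
have dB : B' %| mD A B.
  have -> : (B' %| mpD A B) = (B' %| mpD A B * A' ^+ 2).
    by symmetry; apply: Gauss_dvdpl; rewrite coprimep_expr // coprimep_sym.
  apply/dvdpP; exists (2 * mS A B * A' - mP A B * B'); apply/eqP; rewrite -subr_eq0; apply/eqP. by rewrite -[RHS]th; ring.
have dA : A' %| mP A B.
  have -> : (A' %| mP A B) = (A' %| mP A B * B' ^+ 2).
    by symmetry; apply: Gauss_dvdpl; rewrite coprimep_expr.
  apply/dvdpP; exists (2 * mS A B * B' - mD A B * A'); apply/eqP; rewrite -subr_eq0; apply/eqP. by rewrite -[RHS]th; ring.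
have eB : B' * mB n.+3 = mD A B by rewrite mulB3 mulrC divpK.
have eA : A' * mA n.+3 = mP A B by rewrite mulA3 mulrC divpK.
have eS : A' * mB n.+3 + mA n.+3 * B' = 2 * mS A B.
  apply: (mulfI A'0); apply: (mulfI B'0); apply/eqP; rewrite -subr_eq0; apply/eqP. by rewrite -[RHS]th -eB -eA; ring.
split; first by [].
have sXA : size ('X * A) = (size A).+1 by rewrite mulrC size_mulX // monic_neq0.
have sXB : size ('X * B) = (size B).+1 by rewrite mulrC size_mulX.
have [mP1 sP1] : mP A B \is monic /\ size (mP A B) = (2 * (n.+2 ^ 2).+1).+1.
  have mXA : 'X * A \is monic by rewrite monicMl ?monicX.
  have [m1 s1] : 'X * A - a%:P * B \is monic /\ size ('X * A - a%:P * B) = size ('X * A).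
    apply: size_monic_sum => //; rewrite size_polyN sXA sA_ ltnS mul_polyC. by rewrite (leq_trans (size_scale_leq _ _)) // sB_.
  have sq : size (('X * A - a%:P * B) ^+ 2) = (2 * (n.+2 ^ 2).+1).+1.
    by rewrite size_sqr ?monic_neq0 // s1 sXA sA_ -mul2n mulnS.
  rewrite /mpP -sq; apply: size_monic_sum; first by rewrite expr2 monicMl. rewrite size_polyN sq ltnS.
  have sAB : (size (A + 'X * B)%R <= (n.+2 ^ 2).+1)%N.
    by rewrite size_leD // geq_max sA_ sXB sB_ leqnn.
  have -> : 4 * b%:P * B * (A + 'X * B) = (4 * b) *: (B * (A + 'X * B)).
    by rewrite -mul_polyC polyCM polyC_natr; ring.
  rewrite (leq_trans (size_scale_leq _ _)) // (leq_trans (size_polyMleq _ _)) // sB_.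
  move: sAB; clear; move: (size _) (n.+2 ^ 2)%N => u v; lia.
have mA3 : mA n.+3 \is monic by move: mP1; rewrite -eA monicMl.
have sA3 : size (mA n.+3) = (n.+3 ^ 2).+1.
  have := size_monicM mA' (monic_neq0 mA3); rewrite eA sP1 sA' => e.
  by move: e; rewrite addSn /= -!mulnn; clear; move: (size _) => u; lia.
have [sD lD] : size (mD A B) = (2 * n.+2 ^ 2).+1 /\ lead_coef (mD A B) = ((n.+3 * n.+1) ^ 2)%:R.
  (* With N the index of A and B, the top coefficients of A and x B are 1 and N^2, and 1 - N^2 = -(N
     - 1)(N + 1). *)
  have cAB : (A - 'X * B)`_(n.+2 ^ 2) = - (n.+3 * n.+1)%:R.
    rewrite coefB -{1}[(n.+2 ^ 2)%N]/((n.+2 ^ 2).+1.-1) -sA_ -lead_coefE (monicP mA_).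
    rewrite coefXM; have -> : (n.+2 ^ 2 == 0)%N = false by rewrite expn_eq0. rewrite -[in B`__]sB_ -lead_coefE lB_.
    have -> : (n.+2 ^ 2 = (n.+3 * n.+1).+1)%N by rewrite -mulnn; clear; lia. by rewrite -[in LHS]addn1 natrD opprD addrCA subrr addr0.
  have sAB : (size (A - 'X * B)%R <= (n.+2 ^ 2).+1)%N.
    by rewrite size_leD // geq_max size_polyN sA_ sXB sB_ leqnn.
  have sAB' : size (A - 'X * B)%R = (n.+2 ^ 2).+1.
    apply/eqP; rewrite eqn_leq sAB ltnNge; apply/negP => le. by move/eqP: cAB; rewrite nth_default // eq_sym oppr_eq0 pnatr_eq0.
  have AB0 : A - 'X * B != 0 by rewrite -size_poly_eq0 sAB'. split; first by rewrite /mpD size_sqr // sAB' -mul2n mulnS.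
  by rewrite /mpD lead_coef_exp lead_coefE sAB' cAB sqrrN natrX.
have B30 : mB n.+3 != 0.
  by apply/eqP => e; move: eB sD; rewrite e mulr0 => <-; rewrite size_poly0.
have sB3 : size (mB n.+3) = (n.+3 ^ 2)%N.
  by have := size_mul B'0 B30; rewrite eB sD sB' -!mulnn; clear; move: (size _) => u; lia.
have lB3 : lead_coef (mB n.+3) = (n.+3 ^ 2)%:R.
  have := lead_coefM B' (mB n.+3); rewrite eB lD lB' expnMn mulnC natrM => /mulfI e. by rewrite -e // pnatr_eq0 expn_eq0.
split=> //; apply: coprime_roots => x rA rB.
have ex (p q r : {poly F}) : p * q = r -> p.[x] * q.[x] = r.[x] by move=> <-; rewrite hornerM.
(* At a common root x of the new pair, A(x) = x B(x). After division by powers of B(x) the other two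
   relations say that c and the numerator of the duplication formula both vanish at x. *)
have := ex _ _ _ eB; rewrite rB mulr0 /mpD !hE => /esym/eqP; rewrite sqrf_eq0 subr_eq0 => /eqP AxB.
have Bx : B.[x] != 0.
  apply/eqP => Bx0; have := coprimep_root co_; move=> /(_ x); rewrite rootE AxB Bx0 mulr0 eqxx => /(_ isT); by [].
have := ex _ _ _ eA; rewrite rA mulr0 /mpP !hE AxB => ePx.
have : A'.[x] * (mB n.+3).[x] + (mA n.+3).[x] * B'.[x] = 2 * (mS A B).[x].
  by rewrite -!hornerM -hornerD eS hornerM horner_nat.
rewrite rA rB mulr0 mul0r addr0 /mpS !hE AxB => eSx.
apply: (@no_common_root F E x).
  apply: (mulfI (x := 4 * B.[x] ^+ 2)); first by rewrite mulf_neq0 ?pnatr_eq0 ?expf_neq0. by rewrite mulr0 eSx cubicE; ring.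
apply: (mulfI (x := B.[x] ^+ 2)); first by rewrite expf_neq0.
by rewrite mulr0 ePx; ring.
Qed.

Lemma size_cst_mul (k : F) (p : {poly F}) : k != 0 -> size (k%:P * p) = size p.
Proof. by move=> k0; rewrite mul_polyC size_scale. Qed.

Lemma good1 : good 1.
Proof.
rewrite /good mulA1 mulB1; split; rewrite ?monicX ?size_polyX ?size_poly1 ?lead_coef1 //.
exact: coprimep1.
Qed.

Lemma good2 : good 2.
Proof.
have e : mA 2 = 'X^4 + ((- 2 * a) *: 'X^2 + ((- 8 * b) *: 'X + (a ^+ 2)%:P)).
  by rewrite mulA2 -!mul_polyC !(polyCM, polyCN, polyC_exp, polyC_natr); ring.
have s : (size ((- 2 * a) *: 'X^2 + ((- 8 * b) *: 'X + (a ^+ 2)%:P))%R < 5)%N.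
  rewrite ltnS size_leD // geq_max (leq_trans (size_scale_leq _ _)) ?size_polyXn //=.
  rewrite size_leD // geq_max (leq_trans (size_scale_leq _ _)) ?size_polyX //=. by rewrite size_polyC; case: eqP.
have [||m1 s1] := @size_monic_sum 'X^4 ((- 2 * a) *: 'X^2 + ((- 8 * b) *: 'X + (a ^+ 2)%:P)).
- exact: monicXn.
- by rewrite size_polyXn.
have e4 : mB 2 = (4 : F)%:P * c by rewrite mulB2 polyC_natr.
split; rewrite ?e //.
- by rewrite s1 size_polyXn.
- by rewrite e4 size_cst_mul ?pnatr_eq0 // size_cubic.
- by rewrite e4 lead_coefM lead_coefC lead_cubic mulr1.
rewrite -e; apply: coprime_roots => x; rewrite e4 mulA2 -polyC_natr !hE => eA eB.
apply: (@no_common_root F E x) => //; move/eqP: eB; rewrite mulf_eq0 pnatr_eq0 /= => /eqP <-.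
by rewrite !hE.
Qed.

Lemma mulpoly_spec n : (0 < n)%N -> mul_spec E n.
Proof.
case: n => // n _.
suff [] : [/\ good n.+1, good n.+2 & mul_rel n.+1] /\ good n.+3 by [].
elim: n => [|n [[g1 g2 [rD rP rS]] g3]].
  have [|r g] := mul_step (ltn0Sn 0) good1 good2; last by split=> //; split=> //; [exact: good1|exact: good2].
  rewrite mulA2 mulB2 mulA1 mulB1 /mpD /mpS /mpP /cubic -!mul_polyC; ring.
have [|r g4] := mul_step (ltn0Sn n.+1) g2 g3; last by [].
transitivity (mD (mA n.+2) (mB n.+2) * mA n.+3 ^+ 2 - 2 * mS (mA n.+2) (mB n.+2) * mA n.+3 * mB n.+3
   + mP (mA n.+2) (mB n.+2) * mB n.+3 ^+ 2); first by rewrite /mpD /mpS /mpP; ring.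
by rewrite -rD -rP -rS; ring.
Qed.

Lemma mulpoly_good n : (0 < n)%N -> good n.
Proof. by case/mulpoly_spec. Qed.

End MulPolyC.

Section XCoordinate.
Variable F : fieldType.
Variable E : scurve F.
Local Notation a := (sa E).
Local Notation b := (sb E).
Local Notation c := (cubic a b).
Local Notation pt := (spoint E).
Local Notation mA := (mulA a b).
Local Notation mB := (mulB a b).
Local Notation mD := (@mpD F).
Local Notation mS := (mpS a b).
Local Notation mP := (mpP a b).
Local Notation hE := (hornerD, hornerN, hornerX, hornerC, hornerZ, hornerM, hornerXn, horner_exp, horner_nat, hornerMn).

Hypothesis spec : forall n, (0 < n)%N -> mul_spec E n.

(* (al : be) is the x-coordinate of Q, the point at infinity being (1 : 0) *)
Definition projX (Q : pt) (al be : F) := ~~ ((al == 0) && (be == 0)) /\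
  if val Q is Some (x, _) then al = x * be else be = 0.

Definition unitX (Q : pt) : F * F := if val Q is Some (x, _) then (x, 1) else (1, 0).

Lemma projX_unit Q al be : projX Q al be ->
  exists2 k, k != 0 & al = k * (unitX Q).1 /\ be = k * (unitX Q).2.
Proof.
rewrite /projX /unitX; case: (val Q) => [[x y]|] /= [nz e].
  exists be; last by rewrite e mulr1 mulrC. by apply: contra nz => /eqP be0; rewrite e be0 mulr0 eqxx.
by exists al; rewrite ?e ?mulr1 ?mulr0 //; move: nz; rewrite e eqxx andbT.
Qed.

Lemma unit_projX Q k : k != 0 -> projX Q (k * (unitX Q).1) (k * (unitX Q).2).
Proof.
rewrite /projX /unitX; case: (val Q) => [[x y]|] /= k0; rewrite !(mulr1, mulr0) (negPf k0) ?andbF //.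
by rewrite mulrC.
Qed.

Lemma unitX_opp Q : unitX (- Q) = unitX Q.
Proof. by rewrite /unitX val_opp; case: (val Q) => [[x y]|]. Qed.

(** [dx], [sx] and [px] are the forms [mpD], [mpS] and [mpP] at a fixed value x. *)
Definition dx (x al be : F) := (al - x * be) ^+ 2.
Definition sx (x al be : F) := (al + x * be) * (x * al + a * be) + 2 * b * be ^+ 2.
Definition px (x al be : F) := (x * al - a * be) ^+ 2 - 4 * b * be * (al + x * be).

Lemma add_sub_generic (P Q : pt) x y x1 y1 be : val P = Some (x, y) -> val Q = Some (x1, y1) ->
  x1 != x -> be != 0 -> exists2 k, k != 0 &
  [/\ dx x (x1 * be) be = k * ((unitX (Q - P)).2 * (unitX (Q + P)).2),
     px x (x1 * be) be = k * ((unitX (Q - P)).1 * (unitX (Q + P)).1) &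
     2 * sx x (x1 * be) be = k * ((unitX (Q - P)).1 * (unitX (Q + P)).2
        + (unitX (Q + P)).1 * (unitX (Q - P)).2)].
Proof.
move=> eP eQ x1x be0; have d0 : x1 - x != 0 by rewrite subr_eq0.
have yP := spoint_on eP; have yQ := spoint_on eQ; rewrite !cubicE in yP yQ.
have eP' : val (- P) = Some (x, - y) by rewrite val_opp eP.
have n1 : Q != - P by apply: contra x1x => /eqP e; move: eQ; rewrite e eP' => -[->].
have n2 : Q != - - P by apply: contra x1x => /eqP e; move: eQ; rewrite e opprK eP => -[->].
have e1 := @val_add _ _ Q P x1 y1 x y (x1 - x) (y1 - y) eQ eP n1 d0 (mulrC _ _) _.
have {}e1 := e1 (fun e => False_rect _ (negP x1x (introT eqP e))).
have e2 := @val_add _ _ Q (- P) x1 y1 x (- y) (x1 - x) (y1 - - y) eQ eP' n2 d0 (mulrC _ _) _.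
have {}e2 := e2 (fun e => False_rect _ (negP x1x (introT eqP e))).
exists (be ^+ 2 * (x1 - x) ^+ 2); first by rewrite mulf_neq0 ?expf_neq0.
rewrite /unitX e1 e2 /= /dx /sx /px !mulr1 opprK; split.
- by ring.
- transitivity (be ^+ 2 * (((y1 + y) ^+ 2 - (x1 + x) * (x1 - x) ^+ 2) *
     ((y1 - y) ^+ 2 - (x1 + x) * (x1 - x) ^+ 2)) / (x1 - x) ^+ 2); last by field.
  have -> : ((y1 + y) ^+ 2 - (x1 + x) * (x1 - x) ^+ 2) * ((y1 - y) ^+ 2 - (x1 + x) * (x1 - x) ^+ 2)
     = (y1 ^+ 2 - y ^+ 2) ^+ 2 - 2 * (y1 ^+ 2 + y ^+ 2) * ((x1 + x) * (x1 - x) ^+ 2) + ((x1 + x) * (x1 - x) ^+ 2) ^+ 2 by ring.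
  by rewrite yP yQ; field.
- transitivity (be ^+ 2 * (2 * (y1 ^+ 2 + y ^+ 2) - 2 * (x1 + x) * (x1 - x) ^+ 2)); last by field.
  by rewrite yP yQ; ring.
Qed.

Lemma double_x (P : pt) x y : val P = Some (x, y) ->
  dx x x 1 = 0 /\ 2 * sx x x 1 = 4 * y ^+ 2 /\
  (if y == 0 then P + P = 0 /\ px x x 1 != 0 else
   [/\ (unitX (P + P)).2 = 1 & px x x 1 = 4 * y ^+ 2 * (unitX (P + P)).1]).
Proof.
move=> eP; have yP := spoint_on eP; rewrite cubicE in yP.
rewrite /dx /sx /px; split; first by ring.
split; first by rewrite yP; ring.
have [y0|y0] := eqVneq y 0.
  have PP : P = - P by apply: val_inj; rewrite val_opp eP /= y0 oppr0. split; first by rewrite {2}PP subrr.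
  apply/eqP => e; apply: (@no_common_root F E x); first by rewrite -(spoint_on eP) y0 expr0n. by rewrite -[RHS]e; ring.
have n1 : P != - P.
  apply: contra y0 => /eqP e; have := val_opp P; rewrite -e eP /= => -[yy]; have {}yy : y == - y by rewrite {1}yy.
  by move: yy; rewrite -addr_eq0 -mulr2n -mulr_natr mulf_eq0 (negPf (s_char E)) orbF.
have d0 : 2 * y != 0 by rewrite mulf_neq0 ?s_char ?four_neq0.
have e1 := @val_add _ _ P P x y x y (2 * y) (3 * x ^+ 2 + a) eP eP n1 d0 _ (fun _ => mulrC _ _).
have {}e1 := e1 (etrans (congr1 (fun z => _ * z) (subrr x)) (etrans (mulr0 _)
   (esym (etrans (congr1 (fun z => _ * z) (subrr y)) (mulr0 _))))).
rewrite /unitX e1 /=; split=> //.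
transitivity ((3 * x ^+ 2 + a) ^+ 2 - 8 * x * y ^+ 2); last by field; rewrite ?y0 ?s_char.
by rewrite yP; ring.
Qed.

Lemma add_sub_x (P Q : pt) x y al be : val P = Some (x, y) -> projX Q al be ->
  exists2 k, k != 0 &
  [/\ dx x al be = k * ((unitX (Q - P)).2 * (unitX (Q + P)).2),
     px x al be = k * ((unitX (Q - P)).1 * (unitX (Q + P)).1) &
     2 * sx x al be = k * ((unitX (Q - P)).1 * (unitX (Q + P)).2
        + (unitX (Q + P)).1 * (unitX (Q - P)).2)].
Proof.
move=> eP pQ; have [nz] := pQ; have [Q0|Q0] := eqVneq Q 0.
  rewrite Q0 /= => be0; rewrite be0 eqxx andbT in nz *. rewrite sub0r add0r unitX_opp /unitX eP /dx /sx /px /=.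
  by exists (al ^+ 2); rewrite ?expf_neq0 //; split; ring.
have [x1 [y1 eQ]] := point_xyP Q0; rewrite eQ => alE; subst al.
have be0 : be != 0 by apply: contra nz => /eqP->; rewrite mulr0 eqxx.
have [xx|xx] := eqVneq x1 x; last exact: add_sub_generic eP eQ xx be0.
subst x1; have [d0 [s0 h]] := double_x eP.
have hd : dx x (x * be) be = be ^+ 2 * dx x x 1 by rewrite /dx; ring.
have hp : px x (x * be) be = be ^+ 2 * px x x 1 by rewrite /px; ring.
have hs : 2 * sx x (x * be) be = be ^+ 2 * (2 * sx x x 1) by rewrite /sx; ring.
rewrite hd hp hs d0 s0.
have u0 : unitX 0 = (1, 0) by [].
have QP : Q = P \/ Q = - P.
  have : y1 ^+ 2 == y ^+ 2 by rewrite (spoint_on eQ) (spoint_on eP).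
  rewrite eqf_sqr => /orP[/eqP e|/eqP e]; [left|right]; apply: val_inj; by rewrite ?val_opp eQ eP e.
move: h; case: eqP => [y0 [PP p0]|/eqP y0 [u2 pE]].
  exists (be ^+ 2 * px x x 1); first by rewrite mulf_neq0 ?expf_neq0. have PN : - P = P by apply/eqP; rewrite eq_sym -addr_eq0 PP.
  have -> : Q - P = 0 by case: QP => ->; rewrite PN PP. have -> : Q + P = 0 by case: QP => ->; rewrite ?PN PP.
  by rewrite u0 /= y0; split; ring.
exists (be ^+ 2 * (4 * y ^+ 2)); first by rewrite !mulf_neq0 ?expf_neq0 ?s_char ?four_neq0.
case: QP => ->.
  by rewrite subrr u0 u2 pE /=; split; ring.
by rewrite addNr -opprD unitX_opp u0 u2 pE /=; split; ring.
Qed.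

(** The three values are the coefficients of the quadratic form whose roots are x(Q - P) and x(Q +
    P); the first root is known and determines the second, also when it is at infinity. *)
Lemma projX_step (P Q : pt) x y al be al' be' al'' be'' : val P = Some (x, y) ->
  projX Q al be -> projX (Q - P) al' be' -> ~~ ((al'' == 0) && (be'' == 0)) ->
  be' * be'' = dx x al be -> al' * al'' = px x al be ->
  al' * be'' + al'' * be' = 2 * sx x al be -> projX (Q + P) al'' be''.
Proof.
move=> eP pQ pm nz ed ep es; have [k k0 [hd hp hs]] := add_sub_x eP pQ.
have [l l0 [al'E be'E]] := projX_unit pm.
rewrite -ed in hd; rewrite -ep in hp; rewrite -es in hs.
have kl : k / l != 0 by rewrite mulf_neq0 ?invr_eq0.
suff [-> ->] : al'' = k / l * (unitX (Q + P)).1 /\ be'' = k / l * (unitX (Q + P)).2 by exact: unit_projX.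
move: hd hp hs; rewrite al'E be'E; set u := unitX (Q + P); rewrite /unitX.
case: (val (Q - P)) => [[x' y']|] /=; rewrite !(mulr1, mulr0, mul1r, mul0r, addr0, add0r) => hd hp hs.
  have b'' : be'' = k / l * u.2 by apply: (mulfI l0); rewrite hd; field.
  split=> //; apply: (mulfI l0); apply: (@addrI _ (l * x' * be'')). by rewrite [al'' * l]mulrC in hs; rewrite hs b''; field.
split; apply: (mulfI l0); first by rewrite hp; field.
by rewrite hs; field.
Qed.

Lemma mul_x (P : pt) x y n : val P = Some (x, y) -> (0 < n)%N ->
  projX (P *+ n) (mA n).[x] (mB n).[x].
Proof.
move=> eP; case: n => // n _.
have nzn m : (0 < m)%N -> ~~ (((mA m).[x] == 0) && ((mB m).[x] == 0)).
  move=> m0; have [[_ _ _ _ co] _ _] := spec m0; apply/negP => /andP[r1 r2]. by have := coprimep_root co r1; rewrite r2.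
suff [] : projX (P *+ n.+1) (mA n.+1).[x] (mB n.+1).[x] /\
  projX (P *+ n.+2) (mA n.+2).[x] (mB n.+2).[x] by [].
have P1 : projX P (mA 1).[x] (mB 1).[x].
  by rewrite /projX eP; split; [exact: nzn | rewrite mulA1 mulB1 !hE mulr1].
elim: n => [|n [IH1 IH2]].
  split=> //; apply: (projX_step eP P1 (al' := 1) (be' := 0)).
  - by rewrite subrr /projX oner_eq0.
  - exact: nzn.
  - by rewrite mul0r mulA1 mulB1 /dx !hE; ring.
  - by rewrite mulA1 mulB1 mulA2 /px !hE; ring.
  - by rewrite mulA1 mulB1 mulB2 /sx !hE; ring.
split=> //; have [_ _ [rD rP rS]] := (spec (ltn0Sn n)).
have e3 : P *+ n.+3 = P *+ n.+2 + P by rewrite mulrSr.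
rewrite e3; apply: (projX_step eP IH2 (al' := (mA n.+1).[x]) (be' := (mB n.+1).[x])).
- by rewrite mulrSr addrK.
- exact: nzn.
- by rewrite -hornerM rD /mpD /dx !hE.
- by rewrite -hornerM rP /mpP /px !hE; ring.
- by rewrite -!hornerM -hornerD rS /mpS /sx !hE; ring.
Qed.

Lemma tors_x (P : pt) x y n : val P = Some (x, y) -> (0 < n)%N ->
  (P *+ n == 0) = ((mB n).[x] == 0).
Proof.
move=> eP n0; have [nz] := mul_x eP n0; rewrite point_eq0.
case: (val (P *+ n)) => [[x' y']|] /= e; last by rewrite e eqxx.
by apply/esym/negbTE; apply: contra nz => /eqP B0; rewrite e B0 mulr0 eqxx.
Qed.

End XCoordinate.

(** * Counting torsion points *)

Section TorsionCount.
Variable E : scurve algC.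
Local Notation F := algC.
Local Notation a := (sa E).
Local Notation b := (sb E).
Local Notation c := (cubic a b).
Local Notation pt := (spoint E).
Local Notation mA := (mulA a b).
Local Notation mB := (mulB a b).
Local Notation mD := (@mpD F).
Local Notation mS := (mpS a b).
Local Notation mP := (mpP a b).
Local Notation hE := (hornerD, hornerN, hornerX, hornerC, hornerZ, hornerM, hornerXn, horner_exp, horner_nat, hornerMn).

(** A generic fibre is counted instead of the torsion itself. If q avoids the roots of c and the
    critical values of A_n / B_n, then A_n - q B_n has n^2 distinct roots, and of the two points
    above each root one is mapped to Q and the other to -Q. *)
Lemma fiber_count n : (0 < n)%N -> exists (Q : pt) (s : seq pt),
  [/\ uniq s, size s = (n ^ 2)%N & forall P, (P \in s) = (P *+ n == Q)].
Proof.
move=> n0; have [mon sA sB lB co] := @mulpoly_good E n n0.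
(* The numerator of the derivative of A_n / B_n. Its leading coefficient is n^4 - n^2 (n^2 - 1) =
   n^2, which is not 0. *)
pose W := (mA n)^`() * mB n - mA n * (mB n)^`().
have W0 : W != 0.
  pose m := (n ^ 2)%N; have m0 : (0 < m)%N by rewrite expn_gt0 n0. have [m' mE] : exists m', m = m'.+1 by exists m.-1; rewrite prednK.
  have sA' : (size (mA n)^`() <= m)%N by rewrite -ltnS -sA lt_size_deriv // monic_neq0.
  have sB' : (size (mB n)^`() <= m')%N by rewrite -ltnS -mE /m -sB lt_size_deriv // -size_poly_eq0 sB -/m mE.
  have lA1 : (mA n)`_m = 1 by have /monicP := mon; rewrite lead_coefE sA.
  have lB1 : (mB n)`_m' = m%:R by move: lB; rewrite lead_coefE sB -/m mE. have cW : W`_(m' + m') = m%:R.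
    rewrite coefB coefM_top ?sB -/m -?mE // coef_deriv lB1 -mE lA1. have -> : (mA n * (mB n)^`())`_(m' + m') = m%:R * m'%:R.
      have [m'0|[m'' m'E]] : m' = 0%N \/ exists m'', m' = m''.+1.
        by case: (m') => [|k]; [left|right; exists k]. rewrite m'0 mulr0; have -> : (mB n)^`() = 0.
          by apply/eqP; rewrite -size_poly_eq0 -leqn0 -m'0.
        by rewrite mulr0 coef0.
      have -> : (m' + m' = m + m'')%N by rewrite mE {2}m'E; lia.
      rewrite coefM_top ?sA // -?m'E // lA1 mul1r coef_deriv -m'E lB1 mulr_natr //.
    by rewrite mE -[m'.+1]addn1 natrD; ring.
  by apply/eqP => e; move/eqP: cW; rewrite e coef0 eq_sym pnatr_eq0 mE.
have [rs Wrs] := closed_field_poly_normal W.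
have cc0 : c != 0 := cubic_neq0 a b.
pose bad : {poly F} := c * \prod_(r <- rs) ('X - ((mA n).[r] / (mB n).[r])%:P).
have [q] : exists q, bad.[q] != 0.
  apply: contrapT => /forallNP h; have : bad != 0.
    by rewrite mulf_neq0 // prodf_seq_neq0; apply/allP => r _; rewrite polyXsubC_eq0.
  move=> /eqP; apply; apply: (@poly_zero_off bad 1) => [|x _]; first exact: oner_neq0. by apply/eqP/negPn/negP/h.
rewrite hornerM mulf_eq0 negb_or => /andP[cq bq].
pose p := mA n - q%:P * mB n.
have [pm sp] : p \is monic /\ size p = (n ^ 2).+1.
  rewrite -sA; apply: size_monic_sum => //; rewrite size_polyN sA ltnS mul_polyC. by rewrite (leq_trans (size_scale_leq _ _)) ?sB.
have [ss] := closed_field_poly_normal p; rewrite (monicP pm) scale1r => pE.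
have sss : size ss = (n ^ 2)%N by move: sp; rewrite pE size_prod_XsubC => -[].
have rootp x : (x \in ss) = ((mA n).[x] == q * (mB n).[x]).
  by rewrite -root_prod_XsubC -pE rootE /p !hE subr_eq0.
have nB x : x \in ss -> (mB n).[x] != 0.
  rewrite rootp => /eqP e; apply/eqP => B0. have := coprimep_root co; move=> /(_ x); rewrite rootE e B0 mulr0 eqxx => /(_ isT); by [].
have uss : uniq ss.
  rewrite -separable_prod_XsubC -pE unlock; apply: coprime_roots => x px p'x.
  have xs : x \in ss by rewrite -root_prod_XsubC -pE rootE px. have Ax : (mA n).[x] = q * (mB n).[x] by apply/eqP; rewrite -rootp.
  move: p'x; rewrite /p derivB derivM derivC mul0r add0r !hE => /eqP; rewrite subr_eq0 => /eqP A'x.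
  have : root W x by rewrite rootE /W !hE Ax A'x; apply/eqP; ring. rewrite Wrs rootZ ?lead_coef_eq0 // root_prod_XsubC => xrs.
  move: bq; rewrite horner_prod prodf_seq_neq0 => /allP /(_ x xrs). by rewrite /= !hE Ax mulfK ?nB // subrr eqxx.
have [Q [yQ eQ]] := point_at E q.
have Q2 : Q != - Q.
  apply: contra cq => /eqP e; have yy : yQ = - yQ by move: (eQ); rewrite e val_opp eQ => -[].
  rewrite -(spoint_on eQ) sqrf_eq0; move/eqP: yy. by rewrite -addr_eq0 -mulr2n -mulr_natr mulf_eq0 pnatr_eq0 orbF.
have nPQ (P : pt) x y : val P = Some (x, y) -> (x \in ss) = (P *+ n == Q) || (P *+ n == - Q).
  move=> eP; have [nz] := mul_x (@mulpoly_spec E) eP n0; rewrite rootp. case e: (val (P *+ n)) => [[x' y']|].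
    move=> ->; have B0 : (mB n).[x] != 0.
      by apply: contra nz => /eqP B0; move: (mul_x (@mulpoly_spec E) eP n0).2; rewrite e B0 mulr0 => ->; rewrite eqxx.
    rewrite (inj_eq (mulIf B0)); apply/eqP/orP => [xq|].
      subst x'; have : y' ^+ 2 == yQ ^+ 2 by rewrite (spoint_on e) (spoint_on eQ).
      rewrite eqf_sqr => /orP[/eqP yy|/eqP yy]; [left|right]; apply/eqP/val_inj;
      by rewrite ?val_opp [LHS]e eQ yy.
    by case=> /eqP eq; move: e; rewrite eq ?val_opp eQ => -[].
  move=> B0; rewrite B0 mulr0; have P0 : P *+ n = 0 by apply/eqP; rewrite point_eq0 e. have Q0 : Q != 0 by rewrite point_eq0 eQ.
  rewrite P0 ![0 == _]eq_sym oppr_eq0 (negPf Q0). by apply/negbTE; apply: contra nz => ->; rewrite B0 eqxx.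
pose lift x : pt := let P := sval (cid (point_at E x)) in if P *+ n == Q then P else - P.
have liftE x : exists y, val (lift x) = Some (x, y).
  rewrite /lift; case: cid => P [y eP] /=; case: ifP => _; first by exists y. by exists (- y); rewrite val_opp eP.
have lift_n x : x \in ss -> lift x *+ n = Q.
  move=> xs; rewrite /lift; case: cid => P [y eP] /=; case: ifP => [/eqP//|ne].
  by move: xs; rewrite (nPQ _ _ _ eP) ne /= => /eqP e; rewrite mulNrn e opprK.
exists Q, [seq lift x | x <- ss]; split.
- rewrite map_inj_in_uniq // => x x' _ _ e; have [y ey] := liftE x; have [y' ey'] := liftE x'.
  by move: ey; rewrite e ey' => -[].
- by rewrite size_map.
move=> P; apply/mapP/eqP => [[x xs ->]|nP]; first exact: lift_n.
have [x [y eP]] : exists x y, val P = Some (x, y).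
  by apply: point_xyP; apply/eqP => P0; move: nP; rewrite P0 mul0rn => e; move: eQ; rewrite -e.
have xs : x \in ss by rewrite (nPQ _ _ _ eP) nP eqxx.
exists x => //; have [y' eL] := liftE x.
have : y ^+ 2 == y' ^+ 2 by rewrite (spoint_on eP) (spoint_on eL).
rewrite eqf_sqr => /orP[/eqP yy|/eqP yy]; first by apply: val_inj; rewrite eP eL yy.
have PL : P = - lift x by apply: val_inj; rewrite val_opp eP eL yy.
by case/eqP: Q2; rewrite -{1}nP PL mulNrn lift_n.
Qed.

Lemma torsion_count n : (0 < n)%N -> exists s : seq pt,
  [/\ uniq s, size s = (n ^ 2)%N & forall P, (P \in s) = (P *+ n == 0)].
Proof.
move=> n0; have [Q [s [us ss sE]]] := fiber_count n0.
have [P0 P0s] : exists P0, P0 \in s.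
  have : (0 < size s)%N by rewrite ss expn_gt0 n0. by case: s {us ss sE} => // P s _; exists P; rewrite mem_head.
exists [seq P - P0 | P <- s]; split; first by rewrite map_inj_uniq // => ? ? /addIr.
  by rewrite size_map.
move=> P; rewrite -[P in P *+ n](addrK P0) mulrnBl; move: (P0s); rewrite sE => /eqP->.
rewrite subr_eq0 -sE; apply/mapP/idP => [[R Rs ->]|Ps]; first by rewrite addrNK.
by exists (P + P0); rewrite ?addrK.
Qed.

End TorsionCount.

(** * Structure of E[l^m] and the action of automorphisms on it *)

Section TorsionStructure.
Variable E : scurve algC.
Local Notation pt := (spoint E).
Implicit Types (P Q R S T : pt).

Lemma tors_dvd P m n : (m %| n)%N -> P *+ m = 0 -> P *+ n = 0.
Proof. by move=> /dvdnP[k ->] h; rewrite mulnC mulrnA h mul0rn. Qed.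

Lemma mulrn_mod P n i : P *+ n = 0 -> P *+ (i %% n) = P *+ i.
Proof. by move=> h; rewrite [in RHS](divn_eq i n) mulrnDr mulnC mulrnA h mul0rn add0r. Qed.

Definition tlist n : seq pt :=
  if n is n'.+1 then sval (cid (torsion_count E (ltn0Sn n'))) else [::].

Lemma tlistP n : (0 < n)%N -> [/\ uniq (tlist n), size (tlist n) = (n ^ 2)%N &
  forall P, (P \in tlist n) = (P *+ n == 0)].
Proof. by case: n => // n _; rewrite /tlist; case: cid. Qed.

Definition combs S T n r : seq pt := [seq S *+ i + T *+ j | i <- iota 0 n, j <- iota 0 r].

Lemma size_combs S T n r : size (combs S T n r) = (n * r)%N.
Proof. by rewrite size_allpairs !size_iota. Qed.

Lemma mulr_dvd P m n : P *+ m = 0 -> (m %| n)%N -> P *+ n = 0.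
Proof. by move=> h d; apply: tors_dvd d h. Qed.

Lemma dvd_inverse l j : prime l -> ~~ (l %| j)%N -> exists u, (l %| 1 + u * j)%N.
Proof.
move=> pl lj; have [u _] := Bezoutl j (prime_gt0 pl).
by rewrite (eqP (_ : coprime l j)) ?prime_coprime //; exists u.
Qed.

Lemma tors_prime_dvd P l i : prime l -> P *+ l = 0 -> P != 0 -> P *+ i = 0 -> (l %| i)%N.
Proof.
move=> pl nP P0 iP; apply: contraT => /(dvd_inverse pl)[u /(mulr_dvd nP)].
by rewrite mulrnDr mulnC mulrnA iP mul0rn addr0 mulr1n => /eqP; rewrite (negPf P0).
Qed.

Lemma uniq_combs S T n r : S *+ n = 0 -> T *+ r = 0 ->
  (forall i j, S *+ i + T *+ j = 0 -> (n %| i)%N && (r %| j)%N) -> uniq (combs S T n r).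
Proof.
move=> nS rT indep; apply: allpairs_uniq; rewrite ?iota_uniq //.
move=> [i j] [i' j'] /allpairsP[[u v] /= [hu hv [-> ->]]] /allpairsP[[u' v'] /= [hu' hv' [-> ->]]].
move: hu hv hu' hv'; rewrite !mem_iota !add0n /= => hu hv hu' hv' e.
have : S *+ (u + (n - u')) + T *+ (v + (r - v')) = 0.
  rewrite !mulrnDr !mulrnBr ?(ltnW hu') ?(ltnW hv') // nS rT !sub0r addrACA e. by rewrite addrACA !subrr addr0.
move=> /indep/andP[/dvdnP[k ek] /dvdnP[k' ek']].
have [e1 e2] : k = 1%N /\ k' = 1%N by split; nia.
by congr (_, _); subst; lia.
Qed.

(** Only the orders of the groups E[l^j] enter. S exists because E[l^m] is larger than E[l^(m-1)]. T
    exists because otherwise E[l^m] would be covered by l cosets of E[l^(m-1)]. Independence then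
    climbs from one power of l to the next, and counting shows that S and T generate. *)
Lemma torsion_basis l m : prime l -> (0 < m)%N -> exists S T,
  [/\ S *+ l ^ m = 0, T *+ l ^ m = 0,
    (forall i j, S *+ i + T *+ j = 0 -> (l ^ m %| i)%N && (l ^ m %| j)%N) &
    forall P, P *+ l ^ m = 0 -> exists i j, P = S *+ i + T *+ j].
Proof.
move=> pl; have l0 := prime_gt0 pl; have l1 := prime_gt1 pl.
case: m => // m _; have lm k : (0 < l ^ k)%N by rewrite expn_gt0 l0.
have [u1 s1 e1] := tlistP (lm m.+1); have [u0 s0 e0] := tlistP (lm m).
have [S nS R0] : exists2 S : pt, S *+ l ^ m.+1 = 0 & S *+ l ^ m != 0.
  apply: contrapT => h; have : (size (tlist (l ^ m.+1)) <= size (tlist (l ^ m)))%N.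
    apply: uniq_leq_size => // P; rewrite e1 e0 => /eqP nP. by apply: contraT => h'; case: h; exists P.
  by rewrite s1 s0 leq_exp2r // leq_exp2l // ltnn.
pose R := S *+ l ^ m; have nR : R *+ l = 0 by rewrite -mulrnA -expnSr.
have [T nT T1] : exists2 T : pt, T *+ l ^ m.+1 = 0 & forall i, T *+ l ^ m != R *+ i.
  apply: contrapT => h. have : (size (tlist (l ^ m.+1)) <= size [seq (S *+ i + V)%R | i <- iota 0 l, V <- tlist (l ^ m)])%N.
    apply: uniq_leq_size => // P; rewrite e1 => /eqP nP. have [i iE] : exists i, P *+ l ^ m = R *+ i.
      apply: contrapT => h'; apply: h; exists P => // i; apply/eqP => e; by apply: h'; exists i.
    apply/allpairsP; exists ((i %% l)%N, P - S *+ (i %% l)); split=> /=.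
    - by rewrite mem_iota ltn_mod.
    - rewrite e0 mulrnBl -mulrnA mulnC mulrnA -/R.
      by rewrite (mulrn_mod _ nR) iE subrr.
    - by rewrite addrC subrK.
  rewrite size_allpairs size_iota s1 s0 -!expnM leqNgt. have -> : (l * l ^ (m * 2) = l ^ (m * 2).+1)%N by rewrite expnS.
  by rewrite ltn_exp2l //; lia.
have step i j : (S *+ i + T *+ j) *+ l ^ m = 0 -> (l %| i)%N && (l %| j)%N.
  rewrite mulrnDl ![_ *+ _ *+ l ^ m]mulrnAC -/R => e. have nT' : T *+ l ^ m *+ l = 0 by rewrite -mulrnA -expnSr. have lj : (l %| j)%N.
    apply: contraT => lj; have [u uj] := dvd_inverse pl lj. have := mulr_dvd nT' uj; rewrite mulrnDr mulr1n mulnC mulrnA.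
    move/eqP: e; rewrite addrC addr_eq0 => /eqP->.
    rewrite mulNrn -mulrnA => /eqP; rewrite subr_eq0 => /eqP e; by case/eqP: (T1 (i * u)%N).
  rewrite lj andbT; apply: (tors_prime_dvd pl nR) => //. by move: e; rewrite (mulr_dvd nT' lj) addr0.
have ind k i j : (k <= m.+1)%N -> (S *+ i + T *+ j) *+ l ^ (m.+1 - k) = 0 ->
    (l ^ k %| i)%N && (l ^ k %| j)%N.
  elim: k => [|k IH] km e; first by rewrite !dvd1n. have /andP[/dvdnP[i' ei] /dvdnP[j' ej]] : (l ^ k %| i)%N && (l ^ k %| j)%N.
    by apply: IH (ltnW km) _; rewrite -(subnSK km) expnSr mulrnA e mul0rn.
  rewrite ei ej !expnS !dvdn_pmul2r //; apply: step.
  rewrite -e ei ej !(mulnC _ (l ^ k)%N) ![_ *+ (l ^ k * _)]mulrnA ![_ *+ l ^ k *+ _]mulrnAC -mulrnDl.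
  by rewrite -[RHS]mulrnA -expnD subSS subnKC.
have indep i j : S *+ i + T *+ j = 0 -> (l ^ m.+1 %| i)%N && (l ^ m.+1 %| j)%N.
  by move=> e; apply: ind => //; rewrite subnn expn0 mulr1n.
exists S, T; split=> // P nP.
have uc := uniq_combs nS nT indep.
have [|| _ eq] := @uniq_min_size _ (combs S T (l ^ m.+1) (l ^ m.+1)) (tlist (l ^ m.+1)) uc.
- by move=> Q /allpairsP[[i j] [_ _ ->]]; rewrite e1 mulrnDl !tors_muln // addr0.
- by rewrite s1 size_combs -mulnn.
have : P \in tlist (l ^ m.+1) by rewrite e1 nP.
by rewrite -eq => /allpairsP[[i j] [_ _ ->]]; exists i, j.
Qed.

(** If this power were 1, S and a multiple of T of order r would pair trivially and span n r points,
    more than the 2n + 1 of [weil_nondegenerate] as soon as r > 2. *)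
Lemma weil_basis l m S T r : prime l -> S *+ (l ^ m) = 0 -> T *+ (l ^ m) = 0 ->
  (forall i j, S *+ i + T *+ j = 0 -> (l ^ m %| i)%N && (l ^ m %| j)%N) ->
  (2 < r)%N -> (r %| l ^ m)%N -> weil (l ^ m) S T ^+ (l ^ m %/ r)%N != 1.
Proof.
move=> pl; set n := (l ^ m)%N => nS nT indep.
have n0 : (0 < n)%N by rewrite expn_gt0 prime_gt0.
move=> r2 rn; rewrite -weil_mulr //; apply/eqP => e1.
have rE : ((n %/ r) * r = n)%N by rewrite divnK.
have r0 : (0 < r)%N by lia.
have n0' : (0 < n %/ r)%N by rewrite divn_gt0 // dvdn_leq.
have nT' : T *+ (n %/ r) *+ n = 0 by apply: tors_muln.
have := @weil_nondegenerate _ n n0 S (T *+ (n %/ r)) (combs S (T *+ (n %/ r)) n r) nS nT' e1.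
rewrite size_combs => h.
suff : (n * r <= n.*2.+1)%N by have := dvdn_leq n0 rn; nia.
apply: h; last by move=> Q /allpairsP[[i j] [_ _ ->]]; exists i, j.
apply: uniq_combs => //; first by rewrite -mulrnA rE.
move=> i j; rewrite -mulrnA => /indep; rewrite -[X in (X %| _ * _)%N]rE.
by rewrite dvdn_pmul2l.
Qed.

Section GaloisAction.
Variables (s : {rmorphism algC -> algC}).
Hypotheses (sfa : sa E = s (sa E)) (sfb : sb E = s (sb E)).
Local Notation sp := (pmap sfa sfb).

Lemma weil_primitive l m : prime l -> (0 < m)%N -> exists z : algC,
  [/\ z ^+ (l ^ m)%N = 1,
    (forall P : pt, P *+ l ^ m = 0 -> sp P = P) -> s z = z &
    forall r, (2 < r)%N -> (r %| l ^ m)%N -> z ^+ (l ^ m %/ r)%N != 1].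
Proof.
move=> pl m0; have [S [T [nS nT indep gen]]] := torsion_basis pl m0.
set n := (l ^ m)%N in nS nT indep gen *.
have n0 : (0 < n)%N by rewrite expn_gt0 prime_gt0.
exists (weil n S T); split; first by apply: weil_unity.
  by move=> fx; rewrite -weil_map // !fx.
by move=> r r2 rn; apply: weil_basis.
Qed.

(** Fixing E[l^m] fixes the pairing of a basis, hence all roots of unity of its order. That order is
    l^m for odd l; for l = 2 the restriction r > 2 guarantees only 2^(m-1). *)
Lemma fix_roots l m (w : algC) : prime l -> (0 < m)%N ->
  (forall P : pt, P *+ l ^ m = 0 -> sp P = P) ->
  w ^+ (l ^ (m - (l == 2))%N)%N = 1 -> s w = w.
Proof.
move=> pl m0 fx ew; have n0 : (0 < l ^ m)%N by rewrite expn_gt0 prime_gt0.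
have [z [zn sz zr]] := weil_primitive pl m0.
have [k kz kn] := prim_order_exists n0 zn.
have /(dvdn_pfactor _ _ pl)[j jm kE] := kn.
have jm' : (m - (l == 2%N) <= j)%N.
  rewrite leqNgt; apply/negP => lt. have [l2|l2] := eqVneq l 2%N.
    subst l; rewrite eqxx in lt; have := zr 4%N isT.
    have -> : (4 = 2 ^ 2)%N by []; rewrite dvdn_Pexp2l //. have -> : (1 < m)%N by lia. rewrite -expnB //; last by lia.
    by move=> /(_ isT); rewrite -(prim_order_dvd kz) kE dvdn_Pexp2l //; lia.
  have e1 : (l ^ m %/ l = l ^ m.-1)%N by rewrite -{1}(prednK m0) expnS mulKn ?prime_gt0.
  have l3 : (2 < l)%N by have := prime_gt1 pl; lia. have := zr l l3; rewrite e1 dvdn_exp // => /(_ isT).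
  rewrite -(prim_order_dvd kz) kE dvdn_Pexp2l ?prime_gt1 //. by move: lt; rewrite (negPf l2); lia.
have wk : w ^+ k = 1.
  by apply/eqP; rewrite kE -(subnKC jm') expnD exprM ew expr1n.
by have [i ->] := prim_rootP kz wk; rewrite rmorphXn /= sz.
Qed.

End GaloisAction.

(* delta Q = g Q - Q is l-torsion on E[l^(j+1)], hence fixed by g *)
Lemma level_up (g : {additive pt -> pt}) l j : (0 < l)%N -> (0 < j)%N ->
  (forall P, P *+ l ^ j = 0 -> g P = P) ->
  forall P, P *+ l ^ j.+1 = 0 -> iter l g P = P.
Proof.
move=> l0 j0 fx P nP; pose d := g P - P.
have dl : d *+ l = 0.
  rewrite mulrnBl -raddfMn fx ?subrr // -mulrnA -expnS //.
have gd : g d = d.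
  by apply: fx; rewrite -(prednK j0) expnS mulrnA dl mul0rn.
have gP : g P = P + d by rewrite /d addrC subrK.
have it i : iter i g P = P + d *+ i.
  elim: i => [|i IH]; first by rewrite mulr0n addr0. by rewrite iterS IH raddfD raddfMn gd mulrS addrA gP.
by rewrite it dl addr0.
Qed.

(** Write P = l Q, d = g Q - Q and d2 = g d - d. The l-th iterate of g sends Q to Q + l d + C(l, 2)
    d2. The last term is 0, because l d2 = 0 and l is odd, or because d2 = 0 when j > 1. Hence l d,
    which is g P - P, is 0. *)
Lemma level_strict (g : {additive pt -> pt}) l j : prime l -> (0 < j)%N ->
  odd l || (1 < j)%N ->
  (forall P, P *+ l ^ j = 0 -> g P = P) ->
  (forall P, P *+ l ^ j.+2 = 0 -> iter l g P = P) ->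
  forall P, P *+ l ^ j.+1 = 0 -> g P = P.
Proof.
move=> pl j0 lj fx fx2 P nP; have l0 := prime_gt0 pl.
have [Q eQ] : exists Q : pt, P = Q *+ l.
  have [S [T [nS nT indep gen]]] := torsion_basis pl (ltn0Sn j.+1).
  have [i [i' eP]] := gen P (tors_dvd (dvdn_exp2l l (leqnSn j.+1)) nP). have := nP; rewrite eP mulrnDl -!mulrnA => /indep.
  rewrite ![(l ^ j.+2)%N]expnSr ![(_ * l ^ j.+1)%N]mulnC !dvdn_pmul2l ?expn_gt0 ?l0 //.
  by case/andP=> /dvdnP[u ->] /dvdnP[u' ->]; exists (S *+ u + T *+ u'); rewrite mulrnDl -!mulrnA.
pose d := g Q - Q; pose d2 := g d - d.
have nQ : Q *+ l ^ j.+2 = 0 by rewrite expnS mulrnA -eQ.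
have dl : d *+ l = g P - P by rewrite mulrnBl -raddfMn -eQ.
have ddl : d *+ l *+ l = 0.
  by rewrite dl mulrnBl -raddfMn fx ?subrr // -mulrnA -expnS.
have d2l : d2 *+ l = 0.
  rewrite mulrnBl -raddfMn fx ?subrr // -(prednK j0) expnS mulrnA ddl mul0rn //.
have gd2 : g d2 = d2.
  by apply: fx; rewrite -(prednK j0) expnS mulrnA d2l mul0rn.
have it i : iter i g Q = Q + d *+ i + d2 *+ 'C(i, 2%N).
  elim: i => [|i IH]; first by rewrite !mulr0n !addr0. have e2 : 'C(i.+1, 2%N) = ('C(i, 2%N) + i)%N by rewrite binS bin1.
  rewrite iterS IH e2 mulrnDr mulrS (raddfD g) (raddfD g) !(raddfMn g) gd2. have -> : g Q = Q + d by rewrite /d addrC subrK.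
  have -> : g d = d + d2 by rewrite /d2 addrC subrK. by rewrite (mulrnDl i d d2) -!addrA [d2 *+ i + _]addrC.
have := it l; rewrite fx2 // => /eqP; rewrite -addrA -subr_eq0 opprD addNKr oppr_eq0.
have -> : d2 *+ 'C(l, 2%N) = 0.
  case/orP: lj => [ol|j1].
    by apply: mulr_dvd d2l _; rewrite prime_dvd_bin //= odd_prime_gt2.
  have -> : d2 = 0; last by rewrite mul0rn. apply/eqP; rewrite subr_eq0; apply/eqP/fx.
  by rewrite -(subnK j1) expnD mulnC mulrnA expnS expn1 mulrnA ddl mul0rn.
by rewrite addr0 dl subr_eq0 => /eqP.
Qed.

End TorsionStructure.

(** * Number fields inside algC, automorphisms and traces *)

Lemma pchar_numfield (K : fieldExtType rat) : [pchar K] =i pred0.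
Proof. by move=> p; rewrite pchar_lalg; exact: (pchar_num rat). Qed.

Lemma primitive_element (K : fieldExtType rat) : exists t : K, forall x, exists p : {poly rat},
  x = (map_poly (in_alg K) p).[t].
Proof.
exists (separable_generator 1 {:K}) => x; apply/Fadjoin1_polyP.
rewrite -eq_adjoin_separable_generator ?memvf ?sub1v //.
by apply/separableP => y _; apply: pcharf0_separable; exact: pchar_numfield.
Qed.

Lemma map_in_alg (K : fieldExtType rat) (L : fieldType) (f : {rmorphism K -> L}) (p : {poly rat}) :
  map_poly f (map_poly (in_alg K) p) = map_poly ratr p.
Proof.
rewrite -map_poly_comp; apply: eq_map_poly => q /=.
by rewrite alg_num_field fmorph_rat.
Qed.

Lemma rmorph_fixP (K : fieldExtType rat) (iota : {rmorphism K -> algC}) (t : K)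
    (nu : {rmorphism algC -> algC}) : (forall x, exists p : {poly rat},
    x = (map_poly (in_alg K) p).[t]) -> nu (iota t) = iota t ->
  forall x, nu (iota x) = iota x.
Proof.
move=> tP nt x; have [p ->] := tP x.
rewrite -!horner_map /= nt map_in_alg -map_poly_comp; congr (_.[_]).
by apply: eq_map_poly => q /=; rewrite fmorph_rat.
Qed.

(** The Galois correspondence in a splitting field that contains [al] and the image of a generator
    of K, whose automorphisms extend to algC. *)
Lemma galois_descent (K : fieldExtType rat) (iota : {rmorphism K -> algC}) (al : algC) :
  (forall nu : {rmorphism algC -> algC}, (forall x, nu (iota x) = iota x) -> nu al = al) ->
  exists x, al = iota x.
Proof.
move=> fx; have [t tP] := primitive_element K.
have [r1 e1] := closed_field_poly_normal (minCpoly al).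
have [r2 e2] := closed_field_poly_normal (minCpoly (iota t)).
rewrite (monicP (minCpoly_monic _)) scale1r in e1.
rewrite (monicP (minCpoly_monic _)) scale1r in e2.
have [Qs [QsC [s1 s1E genQ]]] := num_field_exists (r1 ++ r2).
have [q1 [q1E _] _] := minCpolyP al; have [q2 [q2E _] _] := minCpolyP (iota t).
have ax : splitting_field_axiom Qs.
  exists (map_poly (in_alg Qs) (q1 * q2)); first by apply/polyOver1P; exists (q1 * q2).
  exists s1 => //; apply/eqpP; exists (1, 1); rewrite ?oner_eq0 // !scale1r.
  apply: (map_poly_inj QsC); rewrite map_in_alg rmorphM /= -q1E -q2E e1 e2 -big_cat -s1E.
  by rewrite big_map rmorph_prod; apply: eq_bigr => i _; rewrite /= map_polyXsubC.
pose S := FieldExt_isSplittingField.Build rat Qs ax.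
pose L : splittingFieldType rat := HB.pack (FieldExt.sort Qs) S.
have inS z : z \in r1 ++ r2 -> exists z1, z = QsC z1.
  by rewrite -s1E => /mapP[z1 _ ->]; exists z1.
have [al1 al1E] : exists z1, al = QsC z1.
  by apply: inS; rewrite mem_cat -root_prod_XsubC -e1 root_minCpoly.
have [t1 t1E] : exists z1, iota t = QsC z1.
  by apply: inS; rewrite mem_cat -[X in _ || X]root_prod_XsubC -e2 root_minCpoly orbT.
pose K' : {subfield L} := <<1; (t1 : L)>>%AS.
have gal : galois K' {:L}.
  apply/and3P; split; first exact: subvf.
    by apply/separableP => y _; apply: pcharf0_separable; exact: pchar_numfield.
  exact: normalFieldf.
have : (al1 : L) \in K'.
  rewrite -(galois_fixedField gal); apply/fixedFieldP; first exact: memvf. move=> g gG.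
  have gm : monoid_morphism (g : L -> L) by split; [exact: rmorph1 | exact: rmorphM].
  have ga : zmod_morphism (g : L -> L) by exact: raddfB. pose G1 := GRing.isZmodMorphism.Build Qs Qs g ga.
  pose G2 := GRing.isMonoidMorphism.Build Qs Qs g gm. pose phi : {rmorphism Qs -> Qs} := HB.pack (g : Qs -> Qs) G1 G2.
  have [nu nuE] := extend_algC_subfield_aut QsC phi. apply: (fmorph_inj QsC); rewrite -al1E -(fx nu) ?al1E ?nuE //.
  apply: (rmorph_fixP tP); rewrite t1E -nuE; congr (QsC _). by apply: (fixed_gal (subvf K') gG); exact: memv_adjoin.
move=> /Fadjoin1_polyP[p pE]; exists (map_poly (in_alg K) p).[t].
by rewrite al1E pE -!horner_map /= !map_in_alg t1E.
Qed.

Section Trace.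
Variables (K : fieldExtType rat) (iota : {rmorphism K -> algC}).
Local Notation n := (\dim {:K}).
Let vb : n.-tuple K := vbasis {:K}.

Definition mulmat (x : K) : 'M[rat]_n := \matrix_(i, j) coord vb j (x * vb`_i).

Lemma traceE x : trace x = \tr (mulmat x). Proof. by []. Qed.

Lemma mulmatD x y : mulmat (x + y) = mulmat x + mulmat y.
Proof. by apply/matrixP => i j; rewrite !mxE mulrDl linearD. Qed.

Lemma mulmatZ q x : mulmat (q *: x) = q *: mulmat x.
Proof. by apply/matrixP => i j; rewrite !mxE -scalerAl linearZ. Qed.

Lemma mulmat_coord x (i : 'I_n) : x * vb`_i = \sum_j mulmat x i j *: vb`_j.
Proof.
rewrite {1}(coord_vbasis (memvf (x * vb`_i))).
by apply: eq_bigr => j _; rewrite mxE.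
Qed.

Lemma mulmatM x y : mulmat (x * y) = mulmat y *m mulmat x.
Proof.
apply/matrixP => i j; rewrite mxE -mulrA mulmat_coord mulr_sumr linear_sum mxE.
by apply: eq_bigr => k _; rewrite -scalerAr linearZ /=; congr (_ * _); rewrite mxE.
Qed.

Lemma mulmat1 : mulmat 1 = 1%:M.
Proof.
apply/matrixP => i j; rewrite !mxE mul1r coord_free; first by rewrite eq_sym.
exact: basis_free (vbasisP _).
Qed.

Lemma trace_is_additive : zmod_morphism (@trace K).
Proof.
by move=> x y; rewrite !traceE -scaleN1r mulmatD mulmatZ scaleN1r raddfB.
Qed.
HB.instance Definition _ := GRing.isZmodMorphism.Build K rat (@trace K) trace_is_additive.

Lemma traceZ q (x : K) : trace (q *: x) = q * trace x.
Proof. by rewrite !traceE mulmatZ mxtraceZ. Qed.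

Lemma dim_gt0 : (0 < n)%N. Proof. exact: adim_gt0. Qed.

Lemma trace1 : trace (1 : K) = n%:R.
Proof. by rewrite traceE mulmat1 mxtrace1. Qed.

Lemma eigen_horner x (p : {poly rat}) (lam : algC) (v : 'rV[algC]_n) :
  v *m map_mx ratr (mulmat x) = lam *: v ->
  v *m map_mx ratr (mulmat (map_poly (in_alg K) p).[x]) = (map_poly ratr p).[lam] *: v.
Proof.
move=> e; elim/poly_ind: p => [|p c IH].
  rewrite !rmorph0 !horner0 scale0r -(scale0r (1 : K)) mulmatZ scale0r.
  by rewrite (_ : map_mx _ 0 = 0) ?mulmx0 //; apply/matrixP => i j; rewrite !mxE rmorph0.
rewrite !rmorphD !rmorphM /= !map_polyX !map_polyC /= !hornerD !hornerM !hornerX !hornerC.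
rewrite mulmatD mulmatM mulmatZ mulmat1 map_mxD map_mxM mulmxDr mulmxA e -scalemxAl IH.
rewrite scalerA scalerDl mulrC; congr (_ + _).
by rewrite map_mxZ map_mx1 -scalemxAr mulmx1.
Qed.

(** The list consists of the eigenvalues of multiplication by x. They satisfy every rational
    equation of x and so can replace its conjugates. *)
Lemma trace_roots (x : K) : exists r : seq algC, ratr (trace x) = \sum_(z <- r) z /\
  forall z, z \in r -> forall p : {poly rat}, (map_poly ratr p).[iota x] = 0 ->
    (map_poly ratr p).[z] = 0.
Proof.
set M := map_mx (ratr : rat -> algC) (mulmat x).
have [r] := closed_field_poly_normal (char_poly M).
rewrite (monicP (char_poly_monic _)) scale1r => rE; exists r; split.
  have sr : size r = n by have := size_char_poly M; rewrite rE size_prod_XsubC => -[].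
  have := @coefPn_prod_XsubC _ r; rewrite -rE sr -lt0n dim_gt0 char_poly_trace ?dim_gt0 //. move=> /(_ isT)/oppr_inj <-.
  by rewrite traceE /mxtrace rmorph_sum /=; apply: eq_bigr => i _; rewrite /M [in RHS]mxE.
move=> z zr p px; have : eigenvalue M z by rewrite eigenvalue_root_char rE root_prod_XsubC.
case/eigenvalueP => v /(eigen_horner p) + v0.
have -> : (map_poly (in_alg K) p).[x] = 0.
  by apply: (fmorph_inj iota); rewrite rmorph0 -horner_map /= map_in_alg.
rewrite -(scale0r (1 : K)) mulmatZ scale0r (_ : map_mx _ 0 = 0); last first.
  by apply/matrixP => i j; rewrite !mxE rmorph0.
rewrite mulmx0 => /esym/eqP; rewrite scaler_eq0 (negPf v0) orbF => /eqP //.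
Qed.

Lemma int_poly_Aint (x : algC) : x \in Aint -> exists p : {poly int},
  p \is monic /\ root (map_poly intr p) x.
Proof.
move=> xA; have /floorpP[p pE] := xA; exists p; rewrite -pE root_minCpoly; split=> //.
have := minCpoly_monic x; rewrite pE !monicE lead_coef_map_inj //; last exact: intr_inj.
by move=> /eqP e; apply/eqP/(@intr_inj algC); rewrite e.
Qed.

Lemma map_int_rat (p : {poly int}) : map_poly ratr (map_poly (intr : int -> rat) p) = map_poly intr p :> {poly algC}.
Proof. by rewrite -map_poly_comp; apply: eq_map_poly => z /=; rewrite ratr_int. Qed.

Lemma monic_int_Aint (p : {poly int}) (x : algC) : p \is monic -> root (map_poly intr p) x -> x \in Aint.
Proof.
move=> pm rx; apply: root_monic_Aint rx _ _; first exact: monic_map.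
by apply/polyOverP => i; rewrite coef_map /= rpred_int.
Qed.

Lemma integral_Aint x : integralOver (intr : int -> K) x -> iota x \in Aint.
Proof.
case=> p pm px; apply: (monic_int_Aint pm).
have -> : map_poly intr p = map_poly iota (map_poly intr p).
  by rewrite -map_poly_comp; apply: eq_map_poly => z /=; rewrite rmorph_int.
by rewrite fmorph_root.
Qed.

(** Membership in the radical of the ideal generated by l in the algebraic integers. *)
Definition lnil (l : nat) (x : algC) := x \in Aint /\ exists N, x ^+ N / l%:R \in Aint.

Lemma lnilD l x y : lnil l x -> lnil l y -> lnil l (x + y).
Proof.
case=> xA [N xN] [yA [M yM]]; split; first exact: rpredD.
exists (N + M)%N; rewrite exprDn mulr_suml rpred_sum // => i _.
rewrite mulrnAl rpredMn //.
have [h|h] := leqP M i.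
  rewrite -[X in y ^+ X](subnK h) exprD -!mulrA. by apply: rpredM; [exact: rpredX | apply: rpredM; [exact: rpredX | exact: yM]].
have h' : (N <= N + M - i)%N by lia.
rewrite -(subnK h') exprD mulrAC -mulrA mulrCA.
by rewrite -!mulrA; apply: rpredM; [exact: rpredX | apply: rpredM; [exact: rpredX | exact: xN]].
Qed.

(** The property of x passes to the eigenvalues and to their sum, and a rational integer in the
    radical of (l) is divisible by l. *)
Lemma trace_div l (x : K) e : prime l -> lnil l (iota x) -> iota x ^+ e / l%:R \in Aint ->
  exists c : int, trace x = (l%:Z * c)%:~R.
Proof.
move=> pl [xA _] xe; have [r [trE rP]] := trace_roots x.
have l0 : l%:R != 0 :> algC by rewrite pnatr_eq0 -lt0n prime_gt0.
have l0' : l%:R != 0 :> rat by rewrite pnatr_eq0 -lt0n prime_gt0.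
have good z : z \in r -> lnil l z.
  move=> zr; split.
    have [p [pm px]] := int_poly_Aint xA; apply: (monic_int_Aint pm).
    by rewrite /root -map_int_rat (rP z zr) // map_int_rat; apply/eqP.
  exists e; have [p [pm px]] := int_poly_Aint xe; apply: (monic_int_Aint pm).
  pose q : {poly rat} := map_poly intr p \Po (l%:R^-1 *: 'X^e).
  have qE w : (map_poly ratr q).[w] = (map_poly intr p).[w ^+ e / l%:R] :> algC.
    rewrite map_comp_poly map_int_rat horner_comp; congr (_.[_]).
    by rewrite map_polyZ map_polyXn hornerZ hornerXn mulrC fmorphV rmorph_nat.
  by rewrite /root -qE (rP z zr) // qE; apply/eqP.
have [tA [N tN]] : lnil l (ratr (trace x)).
  rewrite trE; elim: (r) good => [_|z r' IH good].
    by rewrite big_nil; split; [exact: rpred0 | exists 1%N; rewrite expr1 mul0r rpred0].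
  rewrite big_cons; apply: lnilD; first by apply: good; rewrite mem_head. by apply: IH => w wr; apply: good; rewrite in_cons wr orbT.
have tZ : (ratr (trace x) : algC) \in Num.int by apply: (Cint_rat_Aint _ tA); apply: Crat_rat.
have /intrP[t tE] := tZ.
have tNZ : (ratr (trace x) : algC) ^+ N / l%:R \in Num.int.
  apply: (Cint_rat_Aint _ tN); rewrite tE -rmorphXn /= -ratr_int -(ratr_nat _ l). by rewrite -fmorphV -rmorphM; apply: Crat_rat.
have [s sE] := intrP tNZ.
have : (t ^+ N = s * l%:Z)%R.
  apply: (@intr_inj algC); rewrite rmorphXn /= -tE rmorphM /= -sE mulfVK //.
move=> e1; have : (l %| `|t|)%N.
  have : (l %| `|t| ^ N)%N.
    by rewrite -abszX e1 abszM dvdn_mull.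
  by rewrite Euclid_dvdX // => /andP[].
case/dvdnP => k kE; exists (sgz t * k%:Z)%R.
apply: (fmorph_inj (ratr : {rmorphism rat -> algC})).
rewrite /= tE rmorph_int; congr (_%:~R); rewrite {1}[t]intEsg kE PoszM.
by ring.
Qed.

Lemma trace_int (x : K) : iota x \in Aint -> exists c : int, trace x = c%:~R.
Proof.
move=> xA; have [r [trE rP]] := trace_roots x.
have tA : ratr (trace x) \in Aint.
  rewrite trE big_seq rpred_sum // => z zr. have [p [pm px]] := int_poly_Aint xA; apply: (monic_int_Aint pm).
  by rewrite /root -map_int_rat (rP z zr) // map_int_rat; apply/eqP.
have /intrP[t tE] : (ratr (trace x) : algC) \in Num.int by apply: (Cint_rat_Aint _ tA); apply: Crat_rat.
by exists t; apply: (fmorph_inj (ratr : {rmorphism rat -> algC})); rewrite /= tE rmorph_int.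
Qed.

End Trace.

(** * Transitivity on the primitive roots of unity of order l^2 *)

Section CyclotomicOrbit.
Variables (l : nat) (pl : prime l).
Local Notation m := (l ^ 2)%N.

Let l0 : (0 < l)%N := prime_gt0 pl.

Lemma prim_root_sq (z : algC) : m.-primitive_root z <-> z ^+ m = 1 /\ z ^+ l != 1.
Proof.
split=> [pz|[zm zl]].
  rewrite (prim_expr_order pz); split=> //; rewrite -(prim_order_dvd pz). by apply/negP => /(dvdn_leq l0); have := prime_gt1 pl; nia.
have m0 : (0 < m)%N by rewrite expn_gt0 l0.
have [k kz /(dvdn_pfactor _ _ pl)[j jm kE]] := prim_order_exists m0 zm.
suff j2 : j = 2%N by rewrite kE j2 in kz.
apply/eqP; rewrite eqn_leq jm ltnNge; apply/negP => j1.
by move/negP: zl; apply; rewrite -(prim_order_dvd kz) kE -{2}(expn1 l) dvdn_exp2l.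
Qed.

(** The roots of the cyclotomic polynomial of order l^2, which is 1 + X^l + ... + X^(l(l-1)). *)
Definition prims : seq algC :=
  sval (closed_field_poly_normal (\sum_(i < l) 'X^(l * i) : {poly algC})).

Lemma primsE : \sum_(i < l) 'X^(l * i) = \prod_(z <- prims) ('X - z%:P) :> {poly algC}.
Proof.
rewrite /prims; case: closed_field_poly_normal => r /= {1}->.
suff -> : lead_coef (\sum_(i < l) 'X^(l * i) : {poly algC}) = 1 by rewrite scale1r.
have -> : (\sum_(i < l) 'X^(l * i) : {poly algC}) = 'X^(l * l.-1) + \sum_(i < l.-1) 'X^(l * i).
  by case: (l) l0 => // k _; rewrite big_ord_recr addrC.
rewrite lead_coefDl ?lead_coefXn // size_polyXn ltnS.
apply: (leq_trans (size_sum _ _ _)); apply/bigmax_leqP => i _.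
by rewrite size_polyXn; have := ltn_ord i; have := prime_gt1 pl; nia.
Qed.

Lemma prims_mul : ('X^l - 1) * \prod_(z <- prims) ('X - z%:P) = 'X^m - 1 :> {poly algC}.
Proof.
rewrite -primsE expnS expn1 exprM [RHS]subrX1; congr (_ * _).
by apply: eq_bigr => i _; rewrite exprM.
Qed.

Lemma prims_prod1 : \prod_(z <- prims) (1 - z) = l%:R.
Proof.
have := congr1 (horner^~ 1) primsE; rewrite horner_sum horner_prod.
have -> : \sum_(i < l) ('X^(l * i) : {poly algC}).[1] = l%:R.
  by rewrite -[in RHS](card_ord l) -sumr_const; apply: eq_bigr => i _; rewrite hornerXn expr1n.
by move=> ->; apply: eq_bigr => z _; rewrite hornerXsubC.
Qed.

Lemma prims_prim z : (z \in prims) = m.-primitive_root z.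
Proof.
have e1 : root ('X^m - 1) z = (z ^+ m == 1) by rewrite rootE !hornerE subr_eq0.
have e2 : root ('X^l - 1) z = (z ^+ l == 1) by rewrite rootE !hornerE subr_eq0.
have e3 := congr1 (fun p => root p z) prims_mul; rewrite /= rootM e1 e2 root_prod_XsubC in e3.
apply/idP/idP => [zp|/prim_root_sq[zm zl]]; last by move: e3; rewrite zm eqxx (negPf zl).
apply/prim_root_sq; split; first by apply/eqP; rewrite -e3 zp orbT.
apply/eqP => zl; move: zp; rewrite -root_prod_XsubC -primsE rootE horner_sum.
under eq_bigr do rewrite hornerXn exprM zl expr1n.
by rewrite sumr_const card_ord pnatr_eq0 -leqn0 leqNgt l0.
Qed.

Lemma prims_uniq : uniq prims.
Proof.
have m0 : (0 < m)%N by rewrite expn_gt0 l0.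
have [z pz] := C_prim_root_exists m0.
have := factor_Xn_sub_1 pz; rewrite -prims_mul big_mkord => e.
have d : \prod_(z <- prims) ('X - z%:P) %| \prod_(z <- [seq z ^+ i | i <- iota 0 m]) ('X - z%:P).
  rewrite big_map; move: e; rewrite -(big_mkord xpredT (fun i => 'X - (z ^+ i)%:P)).
  by rewrite /index_iota subn0 => ->; apply: dvdp_mull.
have [k] := dvdp_prod_XsubC d; rewrite eqp_monic ?monic_prod_XsubC // => /eqP e'.
have pe : perm_eq prims (mask k [seq z ^+ i | i <- iota 0 m]).
  exact: prod_XsubC_eq.
rewrite (perm_uniq pe) mask_uniq // map_inj_in_uniq ?iota_uniq // => i j.
rewrite !mem_iota !add0n /= => im jm /eqP; rewrite (eq_prim_root_expr pz) !modn_small // => /eqP.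
by [].
Qed.

Lemma prim_Aint_div z w : m.-primitive_root z -> m.-primitive_root w -> (1 - z) / (1 - w) \in Aint.
Proof.
move=> pz pw; have [i ->] := prim_rootP pw (prim_expr_order pz).
have w1 : 1 - w != 0.
  rewrite subr_eq0 eq_sym; apply/eqP => e; have [_] := (prim_root_sq w).1 pw. by rewrite e expr1n eqxx.
have -> : (1 - w ^+ i) / (1 - w) = \sum_(j < i) w ^+ j.
  by rewrite -opprB subrX1 -mulNr opprB mulrAC mulfV // mul1r.
by rewrite rpred_sum // => j _; rewrite rpredX // (Aint_prim_root pw).
Qed.

Variables (K : fieldExtType rat) (iota : {rmorphism K -> algC}).
Local Notation n := (\dim {:K}).
Variables (b : n.-tuple K) (d : int).
Hypotheses (b_basis : basis_of {:K} b)
  (b_int : forall i : 'I_n, iota b`_i \in Aint)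
  (b_det : \det (\matrix_(i < n, j < n) trace (b`_i * b`_j)) = d%:~R)
  (ld : ~~ (l %| `|d|)%N).

(** x lies in l times the dual lattice of b, and by Cramer's rule the Gram determinant d carries the
    dual lattice into the span of b. *)
Lemma dual_div (x : K) : (forall j : 'I_n, exists c : int, trace (x * b`_j) = (l%:Z * c)%:~R) ->
  d%:~R * iota x / l%:R \in Aint.
Proof.
move=> tr_x; pose G := \matrix_(i < n, j < n) trace (b`_i * b`_j).
have [Gz GzE] : exists Gz : 'M[int]_n, G = map_mx intr Gz.
  have h (i j : 'I_n) : exists c : int, trace (b`_i * b`_j) = c%:~R.
    by apply: (trace_int (iota := iota)); rewrite rmorphM rpredM.
  exists (\matrix_(i, j) sval (cid (h i j))); apply/matrixP => i j; rewrite !mxE. by case: cid.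
pose a := \row_i coord b i x; pose w := \row_j sval (cid (tr_x j)).
have aG : a *m G = l%:R *: map_mx intr w.
  apply/rowP => j; rewrite !mxE; case: cid => c /= e. rewrite (_ : l%:R * _ = (l%:Z * c)%:~R); last by rewrite intrM. rewrite -e.
  rewrite {1}(coord_basis b_basis (memvf x)) mulr_suml raddf_sum /=. by apply: eq_bigr => i _; rewrite !mxE -scalerAl traceZ.
have da : d%:~R *: a = l%:R *: map_mx intr (w *m \adj Gz).
  rewrite -b_det -/G -mul_mx_scalar -mul_mx_adj mulmxA aG -scalemxAl GzE. by rewrite map_mxM map_mx_adj.
have l0' : l%:R != 0 :> algC by rewrite pnatr_eq0 -lt0n.
have -> : d%:~R * iota x / l%:R = \sum_(i < n) ((w *m \adj Gz) 0 i)%:~R * iota b`_i.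
  apply: (mulIf l0'); rewrite divfK // mulr_suml. rewrite {1}(coord_basis b_basis (memvf x)) rmorph_sum mulr_sumr.
  apply: eq_bigr => i _; rewrite rmorphZ_num mulrA [in RHS]mulrAC; congr (_ * _).
  have := congr1 (fun M : 'rV[rat]_n => ratr (M 0 i) : algC) da.
  by rewrite !mxE !rmorphM /= rmorph_int rmorph_nat => ->; rewrite mulrC rmorph_int.
by rewrite rpred_sum // => i _; rewrite rpredM // Aint_int.
Qed.

(** A total ramification argument. Let r be the size of the orbit O of z, and suppose it is less
    than the number ph of primitive roots. The product al of 1 - u over O lies in K, and al^ph is
    l^r up to a unit. All traces tr(x b_j) are divisible by l, where al = iota x, so d al / l is
    integral; its ph-th power is d^ph l^(r - ph) up to a unit, whence l divides d. *)
Lemma cyclotomic_orbit (z w : algC) : m.-primitive_root z -> m.-primitive_root w ->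
  exists nu : {rmorphism algC -> algC}, (forall x, nu (iota x) = iota x) /\ nu z = w.
Proof.
move=> pz pw; apply: contrapT => nw.
pose inO u := `[< exists nu : {rmorphism algC -> algC}, (forall x, nu (iota x) = iota x) /\ nu z = u >].
pose O := [seq u <- prims | inO u].
have uO : uniq O by rewrite filter_uniq ?prims_uniq.
have lt : (size O < size prims)%N.
  rewrite size_filter -(count_predC inO prims) -[X in (X < _)%N]addn0 ltn_add2l.
  rewrite -has_count; apply/hasP; exists w; rewrite ?prims_prim //. by apply/negP => /asboolP.
have gt : (0 < size O)%N.
  rewrite size_filter -has_count; apply/hasP; exists z; rewrite ?prims_prim //. by apply/asboolP; exists idfun.
pose al := \prod_(u <- O) (1 - u).
have [x xE] : exists x, al = iota x.
  apply: galois_descent => nu nuK; rewrite rmorph_prod.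
  under eq_bigr do rewrite rmorphB rmorph1.
  rewrite -(big_map nu xpredT (fun u => 1 - u)); apply: perm_big.
  apply: uniq_perm => //; first by rewrite map_inj_uniq //; exact: fmorph_inj. have sub : {subset map nu O <= O}.
    move=> _ /mapP[u + ->]; rewrite !mem_filter !prims_prim fmorph_primitive_root => /andP[/asboolP[mu [muK muz]] ->].
    rewrite andbT; apply/asboolP; exists (nu \o mu); split=> [y|] /=; first by rewrite muK nuK. by rewrite muz.
  have um : uniq (map nu O) by rewrite map_inj_uniq //; exact: fmorph_inj.
  by have [|_ e] := uniq_min_size um sub; first by rewrite size_map.
have Oprim u : u \in O -> m.-primitive_root u by rewrite mem_filter prims_prim => /andP[].
pose ph := size prims; pose r := size O.
have l0' : l%:R != 0 :> algC by rewrite pnatr_eq0 -lt0n.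
have al0 : al != 0.
  rewrite prodf_seq_neq0; apply/allP => u /Oprim/prim_root_sq[_ u1]; rewrite subr_eq0 eq_sym.
  by apply: contra u1 => /eqP->; rewrite expr1n.
have alE : al ^+ ph = \prod_(u <- O) \prod_(v <- prims) (1 - u).
  rewrite /al -prodrXl; apply: eq_bigr => u _; rewrite big_const_seq count_predT iter_mulr_1 //.
have lE : l%:R ^+ r = \prod_(u <- O) \prod_(v <- prims) (1 - v).
  by rewrite prims_prod1 big_const_seq count_predT iter_mulr_1.
have A1 : al ^+ ph / l%:R ^+ r \in Aint.
  rewrite alE lE -prodf_div big_seq rpred_prod // => u uO'. rewrite -prodf_div big_seq rpred_prod // => v vP.
  by apply: prim_Aint_div; [exact: Oprim | rewrite -prims_prim].
have A2 : l%:R ^+ r / al ^+ ph \in Aint.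
  rewrite alE lE -prodf_div big_seq rpred_prod // => u uO'. rewrite -prodf_div big_seq rpred_prod // => v vP.
  by apply: prim_Aint_div; [rewrite -prims_prim | exact: Oprim].
have alA : al \in Aint.
  rewrite /al big_seq rpred_prod // => u /Oprim pu; rewrite rpredB ?rpred1 //; exact: Aint_prim_root pu.
have alph : al ^+ ph / l%:R \in Aint.
  have -> : al ^+ ph / l%:R = al ^+ ph / l%:R ^+ r * l%:R ^+ r.-1.
    have -> : l%:R ^+ r = l%:R * l%:R ^+ r.-1 :> algC by rewrite -exprS prednK. by field; rewrite l0' expf_neq0.
  by rewrite rpredM // rpredX // rpred_nat.
have : d%:~R * iota x / l%:R \in Aint.
  apply: dual_div => j; apply: (trace_div (iota := iota) (e := ph)) => //; rewrite rmorphM -xE.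
    split; first by rewrite rpredM. by exists ph; rewrite exprMn mulrAC rpredM // rpredX.
  by rewrite exprMn mulrAC rpredM // rpredX.
rewrite -xE => A3; have A4 : (d%:~R : algC) ^+ ph / l%:R \in Aint.
  have -> : (d%:~R : algC) ^+ ph / l%:R =
    (d%:~R * al / l%:R) ^+ ph * (l%:R ^+ r / al ^+ ph) * l%:R ^+ (ph - r).-1.
    have e : (ph = r + (ph - r).-1.+1)%N by rewrite prednK ?subn_gt0 // subnKC // ltnW.
    rewrite !exprMn exprVn; rewrite [X in _ / _ ^+ X]e exprD exprS. by field; rewrite l0' !expf_neq0.
  by apply: rpredM; [apply: rpredM; [exact: rpredX | exact: A2] | apply: rpredX; exact: rpred_nat].
have /intrP[t tE] : (d%:~R ^+ ph / l%:R : algC) \in Num.int.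
  by apply: (Cint_rat_Aint _ A4); rewrite rpred_div ?rpredX ?rpred_int ?rpred_nat.
have e1 : (d ^+ ph = t * l%:Z)%R.
  by apply: (@intr_inj algC); rewrite rmorphXn rmorphM /= -tE mulfVK.
have : (l %| `|d| ^ ph)%N by rewrite -abszX e1 abszM dvdn_mull.
by rewrite Euclid_dvdX // (negPf ld).
Qed.

End CyclotomicOrbit.

(** Every x returns after at most [size s] steps, and its return time divides the factorial. *)
Lemma iter_fact_fix (T : eqType) (s : seq T) (f : T -> T) : injective f ->
  (forall x, x \in s -> f x \in s) -> forall x, x \in s -> iter (size s)`! f x = x.
Proof.
move=> injf fs x xs.
have itS i : iter i f x \in s by elim: i => //= i; exact: fs.
have : ~~ uniq (traject f x (size s).+1).
  apply/negP => u; have := uniq_leq_size u (s2 := s); rewrite size_traject ltnn => h.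
  by suff : false by []; apply: h => y /trajectP[i _ ->].
rewrite looping_uniq negbK => /trajectP[i il e].
have {}e : iter (size s - i) f x = x.
  have inji k : injective (iter k f) by elim: k => //= k IH y z /injf/IH. by apply: (inji i); rewrite -iterD subnKC // ltnW.
have /dvdnP[q ->] : (size s - i %| (size s)`!)%N.
  by apply: dvdn_fact; rewrite subn_gt0 il leq_subr.
by rewrite iterM; elim: q => //= q ->.
Qed.

Lemma iter_rmorph (R : nzRingType) (s : {rmorphism R -> R}) n :
  exists t : {rmorphism R -> R}, t =1 iter n s.
Proof.
elim: n => [|n [t tE]]; first by exists idfun.
by exists (s \o t) => x /=; rewrite tE.
Qed.

Lemma iter_additive (V : zmodType) (s : {additive V -> V}) n :
  exists t : {additive V -> V}, t =1 iter n s.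
Proof.
elim: n => [|n [t tE]]; first by exists idfun.
by exists (s \o t) => x /=; rewrite tE.
Qed.

Lemma pmapB (F L : fieldType) (f : {rmorphism F -> L}) (E : scurve F) (E' : scurve L)
  (fa : sa E' = f (sa E)) (fb : sb E' = f (sb E)) : zmod_morphism (pmap fa fb).
Proof. by move=> P Q; rewrite pmapD pmapN. Qed.
HB.instance Definition _ (F L : fieldType) (f : {rmorphism F -> L}) (E : scurve F) (E' : scurve L)
  (fa : sa E' = f (sa E)) (fb : sb E' = f (sb E)) :=
  GRing.isZmodMorphism.Build (spoint E) (spoint E') (pmap fa fb) (pmapB fa fb).

(** Taking l-th powers raises the last level on which g is trivial by exactly one: at least one by
    [level_up], at most one by [level_strict]. *)
Lemma level_climb (E : scurve algC) (g : {additive spoint E -> spoint E}) l j i :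
  prime l -> (0 < j)%N -> odd l || (1 < j)%N ->
  (forall P : spoint E, P *+ l ^ j = 0 -> g P = P) ->
  ~ (forall P : spoint E, P *+ l ^ j.+1 = 0 -> g P = P) ->
  (forall P : spoint E, P *+ l ^ (j + i) = 0 -> iter (l ^ i) g P = P) /\
  ~ (forall P : spoint E, P *+ l ^ (j + i).+1 = 0 -> iter (l ^ i) g P = P).
Proof.
move=> pl j0 lj fx nfx; elim: i => [|i [fi nfi]]; first by rewrite addn0 expn0.
have [h hE] := iter_additive g (l ^ i).
have it P : iter (l ^ i.+1) g P = iter l h P.
  by rewrite expnS iterM; apply: eq_iter => Q; rewrite hE.
have ji : (0 < j + i)%N by rewrite addn_gt0 j0.
have lji : odd l || (1 < j + i)%N by case/orP: lj => [->|/leq_trans-> //]; rewrite ?leq_addr ?orbT.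
have hfx P : P *+ l ^ (j + i) = 0 -> h P = P by rewrite hE; exact: fi.
rewrite addnS; split=> [P nP|all]; first by rewrite it (level_up (prime_gt0 pl) ji hfx).
apply: nfi => P nP; rewrite -hE.
by apply: (level_strict pl ji lji hfx) nP => Q nQ; rewrite -it; exact: all.
Qed.

(** * Action on E[l] with a determinant that is not a square *)

Section NonSquareMatrix.
Variables (l : nat) (pl : prime l) (ol : odd l).
Local Notation F := 'F_l.

Lemma sum_ord2 (V : nmodType) (f : 'I_2 -> V) : \sum_i f i = f 0 + f 1.
Proof.
rewrite !big_ord_recl big_ord0 addr0; congr (_ + f _); exact: val_inj.
Qed.

Lemma mx2P (A B : 'M[F]_2) : A 0 0 = B 0 0 -> A 0 1 = B 0 1 -> A 1 0 = B 1 0 ->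
  A 1 1 = B 1 1 -> A = B.
Proof.
move=> e1 e2 e3 e4; apply/matrixP => i j.
have o2 (k : 'I_2) : k = 0 \/ k = 1.
  by case: k => [[|[|k]] hk] //; [left | right]; apply: val_inj.
by case: (o2 i) (o2 j) => -> [->|->].
Qed.

Lemma Fl_expl (x : F) : x ^+ l = x.
Proof. by rewrite -{2}(expf_card x) card_Fp. Qed.

(* the discriminant t^2 - 4d is not zero, so (2M - t)^(l^2) = 2M - t, and Frobenius
   turns this into M^(l^2) = M *)
Lemma nonsquare_det_order (M : 'M[F]_2) (d : F) : M 0 0 * M 1 1 - M 0 1 * M 1 0 = d ->
  (forall x : F, x ^+ 2 != d) -> M ^+ (l ^ 2).-1 = 1.
Proof.
move=> detM nsq; have l0 := prime_gt0 pl.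
pose t : F := M 0 0 + M 1 1; pose D : 'M[F]_2 := 2 *: M - t%:M.
pose e : F := t ^+ 2 - 4 * d.
have ch : l \in [pchar F] := pchar_Fp pl.
have ch' : l \in [pchar 'M[F]_2] by rewrite pchar_lalg.
have two0 : 2 != 0 :> F.
  rewrite -(dvdn_pcharf ch); apply/negP => /dvdn_leq; have := odd_prime_gt2 ol pl; lia.
have d0 : d != 0 by have := nsq 0; rewrite expr0n eq_sym.
have e0 : e != 0.
  apply/eqP => e0; case/eqP: (nsq (t / 2)); move/eqP: e0; rewrite subr_eq0 => /eqP. have -> : 4 = 2 ^+ 2 :> F by rewrite -natrX.
  by rewrite expr_div_n => ->; rewrite mulrAC divff ?mul1r // expf_neq0.
have sc (x : F) : (x%:M : 'M[F]_2) ^+ l = x%:M by rewrite -rmorphXn /= Fl_expl.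
have CH : (t%:M - M) * M = d%:M.
  by apply: mx2P; rewrite -detM !mxE sum_ord2 !mxE /= /t; ring.
have D2 : D ^+ 2 = e%:M.
  by apply: mx2P; rewrite expr2 /e -detM /D !mxE sum_ord2 !mxE /= /t; ring.
have frob (N : 'M[F]_2) : (2 *: N - t%:M) ^+ l = 2 *: N ^+ l - t%:M.
  have cm : GRing.comm (2 *: N) (t%:M : 'M[F]_2).
    exact: scalar_mxC.
  have := pFrobenius_autB_comm ch' cm; rewrite !pFrobenius_autE => ->. by rewrite exprZn Fl_expl sc.
have Dl : D ^+ (l ^ 2) = 2 *: M ^+ (l ^ 2) - t%:M.
  by rewrite expnS expn1 !exprM !frob.
(* D^2 is the scalar e, so D^(l^2) is D times the power (l^2 - 1)/2 of e, and this exponent is a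
   multiple of l - 1. *)
have Dl' : D ^+ (l ^ 2) = D.
  have el : e ^+ l.-1 = 1.
    by apply: (mulfI e0); rewrite -exprS prednK // Fl_expl mulr1.
  have -> : (l ^ 2 = (2 * (l.-1 * (l./2).+1)).+1)%N.
    have := odd_double_half l; rewrite ol; clear; move: (l./2) => h; rewrite -mul2n /=; nia.
  by rewrite exprS exprM D2 -rmorphXn exprM el expr1n rmorph1 mulr1.
have Ml : M ^+ (l ^ 2) = M.
  have := Dl; rewrite Dl' => /addIr/(congr1 (fun A => 2^-1 *: A)). by rewrite !scalerA mulVf // !scale1r.
pose N := d^-1 *: (t%:M - M).
have NM : N * M = 1 by rewrite -scalerAl CH scale_scalar_mx mulVf.
rewrite -[LHS]mul1r -NM -mulrA -exprS prednK ?expn_gt0 ?l0 // Ml //.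
Qed.

Lemma nonsquare_exists : exists d : F, forall x : F, x ^+ 2 != d.
Proof.
apply: contrapT => h.
have sur d : exists x : F, x ^+ 2 = d.
  by apply: contrapT => h'; apply: h; exists d => x; apply/eqP => e; apply: h'; exists x.
have cd : #|image (fun x : F => x ^+ 2) predT| = #|F|.
  by apply: eq_card => d; have [x xd] := sur d; rewrite [RHS]inE; apply/imageP; exists x.
have /image_injP inj : #|image (fun x : F => x ^+ 2) predT| == #|F| by rewrite cd.
have two0 : 2 != 0 :> F.
  rewrite -(dvdn_pcharf (pchar_Fp pl)); apply/negP => /dvdn_leq; have := odd_prime_gt2 ol pl; lia.
have := inj 1 (-1) isT isT; rewrite sqrrN => /(_ erefl)/eqP.
by rewrite -addr_eq0 -[1 + 1]/(2%:R) (negPf two0).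
Qed.

End NonSquareMatrix.

Section NonSquare.
Variables (E : scurve algC) (s : {rmorphism algC -> algC}).
Hypotheses (sfa : sa E = s (sa E)) (sfb : sb E = s (sb E)).
Local Notation sp := (pmap sfa sfb).
Variables (l d : nat) (pl : prime l) (ol : odd l).
Hypothesis sd : forall z : algC, z ^+ l = 1 -> s z = z ^+ d.
Hypothesis nsq : forall x : 'F_l, x ^+ 2 != d%:R.

(** By equivariance of the pairing, the matrix of s on E[l] has determinant d, the exponent with
    which s acts on the l-th roots of unity. *)
Lemma nonsquare_torsion P : P *+ l = 0 -> iter (l ^ 2).-1 sp P = P.
Proof.
have l0 := prime_gt0 pl; have l2 := odd_prime_gt2 ol pl.
have [S [T]] := torsion_basis E pl (ltn0Sn 0); rewrite expn1 => -[nS nT indep gen] nP.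
pose z := weil l S T.
have zl : z ^+ l = 1 by apply: weil_unity.
have z1 : z != 1.
  have := @weil_basis E l 1 S T l pl; rewrite expn1 divnn l0 expr1; exact.
have pz : l.-primitive_root z.
  have [k kz] := prim_order_exists l0 zl; rewrite -(expn1 l) => /(dvdn_pfactor _ _ pl)[j j1 kE].
  move: kz; rewrite kE; case: j j1 {kE} => [|[|//]] _; last by rewrite expn1.
  by rewrite expn0 => /prim_expr_order; rewrite expr1 => /eqP; rewrite (negPf z1).
have [a [c eS]] : exists a c, sp S = S *+ a + T *+ c.
  by apply: gen; rewrite -pmapMn nS pmap0.
have [a' [c' eT]] : exists a c, sp T = S *+ a + T *+ c.
  by apply: gen; rewrite -pmapMn nT pmap0.
pose M : 'M['F_l]_2 := \matrix_(i, j) (if i == 0 then (if j == 0 then a else c) else (if j == 0 then a' else c'))%:R.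
have detM : M 0 0 * M 1 1 - M 0 1 * M 1 0 = d%:R.
  rewrite !mxE /= -!natrM; apply/eqP; rewrite subr_eq -natrD -(Fp_nat_mod pl (a * c')) -(Fp_nat_mod pl (d + c * a')).
  suff /eqP -> : (a * c' == d + c * a' %[mod l])%N by []. rewrite -(eq_prim_root_expr pz); apply/eqP.
  have := weil_map sfa sfb l0 nS nT; rewrite -/z sd // eS eT. have nSa i : S *+ i *+ l = 0 by exact: tors_muln.
  have nTa i : T *+ i *+ l = 0 by exact: tors_muln. have nD i j : (S *+ i + T *+ j) *+ l = 0 by apply: tors_add.
  pose X := S *+ a + T *+ c; rewrite -/X; have nX : X *+ l = 0 by exact: nD.
  have wSX : weil l S X = z ^+ c by rewrite weil_add // !weil_mulr // weilrr // expr1n mul1r.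
  have wXS : weil l X S * z ^+ c = 1 by rewrite -wSX weilC. have wTS : weil l T S * z = 1 by rewrite weilC.
  have wTX : weil l T X = weil l T S ^+ a by rewrite weil_add // !weil_mulr // weilrr // expr1n mulr1. have wXT : weil l X T = z ^+ a.
    have z0 : weil l T S ^+ a != 0 by rewrite expf_neq0 // weil_neq0.
    by apply: (mulIf z0); rewrite -{1}wTX weilC // -exprMn mulrC wTS expr1n.
  rewrite weil_add // !weil_mulr // wXT exprD => <-.
  have e1 : weil l X S ^+ a' * z ^+ (c * a') = 1 by rewrite exprM -exprMn wXS expr1n. by rewrite -exprM mulrAC e1 mul1r.
have Mord := nonsquare_det_order pl ol detM nsq.
have F_nat (Q : spoint E) (x : 'F_l) (i : nat) : Q *+ l = 0 -> x = i%:R -> Q *+ x = Q *+ i.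
  by move=> nQ ->; rewrite val_Fp_nat // mulrn_mod.
pose ev (v : 'rV['F_l]_2) := S *+ v 0 0 + T *+ v 0 1.
have ev_sp v : sp (ev v) = ev (v *m M).
  pose x := v 0 0; pose y := v 0 1; rewrite /ev pmapD !pmapMn eS eT -/x -/y. rewrite (F_nat S _ (x * a + y * a')%N) //; last first.
    by rewrite mxE sum_ord2 !mxE /= natrD !natrM !natr_Zp.
  rewrite (F_nat T _ (x * c + y * c')%N) //; last first.
    by rewrite mxE sum_ord2 !mxE /= natrD !natrM !natr_Zp.
  rewrite !mulrnDl !mulrnDr -!mulrnA ![(x * _)%N]mulnC ![(y * _)%N]mulnC addrACA. by [].
have ev_it i v : iter i sp (ev v) = ev (v *m M ^+ i).
  elim: i => [|i IH]; first by rewrite expr0 mulmx1. by rewrite iterS IH ev_sp -mulmxA exprSr.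
have [i [j ->]] := gen P nP.
have -> : S *+ i + T *+ j = ev (\row_k (if k == 0 then i else j)%:R).
  by rewrite /ev (F_nat S _ i) ?(F_nat T _ j) // mxE.
by rewrite ev_it Mord mulmx1.
Qed.

End NonSquare.

(** Phrased by coordinates, so that it applies to a bare function s without a proof that s fixes the
    coefficients of E. *)
Definition galois_fixes (s : algC -> algC) (E : scurve algC) N :=
  forall P : spoint E, P *+ N = 0 -> omap (fun q => (s q.1, s q.2)) (val P) = val P.

Lemma galois_fixesP (s : {rmorphism algC -> algC}) (E : scurve algC) N
    (sfa : sa E = s (sa E)) (sfb : sb E = s (sb E)) :
  galois_fixes s E N <-> (forall P : spoint E, P *+ N = 0 -> pmap sfa sfb P = P).
Proof.
split=> h P nP; first by apply: val_inj; rewrite val_pmap h.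
by rewrite -[LHS](val_pmap sfa sfb) h.
Qed.

Lemma pmap_iter (s t : {rmorphism algC -> algC}) (E : scurve algC) n
    (sfa : sa E = s (sa E)) (sfb : sb E = s (sb E))
    (tfa : sa E = t (sa E)) (tfb : sb E = t (sb E)) :
  t =1 iter n s -> pmap tfa tfb =1 iter n (pmap sfa sfb).
Proof.
move=> tE P; apply: val_inj; rewrite val_pmap.
suff -> : val (iter n (pmap sfa sfb) P) = omap (fun q => (iter n s q.1, iter n s q.2)) (val P).
  by case: (val P) => [[x y]|] //=; rewrite !tE.
elim: n {tE} => [|n IH]; first by case: (val P) => [[x y]|].
by rewrite iterS val_pmap IH; case: (val P) => [[x y]|].
Qed.

Lemma iter_exp (s : {rmorphism algC -> algC}) n (z : algC) d i :
  (forall z, z ^+ n = 1 -> s z = z ^+ d) -> z ^+ n = 1 -> iter i s z = z ^+ (d ^ i)%N.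
Proof.
move=> sd zn; elim: i => [|i IH] /=; first by rewrite expn0 expr1.
by rewrite IH rmorphXn /= sd // -exprM expnS.
Qed.

Lemma iter_fix (T : Type) (s : T -> T) x n : s x = x -> iter n s x = x.
Proof. by move=> e; elim: n => //= n ->. Qed.

(** * Automorphisms that are trivial on E[l^k] but not on E[l^(k+1)] *)

Section Witness.
Variables (K : fieldExtType rat) (iota : {rmorphism K -> algC}).

Definition fixK (s : algC -> algC) := forall x, s (iota x) = iota x.

Lemma expn_shift d0 l N : exists q, ((d0 + l) ^ N = d0 ^ N + N * l * d0 ^ N.-1 + q * l ^ 2)%N.
Proof.
elim: N => [|N [q e]]; first by exists 0%N.
rewrite expnS e; case: N e => [|N] _; first by exists (q * (d0 + l))%N; rewrite !expn0 expn1 /=; ring.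
exists (N.+1 * d0 ^ N + q * (d0 + l))%N; rewrite /= !expnS; ring.
Qed.

(** If a nonsquare d0 satisfies d0^N = 1 modulo l^2 for N = l^2 - 1, then d0 + l is used instead:
    its N-th power is 1 + N l d0^(N-1) modulo l^2, and l divides neither N nor d0. *)
Lemma good_exponent l : prime l -> odd l -> exists d : nat,
  [/\ coprime d l, forall x : 'F_l, x ^+ 2 != d%:R & ~~ (d ^ (l ^ 2).-1 == 1 %[mod l ^ 2])%N].
Proof.
move=> pl ol; have [d0 nsq] := nonsquare_exists pl ol; have l0 := prime_gt0 pl.
have nsq0 : forall x : 'F_l, x ^+ 2 != (d0 : nat)%:R by move=> x; rewrite natr_Zp.
have nsq1 : forall x : 'F_l, x ^+ 2 != (d0 + l)%:R.
  by move=> x; rewrite natrD pchar_Fp_0 // addr0.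
have cop d : (forall x : 'F_l, x ^+ 2 != d%:R) -> coprime d l.
  move=> h; rewrite coprime_sym prime_coprime // (dvdn_pcharf (pchar_Fp pl)). by have := h 0; rewrite expr0n eq_sym.
have [e0|] := boolP (d0 ^ (l ^ 2).-1 == 1 %[mod l ^ 2])%N; last first.
  by exists d0; split=> //; apply: cop.
exists (d0 + l)%N; split=> //; first exact: cop.
have [q ->] := expn_shift d0 l (l ^ 2).-1.
rewrite addnC modnMDl -modnDml (eqP e0) modnDml -[X in (_ == X %[mod _])%N]addn0 eqn_modDl mod0n.
rewrite -/(dvdn _ _) -mulnA mulnCA expnS expn1 dvdn_pmul2l // Euclid_dvdM // negb_or.
have -> : ~~ (l %| (l * l).-1)%N.
  apply/negP => h; have := prime_gt1 pl; rewrite ltnNge => /negP; apply.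
  apply: dvdn_leq => //; have : (l %| (l * l).-1.+1)%N by rewrite prednK ?muln_gt0 ?l0 // dvdn_mull. by rewrite -addn1 dvdn_addr.
apply/negP => h; have := cop _ nsq0; rewrite coprime_sym prime_coprime // => /negP; apply.
by move: h; apply: contraTT => nd; rewrite Euclid_dvdX // (negPf nd).
Qed.

(** s raises roots of unity of order l^2 to the power e of [good_exponent]. Its power l^2 - 1 is
    trivial on E[l] but moves a root of unity of order l^2, so it is not trivial on E[l^2];
    [level_climb] leads from level 1 to level k. *)
Lemma good_witness (b : (\dim {:K}).-tuple K) (d : int) l k (E : scurve algC) u v :
  basis_of {:K} b -> (forall i : 'I_(\dim {:K}), iota b`_i \in Aint) ->
  \det (\matrix_(i < \dim {:K}, j < \dim {:K}) trace (b`_i * b`_j)) = d%:~R ->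
  prime l -> odd l -> ~~ (l %| `|d|)%N -> (0 < k)%N ->
  sa E = iota u -> sb E = iota v ->
  exists s : {rmorphism algC -> algC}, [/\ fixK s, galois_fixes s E (l ^ k) & ~ galois_fixes s E (l ^ k.+1)].
Proof.
move=> bb bi bd pl ol ld k0 Ea Eb; have l0 := prime_gt0 pl.
have m0 : (0 < l ^ 2)%N by rewrite expn_gt0 l0.
have [e [ce nsq ne]] := good_exponent pl ol.
have [z pz] := C_prim_root_exists m0.
have pze : (l ^ 2).-primitive_root (z ^+ e).
  by rewrite prim_root_exp_coprime // coprimeXr.
have [s [sK sz]] := cyclotomic_orbit pl bb bi bd ld pz pze.
have sd w : w ^+ (l ^ 2)%N = 1 -> s w = w ^+ e.
  by move=> /(prim_rootP pz)[i ->]; rewrite rmorphXn /= sz exprAC.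
have sd' w : w ^+ l = 1 -> s w = w ^+ e.
  by move=> wl; apply: sd; rewrite expnS expn1 exprM wl expr1n.
have sfa : sa E = s (sa E) by rewrite Ea sK.
have sfb : sb E = s (sb E) by rewrite Eb sK.
pose N := (l ^ 2).-1.
have [g gE] := iter_additive (pmap sfa sfb) N.
have g1 P : P *+ l ^ 1 = 0 -> g P = P.
  by rewrite expn1 gE => nP; apply: nonsquare_torsion nP => //; exact: sd'.
have [t tE] := iter_rmorph s N.
have tfix : fixK t by move=> x; rewrite tE; apply: iter_fix.
have tfa : sa E = t (sa E) by rewrite Ea tfix.
have tfb : sb E = t (sb E) by rewrite Eb tfix.
have tg : pmap tfa tfb =1 g by move=> P; rewrite gE; apply: pmap_iter.
have g2 : ~ (forall P, P *+ l ^ 2 = 0 -> g P = P).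
  move=> all; move/negP: ne; apply. have tz : t z = z.
    apply: (@fix_roots E t tfa tfb l 2) => //; first by move=> P nP; rewrite tg all.
    have -> : (l == 2%N) = false by apply/negbTE/eqP => l2; move: ol; rewrite l2. by rewrite subn0 (prim_expr_order pz).
  have := tE z; rewrite tz (iter_exp _ sd (prim_expr_order pz)) => /esym/eqP. by rewrite -[X in _ == X]expr1 (eq_prim_root_expr pz).
have [] := @level_climb E g l 1 k.-1 pl isT _ g1 g2; first by rewrite ol.
rewrite add1n prednK // => f1 f2.
have [r rE] := iter_rmorph t (l ^ k.-1).
have rfix : fixK r by move=> x; rewrite rE; apply: iter_fix.
have rfa : sa E = r (sa E) by rewrite Ea rfix.
have rfb : sb E = r (sb E) by rewrite Eb rfix.
have rg P : pmap rfa rfb P = iter (l ^ k.-1) g P.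
  by rewrite (pmap_iter tfa tfb rfa rfb rE); apply: eq_iter.
exists r; split=> //; first by apply/(galois_fixesP _ rfa rfb) => P nP; rewrite rg f1.
by move=> /(galois_fixesP _ rfa rfb) h; apply: f2 => P nP; rewrite -rg h.
Qed.

(** An automorphism permutes the conjugates of a generator of K, so a suitable factorial power fixes
    it. *)
Lemma fixK_power : exists2 N, (0 < N)%N & forall s : {rmorphism algC -> algC}, fixK (iter N s).
Proof.
have [t tP] := primitive_element K.
have [r rE] := closed_field_poly_normal (minCpoly (iota t)).
rewrite (monicP (minCpoly_monic _)) scale1r in rE.
exists (size r)`! => [|s]; first exact: fact_gt0.
have rP w : (w \in r) = root (minCpoly (iota t)) w by rewrite rE root_prod_XsubC.
have st : iter (size r)`! s (iota t) = iota t.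
  apply: iter_fact_fix; first exact: fmorph_inj.
    move=> w; rewrite !rP; have [q [-> _] _] := minCpolyP (iota t); rewrite -(fmorph_root s).
    suff -> : map_poly s (map_poly ratr q) = map_poly ratr q by [].
    by rewrite -map_poly_comp; apply: eq_map_poly => x /=; rewrite fmorph_rat.
  by rewrite rP root_minCpoly.
have [s' s'E] := iter_rmorph s (size r)`!.
by move=> x; rewrite -s'E; apply: (rmorph_fixP tP); rewrite s'E.
Qed.

(** T must not depend on E. The automorphism t raises the relevant roots of unity to the power D,
    which involves only K and l. It fixes E[l^2], because its exponent contains the factorial of the
    number l^4 of points. As 0 < D - 1 < l^(D+1), it moves roots of unity of order l^(D+1), so it is
    not trivial on E[l^(D+2)]. The last trivial level thus lies between 2 and D + 1, and
    [level_climb] lifts it to k. *)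
Lemma bad_witness l : prime l -> exists T : nat, forall k (E : scurve algC) u v,
  (T <= k)%N -> sa E = iota u -> sb E = iota v ->
  exists s : {rmorphism algC -> algC}, [/\ fixK s, galois_fixes s E (l ^ k) & ~ galois_fixes s E (l ^ k.+1)].
Proof.
move=> pl; have [N0 N00 fixN] := fixK_power; have l0 := prime_gt0 pl; have l1 := prime_gt1 pl.
pose M := (N0 * ((l ^ 2) ^ 2)`!)%N; pose D := (l.+1 ^ M)%N.
have D1 : (1 < D)%N.
  have : (l.+1 ^ 1 <= D)%N by rewrite leq_exp2l // muln_gt0 N00 fact_gt0. by rewrite expn1; apply: leq_trans.
exists D.+2 => k E u v Tk Ea Eb.
have n0 : (0 < l ^ D.+2)%N by rewrite expn_gt0 l0.
have [s0 s0E] := @Qn_aut_exists l.+1 (l ^ D.+2) (coprimeXr _ (coprimeSn l)).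
have [s sE] := iter_rmorph s0 N0.
have sK : fixK s by move=> x; rewrite sE fixN.
have sfa : sa E = s (sa E) by rewrite Ea sK.
have sfb : sb E = s (sb E) by rewrite Eb sK.
pose F := ((l ^ 2) ^ 2)`!.
have [t tE] := iter_rmorph s F.
have tK : fixK t by move=> x; rewrite tE; apply: iter_fix.
have tfa : sa E = t (sa E) by rewrite Ea tK.
have tfb : sb E = t (sb E) by rewrite Eb tK.
have tg : pmap tfa tfb =1 iter F (pmap sfa sfb) by apply: pmap_iter.
pose fx j := forall P : spoint E, P *+ l ^ j = 0 -> pmap tfa tfb P = P.
(* Starting from level 2 provides the hypothesis of [level_climb] when l = 2. *)
have fx2 : fx 2%N.
  have m0 : (0 < l ^ 2)%N by rewrite expn_gt0 l0. have [ut st tlE] := tlistP E m0.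
  move=> P nP; rewrite tg /F -st; apply: iter_fact_fix.
  - exact: pmap_inj.
  - by move=> Q; rewrite !tlE => /eqP nQ; rewrite -pmapMn nQ pmap0.
  - by rewrite tlE nP.
have nfx : ~ fx D.+2.
  move=> all; have n1 : (0 < l ^ D.+1)%N by rewrite expn_gt0 l0. have [z pz] := C_prim_root_exists n1. have tz : t z = z.
    apply: (fix_roots pl _ all) => //.
    have [j jE] : exists j, (D.+2 - (l == 2%N) = D.+1 + j)%N by exists (D.+2 - (l == 2%N) - D.+1)%N; case: (l == 2%N); lia.
    by rewrite jE expnD exprM (prim_expr_order pz) expr1n.
  have zn : z ^+ (l ^ D.+2)%N = 1 by rewrite expnSr exprM (prim_expr_order pz) expr1n. have : t z = z ^+ D.
    have sd w : w ^+ (l ^ D.+2)%N = 1 -> s w = w ^+ (l.+1 ^ N0)%N.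
      by move=> wn; rewrite sE; apply: iter_exp s0E wn.
    by rewrite tE (iter_exp _ sd zn) /D /M expnM.
  rewrite tz => /esym/eqP; rewrite -[X in _ == X]expr1 (eq_prim_root_expr pz) eqn_mod_dvd; last exact: ltnW.
  move=> /dvdn_leq; rewrite subn_gt0 D1 => /(_ isT). have := ltn_expl D.+1 l1; lia.
have [j [j2 jT fj nfj]] : exists j, [/\ (1 < j)%N, (j <= D.+1)%N, fx j & ~ fx j.+1].
  apply: contrapT => h; apply: nfx. have : forall i, (i <= D)%N -> fx (i + 2)%N.
    elim=> [|i IH] iD; first exact: fx2. apply: contrapT => nf; apply: h; exists (i + 2)%N; split=> //; try lia.
    by apply: IH; apply: ltnW.
  by move=> /(_ D (leqnn D)); rewrite addn2.
have [f1 f2] := @level_climb E (pmap tfa tfb) l j (k - j) pl (ltnW j2) (introT orP (or_intror j2)) fj nfj.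
rewrite subnKC in f1 f2; last by lia.
have [r rE] := iter_rmorph t (l ^ (k - j)).
have rfix : fixK r by move=> x; rewrite rE; apply: iter_fix.
have rfa : sa E = r (sa E) by rewrite Ea rfix.
have rfb : sb E = r (sb E) by rewrite Eb rfix.
have rg := pmap_iter tfa tfb rfa rfb rE.
exists r; split=> //; first by apply/(galois_fixesP _ rfa rfb) => P nP; rewrite rg f1.
by move=> /(galois_fixesP _ rfa rfb) h; apply: f2 => P nP; rewrite -rg h.
Qed.

End Witness.

Lemma integral_multiple (z : algC) : exists2 m : nat, (0 < m)%N & m%:R * z \in Aint.
Proof.
have [q [qE qm] _] := minCpolyP z; have [q1 [a a0 q1E]] := rat_poly_scale q.
have rz : (map_poly intr q1 : {poly algC}).[z] = 0.
  have := root_minCpoly z; rewrite qE q1E rootE map_polyZ hornerZ mulf_eq0 fmorph_eq0 invr_eq0 intr_eq0 (negPf a0).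
  by rewrite map_int_rat => /eqP.
have sq : size q1 = size q.
  by rewrite q1E size_scale ?invr_eq0 ?intr_eq0 // size_map_inj_poly //; exact: intr_inj.
have q0 : (0 < size q)%N by rewrite lt0n size_poly_eq0 monic_neq0.
pose n := (size q).-1; have nE : size q = n.+1 by rewrite prednK.
have la : q1`_n = a.
  apply: (@intr_inj rat); have := monicP qm; rewrite lead_coefE q1E coefZ coef_map /=. have an : a%:~R != 0 :> rat by rewrite intr_eq0.
  by rewrite -q1E -/n => e; apply: (mulfI (invr_neq0 an)); rewrite e mulVf.
have n0 : (0 < n)%N.
  rewrite lt0n; apply/eqP => n0; have := rz. have -> : q1 = a%:P by rewrite -la n0; apply: size1_polyC; rewrite sq nE n0.
  by rewrite map_polyC hornerC => /eqP; rewrite intr_eq0 (negPf a0).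
pose P : {poly int} := 'X^n + \poly_(i < n) (q1`_i * a ^+ (n.-1 - i)).
have Pm : P \is monic.
  rewrite monicE lead_coefDl ?lead_coefXn // size_polyXn ltnS; exact: size_poly.
have Pr : root (map_poly intr P) (a%:~R * z).
  rewrite rootE rmorphD /= map_polyXn hornerD hornerXn poly_def rmorph_sum horner_sum /=.
  apply/eqP; transitivity ((a%:~R : algC) ^+ n.-1 * (map_poly intr q1).[z]); last by rewrite rz mulr0.
  rewrite horner_coef size_map_inj_poly //; last exact: intr_inj. rewrite sq nE big_ord_recr /= mulrDr [RHS]addrC; congr (_ + _).
    by rewrite coef_map la /= exprMn -{1}(prednK n0) exprSr -mulrA.
  rewrite mulr_sumr; apply: eq_bigr => i _. rewrite map_polyZ hornerZ map_polyXn hornerXn coef_map /= rmorphM rmorphXn /= exprMn.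
  have -> : (a%:~R : algC) ^+ n.-1 = a%:~R ^+ (n.-1 - i) * a%:~R ^+ i.
    by rewrite -exprD subnK // -ltnS prednK.
  by ring.
have aA := monic_int_Aint Pm Pr.
exists `|a|%N; first by rewrite absz_gt0.
have : (a%:~R * z = `|a|%:R * z) \/ (a%:~R * z = - (`|a|%:R * z)).
  by case: a {a0 q1E la P Pm Pr aA} => [m|m]; [left | right; rewrite NegzE rmorphN mulNr].
by case=> e; rewrite e ?rpredN in aA.
Qed.

Section Basis.
Variables (K : fieldExtType rat) (iota : {rmorphism K -> algC}).
Local Notation n := (\dim {:K}).

Lemma gram_neq0 (b : n.-tuple K) : basis_of {:K} b ->
  \det (\matrix_(i < n, j < n) trace (b`_i * b`_j)) != 0.
Proof.
move=> bb; apply/negP => /det0P[c c0 cG].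
pose x := \sum_(i < n) c 0 i *: b`_i.
have x0 : x != 0.
  apply: contra c0 => /eqP x0; apply/eqP/rowP => i; rewrite mxE. have /freeP fr := basis_free bb; exact: fr x0 i.
have tx y : trace (x * y) = 0.
  rewrite (coord_basis bb (memvf y)) mulr_sumr raddf_sum big1 // => j _. rewrite -scalerAr /= traceZ.
  have := congr1 (fun M : 'rV[rat]_n => M 0 j) cG; rewrite !mxE => e. suff -> : trace (x * b`_j) = 0 by rewrite mulr0.
  rewrite -e /x mulr_suml raddf_sum; apply: eq_bigr => i _. by rewrite -scalerAl /= traceZ mxE.
have := tx x^-1; rewrite mulfV // trace1 => /eqP.
by rewrite pnatr_eq0 -leqn0 leqNgt dim_gt0.
Qed.

Lemma gram_int (b : n.-tuple K) : (forall i : 'I_n, iota b`_i \in Aint) ->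
  exists d : int, \det (\matrix_(i < n, j < n) trace (b`_i * b`_j)) = d%:~R.
Proof.
move=> bi; have h (i j : 'I_n) : exists c : int, trace (b`_i * b`_j) = c%:~R.
  by apply: (trace_int (iota := iota)); rewrite rmorphM rpredM.
exists (\det (\matrix_(i, j) sval (cid (h i j)))).
by rewrite -det_map_mx; congr (\det _); apply/matrixP => i j; rewrite !mxE; case: cid.
Qed.

(** The basis consists of integral elements but may span less than the ring of integers; it serves
    when [disc] has its default value. *)
Lemma integral_basis_exists : exists (b : n.-tuple K) (d : int),
  [/\ basis_of {:K} b, forall i : 'I_n, iota b`_i \in Aint, d != 0 &
    \det (\matrix_(i < n, j < n) trace (b`_i * b`_j)) = d%:~R].
Proof.
have h (i : 'I_n) : exists m : nat, (0 < m)%N /\ m%:R * iota (vbasis {:K})`_i \in Aint.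
  by have [m m0 mA] := integral_multiple (iota (vbasis {:K})`_i); exists m.
pose m i := sval (cid (h i)).
have mP i : (0 < m i)%N /\ (m i)%:R * iota (vbasis {:K})`_i \in Aint by rewrite /m; case: cid.
pose M := (\prod_i m i)%N.
have M0 : (0 < M)%N by rewrite prodn_gt0 // => i; have [] := mP i.
pose b : n.-tuple K := [tuple of map ( *:%R (M%:R : rat)) (vbasis {:K})].
have bE (i : 'I_n) : b`_i = M%:R *: (vbasis {:K})`_i.
  by rewrite (nth_map 0) // size_tuple.
have bb : basis_of {:K} b.
  rewrite basisEfree size_tuple leqnn andbT subvf andbT; apply/freeP => k e i. have /freeP fr := basis_free (vbasisP {:K}).
  have : M%:R * k i = 0.
    apply: (fr (fun i => M%:R * k i)); rewrite -[RHS]e; apply: eq_bigr => j _. by rewrite bE scalerA mulrC.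
  by move/eqP; rewrite mulf_eq0 pnatr_eq0 -leqn0 leqNgt M0 => /eqP.
have bi (i : 'I_n) : iota b`_i \in Aint.
  rewrite bE rmorphZ_num rmorph_nat /M (bigD1 i) //= mulnC natrM -mulrA rpredM ?rpred_nat //. by have [] := mP i.
have [d dE] := gram_int bi; exists b, d; split=> //.
by have := gram_neq0 bb; rewrite dE intr_eq0.
Qed.

Lemma disc_basis : disc K != 0 -> exists b : n.-tuple K,
  [/\ basis_of {:K} b, forall i : 'I_n, iota b`_i \in Aint &
    \det (\matrix_(i < n, j < n) trace (b`_i * b`_j)) = (disc K)%:~R].
Proof.
rewrite /disc; case: classical_sets.xgetP => [d _ [b [bb bi] dE] _|_]; last by rewrite eqxx.
exists b; split=> // i; apply: integral_Aint; apply/bi.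
exists (fun j => (j == i)%:Z); rewrite (bigD1 i) //= eqxx mulr1z big1 ?addr0 // => j /negPf->.
by rewrite mulr0z.
Qed.

Lemma galois_witness : exists T : nat -> nat,
  [/\ (exists B, forall l, (B < l)%N -> T l = 0),
   (forall l, prime l -> T l != 0%N -> (l%:Z %| 2 * disc K)%Z) &
   forall l k (E : scurve algC) u v, prime l -> (0 < k)%N -> (T l <= k)%N ->
    sa E = iota u -> sb E = iota v ->
    exists s : {rmorphism algC -> algC},
     [/\ fixK iota s, galois_fixes s E (l ^ k) & ~ galois_fixes s E (l ^ k.+1)]].
Proof.
(* If [disc K] is 0, every l divides 2 disc(K), so the Gram determinant d of any basis of integral
   elements may define the exceptional primes. *)
have [b [d [bb bi d0 bd dd]]] : exists (b : n.-tuple K) (d : int),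
  [/\ basis_of {:K} b, forall i : 'I_n, iota b`_i \in Aint, d != 0,
    \det (\matrix_(i < n, j < n) trace (b`_i * b`_j)) = d%:~R & disc K = d \/ disc K = 0].
  have [dK|dK] := eqVneq (disc K) 0.
    by have [b [d [? ? ? ?]]] := integral_basis_exists; exists b, d; split=> //; right.
  by have [b [? ? ?]] := disc_basis dK; exists b, (disc K); split=> //; left.
pose T l := if (l %| 2 * `|d|)%N then
  if pselect (prime l) is left pl then sval (cid (bad_witness iota pl)) else 0%N else 0%N.
exists T; split.
- exists (2 * `|d|)%N => l lB; rewrite /T; case: ifP => // /dvdn_leq.
  by rewrite muln_gt0 absz_gt0 d0 => /(_ isT); rewrite leqNgt lB.
- move=> l pl; rewrite /T; case: ifP => // ld _.
  case: dd => ->; last by rewrite mulr0 dvdz0. by rewrite dvdzE abszM.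
move=> l k E u v pl k0; rewrite /T; case: ifP => [ld|/negbT ld] Tk Ea Eb.
  move: Tk; case: pselect => // pl'; case: cid => t tP /= Tk. exact: tP Tk Ea Eb.
apply: (good_witness bb bi bd pl _ _ k0 Ea Eb).
  by apply: contraR ld; case: (even_prime pl) => [->|->] //; rewrite dvdn_mulr.
by apply: contra ld; apply: dvdn_mull.
Qed.

End Basis.

(** * Norms on Z[x]/f *)

Section ModP.
Variables (p : nat) (pp : prime p).
Local Notation phi := (red p).

Lemma intrFp0 (x : int) : (x%:~R == 0 :> 'F_p) = (p%:Z %| x)%Z.
Proof. by rewrite -(dvdz_pcharf (pchar_Fp pp)). Qed.

Lemma phi_eq0 (w : {poly int}) : phi w = 0 <-> exists e, w = p%:Z *: e.
Proof.
split=> [w0|[e ->]]; last first.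
  by apply/polyP => i; rewrite coef_map coefZ coef0; apply/eqP; rewrite /= intrFp0 dvdz_mulr.
exists (\poly_(i < size w) (w`_i %/ p%:Z)%Z); apply/polyP => i; rewrite coefZ coef_poly.
case: ltnP => [_|iw]; last by rewrite mulr0 nth_default.
have := congr1 (fun q : {poly 'F_p} => q`_i) w0; rewrite coef_map coef0 => /eqP.
by rewrite /= intrFp0 => /divzK; rewrite mulrC => ->.
Qed.

Lemma phi_surj (q : {poly 'F_p}) : exists w, phi w = q.
Proof.
exists (\poly_(i < size q) (nat_of_ord q`_i)%:Z); apply/polyP => i.
rewrite coef_map coef_poly; case: ltnP => iq /=; last by rewrite nth_default.
by rewrite -[(_%:Z)%:~R]/((nat_of_ord q`_i)%:R) natr_Zp.
Qed.

Lemma phi_eq (v w : {poly int}) : phi v = phi w <-> exists e, v = w + p%:Z *: e.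
Proof.
split=> [e|[e ->]]; last first.
  by rewrite rmorphD /= [X in _ + X](_ : _ = 0) ?addr0 //; apply/phi_eq0; exists e.
have [r rE] : exists r, v - w = p%:Z *: r by apply/phi_eq0; rewrite rmorphB /= e subrr.
by exists r; rewrite -rE addrC subrK.
Qed.

End ModP.

Section Norm.
Variables (f : {poly int}) (n : nat).
Hypotheses (fm : f \is monic) (sf : size f = n.+1).
Local Notation rm u := (Pdiv.Ring.rmodp u f).
Implicit Types (u v w q r : {poly int}).
Let rmE := (Pdiv.RingMonic.rmodpD fm, Pdiv.RingMonic.rmodpZ fm).

(** Multiplication by u on Z[x]/f in the basis of the powers of x, acting on row vectors; its
    determinant is the norm of u. *)
Definition mulf (u : {poly int}) : 'M[int]_n := \matrix_(i, j) (rm ('X^i * u))`_j.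
Definition pv (w : {poly int}) : 'rV[int]_n := \row_j w`_j.
Definition nrm u : int := \det (mulf u).

Lemma rm_small w : (size w <= n)%N -> rm w = w.
Proof. by move=> h; rewrite Pdiv.Ring.rmodp_small // sf. Qed.

Lemma size_rm w : (size (rm w) <= n)%N.
Proof. by rewrite -ltnS -sf Pdiv.Ring.ltn_rmodpN0 // monic_neq0. Qed.

Lemma rm_mulf w q : rm (w + q * f) = rm w.
Proof. by rewrite rmE Pdiv.RingMonic.rmodp_mull // addr0. Qed.

Lemma poly_sum w : (size w <= n)%N -> w = \sum_(i < n) w`_i *: 'X^i.
Proof.
move=> h; rewrite -(poly_def n (fun i => w`_i)); apply/polyP => i.
by rewrite coef_poly; case: ltnP => // hi; rewrite nth_default // (leq_trans h).
Qed.

Lemma pv_mulf w u : (size w <= n)%N -> pv w *m mulf u = pv (rm (w * u)).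
Proof.
move=> h; apply/rowP => j; rewrite !mxE [in RHS](poly_sum h) mulr_suml.
rewrite Pdiv.RingMonic.rmodp_sum // coef_sum; apply: eq_bigr => i _.
by rewrite !mxE -scalerAl rmE coefZ.
Qed.

Lemma row_mulf u i : row i (mulf u) = pv (rm ('X^i * u)).
Proof. by apply/rowP => j; rewrite !mxE. Qed.

Lemma mulfM u v : mulf (u * v) = mulf u *m mulf v.
Proof.
apply/row_matrixP => i; rewrite row_mul !row_mulf pv_mulf ?size_rm // mulrA.
by rewrite [rm _ * v]mulrC Pdiv.RingMonic.rmodp_mulmr // [v * _]mulrC.
Qed.

Lemma mulf_rm u q : mulf (u + q * f) = mulf u.
Proof. by apply/row_matrixP => i; rewrite !row_mulf mulrDr mulrA rm_mulf. Qed.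

Lemma mulfD u v : mulf (u + v) = mulf u + mulf v.
Proof. by apply/matrixP => i j; rewrite !mxE mulrDr rmE coefD. Qed.

Lemma mulfZ c u : mulf (c *: u) = c *: mulf u.
Proof. by apply/matrixP => i j; rewrite !mxE -scalerAr rmE coefZ. Qed.

Lemma mulf1 : mulf 1 = 1%:M.
Proof.
apply/matrixP => i j; rewrite !mxE mulr1 rm_small ?size_polyXn //.
by rewrite coefXn eq_sym.
Qed.

Lemma nrmM u v : nrm (u * v) = nrm u * nrm v.
Proof. by rewrite /nrm mulfM det_mulmx. Qed.

Lemma nrm_rm u q : nrm (u + q * f) = nrm u.
Proof. by rewrite /nrm mulf_rm. Qed.

Lemma nrmZ c u : nrm (c *: u) = c ^+ n * nrm u.
Proof. by rewrite /nrm mulfZ detZ. Qed.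

Lemma nrmC (c : int) : nrm c%:P = c ^+ n.
Proof. by rewrite -[c%:P]mulr1 mul_polyC nrmZ /nrm mulf1 det1 mulr1. Qed.

Lemma nrm_neq0 a b (c : int) u : c != 0 -> a * u + b * f = c%:P -> nrm u != 0.
Proof.
move=> c0 /(congr1 nrm); rewrite nrm_rm nrmM nrmC => e.
by have : nrm a * nrm u != 0; [rewrite e expf_neq0 | rewrite mulf_eq0 negb_or => /andP[]].
Qed.

Lemma nrm_cong1 p e u : prime p -> u = 1 + p%:Z *: e -> (nrm u)%:~R = 1 :> 'F_p.
Proof.
move=> pp ->; rewrite /nrm mulfD mulf1 mulfZ -[RHS](det1 'F_p n) -det_map_mx; congr (\det _).
apply/matrixP => i j; rewrite !mxE rmorphD rmorphM /=.
have -> : (p%:Z)%:~R = 0 :> 'F_p by apply/eqP; rewrite intrFp0 ?dvdzz.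
rewrite mul0r addr0.
by rewrite rmorph_nat.
Qed.

(** An inverse A of u modulo p and f makes A u = 1 + p e modulo f, whose norm is 1 modulo p. *)
Lemma nrm_coprime p u : prime p ->
  coprimep (red p u) (red p f) -> ~~ (p%:Z %| nrm u)%Z.
Proof.
move=> pp /Bezout_eq1_coprimepP[[a b]] /=.
have [A <-] := phi_surj a; have [B <-] := phi_surj b.
rewrite -!rmorphM -rmorphD /= -(rmorph1 (map_poly intr)) => /(phi_eq pp)[e eE].
have := nrm_cong1 pp eE; rewrite nrm_rm nrmM => h.
apply/negP => d; have : (nrm A * nrm u)%:~R = 0 :> 'F_p.
  by apply/eqP; rewrite intrFp0 // dvdz_mull.
by rewrite h => /eqP; rewrite oner_eq0.
Qed.

(* u Z[x]/f lies in the lattice (h, m), whose index is m^d *)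
Lemma nrm_dvd (h q r a b v : {poly int}) (m : int) d : h \is monic -> size h = d.+1 -> (d <= n)%N ->
  f = h * q + m *: r -> v = h * a + m *: b -> (m ^+ d %| nrm v)%Z.
Proof.
move=> hm sh dn fE vE.
(* A triangular basis of the lattice spanned by h and m: m X^i below degree d and h X^(i-d) from
   there on. *)
pose Br (i : nat) : {poly int} := if (i < d)%N then m *: 'X^i else h * 'X^(i - d).
pose B : 'M[int]_n := \matrix_(i, j) (Br i)`_j.
have detB : \det B = m ^+ d.
  rewrite det_trig; last first.
    apply/is_trig_mxP => i j ij; rewrite mxE /Br; case: ltnP => id.
      by rewrite coefZ coefXn gtn_eqF // mulr0.
    rewrite nth_default // size_Mmonic ?monicXn ?monic_neq0 // sh size_polyXn /=.
    by move: id ij; clear; move: (nat_of_ord i) (nat_of_ord j) => i' j'; lia.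
  under eq_bigr do rewrite mxE.
  rewrite -(big_mkord xpredT (fun i => (Br i)`_i)). rewrite (big_cat_nat (n := d)) //= [X in _ * X]big1_seq ?mulr1; last first.
    move=> i; rewrite mem_index_iota => /andP[_ /andP[di _]]. rewrite /Br ltnNge di /= coefMXn ltnNge leq_subr /= subKn //.
    by have /monicP := hm; rewrite lead_coefE sh.
  rewrite (eq_big_nat _ _ (F2 := fun => m)) ?prodr_const_nat ?subn0 //.
  by move=> i /andP[_ id]; rewrite /Br id coefZ coefXn eqxx mulr1.
have lat w : (size w <= n)%N -> (exists A b, w = h * A + m *: b) -> exists x, pv w = x *m B.
  move=> sw [A [c wE]].
  have cE := Pdiv.RingMonic.rdivp_eq hm c; set c1 := Pdiv.Ring.rdivp c h in cE; set r1 := Pdiv.Ring.rmodp c h in cE.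
  have sr1 : (size r1 <= d)%N by rewrite -ltnS -sh Pdiv.Ring.ltn_rmodpN0 // monic_neq0. pose A' := A + m *: c1.
  have wE' : w = h * A' + m *: r1.
    by rewrite wE cE /A' mulrDr scalerDr -scalerAr addrA [c1 * h]mulrC.
  have sA : (size A' <= n - d)%N.
    have [->|A0] := eqVneq A' 0; first by rewrite size_poly0. have : (size (h * A')%R <= n)%N.
      have -> : h * A' = w - m *: r1 by rewrite wE' addrK.
      rewrite size_leD // geq_max sw size_polyN (leq_trans (size_scale_leq _ _)) //. exact: leq_trans sr1 dn.
    rewrite size_monicM // sh addSn /=; clear; move: (size A') => k; lia.
  exists (\row_i if (i < d)%N then r1`_i else A'`_(i - d)); apply/rowP => j; rewrite !mxE.
  pose F (i : nat) : {poly int} := (if (i < d)%N then r1`_i else A'`_(i - d)) *: Br i. have -> : w = \sum_(i < n) F i.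
    rewrite -(big_mkord xpredT F) (big_cat_nat (n := d)) //= wE' [LHS]addrC; congr (_ + _).
      rewrite -[in LHS](coefK r1) poly_def scaler_sumr big_mkord.
      rewrite (big_ord_widen _ (fun i => m *: (r1`_i *: 'X^i)) sr1) big_mkcond.
      apply: eq_bigr => i _; rewrite /F /Br ltn_ord scalerA mulrC -scalerA. by case: ltnP => // hi; rewrite nth_default // scale0r.
    rewrite -{1}[d]add0n big_addn big_mkord. rewrite -[in LHS](coefK A') poly_def mulr_sumr.
    rewrite (big_ord_widen _ (fun i => h * (A'`_i *: 'X^i)) sA) big_mkcond.
    apply: eq_bigr => i _; have e : (i + d < d)%N = false by rewrite ltnNge leq_addl. rewrite /F /Br e /= addnK -scalerAr.
    by case: ltnP => // hi; rewrite nth_default // scale0r.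
  by rewrite coef_sum; apply: eq_bigr => i _; rewrite !mxE /F coefZ.
have rowX i : exists x, row i (mulf v) = x *m B.
  rewrite row_mulf; apply: lat; first exact: size_rm.
  have := Pdiv.RingMonic.rdivp_eq fm ('X^i * v); set k := Pdiv.Ring.rdivp _ _ => /eqP.
  rewrite addrC -subr_eq => /eqP <-; exists ('X^i * a - k * q), ('X^i * b - k * r). by rewrite vE fE -!mul_polyC; move: k => k; ring.
pose X := \matrix_i sval (cid (rowX i)).
have -> : nrm v = \det X * m ^+ d.
  rewrite -detB -det_mulmx /nrm; congr (\det _); apply/row_matrixP => i. by rewrite row_mul rowK; case: cid.
exact: dvdz_mull.
Qed.

End Norm.

(** Moving each factor, of size at most a, by at most w changes the product by O(w a^(N-1)) for N
    factors. Both sides carry an extra factor a to stay in the integers. *)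
Lemma prod_diff (I : Type) (s : seq I) (x y : I -> int) (a w : int) :
  0 <= w -> w <= a -> (forall i, `|x i| <= a) -> (forall i, `|y i| <= w) ->
  `|\prod_(i <- s) (x i + y i) - \prod_(i <- s) x i| * a <= 3 ^+ size s * w * a ^+ size s.
Proof.
move=> w0 wa xa yw; have a0 := le_trans w0 wa.
elim: s => [|i s IH]; first by rewrite !big_nil subrr normr0 mul0r !expr0 mul1r mulr1.
rewrite !big_cons /=; set P := \prod_(j <- s) _ in IH *; set Q := \prod_(j <- s) x j in IH *.
have -> : (x i + y i) * P - x i * Q = (x i + y i) * (P - Q) + y i * Q by ring.
have Qa : `|Q| <= a ^+ size s.
  rewrite /Q; elim: (s) => [|j s' IH']; first by rewrite big_nil normr1. by rewrite big_cons normrM exprS ler_pM.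
apply: (@le_trans _ _ ((a + a) * (3 ^+ size s * w * a ^+ size s) + w * a ^+ size s * a)).
  apply: (@le_trans _ _ ((`|x i + y i| * `|P - Q| + `|y i| * `|Q|) * a)).
    by rewrite ler_wpM2r // (le_trans (ler_normD _ _)) // !normrM.
  rewrite mulrDl; apply: lerD.
    rewrite -mulrA ler_pM // ?mulr_ge0 //. by rewrite (le_trans (ler_normD _ _)) // lerD // (le_trans (yw i)).
  by rewrite ler_wpM2r // ler_pM.
have h1 : 1 <= (3 : int) ^+ size s by rewrite exprn_ege1.
have h2 : 0 <= w * a ^+ size s * a by rewrite !mulr_ge0 ?exprn_ge0.
have -> : (3 : int) ^+ (size s).+1 * w * a ^+ (size s).+1 =
  (a + a) * (3 ^+ size s * w * a ^+ size s) + 3 ^+ size s * (w * a ^+ size s * a) by rewrite !exprS; ring.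
by rewrite lerD2l; rewrite -[leLHS]mul1r ler_wpM2r.
Qed.

Lemma det_bound n (A : 'M[int]_n) (w : int) : 0 <= w -> (forall i j, `|A i j| <= w) ->
  `|\det A| <= n`!%:R * w ^+ n.
Proof.
move=> w0 Aw; rewrite /determinant (le_trans (ler_norm_sum _ _ _)) //.
rewrite mulr_natl -perm.card_Sn -sumr_const ler_sum // => s _.
rewrite normrM normrX normrN1 expr1n mul1r normr_prod -[X in _ <= w ^+ X](card_ord n) -prodr_const.
by apply: ler_prod => i _; rewrite normr_ge0 Aw.
Qed.

Lemma det_near n (W : 'M[int]_n) (a w : int) : 0 <= w -> 0 < a ->
  2 * n`!%:R * 3 ^+ n * w <= a -> (forall i j, `|W i j| <= w) ->
  2 * `|\det (a%:M + W) - a ^+ n| <= a ^+ n.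
Proof.
move=> w0 a0 wa Ww.
have c1 : 1 <= (2 * n`!%:R * 3 ^+ n : int).
  by rewrite -!natrX -!natrM ler1n !muln_gt0 fact_gt0 expn_gt0.
have wa' : w <= a by rewrite (le_trans _ wa) // -[leLHS]mul1r ler_wpM2r.
have -> : a ^+ n = \det (a%:M : 'M[int]_n) by rewrite det_scalar.
have h : `|\det (a%:M + W) - \det (a%:M : 'M[int]_n)| * a <= n`!%:R * (3 ^+ n * w * a ^+ n).
  rewrite /determinant -sumrB (le_trans (ler_wpM2r (ltW a0) (ler_norm_sum _ _ _))) // mulr_suml.
  rewrite mulr_natl -perm.card_Sn -sumr_const ler_sum // => s _. rewrite -mulrBr normrM normrX normrN1 expr1n mul1r.
  under eq_bigr do rewrite mxE.
  have eE F : \prod_(i < n) F i = \prod_(i <- enum 'I_n) F i :> int by rewrite big_enum.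
  have := @prod_diff 'I_n (enum 'I_n) (fun i => (a%:M : 'M[int]_n) i (perm.fun_of_perm s i)) (fun i => W i (perm.fun_of_perm s i)) a w w0 wa'.
  rewrite size_enum_ord -!eE; apply=> i; rewrite ?Ww // mxE. by case: eqP => _; rewrite ?mulr1n ?mulr0n ?normr0 ?(gtr0_norm a0) // ltW.
rewrite det_scalar in h *.
rewrite -(ler_pM2r a0) -mulrA (le_trans (ler_wpM2l _ h)) //.
by rewrite !mulrA [leRHS]mulrC ler_wpM2r // exprn_ge0 // ltW.
Qed.

Section NormBound.
Variables (f : {poly int}) (n : nat).
Hypotheses (fm : f \is monic) (sf : size f = n.+1).
Implicit Types (u v w q r : {poly int}).

Definition box u (Y : int) := (size u <= n)%N /\ forall i, `|u`_i| <= Y.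

Lemma mulf_bound : exists2 C : int, 0 < C & forall u (Y : int), box u Y -> forall i j, `|mulf f n u i j| <= C * Y.
Proof.
pose S : int := \sum_(k < n + n) \sum_(j < n) `|(Pdiv.Ring.rmodp 'X^k f)`_j|.
have S0 : 0 <= S by rewrite sumr_ge0 // => k _; rewrite sumr_ge0.
have Sk (k j : nat) : (k < n + n)%N -> (j < n)%N -> `|(Pdiv.Ring.rmodp 'X^k f)`_j| <= S.
  move=> kn jn; rewrite /S (bigD1 (Ordinal kn)) //= (bigD1 (Ordinal jn)) //= -addrA lerDl.
  by rewrite addr_ge0 // !sumr_ge0 // => i _; rewrite sumr_ge0.
exists (1 + n%:R * S); first by rewrite ltr_wpDr // mulr_ge0.
move=> u Y [su uY] i j; have Y0 : 0 <= Y := le_trans (normr_ge0 _) (uY 0%N).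
rewrite mxE [in leLHS](poly_sum su) mulr_sumr Pdiv.RingMonic.rmodp_sum // coef_sum.
rewrite (le_trans (ler_norm_sum _ _ _)) // mulrDl mul1r ler_wpDl // -mulrA mulr_natl.
rewrite -[X in _ *+ X](card_ord n) -sumr_const ler_sum // => k _.
rewrite -scalerAr Pdiv.RingMonic.rmodpZ // -exprD coefZ normrM mulrC ler_pM // Sk //.
by rewrite -addnS leq_add // ltnW.
Qed.

Lemma nrm_bound : exists2 C : int, 0 < C & forall u (Y : int), box u Y -> `|nrm f n u| <= C * Y ^+ n.
Proof.
have [C C0 CP] := mulf_bound; exists (n`!%:R * C ^+ n).
  by rewrite mulr_gt0 ?exprn_gt0 // ltr0n fact_gt0.
move=> u Y uY; rewrite -mulrA -exprMn; apply: det_bound; last exact: CP.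
by rewrite mulr_ge0 ?(ltW C0) // (le_trans (normr_ge0 _) (uY.2 0%N)).
Qed.

(** A constant term that dominates the other coefficients keeps the norm positive and within a
    factor 2 of a^n. *)
Lemma nrm_cone : exists2 A : int, 0 < A & forall (a : int) w (Y : int), box w Y -> 0 < a -> A * Y <= a ->
  2 * `|nrm f n (a%:P + w) - a ^+ n| <= a ^+ n.
Proof.
have [C C0 CP] := mulf_bound; exists (2 * n`!%:R * 3 ^+ n * C).
  by rewrite !mulr_gt0 ?exprn_gt0 // ltr0n fact_gt0.
move=> a w Y wY a0 aY; rewrite /nrm mulfD // -[a%:P]mulr1 mul_polyC mulfZ // mulf1 //.
rewrite scale_scalar_mx mulr1; apply: (det_near _ a0 (w := C * Y)); last exact: CP.
  by rewrite mulr_ge0 ?(ltW C0) // (le_trans (normr_ge0 _) (wY.2 0%N)).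
by rewrite mulrA.
Qed.

(* if c = p c' with c' a unit then u (q + p) = p z with z prime to f mod p, while
   p^(n-1) divides N(q + p); so p divides N(u) exactly once *)
Lemma nrm_simple p (t : int) (q a r : {poly int}) (ct : int) : prime p -> (0 < n)%N -> q \is monic -> size q = n ->
  f = ('X - t%:P) * q + (p%:Z ^+ 2) *: r ->
  ~~ (p%:Z %| q.[t])%Z ->
  coprimep (red p a) (red p q) ->
  (p%:Z %| ct)%Z -> (p%:Z ^+ 2 %| nrm f n (('X - t%:P) * a + ct%:P))%Z -> (p%:Z ^+ 2 %| ct)%Z.
Proof.
move=> pp n0 qm sq fE qt caq pc pN; have [c' cE] := dvdzP pc; apply: contraT => nc.
have np0 : p%:Z != 0 by rewrite eqz_nat -lt0n prime_gt0.
have nc' : ~~ (p%:Z %| c')%Z.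
  by apply: contra nc; rewrite cE expr2 => d; rewrite dvdz_mul.
pose P := p%:Z%:P : {poly int}.
set u := _ + ct%:P in pN; pose z := ('X - t%:P) * a + c'%:P * q + P * (c'%:P - r * a).
have uyE : u * (q + P) = p%:Z *: z + a * f.
  rewrite /z -mul_polyC -/P fE -mul_polyC rmorphXn /= -/P /u cE rmorphM /= -/P; ring.
have pN1 : (p%:Z ^+ n.-1 %| nrm f n (q + P))%Z.
  apply: (@nrm_dvd f n fm sf q ('X - t%:P) (p%:Z *: r) 1 1 _ _ _ qm); rewrite ?prednK ?leq_pred //.
    by rewrite fE scalerA -expr2 mulrC.
  by rewrite mulr1 /P -[p%:Z%:P]mulr1 mul_polyC.
have zN : ~~ (p%:Z %| nrm f n z)%Z.
  apply: nrm_coprime => //. have phiP : red p P = 0 by apply/(phi_eq0 pp); exists 1; rewrite -mul_polyC mulr1.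
  have fE' : red p f = ('X - (t%:~R)%:P) * red p q.
    rewrite fE rmorphD rmorphM /= rmorphB /= map_polyX map_polyC /= [X in _ + X](_ : _ = 0) ?addr0 //.
    by apply/(phi_eq0 pp); exists (p%:Z *: r); rewrite scalerA -expr2.
  have zE' : red p z = ('X - (t%:~R)%:P) * red p a + (c'%:~R)%:P * red p q.
    rewrite /z !rmorphD !rmorphM /= phiP mul0r addr0 rmorphB /= map_polyX !map_polyC /=. by [].
  have qt' : ~~ root (red p q) t%:~R.
    by rewrite rootE horner_map /= intrFp0.
  rewrite fE' coprimepMr coprimep_XsubC; apply/andP; split.
    rewrite zE' rootE !hornerE subrr mul0r add0r mulf_eq0 negb_or intrFp0 // nc' /=. exact: qt'.
  rewrite zE' addrC coprimep_sym coprimep_addl_mul coprimepMr coprimep_XsubC qt' /=. by rewrite coprimep_sym.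
have : (p%:Z ^+ n.+1 %| p%:Z ^+ n * nrm f n z)%Z.
  rewrite -nrmZ // -(@nrm_rm f n fm _ a) -uyE nrmM // -[n.+1](_ : 2 + n.-1 = _)%N; last by rewrite addSn addSn prednK.
  by rewrite exprD dvdz_mul.
by rewrite exprSr dvdz_mul2l ?(negPf zN) // expf_neq0.
Qed.
End NormBound.

Lemma dvdz_horner_sub (f : {poly int}) (m x y : int) : (m %| x - y)%Z -> (m %| f.[x] - f.[y])%Z.
Proof.
move=> h; elim/poly_ind: f => [|f c IH]; first by rewrite !horner0 subrr dvdz0.
rewrite !hornerMXaddC (_ : _ - _ = (f.[x] - f.[y]) * x + f.[y] * (x - y)); last by ring.
by apply: rpredD; [exact: dvdz_mulr | exact: dvdz_mull].
Qed.

Lemma dvdz_horner (f : {poly int}) (m x y : int) : (m %| x - y)%Z -> (m %| f.[y])%Z -> (m %| f.[x])%Z.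
Proof. by move=> h hy; rewrite -[f.[x]](subrK f.[y]) rpredD // dvdz_horner_sub. Qed.

Lemma factor_at (f : {poly int}) (t : int) : f \is monic -> (1 < size f)%N -> exists q,
  [/\ f = ('X - t%:P) * q + (f.[t])%:P, q \is monic & size q = (size f).-1].
Proof.
move=> fm sf; have : root (f - (f.[t])%:P) t by rewrite rootE !hornerE subrr.
case/factor_theorem => q e; exists q.
have fE : f = ('X - t%:P) * q + (f.[t])%:P by rewrite mulrC -e subrK.
have sc : (size (f.[t])%:P < size f)%N by rewrite (leq_ltn_trans (size_polyC_leq1 _)).
have m1 : ('X - t%:P) * q \is monic.
  by rewrite mulrC -e monicE lead_coefDl ?size_polyN // -monicE.
have qm : q \is monic by rewrite -(monicMl _ (monicXsubC t)).
split=> //; have : size (f - (f.[t])%:P) = size f by rewrite size_polyDl ?size_polyN.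
by rewrite e size_monicM ?polyXsubC_eq0 // size_XsubC addn2 => <-.
Qed.

(** * Residue classes modulo p and square factors of norms *)

Section Classes.
Variables (f : {poly int}) (n : nat).
Hypotheses (fm : f \is monic) (sf : size f = n.+1) (n0 : (0 < n)%N).
Variables (p : nat) (pp : prime p).
Local Notation phi := (red p).
Hypothesis sepf : separable_poly (phi f).
Implicit Types (u v : {poly int}).

Lemma phi_dvd (h a : {poly int}) : phi h %| phi a -> h \is monic -> exists q r, a = h * q + p%:Z *: r.
Proof.
move=> /dvdpP[q0 qE] hm; have [q qq] := phi_surj q0.
have [r rE] : exists r, a = h * q + p%:Z *: r by apply/(phi_eq pp); rewrite rmorphM /= qq mulrC.
by exists q, r.
Qed.

Lemma monic_lift (g : {poly 'F_p}) : g != 0 -> exists h : {poly int},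
  [/\ h \is monic, size h = size g & phi h %= g].
Proof.
move=> g0; pose g1 := (lead_coef g)^-1 *: g.
have lg : lead_coef g != 0 by rewrite lead_coef_eq0.
have sg1 : size g1 = size g by rewrite size_scale // invr_eq0.
have lg1 : lead_coef g1 = 1 by rewrite lead_coefZ mulVf.
pose d := (size g).-1; have dE : size g = d.+1 by rewrite /d prednK // size_poly_gt0.
pose hl : {poly int} := \poly_(i < d) (nat_of_ord g1`_i)%:Z.
pose h : {poly int} := 'X^d + hl.
have sz : (size hl < size ('X^d : {poly int}))%N.
  by rewrite size_polyXn ltnS size_poly.
exists h; split.
- by rewrite monicE lead_coefDl // lead_coefXn.
- by rewrite size_polyDl // size_polyXn dE.
have -> : phi h = g1.
  rewrite /h rmorphD /= map_polyXn; apply/polyP => i; rewrite coefD coefXn coef_map coef_poly /=.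
  case: (ltngtP i d) => id; rewrite ?addr0 ?rmorph0 ?add0r.
  - by rewrite -[(_%:Z)%:~R]/((nat_of_ord g1`_i)%:R) natr_Zp.
  - by rewrite nth_default // sg1 dE.
  by move: lg1; rewrite lead_coefE sg1 -/d id => ->.
by rewrite /g1 eqp_scale // invr_eq0.
Qed.

Lemma hensel_root (t : int) : (p%:Z %| f.[t])%Z -> exists t' : int,
  (p%:Z %| t' - t)%Z /\ (p%:Z ^+ 2 %| f.[t'])%Z.
Proof.
move=> /dvdzP[k kE].
have f't : (f^`().[t])%:~R != 0 :> 'F_p.
  have := sepf; rewrite unlock => /coprimep_root h.
  have /h : root (phi f) (t%:~R) by rewrite rootE horner_map /= kE intrFp0 // dvdz_mull. by rewrite deriv_map horner_map.
pose c : int := (nat_of_ord (- k%:~R / (f^`().[t])%:~R : 'F_p))%:Z.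
have cE : (p%:Z %| k + c * f^`().[t])%Z.
  rewrite -intrFp0 // rmorphD rmorphM /= /c -[(_%:Z)%:~R]/(_%:R) natr_Zp divfK // addrN //.
exists (t + p%:Z * c); split; first by rewrite addrC addKr dvdz_mulr.
have [r rE] : exists r : int, f.[t + p%:Z * c] = f.[t] + f^`().[t] * (p%:Z * c) + r * (p%:Z * c) ^+ 2.
  elim/poly_ind: (f) => [|g b [r rE]]; first by exists 0; rewrite deriv0 !horner0; ring.
  exists (r * (t + p%:Z * c) + g^`().[t]); rewrite derivD derivC derivM derivX !(hornerD, hornerM, hornerX, hornerC) rE; ring.
rewrite rE kE; have [e eE] := dvdzP cE.
apply/dvdzP; exists (e + r * c ^+ 2).
rewrite (_ : k * p%:Z + _ * _ = (k + c * f^`().[t]) * p%:Z); last by ring.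
by rewrite eE; ring.
Qed.

(* p^2 divides N(v) as soon as u and u' = u + Q v have the same common divisor with f mod p *)
Lemma class_diff u u' v (Q : int) : phi u - phi u' = (Q%:~R)%:P * phi v -> u - u' = Q *: v ->
  ~~ (p%:Z %| Q)%Z ->
  (p%:Z ^+ 2 %| nrm f n u)%Z -> (p%:Z ^+ 2 %| nrm f n u')%Z ->
  gcdp (phi u) (phi f) %| phi u' -> gcdp (phi u') (phi f) %| phi u ->
  (p%:Z ^+ 2 %| nrm f n v)%Z.
Proof.
move=> ephi euv pQ Nu Nu' d1 d2; set g := gcdp (phi u) (phi f).
have f0 : phi f != 0 by rewrite monic_neq0 // monic_map.
have g0 : g != 0 by rewrite gcdp_eq0 negb_and f0 orbT.
have sphi : size (phi f) = n.+1 by rewrite size_map_poly_id0 // (monicP fm) oner_eq0.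
have Q0 : (Q%:~R : 'F_p) != 0 by rewrite intrFp0.
have gv : g %| phi v.
  have : g %| (Q%:~R)%:P * phi v by rewrite -ephi dvdp_sub // dvdp_gcdl. by rewrite mul_polyC dvdpZr.
(* If the common divisor g has degree at least 2, [nrm_dvd] applies directly; degree 0 would make
   the norm prime to p. In degree 1 the common root lifts to t with p^2 dividing f(t), and
   [nrm_simple] shows that p^2 divides u(t) and u'(t), hence v(t). *)
have [s3|s3] := leqP 3 (size g).
  have [h [hm sh hg]] := monic_lift g0. have [q [r fE]] : exists q r, f = h * q + p%:Z *: r.
    by apply: phi_dvd hm; rewrite (eqp_dvdl _ hg) dvdp_gcdr.
  have [a [b vE]] : exists q r, v = h * q + p%:Z *: r.
    by apply: phi_dvd hm; rewrite (eqp_dvdl _ hg).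
  have sgn : (size g <= n.+1)%N by rewrite -sphi dvdp_leq // dvdp_gcdr. have := @nrm_dvd f n fm sf h q r a b v p%:Z (size g).-1 hm.
  rewrite sh prednK ?(leq_trans _ s3) // -ltnS prednK ?(leq_trans _ s3) // => /(_ erefl sgn fE vE).
  by apply: dvdz_trans; apply: dvdz_exp2l; rewrite -ltnS prednK // (leq_trans _ s3).
have s2 : size g = 2%N.
  apply/eqP; rewrite eqn_leq -ltnS s3 ltnNge; apply/negP => s1. have : coprimep (phi u) (phi f).
    by rewrite /coprimep -/g eqn_leq s1 lt0n size_poly_eq0.
  move/(nrm_coprime fm sf pp); rewrite (dvdz_trans _ Nu) //. by rewrite expr2 dvdz_mulr.
have [t0 gt0] : exists t0, g %= 'X - t0%:P.
  have [h [hm sh hg]] := monic_lift g0. move: sh hm hg; rewrite s2 => sh hm hg.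
  exists (- (h`_0)%:~R); suff e : phi h = 'X - (- (h`_0)%:~R)%:P by rewrite -e eqp_sym.
  rewrite rmorphN opprK; apply/polyP => i; rewrite coef_map coefD coefX coefC. case: i => [|[|i]] /=; rewrite ?add0r ?addr0 //.
    by move: hm => /monicP; rewrite lead_coefE sh => ->.
  by rewrite nth_default ?sh.
pose t1 : int := (nat_of_ord t0)%:Z.
have t1E : t1%:~R = t0 :> 'F_p by rewrite /t1 -[(_%:Z)%:~R]/(_%:R) natr_Zp.
have root_g (w : {poly int}) : g %| phi w -> (p%:Z %| w.[t1])%Z.
  by rewrite (eqp_dvdl _ gt0) dvdp_XsubCl rootE -t1E horner_map /= intrFp0.
have ft1 : (p%:Z %| f.[t1])%Z by apply: root_g; apply: dvdp_gcdr.
have [t [tt1 ft]] := hensel_root ft1.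
have tE : t%:~R = t0 :> 'F_p.
  by rewrite -t1E; apply/eqP; rewrite -subr_eq0 -rmorphB /= intrFp0.
have sf1 : (1 < size f)%N by rewrite sf ltnS.
have [q [fE qm sq]] := factor_at t fm sf1.
have {}sq : size q = n by rewrite sq sf.
have fE2 : exists r, f = ('X - t%:P) * q + (p%:Z ^+ 2) *: r.
  by have [k kE] := dvdzP ft; exists k%:P; rewrite {1}fE kE -mul_polyC -rmorphM /= [k * _]mulrC.
have [r fE'] := fE2.
have phif : phi f = ('X - t0%:P) * phi q.
  rewrite fE rmorphD rmorphM /= rmorphB /= map_polyX !map_polyC /= tE. have -> : (f.[t])%:~R = 0 :> 'F_p.
    by apply/eqP; rewrite intrFp0 // (dvdz_trans _ ft) // expr2 dvdz_mulr.
  by rewrite addr0.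
have qt : ~~ (p%:Z %| q.[t])%Z.
  have e : (q.[t])%:~R = (phi q).[t0] by rewrite -tE horner_map.
  rewrite -intrFp0 // e; move: sepf; rewrite phif unlock => /coprimep_root h. have := h t0; rewrite rootM root_XsubC eqxx => /(_ isT).
  by rewrite derivM derivXsubC mul1r hornerD hornerM hornerXsubC subrr mul0r addr0.
have main w : gcdp (phi w) (phi f) %= g -> (p%:Z ^+ 2 %| nrm f n w)%Z -> (p%:Z ^+ 2 %| w.[t])%Z.
  move=> gw Nw; have pw : (p%:Z %| w.[t])%Z.
    by apply: dvdz_horner tt1 _; apply: root_g; rewrite -(eqp_dvdl _ gw) dvdp_gcdl.
  have : root (w - (w.[t])%:P) t by rewrite rootE !hornerE subrr.
  case/factor_theorem => a wE; have {}wE : w = ('X - t%:P) * a + (w.[t])%:P.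
    by rewrite mulrC -wE subrK.
  apply: (@nrm_simple f n fm sf p t q a r (w.[t]) pp n0 qm sq fE' qt _ pw); last by rewrite -wE.
  have phiw : phi w = ('X - t0%:P) * phi a.
    rewrite wE rmorphD rmorphM /= rmorphB /= map_polyX !map_polyC /= tE.
    have -> : (w.[t])%:~R = 0 :> 'F_p by apply/eqP; rewrite intrFp0. by rewrite addr0.
  have := eqp_size gw; rewrite s2 phiw phif (eqp_size (gcdp_mul2l _ _ _)). rewrite size_monicM ?monicXsubC ?size_XsubC //; last first.
    rewrite gcdp_eq0 negb_and [X in _ || X](_ : _ = true) ?orbT // monic_neq0 // monic_map //.
  by case=> e; rewrite /coprimep; apply/eqP; exact: e.
have gg' : gcdp (phi u') (phi f) %= g.
  by apply/andP; split; rewrite dvdp_gcd dvdp_gcdr andbT.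
have pu := main u (eqpxx _) Nu; have pu' := main u' gg' Nu'.
have pv : (p%:Z ^+ 2 %| v.[t])%Z.
  have : (p%:Z ^+ 2 %| Q * v.[t])%Z by rewrite -hornerZ -euv hornerD hornerN rpredB. rewrite Gauss_dvdzr // coprimezXl //; move: pQ.
  by rewrite !dvdzE /= coprimezE /= prime_coprime.
have [b bE] : exists b, v = ('X - t%:P) * b + (p%:Z ^+ 2) *: (v.[t] %/ p%:Z ^+ 2)%Z%:P.
  have : root (v - (v.[t])%:P) t by rewrite rootE !hornerE subrr. case/factor_theorem => b vE; exists b.
  by rewrite -mul_polyC -rmorphM /= [p%:Z ^+ 2 * _]mulrC divzK // [_ * b]mulrC -vE subrK.
have := @nrm_dvd f n fm sf ('X - t%:P) q r b _ v (p%:Z ^+ 2) 1 (monicXsubC t) (size_XsubC t) n0 fE' bE.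
by rewrite expr1.
Qed.

End Classes.

Lemma expnDn_le a b n : ((a + b) ^ n <= 2 ^ n * (a ^ n + b ^ n))%N.
Proof.
have h c d : (c <= d -> (c + d) ^ n <= 2 ^ n * (c ^ n + d ^ n))%N.
  move=> cd; apply: (@leq_trans ((2 * d) ^ n)%N).
    by case: (n) => // k; rewrite leq_exp2r //; lia.
  by rewrite expnMn leq_mul2l leq_addl orbT.
have [/h//|/ltnW/h] := leqP a b.
by rewrite addnC [(b ^ n + _)%N]addnC.
Qed.

Lemma PoszX a n : (a ^ n)%N%:Z = a%:Z ^+ n.
Proof. by elim: n => // n IH; rewrite expnS PoszM IH exprS. Qed.

Lemma card_fibers (T : finType) (T' : eqType) (A : {set T}) (f : T -> T') (L : seq T') k :
  (forall x, x \in A -> f x \in L) ->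
  (forall y, y \in L -> (#|[set x in A | f x == y]| <= k)%N) -> (#|A| <= size L * k)%N.
Proof.
elim: L A => [|y L IH] A AL h.
  rewrite mul0n leqn0 cards_eq0; apply/eqP/setP => x; rewrite inE. by apply/negbTE/negP => /AL.
rewrite -(cardsID [set x | f x == y] A) mulSn; apply: leq_add.
  apply: leq_trans (h y (mem_head _ _)); apply: subset_leq_card. by apply/subsetP => x; rewrite !inE.
apply: IH => [x|z zL].
  by rewrite !inE => /andP[/negPf fx /AL]; rewrite in_cons fx.
apply: leq_trans (h z _); last by rewrite in_cons zL orbT.
by apply: subset_leq_card; apply/subsetP => x; rewrite !inE => /andP[/andP[_ ->] ->].
Qed.

(** * Lower bound for the number of ideals *)

Section Separation.
Variables (f : {poly int}) (n : nat).
Hypotheses (fm : f \is monic) (sf : size f = n.+1) (n0 : (0 < n)%N).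

Definition pw Y (w : {ffun 'I_n -> 'I_Y}) : {poly int} := rVpoly (\row_i (w i : nat)%:Z).

Lemma size_pw Y (w : {ffun 'I_n -> 'I_Y}) : (size (pw w) <= n)%N.
Proof. exact: size_poly. Qed.

Lemma coef_pw Y (w : {ffun 'I_n -> 'I_Y}) (i : 'I_n) : (pw w)`_i = (w i : nat)%:Z.
Proof. by rewrite coef_rVpoly_ord mxE. Qed.

Lemma box_pw Y (w : {ffun 'I_n -> 'I_Y}) : box n (pw w) Y%:Z.
Proof.
split=> [|i]; first exact: size_pw.
have [h|h] := ltnP i n; last by rewrite nth_default ?normr0 // (leq_trans (size_pw _)).
by rewrite -[i]/(nat_of_ord (Ordinal h)) coef_pw ger0_norm // lez_nat ltnW.
Qed.

(** The box is cut into cubes of side D, the least D > 0 with R <= C D^n. Two elements of S in one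
    cube would differ by a vector with entries at most D - 1, of norm at most C (D - 1)^n < R. So
    every cube holds at most one element of S. *)
Lemma sep_count : exists2 K : nat, (0 < K)%N & forall Y R (S : {set {ffun 'I_n -> 'I_Y}}), (0 < R)%N ->
  (forall w w', w \in S -> w' \in S -> w != w' -> (R%:Z <= `|nrm f n (pw w - pw w')|)) ->
  (#|S| * R <= K * (R + Y ^ n))%N.
Proof.
have [C0 C00 CP] := @nrm_bound f n fm; have [C CE] : exists C : nat, C0 = C%:Z.
  by case: C0 C00 {CP} => // C _; exists C.
rewrite {}CE in C00 CP.
exists (C * (2 ^ n * 2 ^ n))%N => [|Y R S R0 sep]; first by rewrite muln_gt0 -ltz_nat C00 -expnD expn_gt0.
have exD : exists D, (0 < D)%N && (R <= C * D ^ n)%N.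
  exists R; rewrite R0 /=; apply: leq_trans (leq_pmull _ _); last by rewrite -ltz_nat. by rewrite -{1}(expn1 R) leq_pexp2l.
have [D /andP[D0 RD] minD] := ex_minnP exD.
have lt : (C * D.-1 ^ n < R)%N.
  have [D1|D1] := posnP D.-1; first by rewrite D1 exp0n // muln0.
  rewrite ltnNge; apply/negP => h; have := minD D.-1; rewrite D1 h => /(_ isT). by rewrite -[X in (X <= _)%N](prednK D0) ltnn.
have divlt Y' (w : 'I_Y') : (w %/ D < (Y' %/ D).+1)%N by rewrite ltnS leq_div2r // ltnW.
pose q (w : {ffun 'I_n -> 'I_Y}) := [ffun i => Ordinal (divlt _ (w i))].
have inj : {in S &, injective q}.
  move=> w w' wS wS' e; apply/eqP; apply: contraT => ne. have := sep w w' wS wS' ne; rewrite leNgt => /negP[].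
  apply: (@le_lt_trans _ _ (C%:Z * D.-1%:Z ^+ n)); last by rewrite -PoszX -PoszM ltz_nat.
  apply: CP; split=> [|i]; first by rewrite size_leD // geq_max size_polyN !size_pw. have [h|h] := ltnP i n; last first.
    by rewrite nth_default ?normr0 // size_leD // geq_max size_polyN !(leq_trans (size_pw _)).
  rewrite coefB -[i]/(nat_of_ord (Ordinal h)) !coef_pw.
  have := congr1 (fun g : {ffun 'I_n -> 'I_(Y %/ D).+1} => nat_of_ord (g (Ordinal h))) e.
  rewrite !ffunE /=; move: (w _ : nat) (w' _ : nat) => a b ab.
  have ha := divn_eq a D; have hb := divn_eq b D; have ra := ltn_pmod a D0; have rb := ltn_pmod b D0.
  by rewrite ha hb ab; clear -ra rb D0; move: (a %% D)%N (b %% D)%N (b %/ D * D)%N ra rb => x y z; lia.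
have := @leq_card_in _ _ q (mem S) inj; rewrite card_ffun !card_ord => cS.
apply: (@leq_trans ((Y %/ D).+1 ^ n * (C * D ^ n))%N); first exact: leq_mul.
rewrite mulnCA -expnMn -!mulnA leq_mul2l; apply/orP; right.
apply: (@leq_trans ((Y + D) ^ n)%N); first by rewrite leq_exp2r // mulSn addnC leq_add2r leq_trunc_div.
apply: (leq_trans (expnDn_le _ _ _)); rewrite leq_mul2l; apply/orP; right; rewrite addnC mulnDr leq_add //.
  have [D1|D1] := posnP D.-1.
    have -> : D = 1%N by rewrite -(prednK D0) D1. by rewrite exp1n muln_gt0 expn_gt0.
  apply: (@leq_trans ((2 * D.-1) ^ n)%N); first by rewrite leq_exp2r //; lia.
  rewrite expnMn leq_mul2l; apply/orP; right; rewrite (leq_trans _ (ltnW lt)) // leq_pmull //.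
by rewrite leq_pmull // expn_gt0.
Qed.

End Separation.

(** As f is separable, gcd(u, f) is determined by the set of roots of f at which u vanishes. *)
Lemma gcd_roots (F : fieldType) (L : fieldExtType F) (f u u' : {poly F}) (rs : seq L) :
  map_poly (in_alg L) f %= \prod_(r <- rs) ('X - r%:P) -> separable_poly f ->
  (forall r, r \in rs -> root (map_poly (in_alg L) u) r = root (map_poly (in_alg L) u') r) ->
  gcdp u f %| u'.
Proof.
move=> fE sepf h; rewrite -(dvdp_map (in_alg L)) gcdp_map.
set G := gcdp _ _; have : G %| \prod_(r <- rs) ('X - r%:P) by rewrite -(eqp_dvdr _ fE) dvdp_gcdr.
move=> /dvdp_prod_XsubC[k Gk]; rewrite (eqp_dvdl _ Gk).
apply: uniq_roots_dvdp; last first.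
  rewrite uniq_rootsE mask_uniq //; move: sepf. by rewrite -(separable_map (in_alg L)) (eqp_separable fE) separable_prod_XsubC.
apply/allP => r rk; rewrite -h ?(mem_mask rk) //.
have : root G r by rewrite (eqp_root Gk) root_prod_XsubC.
by rewrite root_gcd => /andP[].
Qed.

(** Telescoping, with 1/i^2 <= 1/(i-1) - 1/i. *)
Lemma inv_sq_sum (B P : nat) : (0 < B)%N ->
  \sum_(B.+1 <= i < P) (i%:R ^- 2 : rat) <= B%:R^-1.
Proof.
move=> B0; have [PB|BP] := leqP P B.+1.
  by rewrite big_geq // invr_ge0.
have [k ->] : exists k, P = (B.+1 + k)%N by exists (P - B.+1)%N; rewrite subnKC // ltnW.
suff : \sum_(B.+1 <= i < B.+1 + k) (i%:R ^- 2 : rat) <= B%:R^-1 - (B + k)%:R^-1.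
  by move=> h; apply: (le_trans h); rewrite lerBlDr lerDl invr_ge0.
elim: k => [|k IH]; first by rewrite addn0 big_geq // addn0 subrr.
rewrite addnS big_nat_recr ?leq_addr //= (le_trans (lerD IH (lexx _))) //.
rewrite -addrA lerD2l addnS addSn -natr1.
have b0 : 0 < (B + k)%:R :> rat by rewrite ltr0n addn_gt0 B0.
move: ((B + k)%:R : rat) b0 => b b0.
have b1 : 0 < b + 1 by rewrite ltr_wpDr.
rewrite -subr_ge0 (_ : _ - _ = (b * (b + 1) ^+ 2)^-1); last by field; rewrite !gt_eqF.
by rewrite invr_ge0 mulr_ge0 ?exprn_ge0 // ltW.
Qed.

Lemma crt_common (f u : {poly int}) m : (0 < m)%N ->
  (forall p, prime p -> (p %| m)%N -> ~~ (p ^ 2 %| m)%N /\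
     exists t : nat, (p%:Z %| f.[t%:Z])%Z /\ (p%:Z %| u.[t%:Z])%Z) ->
  exists t : nat, [/\ (t < m)%N, (m%:Z %| f.[t%:Z])%Z & (m%:Z %| u.[t%:Z])%Z].
Proof.
elim/ltn_ind: m => m IH m0 h.
have [m1|m1] := leqP m 1; first by exists 0%N; split=> //; rewrite (_ : m = 1%N) ?dvd1z //; lia.
pose p := pdiv m; have pp : prime p := pdiv_prime m1; have pm : (p %| m)%N := pdiv_dvd m.
have [p2 [t [ft ut]]] := h p pp pm.
have [m' mE] := dvdnP pm; have p1 := prime_gt1 pp.
have m'0 : (0 < m')%N by move: m0; rewrite mE muln_gt0 => /andP[].
have [|//|q qp qm|t' [tm' ft' ut']] := IH m'; first by rewrite mE -[X in (X < _)%N]muln1 ltn_pmul2l.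
  have m'm : (m' %| m)%N by rewrite mE dvdn_mulr. have [q2 ex] := h q qp (dvdn_trans qm m'm).
  by split=> //; apply: contra q2 => d; apply: dvdn_trans d m'm.
have co : coprime p m'.
  rewrite prime_coprime //; apply: contra p2 => /dvdnP[k kE]. by rewrite mE kE -mulnA dvdn_mull.
pose s := (chinese p m' t t' %% m)%N.
have sp : (p%:Z %| s%:Z - t%:Z)%Z.
  rewrite -eqz_mod_dvd !modz_nat eqz_nat; apply/eqP; rewrite modn_dvdm ?mE ?dvdn_mull //. exact: chinese_modl.
have sm' : (m'%:Z %| s%:Z - t'%:Z)%Z.
  rewrite -eqz_mod_dvd !modz_nat eqz_nat; apply/eqP; rewrite modn_dvdm ?mE ?dvdn_mulr //. exact: chinese_modr.
have both (w : {poly int}) : (p%:Z %| w.[t%:Z])%Z -> (m'%:Z %| w.[t'%:Z])%Z -> (m%:Z %| w.[s%:Z])%Z.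
  move=> h1 h2; rewrite mE mulnC PoszM Gauss_dvdz.
    by rewrite (dvdz_horner sp h1) (dvdz_horner sm' h2).
  by rewrite coprimezE.
by exists s; rewrite ltn_mod m0; split=> //; apply: both.
Qed.

(** The pair stands for the ideal (m, x - t) of Z[x]/f, with quotient Z/m: a product of primes of
    degree one over distinct rational primes larger than B. *)
Definition ideal (f : {poly int}) B m t :=
  [&& (0 < m)%N, all (fun p => (B < p)%N && ~~ (p ^ 2 %| m)%N) (primes m) & (m%:Z %| f.[t%:Z])%Z].

Section LowerBound.
Variables (f : {poly int}) (n : nat).
Hypotheses (fm : f \is monic) (sf : size f = n.+1) (n0 : (0 < n)%N).
Hypothesis Hirr : forall u : {poly int}, u != 0 -> (size u <= n)%N ->
  exists a b (c : int), c != 0 /\ a * u + b * f = c%:P.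
Variables (sa sb : {poly int}) (sc : int).
Hypotheses (sc0 : sc != 0) (Hsep : sa * f + sb * f^`() = sc%:P).

Lemma sep_mod p : prime p -> (`|sc| < p)%N -> separable_poly (red p f).
Proof.
move=> pp lt; rewrite unlock deriv_map; apply/Bezout_coprimepP.
exists (map_poly intr sa, map_poly intr sb); rewrite /= -!rmorphM -rmorphD /= Hsep map_polyC /=.
apply/eqpP; exists (1, sc%:~R); rewrite ?oner_eq0 ?scale1r ?intrFp0 //=; last by rewrite alg_polyC.
by apply/negP; rewrite dvdzE => /dvdn_leq; rewrite absz_gt0 sc0 leqNgt lt => /(_ isT).
Qed.

Lemma nrm_diff_neq0 Y (w w' : {ffun 'I_n -> 'I_Y}) : w != w' -> nrm f n (pw w - pw w') != 0.
Proof.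
move=> ne; have [||a [b [c [c0 e]]]] := @Hirr (pw w - pw w').
- apply: contra ne => /eqP e; apply/eqP/ffunP => i; apply/val_inj/eqP; rewrite -eqz_nat.
  by rewrite -!coef_pw -subr_eq0 -coefB e coef0.
- by rewrite size_leD // geq_max size_polyN !size_pw.
exact: (@nrm_neq0 f n fm sf _ _ c _ c0 e).
Qed.

Lemma dvdz_le_norm (m : nat) (x : int) : x != 0 -> (m%:Z %| x)%Z -> m%:Z <= `|x|.
Proof. by move=> x0 d; rewrite -abszE lez_nat dvdn_leq // absz_gt0. Qed.

Section Scale.
Variables (Q A Y : nat).
Hypotheses (Q0 : (0 < Q)%N) (A0 : (0 < A)%N) (Y0 : (0 < Y)%N).
Hypothesis cone : forall (a : int) w (Y : int), box n w Y -> 0 < a -> A%:Z * Y <= a ->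
  2 * `|nrm f n (a%:P + w) - a ^+ n| <= a ^+ n.
Let W := {ffun 'I_n -> 'I_Y}.
(** The element is 1 modulo Q, so its norm is prime to Q; the large constant term brings it under
    [cone], so its norm is positive and of the order of Y^n. *)
Definition uw (w : W) : {poly int} := (1 + Q * (A * Y))%N%:Z%:P + Q%:Z *: pw w.
Definition mw (w : W) : nat := `|nrm f n (uw w)|%N.

Lemma uw_diff w w' : uw w - uw w' = Q%:Z *: (pw w - pw w').
Proof. by rewrite /uw opprD addrACA subrr add0r scalerBr. Qed.

Lemma uw_bound w : [/\ nrm f n (uw w) = (mw w)%:Z, (0 < mw w)%N,
   (Y ^ n <= 2 * mw w)%N & (mw w <= 2 * (2 * Q * A) ^ n * Y ^ n)%N].
Proof.
pose a := (1 + Q * (A * Y))%N.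
have : 2 * `|nrm f n (uw w) - a%:Z ^+ n| <= a%:Z ^+ n.
  apply: (cone (Y := (Q * Y)%N%:Z)) => //.
    split=> [|i]; first by rewrite (leq_trans (size_scale_leq _ _)) ?size_pw. by rewrite coefZ normrM PoszM ler_pM // (box_pw w).2.
  rewrite -PoszM lez_nat /a; lia.
rewrite -PoszX => h.
have aY : (Y ^ n <= a ^ n)%N by rewrite leq_exp2r // (leq_trans _ (leqnSn _)) // mulnA leq_pmull // muln_gt0 Q0.
have aY2 : (a ^ n <= (2 * Q * A) ^ n * Y ^ n)%N by rewrite -expnMn leq_exp2r // /a -!mulnA; have : (0 < Q * (A * Y))%N; [rewrite !muln_gt0 Q0 A0 | lia].
have a0 : (0 < a ^ n)%N by rewrite expn_gt0.
have h1 := ler_norm (nrm f n (uw w) - (a ^ n)%N%:Z); have h2 := ler_norm (- (nrm f n (uw w) - (a ^ n)%N%:Z)).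
rewrite normrN in h2; move: (`|_ - _|) h h1 h2 => y h h1 h2.
have N0 : 0 < nrm f n (uw w) by lia.
have e : nrm f n (uw w) = (mw w)%:Z by rewrite /mw abszE gtr0_norm.
by rewrite e in h1 h2 N0 *; split=> //; lia.
Qed.

Lemma uw_coprime w p : prime p -> (p %| Q)%N -> ~~ (p %| mw w)%N.
Proof.
move=> pp /dvdnP[k kE]; have := @nrm_cong1 f n fm sf p ((k * (A * Y))%N%:Z%:P + k%:Z *: pw w) (uw w) pp.
rewrite /uw kE => h; apply/negP => d.
have : (nrm f n (uw w))%:~R = 0 :> 'F_p by apply/eqP; rewrite intrFp0 // dvdzE.
rewrite /uw kE h ?[k * p]mulnC; first by move/eqP; rewrite oner_eq0.
rewrite scalerDr scalerA -PoszM addrA; congr (_ + _).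
  rewrite -mul_polyC -rmorphM -(rmorph1 polyC) -rmorphD; congr (_%:P). by rewrite -PoszM -PoszD; congr Posz; ring.
by rewrite [(p * k)%N]mulnC.
Qed.

(** The w are sorted by the set of roots of f modulo p at which [uw w] vanishes, which gives at most
    2^n classes. Within a class [class_diff] makes p^2 divide the norms of differences; these are
    not 0, so they are at least p^2 in absolute value and [sep] applies. *)
Lemma bad_count K p : (forall R (S : {set W}), (0 < R)%N ->
  (forall w w', w \in S -> w' \in S -> w != w' -> (R%:Z <= `|nrm f n (pw w - pw w')|)) ->
  (#|S| * R <= K * (R + Y ^ n))%N) ->
  prime p -> (`|sc| < p)%N -> ~~ (p %| Q)%N ->
  (#|[set w | p ^ 2 %| mw w]| * p ^ 2 <= 2 ^ n * K * (p ^ 2 + Y ^ n))%N.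
Proof.
move=> sep pp scp pQ; have sepf := sep_mod pp scp.
set phi := red p in sepf.
have f0 : phi f != 0 by rewrite monic_neq0 // monic_map.
have [L [rs fE _]] := FinSplittingFieldFor f0.
have p20 : (0 < p ^ 2)%N by rewrite expn_gt0 prime_gt0.
have srs : size rs = n.
  have := eqp_size fE; rewrite size_map_poly size_prod_XsubC. by rewrite /phi size_map_poly_id0 ?(monicP fm) ?oner_eq0 // sf => -[].
pose kap (w : W) := [ffun i : 'I_n => root (map_poly (in_alg L) (phi (uw w))) rs`_i].
set S := [set w | _].
have card2 : size (enum {ffun 'I_n -> bool}) = (2 ^ n)%N by rewrite -cardT card_ffun card_bool card_ord.
have := @card_fibers _ _ S kap (enum {ffun 'I_n -> bool}) ((K * (p ^ 2 + Y ^ n)) %/ p ^ 2).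
rewrite card2 => h; apply: (@leq_trans (2 ^ n * (K * (p ^ 2 + Y ^ n) %/ p ^ 2) * p ^ 2)%N).
  rewrite leq_mul2r; apply/orP; right; apply: h => [w _|y _]; first by rewrite mem_enum.
  rewrite leq_divRL //; apply: sep => // w w'; rewrite !inE => /andP[dw /eqP kw] /andP[dw' /eqP kw'] ne.
  have same : forall r, r \in rs -> root (map_poly (in_alg L) (phi (uw w))) r = root (map_poly (in_alg L) (phi (uw w'))) r.
    move=> r rr; have ir : (index r rs < n)%N by rewrite -srs index_mem.
    have := congr1 (fun g : {ffun 'I_n -> bool} => g (Ordinal ir)) (etrans kw (esym kw')). by rewrite !ffunE /= nth_index.
  apply: dvdz_le_norm; first exact: nrm_diff_neq0. have Nw (v : W) : (p ^ 2 %| mw v)%N -> (p%:Z ^+ 2 %| nrm f n (uw v))%Z.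
    by move=> d; rewrite -PoszX dvdzE.
  rewrite PoszX; apply: (@class_diff f n fm sf n0 p pp sepf (uw w) (uw w') _ Q%:Z).
  - by rewrite -rmorphB /= uw_diff -mul_polyC rmorphM /= map_polyC.
  - exact: uw_diff.
  - by rewrite dvdzE.
  - exact: Nw.
  - exact: Nw.
  - by apply: gcd_roots fE sepf _ => r /same.
  - by apply: gcd_roots fE sepf _ => r /same ->.
by rewrite -!mulnA leq_mul2l; apply/orP; right; exact: leq_trunc_div.
Qed.

End Scale.
End LowerBound.

Lemma dvd_sqfree (m : nat) (x : int) : (0 < m)%N -> all (fun p => ~~ (p ^ 2 %| m)%N) (primes m) ->
  (forall p, prime p -> (p %| m)%N -> (p%:Z %| x)%Z) -> (m%:Z %| x)%Z.
Proof.
move=> m0 /allP sq h; rewrite dvdzE /=; apply/dvdn_partP => // p; rewrite mem_primes => /and3P[pp _ pm].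
have -> : (m`_p = p)%N.
  rewrite p_part; have l1 : (0 < logn p m)%N by rewrite logn_gt0 mem_primes pp m0.
  have : ~~ (p ^ 2 %| m)%N by apply: sq; rewrite mem_primes pp m0.
  by rewrite pfactor_dvdn // -ltnNge ltnS => l2; rewrite (_ : logn p m = 1%N) ?expn1 //; apply/eqP; rewrite eqn_leq l2.
by have := h p pp pm; rewrite dvdzE.
Qed.

Lemma prime_ndvd_fact p B : prime p -> (B < p)%N -> ~~ (p %| B`!)%N.
Proof.
move=> pp; elim: B => [|B IH] Bp; first by rewrite dvdn1 gtn_eqF // prime_gt1.
rewrite factS Euclid_dvdM // negb_or IH ?andbT; last exact: ltnW.
by apply/negP => /dvdn_leq => /(_ isT); rewrite leqNgt Bp.
Qed.

Lemma dvd_horner_lin (m t : int) (u : {poly int}) : (m %| u.[t])%Z ->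
  exists q r, u = ('X - t%:P) * q + m *: r.
Proof.
move=> ud; have : root (u - (u.[t])%:P) t by rewrite rootE hornerD hornerN hornerC subrr.
case/factor_theorem => b uE; exists b, (u.[t] %/ m)%Z%:P.
by rewrite -mul_polyC -rmorphM /= [m * _]mulrC divzK // mulrC -uE subrK.
Qed.

Section Lower.
Variables (f : {poly int}) (n : nat).
Hypotheses (fm : f \is monic) (sf : size f = n.+1) (n0 : (0 < n)%N).

(** Since p divides the norm exactly once, the gcd of u and f modulo p has degree exactly 1. *)
Lemma common_root p (u : {poly int}) : prime p -> (p%:Z %| nrm f n u)%Z -> ~~ (p%:Z ^+ 2 %| nrm f n u)%Z ->
  exists t : nat, (p%:Z %| f.[t%:Z])%Z /\ (p%:Z %| u.[t%:Z])%Z.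
Proof.
move=> pp d nd; set g := gcdp (red p u) (red p f).
have f0 : red p f != 0 by rewrite monic_neq0 // monic_map.
have sphi : size (red p f) = n.+1 by rewrite size_map_poly_id0 // (monicP fm) oner_eq0.
have g0 : g != 0 by rewrite gcdp_eq0 negb_and f0 orbT.
have [h [hm sh hg]] := monic_lift g0.
have sgn : (size g <= n.+1)%N by rewrite -sphi dvdp_leq // dvdp_gcdr.
have [q [r fE]] : exists q r, f = h * q + p%:Z *: r.
  by apply: phi_dvd hm; rewrite ?(eqp_dvdl _ hg) ?dvdp_gcdr.
have [a [b uE]] : exists q r, u = h * q + p%:Z *: r.
  by apply: phi_dvd hm; rewrite ?(eqp_dvdl _ hg) ?dvdp_gcdl.
have s1 : (1 < size g)%N.
  rewrite ltnNge; apply/negP => s1; move: d; apply/negP; apply: nrm_coprime => //.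
  by rewrite /coprimep -/g eqn_leq s1 lt0n size_poly_eq0.
have s2 : size h = 2%N.
  apply/eqP; rewrite sh eqn_leq s1 andbT leqNgt; apply: contra nd => s3. have sE : (size g).-1.+1 = size g by rewrite prednK // ltnW.
  have := @nrm_dvd f n fm sf h q r a b u p%:Z (size g).-1 hm.
  rewrite sh -ltnS sE => /(_ erefl sgn fE uE); apply: dvdz_trans; apply: dvdz_exp2l. by rewrite -ltnS sE.
pose t : nat := nat_of_ord (- (h`_0)%:~R : 'F_p).
have ht : (p%:Z %| h.[t%:Z])%Z.
  have -> : h.[t%:Z] = h`_0 + t%:Z.
    rewrite horner_coef s2 big_ord_recl big_ord1 expr0 mulr1 expr1.
    by move: hm => /monicP; rewrite lead_coefE s2 /= => ->; rewrite mul1r.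
  rewrite -intrFp0 // rmorphD /= -[(t%:Z)%:~R]/(t%:R) /t natr_Zp. by rewrite subrr.
exists t; rewrite fE uE !hornerD !hornerM !hornerZ.
by rewrite !rpredD ?(dvdz_mulr _ ht) // dvdz_mulr.
Qed.

Hypothesis Hirr : forall u : {poly int}, u != 0 -> (size u <= n)%N ->
  exists a b (c : int), c != 0 /\ a * u + b * f = c%:P.
Variables (sa sb : {poly int}) (sc : int).
Hypotheses (sc0 : sc != 0) (Hsep : sa * f + sb * f^`() = sc%:P).

(** For at least half of the w the norm m of [uw w] is squarefree, and m together with a common root
    t of f and [uw w] modulo m is an ideal. One ideal comes from at most 3K of the w, because then
    the vectors w differ by elements of norm at least m >= Y^n / 2. *)
Lemma ideal_lower : exists B1 : nat, forall B, (B1 <= B)%N -> exists c1 c2 Y0 : nat,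
  forall Y, (Y0 <= Y)%N -> exists L : seq (nat * nat), [/\ uniq L,
    forall x, x \in L -> [/\ ideal f B x.1 x.2, (x.2 < x.1)%N, (Y ^ n <= 2 * x.1)%N & (x.1 <= c2 * Y ^ n)%N] &
    (Y ^ n <= c1 * size L)%N].
Proof.
have [K K0 sep] := sep_count fm sf n0.
have [A0 A00 cone] := @nrm_cone f n fm sf; have [A AE] : exists A : nat, A0 = A%:Z.
  by case: A0 A00 {cone} => // A _; exists A.
rewrite {}AE ltz_nat in A00 cone.
pose M := (2 ^ n * K)%N; have M0 : (0 < M)%N by rewrite muln_gt0 expn_gt0.
(* The number of bad w is at most the sum of M (1 + Y^n / p^2) over B < p <= P, hence at most M P +
   M Y^n / B. With B >= 4M and P = Y^n / (4M) each term is at most Y^n / 4. B >= |sc| keeps f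
   separable modulo p. *)
exists (4 * M + `|sc|)%N => B BB.
pose Q := B`!; have Q0 : (0 < Q)%N := fact_gt0 B.
pose c2 := (2 * (2 * Q * A) ^ n)%N.
(* All norms are at most c2 Y^n, so Y > (4M)^2 c2 forces p <= P whenever p^2 divides one of them. *)
exists (6 * K)%N, c2, ((4 * M) ^ 2 * c2).+1 => Y YY.
have Y0 : (0 < Y)%N by apply: leq_trans YY.
have YYn : (Y <= Y ^ n)%N by rewrite -{1}(expn1 Y) leq_pexp2l.
pose W := {ffun 'I_n -> 'I_Y}; pose m (w : W) := @mw f n Q A Y w.
have bnd w := uw_bound fm sf n0 sc0 Q0 A00 Y0 cone w.
have primB w p : prime p -> (p %| m w)%N -> (B < p)%N.
  move=> pp pm; rewrite ltnNge; apply/negP => pB.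
  have := @uw_coprime f n fm sf Q A Y w p pp; rewrite dvdn_fact ?prime_gt0 // => /(_ isT). by rewrite pm.
pose Bad := [set w : W | ~~ all (fun p => ~~ (p ^ 2 %| m w)%N) (primes (m w))].
pose P := (Y ^ n %/ (4 * M))%N.
have badP w : w \in Bad -> exists p, [/\ prime p, (B < p)%N, (p < P.+1)%N & (p ^ 2 %| m w)%N].
  rewrite inE => /allPn[p]; rewrite mem_primes negbK => /and3P[pp _ pm] p2; exists p; split=> //.
    exact: primB pm.
  have [_ mw0 _ mw2] := bnd w; have p2m := dvdn_leq mw0 p2. have M4 : (0 < 4 * M)%N by rewrite muln_gt0.
  rewrite ltnS leq_divRL // -(@leq_exp2r _ _ 2) //. rewrite expnMn; apply: (@leq_trans (c2 * Y ^ n * (4 * M) ^ 2)%N).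
    by rewrite leq_mul2r; apply/orP; right; apply: leq_trans p2m mw2.
  rewrite mulnAC mulnC -[X in (_ <= X ^ 2)%N]/(Y ^ n)%N expnS expn1 leq_mul2l; apply/orP; right.
  by rewrite mulnC; apply: leq_trans (ltnW YY) YYn.
have cardBad : (2 * #|Bad| <= Y ^ n)%N.
  have step1 : (#|Bad| <= \sum_(B.+1 <= p < P.+1 | prime p) #|[set w : W | p ^ 2 %| m w]|)%N.
    under eq_bigr do rewrite -sum1_card.
    rewrite -sum1_card (exchange_big_dep predT) //=. rewrite big_mkcond [leqRHS]big_mkcond; apply: leq_sum => w _.
    case: ifP => // /badP[p [pp pB pP p2]]. rewrite big_mkcond (bigD1_seq p) ?iota_uniq ?mem_index_iota ?pB ?pP //=.
    by rewrite pp inE p2.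
  have step2 : (#|Bad|%:R : rat) <= M%:R * (P%:R + (Y ^ n)%:R / B%:R).
    apply: (@le_trans _ _ (\sum_(B.+1 <= p < P.+1 | prime p) (#|[set w : W | (p ^ 2 %| m w)%N]|%:R : rat))).
      by rewrite -natr_sum ler_nat.
    apply: (@le_trans _ _ (\sum_(B.+1 <= p < P.+1) (M%:R * (1 + (Y ^ n)%:R * p%:R ^- 2) : rat))).
      rewrite big_mkcond /= [leLHS]big_nat [leRHS]big_nat; apply: ler_sum => p /andP[pB _].
      have p20 : 0 < p%:R ^+ 2 :> rat by rewrite exprn_gt0 // ltr0n; lia.
      case: ifP => pp; last by rewrite mulr_ge0 // addr_ge0 // mulr_ge0 // invr_ge0 ltW.
      have pQ : ~~ (p %| Q)%N by apply: prime_ndvd_fact => //; lia. have scp : (`|sc| < p)%N by clear -BB pB; lia.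
      have := @bad_count f n fm sf n0 Hirr sa sb sc sc0 Hsep Q A Y K p (sep Y) pp scp pQ. rewrite -(ler_nat rat) natrM natrX => h.
      rewrite -(ler_pM2r p20); apply: (le_trans h); rewrite -/M natrM natrD natrX.
      rewrite le_eqVlt; apply/orP; left; apply/eqP; field; rewrite pnatr_eq0; lia.
    rewrite -mulr_sumr big_split /= -mulr_sumr ler_wpM2l // lerD //.
      rewrite big_const_nat iter_addr addr0 subSS ler_nat leq_subr //.
    by rewrite ler_wpM2l // inv_sq_sum //; lia.
  rewrite -(ler_nat rat) natrM. have hP : P%:R * (4 * M%:R) <= (Y ^ n)%:R :> rat by rewrite -!natrM ler_nat leq_trunc_div.
  have hB : 4 * M%:R <= B%:R :> rat by rewrite -natrM ler_nat; lia. have M0' : 0 < M%:R :> rat by rewrite ltr0n.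
  have hY : 0 <= (Y ^ n)%:R :> rat by []. have B0 : 0 < B%:R :> rat by rewrite (lt_le_trans _ hB) // mulr_gt0.
  have h2 : M%:R * ((Y ^ n)%:R / B%:R) * 4 <= (Y ^ n)%:R :> rat.
    have -> : M%:R * ((Y ^ n)%:R / B%:R) * 4 = (Y ^ n)%:R * (4 * M%:R) / B%:R :> rat by ring. by rewrite ler_pdivrMr // ler_wpM2l.
  have hP' : M%:R * P%:R * 4 <= (Y ^ n)%:R :> rat by apply: le_trans hP; rewrite le_eqVlt; apply/orP; left; apply/eqP; ring.
  rewrite mulrDr in step2; clear -step2 hP' h2; move: step2 hP' h2.
  set a : rat := #|Bad|%:R; set b : rat := (Y ^ n)%:R; set c : rat := M%:R * P%:R; set d : rat := M%:R * _.
  by clearbody a b c d; move=> h1 h2 h3; lra.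
pose G := ~: Bad.
have cardG : (Y ^ n <= 2 * #|G|)%N.
  have := cardsC Bad; rewrite -/G card_ffun !card_ord => e; lia.
have mwG w : w \in G -> all (fun p => ~~ (p ^ 2 %| m w)%N) (primes (m w)).
  by rewrite !inE negbK.
have exT w : w \in G -> exists t : nat, [/\ (t < m w)%N, ((m w)%:Z %| f.[t%:Z])%Z & ((m w)%:Z %| (uw Q A w).[t%:Z])%Z].
  move=> /mwG/allP wG; have [e mw0 _ _] := bnd w.
  apply: crt_common => // p pp pm; have np2 : ~~ (p ^ 2 %| m w)%N by apply: wG; rewrite mem_primes pp mw0.
  by split=> //; apply: common_root pp _ _; rewrite e ?dvdzE // abszX.
pose tau w := if pselect (exists t : nat, [/\ (t < m w)%N, ((m w)%:Z %| f.[t%:Z])%Z & ((m w)%:Z %| (uw Q A w).[t%:Z])%Z])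
  is left h then sval (cid h) else 0%N.
have tauP w : w \in G -> [/\ (tau w < m w)%N, ((m w)%:Z %| f.[(tau w)%:Z])%Z & ((m w)%:Z %| (uw Q A w).[(tau w)%:Z])%Z].
  by move=> /exT ex; rewrite /tau; case: pselect => // h; case: cid.
pose L := undup [seq (m w, tau w) | w <- enum G].
exists L; split; first exact: undup_uniq.
  move=> x; rewrite mem_undup => /mapP[w]; rewrite mem_enum => wG -> /=.
  have [e mw0 lo hi] := bnd w; have [t1 t2 t3] := tauP w wG; split=> //. rewrite /ideal mw0 t2 andbT /=; apply/allP => p pm.
  move: (pm); rewrite mem_primes => /and3P[pp _ pd]. by rewrite (primB w p) //=; apply: (allP (mwG w wG)).
have := @card_fibers _ _ G (fun w => (m w, tau w)) L (3 * K).
have inL w : w \in G -> (m w, tau w) \in L.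
  by move=> wG; rewrite mem_undup; apply/mapP; exists w; rewrite // mem_enum.
move=> /(_ inL) fib; apply: (leq_trans cardG).
rewrite (_ : (6 * K * size L = 2 * (size L * (3 * K)))%N) ?leq_mul2l; last by ring.
apply: fib => [[m1 t1]] yL.
have [m10 lo] : (0 < m1)%N /\ (Y ^ n <= 2 * m1)%N.
  move: yL; rewrite mem_undup => /mapP[w]; rewrite mem_enum => wG [-> _]. by have [_ ? ? _] := bnd w.
rewrite -(leq_pmul2r m10); apply: (leq_trans (sep Y m1 _ m10 _)).
  move=> w w'; rewrite !inE => /andP[wG /eqP[e1 e2]] /andP[wG' /eqP[e1' e2']] ne. have {}wG : w \in G by rewrite !inE.
  have {}wG' : w' \in G by rewrite !inE. apply: dvdz_le_norm; first exact: (nrm_diff_neq0 fm sf Hirr).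
  have [_ ft ut] := tauP w wG; have [_ _ ut'] := tauP w' wG'. rewrite e1 e2 in ft ut; rewrite e1' e2' in ut'.
  have pv : (m1%:Z %| (pw w - pw w').[t1%:Z])%Z.
    have : (m1%:Z %| Q%:Z * (pw w - pw w').[t1%:Z])%Z.
      by rewrite -hornerZ -(uw_diff Q A) hornerD hornerN rpredB.
    rewrite Gauss_dvdzr // coprimezE /= /coprime; apply: contraT => g1. have g0 : (0 < gcdn m1 Q)%N by rewrite gcdn_gt0 m10.
    have {}g1 : (1 < gcdn m1 Q)%N by lia. have pp := pdiv_prime g1; have pd := pdiv_dvd (gcdn m1 Q).
    have := @uw_coprime f n fm sf Q A Y w _ pp (dvdn_trans pd (dvdn_gcdr _ _)).
    by rewrite (_ : mw f Q A w = m1) // (dvdn_trans pd (dvdn_gcdl _ _)).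
  have [q1 [r1 fE1]] := dvd_horner_lin ft; have [a1 [b1 vE1]] := dvd_horner_lin pv.
  have := @nrm_dvd f n fm sf _ q1 r1 a1 b1 _ m1%:Z 1 (monicXsubC t1%:Z) (size_XsubC _) n0 fE1 vE1. by rewrite expr1.
by rewrite [(3 * K)%N]mulnC -mulnA leq_mul2l; apply/orP; right; lia.
Qed.

End Lower.

(** * Upper bound for the number of ideals and for the sum of inverse norms *)

Lemma two_roots_dvd p (s s' : int) (u : {poly int}) : prime p ->
  (p%:Z %| u.[s])%Z -> (p%:Z %| u.[s'])%Z -> ~~ (p%:Z %| s - s')%Z ->
  red p (('X - s%:P) * ('X - s'%:P)) %| red p u.
Proof.
move=> pp us us' ne; rewrite rmorphM !rmorphB /= map_polyX !map_polyC /=.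
have e (t : int) : (p%:Z %| u.[t])%Z -> ('X - (t%:~R)%:P %| red p u).
  by move=> ut; rewrite dvdp_XsubCl rootE horner_map /= intrFp0.
rewrite Gauss_dvdp ?e //; apply: coprimep_XsubC2.
by rewrite -rmorphB /= intrFp0 // -opprB rpredN.
Qed.

Lemma root_floor m n : (0 < n)%N -> exists y, (y ^ n <= m < y.+1 ^ n)%N.
Proof.
move=> n0; have exY : exists y, (m < y.+1 ^ n)%N.
  by exists m; rewrite (leq_trans (ltnSn m)) // -{1}(expn1 m.+1) leq_pexp2l.
have [y my miny] := ex_minnP exY; exists y; rewrite my andbT.
case: y miny {my} => [|y] miny; first by rewrite exp0n.
by rewrite leqNgt; apply/negP => /miny; rewrite ltnn.
Qed.

Section Upper.
Variables (f : {poly int}) (n : nat).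
Hypotheses (fm : f \is monic) (sf : size f = n.+1) (n0 : (0 < n)%N).

Lemma nrm_two_roots p (s s' : int) (u : {poly int}) : prime p ->
  (p%:Z %| f.[s])%Z -> (p%:Z %| f.[s'])%Z -> (p%:Z %| u.[s])%Z -> (p%:Z %| u.[s'])%Z ->
  ~~ (p%:Z %| s - s')%Z -> (p%:Z ^+ 2 %| nrm f n u)%Z.
Proof.
move=> pp fs fs' us us' ne; pose h := ('X - s%:P) * ('X - s'%:P).
have hm : h \is monic by rewrite monicMr ?monicXsubC.
have sh : size h = 3%N by rewrite size_monicM ?monicXsubC ?polyXsubC_eq0 // !size_XsubC.
have df := two_roots_dvd pp fs fs' ne.
have [q [r fE]] := phi_dvd pp df hm.
have [a [b uE]] := phi_dvd pp (two_roots_dvd pp us us' ne) hm.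
have n2 : (2 <= n)%N.
  have := dvdp_leq _ df; rewrite !size_map_poly_id0 ?(monicP fm) ?(monicP hm) ?oner_eq0 // sh sf.
  by apply; rewrite monic_neq0 // monic_map.
exact: (nrm_dvd fm sf hm sh n2 fE uE).
Qed.

Hypothesis Hirr : forall u : {poly int}, u != 0 -> (size u <= n)%N ->
  exists a b (c : int), c != 0 /\ a * u + b * f = c%:P.

(** Minkowski's argument by pigeonhole: more than m vectors with entries in 0..Y take equal values
    at s modulo m for two of them, and their difference is a short element of the ideal. *)
Lemma ideal_short : exists2 C : nat, (0 < C)%N & forall Y (m s : nat), (0 < m)%N -> (m < Y.+1 ^ n)%N ->
  (m%:Z %| f.[s%:Z])%Z -> exists (u : {poly int}),
  [/\ box n u Y%:Z, (m%:Z %| u.[s%:Z])%Z, (m%:Z %| nrm f n u)%Z, nrm f n u != 0 & `|nrm f n u| <= (C * Y ^ n)%N%:Z].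
Proof.
have [C0 C00 CP] := @nrm_bound f n fm; have [C CE] : exists C : nat, C0 = C%:Z.
  by case: C0 C00 {CP} => // C _; exists C.
rewrite {}CE ltz_nat in C00 CP; exists C => // Y m s m0 mY fms.
have lt x : (`|(x %% m%:Z)%Z| < m)%N.
  by rewrite -ltz_nat abszE ger0_norm ?modz_ge0 ?ltz_pmod // eqz_nat -lt0n.
pose g (w : {ffun 'I_n -> 'I_Y.+1}) := Ordinal (lt (pw w).[s%:Z]).
have /injectivePn[w [w' ne e]] : ~~ injectiveb g.
  apply/negP => /injectiveP/leq_card; rewrite card_ffun !card_ord => h. by have := leq_trans mY h; rewrite ltnn.
have us : (m%:Z %| (pw w - pw w').[s%:Z])%Z.
  rewrite hornerD hornerN -eqz_mod_dvd; have /(congr1 (fun i : 'I_m => (i : nat)%:Z)) := e.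
  by rewrite /= !abszE !ger0_norm ?modz_ge0 // ?eqz_nat -?lt0n // => ->.
have bx : box n (pw w - pw w') Y%:Z.
  split=> [|i]; first by rewrite size_leD // geq_max size_polyN !size_pw. have [h|h] := ltnP i n; last first.
    by rewrite nth_default ?normr0 // size_leD // geq_max size_polyN !(leq_trans (size_pw _)).
  rewrite coefB -[i]/(nat_of_ord (Ordinal h)) !coef_pw.
  by have := ltn_ord (w (Ordinal h)); have := ltn_ord (w' (Ordinal h)); move: (nat_of_ord (w _)) (nat_of_ord (w' _)) => a b; clear; lia.
exists (pw w - pw w'); split=> //; last 1 first.
- by rewrite PoszM PoszX; apply: CP.
- have [q1 [r1 fE1]] := dvd_horner_lin fms; have [a1 [b1 uE1]] := dvd_horner_lin us.
  by have := @nrm_dvd f n fm sf _ q1 r1 a1 b1 _ m%:Z 1 (monicXsubC s%:Z) (size_XsubC _) n0 fE1 uE1; rewrite expr1.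
exact: nrm_diff_neq0.
Qed.

(** An ideal (m, s) is recovered from a short element u, the cofactor c = |N(u)| / m and the residue
    of s modulo c. For a prime p dividing m and c, the last datum gives s modulo p. For the other p
    dividing m, p^2 does not divide N(u), so by [nrm_two_roots] there is only one common root of u
    and f modulo p. As c is bounded, the number of data is O(X). *)
Lemma ideal_upper : exists C : nat, forall B X (L : seq (nat * nat)), uniq L ->
  (forall x, x \in L -> [/\ ideal f B x.1 x.2, (x.2 < x.1)%N & (x.1 <= X)%N]) -> (size L <= C * X)%N.
Proof.
have [C C0 short] := ideal_short.
exists (3 ^ n * C.+1 * C.+1)%N => B X L uL LP.
have [X0|X0] := posnP X.
  case: L LP {uL} => [//|x L] /(_ _ (mem_head _ _))[/and3P[x0 _ _] _]. by rewrite X0 leqn0 => /eqP x1; rewrite x1 in x0.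
have [Y /andP[YX XY]] := root_floor X n0.
have Y0 : (0 < Y)%N by rewrite lt0n; apply/eqP => YE; move: XY; rewrite YE exp1n; lia.
pose T := ({ffun 'I_n -> 'I_(2 * Y).+1} * 'I_C.+1 * 'I_C.+1)%type.
have key x : exists k : T, x \in L -> exists u : {poly int}, [/\ box n u Y%:Z, (x.1%:Z %| u.[x.2%:Z])%Z,
    (forall i : 'I_n, (u`_i + Y%:Z = k.1.1 i :> int)), nrm f n u != 0 &
    `|nrm f n u|%N = (x.1 * k.1.2)%N /\ (x.2 %% k.1.2 = k.2)%N].
  case xL : (x \in L); last by exists ([ffun=> ord0], ord0, ord0). have [/and3P[m0 _ fms] sm mX] := LP x xL.
  have [y /andP[ym my]] := root_floor x.1 n0. have [u [[su bu] us mN N0 NC]] := short y x.1 x.2 m0 my fms.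
  have yY : (y <= Y)%N by rewrite -ltnS -(ltn_exp2r _ _ n0) (leq_ltn_trans ym) // (leq_ltn_trans mX).
  have bY : box n u Y%:Z by split=> // i; apply: le_trans (bu i) _; rewrite lez_nat.
  have [c cE] : exists c, `|nrm f n u|%N = (x.1 * c)%N by move: mN; rewrite dvdzE => /dvdnP[c ->]; exists c; rewrite mulnC.
  have c0 : (0 < c)%N by move: N0; rewrite -absz_gt0 cE muln_gt0 => /andP[]. have cC : (c < C.+1)%N.
    rewrite ltnS -(leq_pmul2l m0) -cE -lez_nat abszE; apply: le_trans NC _. by rewrite lez_nat mulnC leq_mul2r ym orbT.
  have rC : (x.2 %% c < C.+1)%N by rewrite (leq_trans _ cC) // ltnW // ltnS ltn_mod.
  have vY (i : 'I_n) : (absz (u`_i + Y%:Z)%R < (2 * Y).+1)%N by have := bY.2 i; clear; lia.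
  exists ([ffun i => Ordinal (vY i)], Ordinal cC, Ordinal rC) => _; exists u; split=> //= i.
  have h : 0 <= u`_i + Y%:Z by have := bY.2 i; clear; lia. by rewrite ffunE /= abszE ger0_norm.
pose kf x := sval (cid (key x)); have kfP x := svalP (cid (key x)).
have inj : {in L &, injective kf}.
  move=> [m s] [m' s'] xL xL' e; have [u [bu us uk N0 [Nm sr]]] := kfP _ xL. have [u' [bu' us' uk' _ [Nm' sr']]] := kfP _ xL'.
  rewrite -/(kf _) -e in uk' Nm' sr'; rewrite -/(kf _) in uk Nm sr. have uu : u' = u.
    apply/polyP => i; have [h|h] := ltnP i n; last by rewrite !nth_default // ?(leq_trans bu.1) ?(leq_trans bu'.1).
    by apply: (addIr Y%:Z); rewrite (uk (Ordinal h)) (uk' (Ordinal h)).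
  subst u'; have [/and3P[/= m0 /allP sq fs] /= sm _] := LP _ xL.
  have [/and3P[/= m0' _ fs'] /= sm' _] := LP _ xL'. move: (kf (m, s)).1.2 (kf (m, s)).2 Nm Nm' sr sr' => /= c r Nm Nm' sr sr'.
  have c0 : (0 < c)%N by move: N0; rewrite -absz_gt0 Nm muln_gt0 => /andP[].
  have mm : m' = m by apply/eqP; rewrite -(eqn_pmul2r c0) -Nm' Nm.
  subst m'; congr (_, _).
  suff : (m%:Z %| s%:Z - s'%:Z)%Z.
    by rewrite -eqz_mod_dvd !modz_nat eqz_nat !modn_small // => /eqP.
  have sq' p : p \in primes m -> ~~ (p ^ 2 %| m)%N by move=> /sq/andP[]. apply: dvd_sqfree => [//||p pp pm]; first by apply/allP.
  have [pc|pc] := boolP (p %| c)%N.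
    have : (s = s' %[mod c])%N by rewrite sr sr'. move=> /(congr1 (modn^~ p)) /=; rewrite !modn_dvdm // => /eqP ss.
    by rewrite -eqz_mod_dvd !modz_nat eqz_nat.
  apply: contraT => ne; have dm t : (m%:Z %| t)%Z -> (p%:Z %| t)%Z by apply: dvdz_trans; rewrite dvdzE.
  have := nrm_two_roots pp (dm _ fs) (dm _ fs') (dm _ us) (dm _ us') ne.
  rewrite dvdzE abszX /= Nm Gauss_dvdl; last by rewrite coprimeXl // prime_coprime. by rewrite (negPf (sq' p _)) // mem_primes pp m0.
have u2 : uniq (map kf L) by rewrite map_inj_in_uniq.
rewrite -(size_map kf) -(card_uniqP u2) (leq_trans (max_card _)) // !card_prod card_ffun !card_ord.
rewrite -!mulnA [X in (_ <= X)%N](_ : _ = (3 ^ n * X) * (C.+1 * C.+1))%N; last by ring.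
rewrite leq_mul2r; apply/orP; right; apply: (@leq_trans ((3 * Y) ^ n)%N); first by rewrite leq_exp2r //; lia.
by rewrite expnMn leq_mul2l YX orbT.
Qed.

End Upper.

Definition idl f B X (x : 'I_X.+1 * 'I_X.+1) := ideal f B x.1 x.2 && (x.2 < x.1)%N.
(** A truncation at 1 of the Dedekind zeta function, restricted to the ideals in question. *)
Definition zsum f B X : rat := \sum_(x | @idl f B X x) (x.1 : nat)%:R^-1.

Lemma sum_inj_le (I J : finType) (P : pred I) (Q : pred J) (phi : I -> J) (F : J -> rat) :
  (forall j, 0 <= F j) -> {in P &, injective phi} -> (forall i, P i -> Q (phi i)) ->
  \sum_(i | P i) F (phi i) <= \sum_(j | Q j) F j.
Proof.
move=> F0 inj PQ; rewrite -(big_imset F inj) big_mkcond [leRHS]big_mkcond /=.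
apply: ler_sum => j _; case: ifP => [/imsetP[i Pi ->]|_]; first by rewrite PQ.
by case: ifP.
Qed.

Lemma zsum_list f B X (L : seq (nat * nat)) : uniq L ->
  (forall x, x \in L -> [/\ ideal f B x.1 x.2, (x.2 < x.1)%N & (x.1 <= X)%N]) ->
  \sum_(x <- L) x.1%:R^-1 <= zsum f B X.
Proof.
move=> uL LP; pose c (x : nat * nat) : 'I_X.+1 * 'I_X.+1 := (inord x.1, inord x.2).
have cE x : x \in L -> ((c x).1 = x.1 :> nat) * ((c x).2 = x.2 :> nat).
  by move=> /LP[_ x21 xX]; rewrite /c /= !inordK // ltnS // ltnW // (leq_trans x21).
have inj : {in L &, injective c}.
  move=> x y xL yL e; have := cE _ xL; rewrite e !(cE _ yL) => -[]. by case: (x) (y) => ? ? [? ?] /= -> ->.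
have u2 : uniq (map c L) by rewrite map_inj_in_uniq.
rewrite big_seq (eq_bigr (fun x => ((c x).1 : nat)%:R^-1)) => [|x xL]; last by rewrite (cE _ xL).
rewrite -big_seq -(big_map c xpredT (fun y => ((y.1 : nat)%:R^-1 : rat))) big_uniq //.
rewrite /zsum [leRHS]big_mkcond [leLHS]big_mkcond /=; apply: ler_sum => y _.
case: ifP => [/mapP[x xL ->]|_]; last by case: ifP => _ //; rewrite invr_ge0.
by have [h1 h2 _] := LP x xL; rewrite /idl !(cE x xL) h1 h2.
Qed.

Section UpperSum.
Variables (f : {poly int}) (C : nat).
Hypothesis up : forall B X (L : seq (nat * nat)), uniq L ->
  (forall x, x \in L -> [/\ ideal f B x.1 x.2, (x.2 < x.1)%N & (x.1 <= X)%N]) -> (size L <= C * X)%N.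

Lemma idl_count B X k : (#|[set x | @idl f B X x && (x.1 <= k)%N]| <= C * k)%N.
Proof.
set A := [set x | _]; pose L := [seq (nat_of_ord x.1, nat_of_ord x.2) | x <- enum A].
rewrite cardE -(size_map (fun x => (nat_of_ord x.1, nat_of_ord x.2)) (enum A)).
apply: (up (B := B)).
  rewrite map_inj_uniq ?enum_uniq // => -[a b] [a' b'] /= [/ord_inj -> /ord_inj ->] //.
by move=> y /mapP[x]; rewrite mem_enum inE => /andP[/andP[? ?] ?] ->.
Qed.

(** The norms between 2^k and 2^(k+1) contribute at most C 2^(k+1) / 2^k = 2C. *)
Lemma zsum_upper B X k : (X <= 2 ^ k)%N -> zsum f B X <= (C * (2 * k + 1))%:R.
Proof.
move=> Xk; rewrite /zsum (eq_bigl (fun x => @idl f B X x && (x.1 <= 2 ^ k)%N)); last first.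
  by move=> x; rewrite (leq_trans _ Xk) ?andbT // -ltnS.
elim: k {Xk} => [|k IH].
  apply: (@le_trans _ _ (\sum_(x in [set x | @idl f B X x && (x.1 <= 1)%N]) 1)).
    rewrite [leRHS](eq_bigl (fun x => @idl f B X x && (x.1 <= 1)%N)); last by move=> x; rewrite inE.
    apply: ler_sum => x /andP[/andP[/andP[m0 _] _] _]. by rewrite invf_le1 ?ler1n ?ltr0n.
  by rewrite sumr_const ler_nat idl_count.
rewrite (bigID (fun x : 'I_X.+1 * 'I_X.+1 => (x.1 <= 2 ^ k)%N)) /=.
have -> : (C * (2 * k.+1 + 1))%:R = (C * (2 * k + 1))%:R + (2 * C)%:R :> rat by rewrite -natrD; congr _%:R; ring.
apply: lerD.
  apply: le_trans IH; rewrite le_eqVlt; apply/orP; left; apply/eqP/eq_bigl => x; rewrite -andbA.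
  case: (leqP x.1 (2 ^ k)%N) => h; rewrite ?andbF // !andbT. by rewrite (leq_trans h) ?andbT ?leq_exp2l.
apply: (@le_trans _ _ (\sum_(x in [set x | @idl f B X x && (x.1 <= 2 ^ k.+1)%N]) (2 ^ k)%:R^-1)).
  rewrite [leRHS](eq_bigl (fun x => @idl f B X x && (x.1 <= 2 ^ k.+1)%N)); last by move=> x; rewrite inE.
  rewrite big_mkcondr; apply: ler_sum => x /andP[/andP[/andP[m0 _] _] _]. case: ifP => [|_]; last by rewrite invr_ge0.
  by rewrite -ltnNge => h; rewrite lef_pV2 ?posrE ?ltr0n ?expn_gt0 // ler_nat ltnW.
rewrite sumr_const -[leLHS]mulr_natl ler_pdivrMr ?ltr0n ?expn_gt0 // -natrM ler_nat.
by rewrite (leq_trans (idl_count _ _ _)) // expnS mulnA [(C * 2)%N]mulnC.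
Qed.

End UpperSum.

Lemma root_count (f : {poly int}) n p : f \is monic -> size f = n.+1 -> prime p ->
  (#|[set r : 'I_p | (p%:Z %| f.[(r : nat)%:Z])%Z]| <= n)%N.
Proof.
move=> fm sf pp; set A := [set r | _].
have f0 : red p f != 0 by rewrite monic_neq0 // monic_map.
rewrite cardE -(size_map (fun r : 'I_p => (r : nat)%:R : 'F_p)) -ltnS -sf.
rewrite -(size_map_poly_id0 (f := (intr : int -> 'F_p))) ?(monicP fm) ?oner_eq0 //.
apply: max_poly_roots => //.
  apply/allP => _ /mapP[r rA ->]; move: rA; rewrite mem_enum inE => rA.
  by rewrite rootE -[(r : nat)%:R]/((r : nat)%:Z%:~R) horner_map /= intrFp0.
rewrite map_inj_uniq ?enum_uniq // => r r' /(congr1 val) /=; rewrite !val_Fp_nat // !modn_small //.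
exact: val_inj.
Qed.

Lemma ideal_dvd f B m m' t : (m' %| m)%N -> (0 < m')%N -> ideal f B m t -> ideal f B m' (t %% m')%N.
Proof.
move=> mm m'0 /and3P[m0 /allP h ft]; rewrite /ideal m'0 /=; apply/andP; split.
  apply/allP => q; rewrite mem_primes => /and3P[qp _ qm]. have : q \in primes m by rewrite mem_primes qp m0 (dvdn_trans qm).
  by move=> /h/andP[-> /=]; apply: contra => /dvdn_trans; apply.
have tt : (m'%:Z %| (t %% m')%N%:Z - t%:Z)%Z by rewrite -eqz_mod_dvd !modz_nat modn_mod.
by apply: dvdz_horner tt _; apply: dvdz_trans ft; rewrite dvdzE.
Qed.

(** * Pairs of ideals and their lifts to a larger field *)

Section PairSums.
Variables (f : {poly int}) (n B X : nat).
Hypotheses (fm : f \is monic) (sf : size f = n.+1).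
Let F (x : 'I_X.+1 * 'I_X.+1) : rat := (x.1 : nat)%:R^-1.
Let F0 x : 0 <= F x. Proof. by rewrite invr_ge0. Qed.

(** An ideal of norm m divisible by p is determined by an ideal of norm m / p and one of the at most
    n roots of f modulo p. *)
Lemma zsum_prime p : prime p ->
  \sum_(x | @idl f B X x && (p %| x.1)%N) F x <= n%:R / p%:R * zsum f B X.
Proof.
move=> pp; have p0 := prime_gt0 pp.
pose phi (x : 'I_X.+1 * 'I_X.+1) : ('I_X.+1 * 'I_X.+1) * 'I_p :=
  ((inord (x.1 %/ p), inord (x.2 %% (x.1 %/ p))), Ordinal (ltn_pmod x.2 p0)).
pose Q (z : ('I_X.+1 * 'I_X.+1) * 'I_p) := idl f B z.1 && (p%:Z %| f.[(z.2 : nat)%:Z])%Z.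
pose G (z : ('I_X.+1 * 'I_X.+1) * 'I_p) : rat := p%:R^-1 * F z.1.
have small x : @idl f B X x -> (p %| x.1)%N -> [/\ (0 < x.1 %/ p)%N,
   (phi x).1.1 = (x.1 %/ p)%N :> nat & (phi x).1.2 = (x.2 %% (x.1 %/ p))%N :> nat].
  move=> /andP[/and3P[m0 _ _] _] px; have q0 : (0 < x.1 %/ p)%N by rewrite divn_gt0 // dvdn_leq.
  have h1 : (x.1 %/ p < X.+1)%N by rewrite (leq_ltn_trans (leq_div _ _)).
  by split=> //=; rewrite inordK // (leq_trans _ h1) // ltnW // ltnS ltn_mod.
apply: (@le_trans _ _ (\sum_(z | Q z) G z)); last first.
  rewrite -(pair_big_dep (idl f B (X:=X)) (fun _ (r : 'I_p) => (p%:Z %| f.[(r : nat)%:Z])%Z) (fun x r => p%:R^-1 * F x)) /=.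
  rewrite mulr_sumr; apply: ler_sum => x _; rewrite sumr_const -/(F x) -[leLHS]mulr_natl mulrA.
  rewrite ler_wpM2r // ler_wpM2r ?invr_ge0 // ler_nat. by have := root_count fm sf pp; rewrite cardsE.
rewrite (eq_bigr (fun x => G (phi x))) => [|x /andP[xi px]]; last first.
  have [q0 e1 _] := small x xi px; rewrite /G /F e1 -invfM -natrM mulnC divnK //.
apply: sum_inj_le => [z|x y /andP[xi px] /andP[yi py] e|x /andP[xi px]].
- by rewrite mulr_ge0 ?invr_ge0.
- have [q0 e1 e2] := small x xi px; have [_ e1' e2'] := small y yi py.
  have m12 : x.1 = y.1.
    apply/val_inj => /=; rewrite -(divnK px) -(divnK py); congr (_ * _)%N. by rewrite -e1 -e1' e.
  have e3 : (x.2 %% p = y.2 %% p)%N by have := congr1 (fun z => nat_of_ord z.2) e.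
  have e4 : (x.2 %% (x.1 %/ p) = y.2 %% (x.1 %/ p))%N by rewrite -e2 e e2' m12.
  case: x y m12 xi yi px {py e e1 e1' e2 e2'} q0 e3 e4 => x1 x2 [y1 y2] /= <- /andP[/= /and3P[m0 /allP h _] xl] /andP[/= _ yl] px q0 e3 e4.
  congr (_, _); apply/val_inj => /=.
  have co : coprime p (x1 %/ p).
    rewrite prime_coprime //; apply/negP => /dvdnP[k kE]. have := h p; rewrite mem_primes pp m0 px => /(_ isT)/andP[_ /negP[]].
    by rewrite -(divnK px) kE -mulnA dvdn_mull.
  have : (x2 == y2 %[mod p * (x1 %/ p)]) by rewrite chinese_remainder // e3 e4 !eqxx. by rewrite mulnC divnK // !modn_small // => /eqP.
- have [q0 e1 e2] := small x xi px; have /andP[xI _] := xi.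
  rewrite /Q /idl e1 e2 ltn_mod q0 andbT; apply/andP; split.
    by apply: ideal_dvd xI; rewrite ?dvdn_div //; apply/dvdnP; exists p; rewrite mulnC divnK.
  have /and3P[_ _] := ideal_dvd px p0 xI; by [].
Qed.

(** Norms that are not coprime share a prime p > B, and the squares of n/p over these p add up to at
    most n^2 / B. *)
Lemma zsum_noncoprime : (0 < B)%N ->
  \sum_(x | @idl f B X x) \sum_(y | @idl f B X y && ~~ coprime x.1 y.1) F x * F y
    <= (n ^ 2)%:R / B%:R * zsum f B X ^+ 2.
Proof.
move=> B0; have Z0 : 0 <= zsum f B X by apply: sumr_ge0 => x _; apply: F0.
apply: (@le_trans _ _ (\sum_(B.+1 <= p < X.+1 | prime p) (n%:R / p%:R * zsum f B X) ^+ 2)).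
  apply: (@le_trans _ _ (\sum_(B.+1 <= p < X.+1 | prime p) (\sum_(x | @idl f B X x && (p %| x.1)%N) F x) ^+ 2)); last first.
    apply: ler_sum => p pp; rewrite lerXn2r ?nnegrE ?sumr_ge0 //; last exact: zsum_prime. by rewrite mulr_ge0 // divr_ge0.
  apply: (@le_trans _ _ (\sum_(x | @idl f B X x) \sum_(y | @idl f B X y) \sum_(B.+1 <= p < X.+1 | prime p)
     if (p %| x.1)%N && (p %| y.1)%N then F x * F y else 0)).
    apply: ler_sum => x xi; rewrite big_mkcondr; apply: ler_sum => y yi.
    have G0 p : 0 <= (if (p %| x.1)%N && (p %| y.1)%N then F x * F y else 0) by case: ifP => // _; rewrite mulr_ge0.
    case: ifP => [nc|_]; last by rewrite sumr_ge0. have /andP[/and3P[m0 /allP h _] _] := xi.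
    have g1 : (1 < gcdn x.1 y.1)%N by move: nc (gcdn_gt0 x.1 y.1); rewrite /coprime m0 /=; case: (gcdn _ _) => [|[|]].
    have pp := pdiv_prime g1; have pd := pdiv_dvd (gcdn x.1 y.1); move: (pdiv _) pp pd => p pp pd.
    have px := dvdn_trans pd (dvdn_gcdl _ _); have py := dvdn_trans pd (dvdn_gcdr _ _).
    have Bp : (B < p)%N by have := h p; rewrite mem_primes pp m0 px => /(_ isT)/andP[].
    have pX : (p < X.+1)%N by rewrite (leq_ltn_trans (dvdn_leq m0 px)).
    rewrite big_mkcond (bigD1_seq p) ?mem_index_iota ?Bp ?iota_uniq //= pp px py /= lerDl sumr_ge0 // => q _. by case: ifP.
  rewrite le_eqVlt; apply/orP; left; apply/eqP.
  under eq_bigr do rewrite exchange_big /=.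
  rewrite exchange_big /=; apply: eq_bigr => p pp. rewrite expr2 big_distrlr /= [RHS]big_mkcondr; apply: eq_bigr => x xi.
  case: (p %| x.1)%N => /=; last by rewrite big1. by rewrite [RHS]big_mkcondr.
rewrite (eq_bigr (fun p : nat => (n ^ 2)%:R * zsum f B X ^+ 2 * p%:R ^- 2)) => [|p _]; last first.
  by rewrite !exprMn natrX exprVn mulrAC.
rewrite -mulr_sumr [leRHS]mulrAC ler_wpM2l ?mulr_ge0 ?exprn_ge0 //.
apply: le_trans (inv_sq_sum X.+1 B0); rewrite big_mkcond; apply: ler_sum => p _.
by case: ifP => // _; rewrite invr_ge0 exprn_ge0.
Qed.

End PairSums.

Lemma coprime_ndvd p m n : prime p -> coprime m n -> (p %| m)%N -> ~~ (p %| n)%N.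
Proof. by move=> pp co pm; rewrite -prime_coprime // (coprime_dvdl pm co). Qed.

Lemma crt_choice (c : nat -> nat) m : (0 < m)%N -> all (fun p => ~~ (p ^ 2 %| m)%N) (primes m) ->
  exists2 s : nat, (s < m)%N & forall p, prime p -> (p %| m)%N -> (p%:Z %| s%:Z - (c p)%:Z)%Z.
Proof.
elim/ltn_ind: m => m IH m0 /allP sq.
have [m1|m1] := leqP m 1.
  by exists 0%N => // p pp pm; have := dvdn_leq m0 pm; have := prime_gt1 pp; lia.
pose p := pdiv m; have pp : prime p := pdiv_prime m1; have pm : (p %| m)%N := pdiv_dvd m.
have [m' mE] := dvdnP pm; have p1 := prime_gt1 pp.
have m'0 : (0 < m')%N by move: m0; rewrite mE muln_gt0 => /andP[].
have m'm : (m' %| m)%N by rewrite mE dvdn_mulr.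
have p2 : ~~ (p ^ 2 %| m)%N by apply: sq; rewrite mem_primes pp m0.
have [|//||s' s'm s'P] := IH m'; first by rewrite mE -[X in (X < _)%N]muln1 ltn_pmul2l.
  apply/allP => q; rewrite mem_primes => /and3P[qp _ qm]. have : q \in primes m by rewrite mem_primes qp m0 (dvdn_trans qm).
  by move=> /sq; apply: contra => /dvdn_trans; apply.
have co : coprime p m'.
  rewrite prime_coprime //; apply: contra p2 => /dvdnP[k kE]. by rewrite mE kE -mulnA dvdn_mull.
exists (chinese p m' (c p) s' %% m)%N => [|q qp]; first by rewrite ltn_mod.
rewrite {1}mE Euclid_dvdM // (dvdn_prime2 qp pp) => /orP[qm'|/eqP ->].
  have e : (chinese p m' (c p) s' %% m = s' %[mod q])%N.
    rewrite modn_dvdm ?(dvdn_trans qm' m'm) // -(modn_dvdm _ qm') chinese_modr // modn_dvdm //.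
  have : (q%:Z %| (chinese p m' (c p) s' %% m)%N%:Z - s'%:Z)%Z by rewrite -eqz_mod_dvd !modz_nat eqz_nat e.
  by move=> /rpredD/(_ (s'P q qp qm')); rewrite addrA subrK.
by rewrite -eqz_mod_dvd !modz_nat eqz_nat modn_dvdm ?mE ?dvdn_mull // chinese_modl.
Qed.

Section Split.
Variables (f g h : {poly int}) (d B X : nat).
Hypotheses (d0 : (0 < d)%N) (dB : (d <= B)%N).
(** In the application h(zM) = d zL for the generators, so the congruence h(s) = d t says that the
    prime (p, s) of M lies above the prime (p, t) of L. *)
Hypothesis two : forall p t : nat, prime p -> (B < p)%N -> (p%:Z %| f.[t%:Z])%Z -> exists s : nat * nat,
  [/\ (p%:Z %| g.[s.1%:Z])%Z, (p%:Z %| g.[s.2%:Z])%Z, (p%:Z %| h.[s.1%:Z] - d%:Z * t%:Z)%Z,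
      (p%:Z %| h.[s.2%:Z] - d%:Z * t%:Z)%Z & ~~ (p%:Z %| s.1%:Z - s.2%:Z)%Z].
Let F (x : 'I_X.+1 * 'I_X.+1) : rat := (x.1 : nat)%:R^-1.

(** A pair of ideals of L with coprime norms goes to one ideal of M, built with the first lift at
    the primes of the first ideal and with the second lift at those of the second. The lifts differ
    modulo p, so the pair can be read off from the image; norms are multiplied. *)
Lemma zsum_coprime : \sum_(x | @idl f B X x) \sum_(y | @idl f B X y && coprime x.1 y.1) F x * F y
  <= zsum g B (X * X).
Proof.
have pair p t : exists s : nat * nat, prime p -> (B < p)%N -> (p%:Z %| f.[t%:Z])%Z ->
  [/\ (p%:Z %| g.[s.1%:Z])%Z, (p%:Z %| g.[s.2%:Z])%Z, (p%:Z %| h.[s.1%:Z] - d%:Z * t%:Z)%Z,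
      (p%:Z %| h.[s.2%:Z] - d%:Z * t%:Z)%Z & ~~ (p%:Z %| s.1%:Z - s.2%:Z)%Z].
  case: (pselect [/\ prime p, (B < p)%N & (p%:Z %| f.[t%:Z])%Z]) => [[pp Bp ft]|no].
    by have [s sP] := two pp Bp ft; exists s.
  by exists (0%N, 0%N) => pp Bp ft; case: no.
pose c p t := sval (cid (pair p t)).
have cP p t : prime p -> (B < p)%N -> (p%:Z %| f.[t%:Z])%Z ->
  [/\ (p%:Z %| g.[(c p t).1%:Z])%Z, (p%:Z %| g.[(c p t).2%:Z])%Z, (p%:Z %| h.[(c p t).1%:Z] - d%:Z * t%:Z)%Z,
      (p%:Z %| h.[(c p t).2%:Z] - d%:Z * t%:Z)%Z & ~~ (p%:Z %| (c p t).1%:Z - (c p t).2%:Z)%Z] := svalP (cid (pair p t)).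
pose q (z : ('I_X.+1 * 'I_X.+1) * ('I_X.+1 * 'I_X.+1)) p :=
  if (p %| z.1.1)%N then (c p (z.1.2 %% p)%N).1 else (c p (z.2.2 %% p)%N).2.
pose P (z : ('I_X.+1 * 'I_X.+1) * ('I_X.+1 * 'I_X.+1)) := [&& idl f B z.1, idl f B z.2 & coprime z.1.1 z.2.1].
have sqP (z : ('I_X.+1 * 'I_X.+1) * ('I_X.+1 * 'I_X.+1)) : P z -> (0 < z.1.1 * z.2.1)%N /\ all (fun p => (B < p)%N && ~~ (p ^ 2 %| z.1.1 * z.2.1)%N) (primes (z.1.1 * z.2.1)).
  move=> /and3P[/andP[/and3P[m0 /allP h1 _] _] /andP[/and3P[m0' /allP h2 _] _] co]. split; first by rewrite muln_gt0 m0.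
  apply/allP => p; rewrite mem_primes => /and3P[pp _]; rewrite Euclid_dvdM // => /orP[]pm.
    have := h1 p; rewrite mem_primes pp m0 pm => /(_ isT)/andP[-> /=]; apply: contra.
    by rewrite mulnC Gauss_dvdr // coprimeXl // prime_coprime // (coprime_ndvd pp co).
  have := h2 p; rewrite mem_primes pp m0' pm => /(_ isT)/andP[-> /=]; apply: contra.
  by rewrite coprime_sym in co; rewrite Gauss_dvdr // coprimeXl // prime_coprime // (coprime_ndvd pp co).
have exs (z : ('I_X.+1 * 'I_X.+1) * ('I_X.+1 * 'I_X.+1)) : exists s : nat, P z -> (s < z.1.1 * z.2.1)%N /\
   forall p, prime p -> (p %| z.1.1 * z.2.1)%N -> (p%:Z %| s%:Z - (q z p)%:Z)%Z.
  case Pz : (P z); last by exists 0%N.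
  have [m0 /allP sq] := sqP z Pz; have [s sm sP] := @crt_choice (q z) _ m0 (introT allP (fun p pm => proj2 (andP (sq p pm)))).
  by exists s.
pose s z := sval (cid (exs z)).
have sP (z : ('I_X.+1 * 'I_X.+1) * ('I_X.+1 * 'I_X.+1)) : P z -> (s z < z.1.1 * z.2.1)%N /\
   forall p, prime p -> (p %| z.1.1 * z.2.1)%N -> (p%:Z %| (s z)%:Z - (q z p)%:Z)%Z := svalP (cid (exs z)).
pose phi (z : ('I_X.+1 * 'I_X.+1) * ('I_X.+1 * 'I_X.+1)) : 'I_(X * X).+1 * 'I_(X * X).+1 := (inord (z.1.1 * z.2.1), inord (s z)).
have phiE (z : ('I_X.+1 * 'I_X.+1) * ('I_X.+1 * 'I_X.+1)) : P z -> ((phi z).1 = (z.1.1 * z.2.1)%N :> nat) * ((phi z).2 = s z :> nat).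
  move=> Pz; have l1 : (z.1.1 * z.2.1 < (X * X).+1)%N by rewrite ltnS leq_mul // -ltnS.
  by rewrite /phi /= !inordK // (ltn_trans (sP z Pz).1).
have fmod m t p : ideal f B m t -> prime p -> (p %| m)%N -> [/\ (B < p)%N, (p%:Z %| f.[(t %% p)%N%:Z])%Z & (p%:Z %| (t %% p)%N%:Z - t%:Z)%Z].
  move=> fI pp pm; have /and3P[_ /allP /(_ p) h1 h2] := ideal_dvd pm (prime_gt0 pp) fI.
  split=> //; last by rewrite -eqz_mod_dvd !modz_nat modn_mod. by move: h1; rewrite primes_prime // mem_head => /(_ isT)/andP[].
(* the behaviour of [s z] at the primes of each factor *)
have side1 (z : ('I_X.+1 * 'I_X.+1) * ('I_X.+1 * 'I_X.+1)) p : P z -> prime p -> (p %| z.1.1)%N ->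
   [/\ (p%:Z %| g.[(s z)%:Z])%Z, (p%:Z %| h.[(s z)%:Z] - d%:Z * (z.1.2 : nat)%:Z)%Z, (B < p)%N,
    (p%:Z %| (s z)%:Z - (c p (z.1.2 %% p)%N).1%:Z)%Z & (p%:Z %| f.[(z.1.2 %% p)%N%:Z])%Z].
  move=> Pz pp pm; have /and3P[/andP[xi _] _ _] := Pz; have [Bp ft tt] := fmod _ _ _ xi pp pm.
  have [_ /(_ p pp)] := sP z Pz; rewrite dvdn_mulr // => /(_ isT); rewrite /q pm => ss.
  have [g1 _ h1 _ _] := cP p _ pp Bp ft; split=> //; first exact: dvdz_horner ss g1.
  have : (p%:Z %| (h - (d%:Z * (z.1.2 %% p)%N%:Z)%:P).[(s z)%:Z])%Z.
    by apply: dvdz_horner ss _; rewrite hornerD hornerN hornerC.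
  rewrite hornerD hornerN hornerC => /rpredD/(_ (dvdz_mull d%:Z tt)); congr (_ %| _)%Z; ring.
have side2 (z : ('I_X.+1 * 'I_X.+1) * ('I_X.+1 * 'I_X.+1)) p : P z -> prime p -> (p %| z.2.1)%N ->
   [/\ (p%:Z %| g.[(s z)%:Z])%Z, (p%:Z %| h.[(s z)%:Z] - d%:Z * (z.2.2 : nat)%:Z)%Z, (B < p)%N,
    (p%:Z %| (s z)%:Z - (c p (z.2.2 %% p)%N).2%:Z)%Z & (p%:Z %| f.[(z.2.2 %% p)%N%:Z])%Z].
  move=> Pz pp pm; have /and3P[_ /andP[xi _] co] := Pz; have [Bp ft tt] := fmod _ _ _ xi pp pm.
  have np : ~~ (p %| z.1.1)%N by rewrite coprime_sym in co; apply: coprime_ndvd pp co pm.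
  have [_ /(_ p pp)] := sP z Pz; rewrite dvdn_mull // => /(_ isT); rewrite /q (negPf np) => ss.
  have [_ g1 _ h1 _] := cP p _ pp Bp ft; split=> //; first exact: dvdz_horner ss g1.
  have : (p%:Z %| (h - (d%:Z * (z.2.2 %% p)%N%:Z)%:P).[(s z)%:Z])%Z.
    by apply: dvdz_horner ss _; rewrite hornerD hornerN hornerC.
  rewrite hornerD hornerN hornerC => /rpredD/(_ (dvdz_mull d%:Z tt)); congr (_ %| _)%Z; ring.
have same p (a b e : nat) : prime p -> (B < p)%N -> (p%:Z %| h.[e%:Z] - d%:Z * a%:Z)%Z -> (p%:Z %| h.[e%:Z] - d%:Z * b%:Z)%Z -> (p%:Z %| a%:Z - b%:Z)%Z.
  move=> pp Bp h1 h2; have := rpredB h2 h1. rewrite (_ : _ - _ = d%:Z * (a%:Z - b%:Z)); last by ring.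
  rewrite Gauss_dvdzr // coprimezE /= prime_coprime //; apply/negP => /(dvdn_leq d0) pd.
  by move: (leq_trans Bp (leq_trans pd dB)); rewrite ltnn.
(* A prime dividing the first norm of z and the second norm of z' would make one residue equal to
   both lifts of the same t. *)
have cross (z z' : ('I_X.+1 * 'I_X.+1) * ('I_X.+1 * 'I_X.+1)) p : P z -> P z' -> phi z = phi z' -> prime p -> (p %| z.1.1)%N -> (p %| z'.2.1)%N -> False.
  move=> Pz Pz' e pp pm pm'; have [_ h1 Bp c1 f1] := side1 z p Pz pp pm; have [_ h2 _ c2 f2] := side2 z' p Pz' pp pm'.
  have es : s z = s z' by rewrite -(phiE z Pz) e (phiE z' Pz'). rewrite -es in h2 c2; have tt := same p _ _ _ pp Bp h1 h2.
  have e2 : (z.1.2 %% p = z'.2.2 %% p)%N by move: tt; rewrite -eqz_mod_dvd !modz_nat eqz_nat => /eqP.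
  rewrite -e2 in c2; have [_ _ _ _ /negP[]] := cP p _ pp Bp f1. by have := rpredB c2 c1; congr (_ %| _)%Z; ring.
have sqf m t : ideal f B m t -> all (fun p => ~~ (p ^ 2 %| m)%N) (primes m).
  by move=> /and3P[_ /allP h1 _]; apply/allP => p /h1/andP[].
have dvd1 (z z' : ('I_X.+1 * 'I_X.+1) * ('I_X.+1 * 'I_X.+1)) : P z -> P z' -> phi z = phi z' -> (z.1.1 %| z'.1.1)%N.
  move=> Pz Pz' e; have /and3P[/andP[xi _] _ _] := Pz; have /and3P[m0 _ _] := xi. suff : (z.1.1%:Z %| z'.1.1%:Z)%Z by rewrite dvdzE.
  apply: dvd_sqfree (sqf _ _ xi) _ => // p pp pm; rewrite dvdzE /=.
  have : (p %| z'.1.1 * z'.2.1)%N by rewrite -(phiE z' Pz') -e (phiE z Pz) dvdn_mulr.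
  by rewrite Euclid_dvdM // => /orP[//|pm']; case: (cross z z' p).
have inj : {in P &, injective phi}.
  move=> z z' Pz Pz' e. have m1 : z.1.1 = z'.1.1 by apply/val_inj/eqP; rewrite /= eqn_dvd !dvd1.
  have /and3P[/andP[xi xl] /andP[yi yl] _] := Pz; have /and3P[/andP[xi' xl'] /andP[yi' yl'] _] := Pz'.
  have /and3P[m0 _ _] := xi; have /and3P[m0' _ _] := yi. have m2 : z.2.1 = z'.2.1.
    apply/val_inj/eqP; rewrite /= -(eqn_pmul2l m0) {2}m1; apply/eqP. by rewrite -(phiE z Pz) -(phiE z' Pz') e.
  have es : s z = s z' by rewrite -(phiE z Pz) e (phiE z' Pz').
  have fin m (a b : nat) : (0 < m)%N -> (a < m)%N -> (b < m)%N -> all (fun p => ~~ (p ^ 2 %| m)%N) (primes m) ->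
     (forall p, prime p -> (p %| m)%N -> (p%:Z %| a%:Z - b%:Z)%Z) -> a = b.
    move=> mm am bm sq hp; have := dvd_sqfree mm sq hp. by rewrite -eqz_mod_dvd !modz_nat eqz_nat !modn_small // => /eqP.
  have t1 : z.1.2 = z'.1.2.
    apply/val_inj; apply: (fin z.1.1) => //=; rewrite ?m1 ?(sqf _ _ xi') // => p pp pm.
    have [_ h1 Bp _ _] := side1 z' p Pz' pp pm; have [|_ h2 _ _ _] := side1 z p Pz pp; first by rewrite m1.
    by rewrite es in h2; apply: same h2 h1.
  have t2 : z.2.2 = z'.2.2.
    apply/val_inj; apply: (fin z.2.1) => //=; rewrite ?m2 ?(sqf _ _ yi') // => p pp pm.
    have [_ h1 Bp _ _] := side2 z' p Pz' pp pm; have [|_ h2 _ _ _] := side2 z p Pz pp; first by rewrite m2.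
    by rewrite es in h2; apply: same h2 h1.
  by case: z z' m1 m2 t1 t2 {Pz Pz' e xi yi xl yl xi' yi' xl' yl' m0 m0' es} => -[a b] [a' b'] [[a1 b1] [a1' b1']] /= -> -> -> ->.
pose G (z : 'I_(X * X).+1 * 'I_(X * X).+1) : rat := (z.1 : nat)%:R^-1.
rewrite pair_big_dep /= (eq_bigl P) => [|z]; last by rewrite /P.
rewrite (eq_bigr (fun z => G (phi z))) => [|z Pz]; last first.
  by rewrite /F /G (phiE z Pz) natrM invfM.
apply: sum_inj_le inj _ => [z|z Pz]; first by rewrite invr_ge0.
have [m0 all2] := sqP z Pz; have [s1 s2] := sP z Pz.
rewrite /idl !(phiE z Pz) s1 andbT /ideal m0 all2 /=; apply: dvd_sqfree => // [|p pp].
  by apply/allP => p /(allP all2)/andP[].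
by rewrite Euclid_dvdM // => /orP[] pm; [have [] := side1 z p Pz pp pm | have [] := side2 z p Pz pp pm].
Qed.

End Split.

(** * A prime of L without two lifts of degree one *)

Section GoodPrime.
Variables (f : {poly int}) (n : nat).
Hypotheses (fm : f \is monic) (sf : size f = n.+1) (n0 : (0 < n)%N).
Hypothesis firr : forall u : {poly int}, u != 0 -> (size u <= n)%N ->
  exists a b (c : int), c != 0 /\ a * u + b * f = c%:P.
Variables (sa sb : {poly int}) (sc : int).
Hypotheses (sc0 : sc != 0) (fsep : sa * f + sb * f^`() = sc%:P).
Variables (g : {poly int}) (N : nat).
Hypotheses (gm : g \is monic) (sg : size g = N.+1) (N0 : (0 < N)%N).
Hypothesis girr : forall u : {poly int}, u != 0 -> (size u <= N)%N ->
  exists a b (c : int), c != 0 /\ a * u + b * g = c%:P.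
Variables (h : {poly int}) (d : nat).
Hypothesis d0 : (0 < d)%N.

(** Each scale Y adds at least 1/(c1 c2). The ratio A > 2 c2 between scales makes the ranges from
    Y^n / 2 to c2 Y^n disjoint, so that no ideal is counted twice. *)
Lemma scale_sum B c1 c2 Y0 : (0 < c1)%N -> (0 < c2)%N -> (forall Y, (Y0 <= Y)%N -> exists L : seq (nat * nat), [/\ uniq L,
    forall x, x \in L -> [/\ ideal f B x.1 x.2, (x.2 < x.1)%N, (Y ^ n <= 2 * x.1)%N & (x.1 <= c2 * Y ^ n)%N] &
    (Y ^ n <= c1 * size L)%N]) -> forall J : nat, exists L : seq (nat * nat), [/\ uniq L,
    forall x, x \in L -> [/\ ideal f B x.1 x.2, (x.2 < x.1)%N & (x.1 <= c2 * ((2 * c2).+1 ^ (Y0 + J)) ^ n)%N] &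
    J%:R / (c1 * c2)%:R <= \sum_(x <- L) x.1%:R^-1 :> rat].
Proof.
move=> c10 c20 low; elim=> [|J [L [uL LP LS]]]; first by exists [::]; rewrite big_nil mul0r.
set A := (2 * c2).+1 in LP *; have A1 : (1 < A)%N by rewrite /A; lia.
pose Y := (A ^ (Y0 + J.+1))%N; have Y00 : (Y0 <= Y)%N by rewrite (leq_trans (leq_addr J.+1 _)) // ltnW // ltn_expl.
have Yn0 : (0 < Y ^ n)%N by rewrite !expn_gt0.
have YE : (Y ^ n = A ^ n * (A ^ (Y0 + J)) ^ n)%N by rewrite /Y addnS expnS expnMn.
have An : (A <= A ^ n)%N by rewrite -{1}(expn1 A) leq_pexp2l.
have [L' [uL' LP' LS']] := low Y Y00; exists (L' ++ L); split.
- rewrite cat_uniq uL uL' andbT /=; apply/hasPn => x xL; apply/negP => xL'.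
  have [_ _ h1] := LP x xL; have [_ _ h2 _] := LP' x xL'.
  have : (Y ^ n <= 2 * c2 * (A ^ (Y0 + J)) ^ n)%N by rewrite (leq_trans h2) // -mulnA leq_mul2l h1.
  by rewrite YE leq_pmul2r ?expn_gt0 // leqNgt (leq_trans _ An).
- move=> x; rewrite mem_cat => /orP[/LP'[]//|/LP[h1 h2 h3]]; split=> //; rewrite (leq_trans h3) //.
  by rewrite leq_mul2l -/Y YE leq_pmull ?orbT // expn_gt0.
rewrite big_cat /= -natr1 mulrDl addrC lerD //.
apply: (@le_trans _ _ (\sum_(x <- L') (c2 * Y ^ n)%:R^-1)).
  rewrite big_const_seq count_predT iter_addr addr0 mul1r -[leRHS]mulr_natr mulrC.
  rewrite ler_pdivlMr ?ltr0n ?muln_gt0 ?c20 // ler_pdivrMl ?ltr0n ?muln_gt0 ?c10 // -!natrM ler_nat.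
  by rewrite [(c1 * c2)%N]mulnC -mulnA leq_mul2l LS' orbT.
rewrite big_seq [leRHS]big_seq; apply: ler_sum => x /LP'[/and3P[m0 _ _] _ _ hx].
by rewrite lef_pV2 ?posrE ?ltr0n ?muln_gt0 ?c20 // ler_nat.
Qed.

(** Otherwise the square of the sum for f up to X is at most twice the sum for g up to X^2. For X of
    size A^(n(Y0 + J)) the former sum is at least J / c, while the latter is at most linear in log
    X, hence in J. This gives J^2 <= a + b J, which is false for J = a + b + 1. *)
Theorem good_prime B0 : exists p t : nat, [/\ prime p, (B0 < p)%N, (p%:Z %| f.[t%:Z])%Z &
  forall s1 s2 : nat, (p%:Z %| g.[s1%:Z])%Z -> (p%:Z %| g.[s2%:Z])%Z ->
   (p%:Z %| h.[s1%:Z] - d%:Z * t%:Z)%Z -> (p%:Z %| h.[s2%:Z] - d%:Z * t%:Z)%Z -> (p%:Z %| s1%:Z - s2%:Z)%Z].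
Proof.
apply: contrapT => no.
have [B1 low] := ideal_lower fm sf n0 firr sc0 fsep; have [C up] := ideal_upper gm sg N0 girr.
(* B >= 2 n^2 leaves at most half of the double sum to pairs that are not coprime; B >= d makes d
   invertible modulo p, so that h(s) determines t. *)
pose B := (B0 + B1 + d + 2 * n ^ 2).+1.
have dB : (d <= B)%N by rewrite /B; lia.
have two p t : prime p -> (B < p)%N -> (p%:Z %| f.[t%:Z])%Z -> exists s : nat * nat,
  [/\ (p%:Z %| g.[s.1%:Z])%Z, (p%:Z %| g.[s.2%:Z])%Z, (p%:Z %| h.[s.1%:Z] - d%:Z * t%:Z)%Z,
      (p%:Z %| h.[s.2%:Z] - d%:Z * t%:Z)%Z & ~~ (p%:Z %| s.1%:Z - s.2%:Z)%Z].
  move=> pp Bp ft; apply: contrapT => no2; apply: no; exists p, t; split=> //; first by rewrite /B in Bp; lia.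
  by move=> s1 s2 h1 h2 h3 h4; apply: contraT => h5; case: no2; exists (s1, s2).
have key X : zsum f B X ^+ 2 <= 2 * zsum g B (X * X).
  have cop := @zsum_coprime f g h d B X d0 dB two. have ncop := @zsum_noncoprime f n B X fm sf (ltn0Sn _).
  have hB : (n ^ 2)%:R / B%:R * zsum f B X ^+ 2 <= 2^-1 * zsum f B X ^+ 2.
    rewrite ler_wpM2r ?exprn_ge0 //; first by apply: sumr_ge0 => x _; rewrite invr_ge0.
    by rewrite ler_pdivrMr // ler_pdivlMl // -natrM ler_nat /B; lia.
  have : zsum f B X ^+ 2 <= zsum g B (X * X) + 2^-1 * zsum f B X ^+ 2.
    apply: le_trans (lerD cop (le_trans ncop hB)); rewrite -big_split /=.
    rewrite expr2 big_distrlr /= le_eqVlt; apply/orP; left; apply/eqP/eq_bigr => x _.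
    by rewrite (bigID (fun y : 'I_X.+1 * 'I_X.+1 => coprime x.1 y.1)).
  by move: (zsum f B X ^+ 2) => z; lra.
have [|c1 [c2 [Y0 lowB]]] := low B; first by rewrite /B; lia.
have lowB' Y : (Y0 <= Y)%N -> exists L : seq (nat * nat), [/\ uniq L,
    forall x, x \in L -> [/\ ideal f B x.1 x.2, (x.2 < x.1)%N, (Y ^ n <= 2 * x.1)%N & (x.1 <= c2.+1 * Y ^ n)%N] &
    (Y ^ n <= c1.+1 * size L)%N].
  move=> /lowB[L [uL LP LS]]; exists L; split=> // [x /LP[? ? ? hx]|]; last first.
    by rewrite (leq_trans LS) // leq_mul2r leqnSn orbT.
  by split=> //; rewrite (leq_trans hx) // leq_mul2r leqnSn orbT.
have scale := scale_sum (ltn0Sn c1) (ltn0Sn c2) lowB'.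
set A := (2 * c2.+1).+1 in scale; pose c := (c1.+1 * c2.+1)%N.
pose a := (c ^ 2 * (2 * (C * (4 * (c2.+1 + A * Y0 * n) + 1))))%N.
pose b := (c ^ 2 * (2 * (C * (4 * (A * n)))))%N.
pose J := (a + b).+1.
have [L [uL LP LS]] := scale J; pose X := (c2.+1 * (A ^ (Y0 + J)) ^ n)%N.
have zX : J%:R / c%:R <= zsum f B X := le_trans LS (zsum_list uL LP).
pose k := (c2.+1 + A * (Y0 + J) * n)%N.
have Xk : (X <= 2 ^ k)%N.
  rewrite /X /k (expnD 2) leq_mul //; first by rewrite ltnW // ltn_expl.
  rewrite (expnM 2) leq_exp2r // (expnM 2); case: (Y0 + J)%N => // m. by rewrite leq_exp2r // ltnW // ltn_expl.
have XX : (X * X <= 2 ^ (2 * k))%N by rewrite mul2n -addnn (expnD 2) leq_mul.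
have zg := zsum_upper up B XX.
have c0 : 0 < c%:R :> rat by rewrite ltr0n.
have : J%:R ^+ 2 <= c%:R ^+ 2 * (2 * (C * (2 * (2 * k) + 1))%:R) :> rat.
  rewrite -ler_pdivrMl ?exprn_gt0 //; apply: le_trans (ler_wpM2l _ zg) => //.
  apply: le_trans (key X); rewrite mulrC -expr_div_n lerXn2r ?nnegrE ?divr_ge0 //. by apply: sumr_ge0 => x _; rewrite invr_ge0.
rewrite -!natrX -!natrM ler_nat.
have -> : (c ^ 2 * (2 * (C * (2 * (2 * k) + 1))) = a + b * J)%N by rewrite /a /b /k; ring.
by rewrite /J; clear; move: a b => a b; nia.
Qed.

End GoodPrime.

(** * Full torsion over one field and its extensions *)

Lemma dvd_split_power (q : {poly algC}) (rs : seq algC) : q != 0 ->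
  (forall x, root q x -> x \in rs) -> q %| (\prod_(r <- rs) ('X - r%:P)) ^+ (size q).-1.
Proof.
move=> q0 h; have [ss qE] := closed_field_poly_normal q.
have l0 : lead_coef q != 0 by rewrite lead_coef_eq0.
have sz : size q = (size ss).+1 by rewrite qE size_scale // size_prod_XsubC.
have {}h x : x \in ss -> x \in rs.
  by move=> xs; apply: h; rewrite qE rootZ // root_prod_XsubC.
rewrite sz /= qE dvdpZl //; elim: ss {qE sz} h => [|x ss IH] h; first by rewrite big_nil.
rewrite big_cons exprS dvdp_mul ?IH // => [|y ys]; last by apply: h; rewrite in_cons ys orbT.
by rewrite dvdp_XsubCl root_prod_XsubC h ?mem_head.
Qed.

Section FullTorsion.
Variables (L F : fieldType) (i : {rmorphism L -> algC}) (j : {rmorphism L -> F}).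
Variables (E : scurve L) (EC : scurve algC) (EF : scurve F).
Hypotheses (ia : sa EC = i (sa E)) (ib : sb EC = i (sb E)).
Hypotheses (ja : sa EF = j (sa E)) (jb : sb EF = j (sb E)).

Lemma mul_spec_of_algC n : (0 < n)%N -> mul_spec EF n.
Proof.
by move=> n0; apply/(mul_spec_map ja jb)/(mul_spec_map ia ib)/mulpoly_spec.
Qed.

(** The denominator B_n divides a power of the product of X - x(P) over the torsion points P defined
    over L. This divisibility descends from algC to L and passes to F, so x(R) is the image of some
    x(P). *)
Lemma full_torsion n : (0 < n)%N ->
  (forall Q : spoint EC, Q *+ n = 0 -> exists P : spoint E, Q = pmap ia ib P) ->
  forall R : spoint EF, R *+ n = 0 -> exists2 P : spoint E, P *+ n = 0 & R = pmap ja jb P.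
Proof.
move=> n0 full R Rn.
have [s [us ss sP]] := torsion_count EC n0.
have pull Q : exists P : spoint E, Q \in s -> Q = pmap ia ib P.
  case Qs : (Q \in s); last by exists 0. by move: Qs; rewrite sP => /eqP/full[P ->]; exists P.
pose pl Q := sval (cid (pull Q)); have plP Q : Q \in s -> Q = pmap ia ib (pl Q) := svalP (cid (pull Q)).
have pln Q : Q \in s -> pl Q *+ n = 0.
  move=> Qs; apply: (pmap_inj (fa := ia) (fb := ib)). by rewrite pmapMn -plP // pmap0; move: Qs; rewrite sP => /eqP.
have [->|R0] := eqVneq R 0; first by exists 0; rewrite ?mul0rn ?pmap0.
have [x [y eR]] := point_xyP R0.
have Bx : (mulB (sa EF) (sb EF) n).[x] = 0.
  by apply/eqP; rewrite -(tors_x mul_spec_of_algC eR n0) Rn.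
pose xs := [seq if val (pl Q) is Some (x, _) then x else 0 | Q <- s & pl Q != 0].
have dv : mulB (sa E) (sb E) n %| (\prod_(r <- xs) ('X - r%:P)) ^+ (size (mulB (sa E) (sb E) n)).-1.
  have [_ eB] := map_mulpoly i (sa E) (sb E) n. rewrite -(dvdp_map i) rmorphXn /= rmorph_prod /= -(size_map_poly i) eB -ia -ib.
  rewrite (eq_bigr (fun r => 'X - (i r)%:P)) => [|r _]; last by rewrite rmorphB /= map_polyX map_polyC.
  rewrite -(big_map i xpredT (fun r => 'X - r%:P)); apply: dvd_split_power.
    have [[_ _ sB _ _] _ _] := mulpoly_spec EC n0. by rewrite -size_poly_eq0 sB expn_eq0 negb_and -lt0n n0.
  move=> x' rx; have [Q [y' eQ]] := point_at EC x'. have Qs : Q \in s by rewrite sP (tors_x (@mulpoly_spec EC) eQ n0) -rootE.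
  apply/mapP; exists (if val (pl Q) is Some (x, _) then x else 0); first apply/mapP; first (exists Q => //; rewrite mem_filter Qs andbT).
    by apply/eqP => e; move: eQ; rewrite (plP Q Qs) e pmap0.
  by move: eQ; rewrite {1}(plP Q Qs) val_pmap; case: (val (pl Q)) => [[x1 y1]|] //= -[].
have : root (map_poly j (\prod_(r <- xs) ('X - r%:P))) x.
  have := dv; rewrite -(dvdp_map j) (map_mulpoly j _ _ n).2 -ja -jb => /dvdpP[q].
  rewrite rmorphXn /= => e; have := congr1 (fun p => p.[x]) e; rewrite hornerM Bx mulr0 horner_exp => /eqP.
  by rewrite expf_eq0 rootE => /andP[].
rewrite rmorph_prod /= (eq_bigr (fun r => 'X - (j r)%:P)) => [|r _]; last by rewrite rmorphB /= map_polyX map_polyC.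
rewrite -(big_map j xpredT (fun r => 'X - r%:P)) root_prod_XsubC => /mapP[x' /mapP[Q]].
rewrite mem_filter => /andP[Q0 Qs] -> xE.
have [x1 [y1 eP]] := point_xyP Q0; rewrite eP in xE.
have : y ^+ 2 == (j y1) ^+ 2.
  have -> : y ^+ 2 = (cubic (sa EF) (sb EF)).[x] by apply: spoint_on eR. rewrite -rmorphXn /= (spoint_on eP) xE !cubicE ja jb.
  by rewrite !(rmorphD, rmorphM, rmorphXn).
rewrite eqf_sqr => /orP[]/eqP yE.
  by exists (pl Q); [exact: pln | apply: val_inj; rewrite val_pmap eP eR xE yE].
exists (- pl Q); first by rewrite mulNrn pln ?oppr0.
by apply: val_inj; rewrite val_pmap val_opp eP eR xE yE /= rmorphN.
Qed.

End FullTorsion.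

(** * Valuations of completions and finiteness of residue classes *)

Section Ord.
Variables (F : fieldType) (v : finite_prime F).

Lemma ordX x n : x != 0 -> v (x ^+ n) = v x *+ n.
Proof.
move=> x0; elim: n => [|n IH]; first by rewrite expr0 mulr0n Defs.ord1.
by rewrite exprS ordM ?expf_neq0 // IH mulrS.
Qed.

Lemma ord_geE n x : x != 0 -> ord_ge v n x = (n <= v x).
Proof. by rewrite /ord_ge => /negPf->. Qed.

Lemma ord_ge1 : ord_ge v 0 1.
Proof. by rewrite ord_geE ?oner_eq0 // Defs.ord1. Qed.

Lemma ord_geX m n x : ord_ge v m x -> ord_ge v (m *+ n) (x ^+ n).
Proof.
by move=> h; elim: n => [|n IH]; rewrite ?mulr0n ?expr0 ?ord_ge1 // mulrS exprS ord_geM.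
Qed.

Lemma ord_ge_sum n (I : Type) (r : seq I) (P : pred I) (G : I -> F) :
  (forall i, P i -> ord_ge v n (G i)) -> ord_ge v n (\sum_(i <- r | P i) G i).
Proof. by move=> h; apply: (big_ind (fun x => ord_ge v n x)) => //; [exact: ord_ge0 | move=> x y; exact: ord_geD]. Qed.

Lemma ord_nat n : ord_ge v 0 n%:R.
Proof. by elim: n => [|n IH]; rewrite ?ord_ge0 // -natr1 ord_geD ?ord_ge1. Qed.

Lemma ord_int (n : int) : ord_ge v 0 n%:~R.
Proof.
by case: n => n; rewrite ?NegzE ?mulrNz ?ord_geN; exact: ord_nat.
Qed.

Lemma ord_add_lt n x y : x != 0 -> v x < n -> ord_ge v n y -> x + y != 0 /\ v (x + y) = v x.
Proof.
move=> x0 xn yn.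
have xy0 : x + y != 0.
  apply/eqP => e; have yx : y = - x by apply/eqP; rewrite -addr_eq0 addrC e. by move: yn; rewrite yx ord_geN ord_geE // leNgt xn.
split=> //; apply/eqP; rewrite eq_le; apply/andP; split.
  have : ~~ ord_ge v (v x + 1) x by rewrite ord_geE // -ltNge ltrDl.
  apply: contraNT; rewrite -ltNge => h; rewrite -{2}[x](addrK y); apply: ord_geB.
    by rewrite ord_geE // lezD1.
  by apply: ord_geW yn; rewrite lezD1.
have : ord_ge v (v x) (x + y) by rewrite ord_geD ?(ord_geW (ltW xn) yn) // ord_geE.
by rewrite ord_geE.
Qed.

Lemma ord_geV x n : x != 0 -> v x <= n -> ord_ge v (- n) x^-1.
Proof. by move=> x0 xn; rewrite ord_geE ?invr_eq0 // ordV // lerN2. Qed.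

Lemma ord_geZ n (c : int) x : ord_ge v n x -> ord_ge v n (x *~ c).
Proof. by move=> h; rewrite -mulrzl -[n]add0r ord_geM ?ord_int. Qed.

Lemma ord_horner (p : {poly F}) m : exists C, forall x, ord_ge v m x -> ord_ge v C p.[x].
Proof.
elim/poly_ind: p => [|p c [C h]]; first by exists 0 => x _; rewrite horner0 ord_ge0.
exists (Num.min (C + m) (v c)) => x xm; rewrite hornerMXaddC; apply: ord_geD.
  by apply: ord_geW (ord_geM (h x xm) xm); rewrite ge_min lexx.
by rewrite /ord_ge ge_min lexx !orbT.
Qed.

End Ord.

Section CompletionOrd.
Variables (K : fieldType) (P : finite_prime K).
Local Notation KP := (completion P).
Local Notation cls u := (\pi_{ideal_quot (null_seq (p := P))}%qT u).

Lemma cls_eq0 (u : cauchy_seq P) : (cls u == 0 :> KP) = (u \in null_seq (p := P)).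
Proof. by rewrite -(rmorph0 (\pi_{ideal_quot (null_seq (p := P))}%qT)) -Quotient.idealrBE subr0. Qed.

Lemma cls_eq (u w : cauchy_seq P) : (cls u == cls w :> KP) = (u - w \in null_seq (p := P)).
Proof. by rewrite -Quotient.idealrBE. Qed.

Lemma cls_surj (x : KP) : exists u : cauchy_seq P, x = cls u.
Proof. by elim/quotW: x => u; exists u. Qed.

Lemma stable_ord (u : cauchy_seq P) : cls u != 0 :> KP ->
  exists w : int, exists N, forall i, (N <= i)%N -> u i != 0 /\ P (u i) = w.
Proof.
rewrite cls_eq0 => /asboolPn/existsNP[n uN].
have [N uC] := asboolP _ (valP u) n.
have [i0 Ni0 ui0] : exists2 i0, (N <= i0)%N & ~~ ord_ge P n (u i0).
  by apply: contrapT => h; apply: uN; exists N => i Ni; apply/negPn/negP => ui; apply: h; exists i.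
move: ui0; rewrite /ord_ge negb_or -ltNge => /andP[u0 un]; exists (P (u i0)), N => i Ni.
by have := ord_add_lt u0 un (uC _ _ Ni Ni0); rewrite addrC subrK.
Qed.

(** A Cauchy sequence that does not tend to 0 has eventually constant order, the same for all
    representatives of its class. *)
Lemma cord_subproof (x : KP) : exists w : int, (x = 0 -> w = 0) /\ (x != 0 -> forall u : cauchy_seq P, x = cls u ->
   exists N, forall i, (N <= i)%N -> u i != 0 /\ P (u i) = w).
Proof.
have [->|x0] := eqVneq x 0; first by exists 0; split=> //; rewrite eqxx.
have [u xu] := cls_surj x; have [|w [N uw]] := @stable_ord u; first by rewrite -xu.
exists w; split=> [x00|_ u' xu']; first by rewrite x00 eqxx in x0.
have : u' - u \in null_seq (p := P) by rewrite -cls_eq -xu -xu'.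
move=> /asboolP/(_ (w + 1))[M dM]; exists (maxn N M) => i; rewrite geq_max => /andP[Ni Mi].
have [u0 ui] := uw i Ni; have := dM i Mi.
have h : P (u i) < w + 1 by rewrite ui ltrDl.
by move=> /(ord_add_lt u0 h); rewrite (_ : u i + (u' - u) i = u' i) ?ui // addrC subrK.
Qed.

Definition cord (x : KP) : int := sval (cid (cord_subproof x)).

Lemma cordP (u : cauchy_seq P) : cls u != 0 :> KP ->
  exists N, forall i, (N <= i)%N -> u i != 0 /\ P (u i) = cord (cls u).
Proof. by move=> u0; rewrite /cord; case: cid => w /= [_ /(_ u0 u erefl)]. Qed.

Lemma cord0 : cord 0 = 0. Proof. by rewrite /cord; case: cid => w /= [-> ]. Qed.

Lemma cordM x y : x != 0 -> y != 0 -> cord (x * y) = cord x + cord y.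
Proof.
have [[u ->] [w ->]] := (cls_surj x, cls_surj y) => u0 w0; have := mulf_neq0 u0 w0.
rewrite -rmorphM => uw0; have [[N hN] [M hM] [Q hQ]] := And3 (cordP u0) (cordP w0) (cordP uw0).
pose i := maxn (maxn N M) Q; have [|ui eu] := hN i; first by rewrite /i; lia.
have [|wi ew] := hM i; first by rewrite /i; lia.
have [|_ <-] := hQ i; first by rewrite /i; lia.
by rewrite -eu -ew -ordM.
Qed.

Lemma cordD x y : x != 0 -> y != 0 -> x + y != 0 -> Num.min (cord x) (cord y) <= cord (x + y).
Proof.
have [[u ->] [w ->]] := (cls_surj x, cls_surj y) => u0 w0.
rewrite -rmorphD => uw0; have [[N hN] [M hM] [Q hQ]] := And3 (cordP u0) (cordP w0) (cordP uw0).
pose i := maxn (maxn N M) Q; have [|ui eu] := hN i; first by rewrite /i; lia.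
have [|wi ew] := hM i; first by rewrite /i; lia.
have [|uwi <-] := hQ i; first by rewrite /i; lia.
by rewrite -eu -ew ordD.
Qed.

Lemma cord_const x : cord (to_completion P x) = P x.
Proof.
have [->|x0] := eqVneq x 0; first by rewrite rmorph0 cord0 Defs.ord0.
have : to_completion P x != 0 by rewrite fmorph_eq0.
by move=> /cordP[N /(_ N (leqnn _))[_ /= <-]].
Qed.

Lemma cord_uniformizer : exists2 x, x != 0 & cord x = 1.
Proof.
by have [x x0 x1] := ord_uniformizer P; exists (to_completion P x); rewrite ?fmorph_eq0 ?cord_const.
Qed.

Definition cprime : finite_prime KP := FinitePrime cord0 cordM cordD cord_uniformizer.

Lemma cprime_const x : cprime (to_completion P x) = P x. Proof. exact: cord_const. Qed.

Lemma cprime_ge_const n x : ord_ge cprime n (to_completion P x) = ord_ge P n x.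
Proof. by rewrite /ord_ge fmorph_eq0 cprime_const. Qed.

Lemma cprime_ge (u : cauchy_seq P) n : (exists N, forall i, (N <= i)%N -> ord_ge P n (u i)) ->
  ord_ge cprime n (cls u).
Proof.
move=> [N uN]; have [->|u0] := eqVneq (cls u : KP) 0; first exact: ord_ge0.
have [M uM] := cordP u0; rewrite ord_geE //.
have [|ui e] := uM (maxn N M); first by rewrite leq_maxr.
suff : n <= cord (cls u : KP) by [].
rewrite -e.
by have := uN (maxn N M) (leq_maxl _ _); rewrite ord_geE.
Qed.

Lemma cls_near (u : cauchy_seq P) n : exists N, forall i, (N <= i)%N ->
  ord_ge cprime n (cls u - to_completion P (u i)).
Proof.
have [N uN] := asboolP _ (valP u) n; exists N => i Ni.
rewrite -rmorphB; apply: cprime_ge; exists N => j Nj; exact: (uN j i Nj Ni).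
Qed.

Lemma completion_dense (x : KP) n : exists y, ord_ge cprime n (x - to_completion P y).
Proof.
have [u ->] := cls_surj x; have [N uN] := cls_near u n; exists (u N); exact: uN.
Qed.

End CompletionOrd.

Section Residues.
Variables (K : fieldExtType rat) (P : finite_prime K).

Lemma natr_neq0 n : n.+1%:R != 0 :> K.
Proof. by rewrite -(rmorph_nat (in_alg K)) fmorph_eq0 pnatr_eq0. Qed.

Lemma intr_eq0K (n : int) : (n%:~R == 0 :> K) = (n == 0).
Proof. by rewrite -(rmorph_int (in_alg K)) fmorph_eq0 intr_eq0. Qed.

Lemma dep_int (s : seq K) : (\dim {:K} < size s)%N -> exists c : nat -> int,
  (exists2 i, (i < size s)%N & c i != 0) /\ \sum_(i < size s) s`_i *~ c i = 0.
Proof.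
move=> sd; have nf : ~~ free (in_tuple s).
  by apply/negP => /eqP fr; have := dimvS (subvf <<s>>); rewrite fr leqNgt sd.
apply: contrapT => no; case/negP: nf; apply/freeP => k k0 i.
pose D : int := \prod_(j < size s) denq (k j).
have D0 : D != 0 by apply/prodf_neq0 => j _; rewrite denq_neq0.
pose c (j : nat) : int := if insub j is Some j' then numq (k j') * \prod_(t < size s | t != j') denq (k t) else 0.
have cE (j : 'I_(size s)) : (c j)%:~R = (k j : rat) * D%:~R :> rat.
  rewrite /c; case: insubP => [j' _ /ord_inj ->|]; last by rewrite ltn_ord.
  have mM (x y : int) : (x * y)%:~R = x%:~R * y%:~R :> rat by rewrite intrM.
  apply: (etrans (mM _ _)); have -> : D = denq (k j) * \prod_(t < size s | t != j) denq (k t) by rewrite /D (bigD1 j).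
  apply: esym; rewrite mM. by rewrite mulrA; congr (_ * _); rewrite -{1}[k j]divq_num_den divfK // intr_eq0 denq_neq0.
apply: contrapT => ki; apply: no; exists c; split.
  exists i => //; rewrite -(intr_eq0 rat) cE mulf_neq0 ?intr_eq0 //; exact/eqP.
transitivity (D%:~R *: \sum_(j < size s) k j *: s`_j); last by rewrite k0 scaler0.
rewrite scaler_sumr; apply: eq_bigr => j _.
by rewrite scalerA mulrC -cE scaler_int.
Qed.

(** A nontrivial relation of least total size has a coefficient prime to p, since otherwise division
    by p would give a smaller one. *)
Lemma dep_int_prim (s : seq K) p : prime p -> (\dim {:K} < size s)%N -> exists c : nat -> int,
  (exists2 i, (i < size s)%N & ~~ (p%:Z %| c i)%Z) /\ \sum_(i < size s) s`_i *~ c i = 0.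
Proof.
move=> pp sd; pose w (c : nat -> int) := (\sum_(i < size s) `|c i|)%N.
pose Q (n : nat) := `[< exists c : nat -> int, [/\ w c = n, exists2 i, (i < size s)%N & c i != 0 &
  \sum_(i < size s) s`_i *~ c i = 0] >].
have exQ : exists n, Q n by have [c [c1 c2]] := dep_int sd; exists (w c); apply/asboolP; exists c.
have [n /asboolP[c [wc [i0 i0s ci0] c0]] minn] := ex_minnP exQ.
exists c; split=> //; apply: contrapT => no.
have dv i : (i < size s)%N -> (p%:Z %| c i)%Z by move=> h; apply: contraT => h2; case: no; exists i.
pose c' i := (c i %/ p%:Z)%Z.
have cE (i : 'I_(size s)) : c i = c' i * p%:Z by rewrite /c' divzK // dv.
have c'0 : c' i0 != 0.
  by apply: contra ci0 => /eqP e; rewrite -[i0]/(nat_of_ord (Ordinal i0s)) cE /= e mul0r.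
have : Q (w c').
  apply/asboolP; exists c'; split=> //; first by exists i0.
  apply: (mulIf (_ : p%:R != 0 :> K)); first by case: (p) (prime_gt0 pp) => // k _; exact: natr_neq0.
  rewrite mul0r -[RHS]c0 mulr_suml; apply: eq_bigr => i _. by rewrite cE mulrzA -mulrzl -[_ *~ p%:Z]mulrzl mulrC mulrzl.
move=> /minn; rewrite -wc /w (bigD1 (Ordinal i0s)) //= [X in (_ <= X)%N](bigD1 (Ordinal i0s)) //=.
have p1 := prime_gt1 pp; apply/negP; rewrite -ltnNge -addSn; apply: leq_add.
  by rewrite -[i0]/(nat_of_ord (Ordinal i0s)) cE abszM /= ltn_Pmulr // absz_gt0.
by apply: leq_sum => i _; rewrite cE abszM /= leq_pmulr // prime_gt0.
Qed.

Variable p : nat.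
Hypotheses (pp : prime p) (vp : 0 < P p%:R).

Lemma ord_ge_dvd (c : int) x : (p%:Z %| c)%Z -> ord_ge P 0 x -> ord_ge P 1 (x *~ c).
Proof.
move=> /dvdzP[d ->] x0; rewrite -mulrzl intrM -mulrA [_%:~R * x]mulrC mulrA.
rewrite -[1]add0r; apply: ord_geM; first by rewrite mulrzl ord_geZ.
by rewrite /ord_ge -gtz0_ge1 vp orbT.
Qed.

(** Linear independence over F_p of the residues of the members of s. *)
Definition indep (s : seq K) := all (ord_ge P 0) s /\
  forall c : nat -> int, ord_ge P 1 (\sum_(i < size s) s`_i *~ c i) -> forall i, (i < size s)%N -> (p%:Z %| c i)%Z.

Lemma indep_size s : indep s -> (size s <= \dim {:K})%N.
Proof.
move=> [_ h]; rewrite leqNgt; apply/negP => /(dep_int_prim pp)[c [[i si ci] c0]].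
by case/negP: ci; apply: h; rewrite ?c0 ?ord_ge0.
Qed.

(** An independent list of maximal length spans the residue field over F_p, so its combinations with
    coefficients below p represent all residues. *)
Lemma residue_list : exists R : seq K, forall x, ord_ge P 0 x -> exists2 r, r \in R & ord_ge P 1 (x - r).
Proof.
pose Q n := `[< exists2 s, indep s & size s = n >].
have exQ : exists n, Q n.
  by exists 0%N; apply/asboolP; exists [::] => //; split=> // c _ i.
have bd n : Q n -> (n <= \dim {:K})%N by move=> /asboolP[s si <-]; apply: indep_size.
have [r /asboolP[s [sO si] sr] maxr] := ex_maxnP exQ bd; pose cmb (f : {ffun 'I_r -> 'I_p}) := \sum_(i < r) s`_i *~ (f i : nat)%:Z.
exists [seq cmb f | f : {ffun 'I_r -> 'I_p}] => x x0.
have [c [c1 [i0 i0r ci0]]] : exists c : nat -> int, ord_ge P 1 (x *~ c 0%N + \sum_(i < r) s`_i *~ c i.+1) /\ exists2 i, (i <= r)%N & ~~ (p%:Z %| c i)%Z.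
  apply: contrapT => no; suff /maxr : Q r.+1 by rewrite ltnn. apply/asboolP; exists (x :: s); last by rewrite /= sr.
  split=> [|c]; first by rewrite /= x0. rewrite /= sr big_ord_recl /= => c1 i ir; apply: contraT => ci; case: no; exists c; split=> //.
  by exists i.
have sO' i : ord_ge P 0 s`_i.
  have [h|h] := ltnP i (size s); first exact: (allP sO _ (mem_nth _ h)). by rewrite nth_default ?ord_ge0.
have pc0 : ~~ (p%:Z %| c 0%N)%Z.
  apply/negP => d0; have h : ord_ge P 1 (\sum_(i < size s) s`_i *~ c i.+1).
    have := ord_geB c1 (ord_ge_dvd d0 x0); by rewrite addrC addrA addNr add0r sr.
  case: i0 i0r ci0 => [|i] ir ci; first by rewrite d0 in ci. by have := si (fun i => c i.+1) h i; rewrite sr ir (negPf ci) => /(_ isT).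
have [e eE] : exists e : int, (p%:Z %| e * c 0%N - 1)%Z.
  have : coprimez (c 0%N) p%:Z by rewrite coprimez_sym coprimezE /= prime_coprime // -dvdzE.
  move=> /coprimezP[[u w] /= uw]; exists u; rewrite -uw opprD addrA subrr add0r. by rewrite rpredN dvdz_mull.
have lt i : (`|(- e * c i) %% p%:Z|%Z < p)%N.
  by rewrite -ltz_nat abszE ger0_norm ?modz_ge0 ?ltz_pmod // ?eqz_nat -?lt0n ?ltz_nat prime_gt0.
pose f := [ffun i : 'I_r => Ordinal (lt i.+1)].
exists (cmb f); first by apply/imageP; exists f.
have fE (i : 'I_r) : (p%:Z %| (f i : nat)%:Z + e * c i.+1)%Z.
  rewrite ffunE /= abszE ger0_norm ?modz_ge0 ?eqz_nat -?lt0n ?prime_gt0 //. by rewrite -[e * _]opprK -mulNr -eqz_mod_dvd modz_mod.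
have step : ord_ge P 1 (x *~ (e * c 0%N) + \sum_(i < r) s`_i *~ (e * c i.+1)).
  have -> : \sum_(i < r) s`_i *~ (e * c i.+1) = (\sum_(i < r) s`_i *~ c i.+1) *~ e.
    rewrite -[RHS]mulrzl mulr_sumr; apply: eq_bigr => i _. by rewrite mulrzl [e * _]mulrC mulrzA.
  by have := ord_geZ e c1; rewrite mulrzDl -mulrzA [c 0%N * e]mulrC.
have -> : x - cmb f = (x *~ (e * c 0%N) + \sum_(i < r) s`_i *~ (e * c i.+1)) - x *~ (e * c 0%N - 1)
    - \sum_(i < r) s`_i *~ ((f i : nat)%:Z + e * c i.+1).
  have -> : \sum_(i < r) s`_i *~ ((f i : nat)%:Z + e * c i.+1) = cmb f + \sum_(i < r) s`_i *~ (e * c i.+1).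
    by rewrite /cmb -big_split /=; apply: eq_bigr => i _; rewrite mulrzDr.
  by rewrite mulrzBr mulr1z; move: (cmb f) (\sum_(i < r) _) (x *~ _) => t1 t2 t3; ring.
apply: ord_geB; first by apply: ord_geB step _; apply: ord_ge_dvd.
by apply: ord_ge_sum => i _; apply: ord_ge_dvd.
Qed.

(** Local compactness of the completion. Density reduces to K, a power of a uniformizer to M = 0,
    and induction on m to the residue field. *)
Lemma residue_cover m M : exists R : seq (completion P), forall x, ord_ge (cprime P) M x ->
  exists2 r, r \in R & ord_ge (cprime P) m (x - r).
Proof.
have [pi pi0 pi1] := ord_uniformizer P.
have [R1 R1P] := residue_list.
have base (n : nat) : exists R : seq K, forall x, ord_ge P 0 x -> exists2 r, r \in R & ord_ge P n%:Z (x - r).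
  elim: n => [|n [R RP]]; first by exists [:: 0] => x x0; exists 0; rewrite ?mem_head ?subr0.
  exists [seq r1 + pi * r | r1 <- R1, r <- R] => x x0; have [r1 r1R h1] := R1P x x0. have : ord_ge P 0 ((x - r1) / pi).
    rewrite -(subrr 1); apply: ord_geM h1 _; apply: ord_geV => //; by rewrite pi1.
  move=> /RP[r rR h]; exists (r1 + pi * r); first by apply/allpairsP; exists (r1, r).
  have -> : x - (r1 + pi * r) = pi * ((x - r1) / pi - r) by field.
  by rewrite -addn1 PoszD addrC; apply: ord_geM h; rewrite ord_geE // pi1.
have [R RP] := base (absz (Num.max 0 (m - M))).
have mE : m - M <= (absz (Num.max 0 (m - M)))%:Z.
  by rewrite abszE ger0_norm ?le_max ?lexx ?orbT.
pose s : K := if 0 <= M then pi ^+ `|M| else pi ^- `|M|.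
have s0 : s != 0 by rewrite /s; case: ifP; rewrite ?invr_eq0 expf_neq0.
have vs : P s = M.
  by rewrite /s; case: (ltP M 0) => h; rewrite ?ordV ?expf_neq0 // ordX // pi1 -?mulNrn; lia.
exists [seq to_completion P (s * r) | r <- R] => x xM.
have [y xy] := completion_dense x (Num.max m M).
have yM : ord_ge P M y.
  rewrite -cprime_ge_const -[to_completion P y](subrK x); apply: ord_geD xM.
  by rewrite -opprB ord_geN; apply: ord_geW xy; rewrite le_max lexx orbT.
have : ord_ge P 0 (s^-1 * y) by rewrite -(addNr M); apply: ord_geM yM; apply: ord_geV; rewrite ?vs.
move=> /RP[r rR h]; exists (to_completion P (s * r)); first by apply: map_f.
have -> : x - to_completion P (s * r) = (x - to_completion P y) + (to_completion P y - to_completion P (s * r)).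
  by rewrite addrA subrK.
apply: ord_geD; first by apply: ord_geW xy; rewrite le_max lexx.
rewrite -rmorphB cprime_ge_const.
have -> : y - s * r = s * (s^-1 * y - r) by field.
have -> : m = M + (m - M) by rewrite addrC subrK.
by apply: ord_geM; [rewrite ord_geE // vs | apply: ord_geW h].
Qed.

End Residues.

(** * Finiteness of the torsion over a completion *)

Section FiniteTorsion.
Variables (F : fieldType) (v : finite_prime F) (E : scurve F).
Hypothesis spec : forall n, (0 < n)%N -> mul_spec E n.
Hypothesis char0 : forall n, n.+1%:R != 0 :> F.
Variable p : nat.
Hypotheses (pp : prime p) (vp : 0 < v p%:R).
Hypothesis cover : forall m M : int, exists R : seq F, forall x, ord_ge v M x ->
  exists2 r, r \in R & ord_ge v m (x - r).
Local Notation a := (sa E).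
Local Notation b := (sb E).
Local Notation pt := (spoint E).

Lemma ord_low (x : F) : exists C : nat, ord_ge v (- C%:Z) x.
Proof.
exists (absz (v x)); rewrite /ord_ge; apply/orP; right; rewrite lerNl abszE.
by rewrite -normrN ler_norm.
Qed.

(** The neighbourhoods of O: points whose x-coordinate has a pole of order at least m. *)
Definition deep (m : int) (P : pt) := if val P is Some (x, _) then (x != 0) && (v x <= - m) else true.

(** The Newton polygon of the quadratic with roots w and w'. *)
Lemma ord_ge_quad m w w' : ord_ge v m (w + w') -> ord_ge v (m *+ 2) (w * w') -> ord_ge v m w.
Proof.
move=> s pr; apply: contraT; rewrite /ord_ge negb_or -ltNge => /andP[w0 wm].
have h : v (- w) < m by rewrite ordN.
have [] := ord_add_lt (_ : - w != 0) h s; rewrite ?oppr_eq0 // addKr => w'0.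
rewrite ordN => e; move: pr; rewrite ord_geE ?mulf_neq0 // ordM // e -mulr2n.
by rewrite lerMn2r leNgt wm.
Qed.

(** By [add_sub_x], the inverses of x(Q + P) and x(Q - P) are the roots of a quadratic with
    coefficients in 1/x(P) and 1/x(Q), after division by Pp, which has order 0. The Newton polygon
    then bounds their orders. *)
Lemma deepD : exists2 m0 : int, 0 < m0 & forall m, m0 <= m -> forall P Q, deep m P -> deep m Q -> deep m (Q + P).
Proof.
have [A hA] := ord_low a; have [B hB] := ord_low b.
have hnB n : ord_ge v (- B%:Z) (n%:R * b) by rewrite -[- _]add0r; apply: ord_geM (ord_nat v n) hB.
exists (A + B).+1%:Z => // m mm P Q dP dQ.
have [->|P0] := eqVneq P 0; first by rewrite addr0.
have [->|Q0] := eqVneq Q 0; first by rewrite add0r.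
have [[x [y eP]] [x1 [y1 eQ]]] := (point_xyP P0, point_xyP Q0).
move: dP dQ; rewrite /deep eP eQ => /andP[x0 vx] /andP[x10 vx1].
have pQ : projX Q x1 1 by rewrite /projX eQ mulr1 oner_eq0 andbF.
have [k k0 [hd hp hs]] := add_sub_x eP pQ.
set w := unitX (Q - P) in hd hp hs; set z := unitX (Q + P) in hd hp hs.
have vu : ord_ge v m x^-1 by rewrite -[m]opprK ord_geV.
have vu1 : ord_ge v m x1^-1 by rewrite -[m]opprK ord_geV.
set Pp := (1 - a * (x^-1 * x1^-1)) ^+ 2 - 4 * b * (x^-1 * x1^-1) * (x^-1 + x1^-1).
have pE : px E x x1 1 = (x * x1) ^+ 2 * Pp by rewrite /px /Pp; field; rewrite x0 x10.
have dE : dx x x1 1 = (x * x1) ^+ 2 * (x^-1 - x1^-1) ^+ 2 by rewrite /dx; field; rewrite x0 x10.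
have sE : 2 * sx E x x1 1 = (x * x1) ^+ 2 * (2 * ((x^-1 + x1^-1) * (1 + a * (x^-1 * x1^-1)) + 2 * b * (x^-1 * x1^-1) ^+ 2)).
  by rewrite /sx; field; rewrite x0 x10.
have h2 : ord_ge v (m + m) (x^-1 * x1^-1) by rewrite ord_geM.
have ha : ord_ge v 1 (a * (x^-1 * x1^-1)).
  by apply: ord_geW (ord_geM hA h2); move: mm; clear; lia.
have hb : ord_ge v 1 (4 * b * (x^-1 * x1^-1) * (x^-1 + x1^-1)).
  by apply: ord_geW (ord_geM (ord_geM (hnB 4) h2) (ord_geD vu vu1)); move: mm; clear; lia.
have [Pp0 vPp] : Pp != 0 /\ v Pp = 0.
  have -> : Pp = 1 + (a * (x^-1 * x1^-1) * (a * (x^-1 * x1^-1) - 2) - 4 * b * (x^-1 * x1^-1) * (x^-1 + x1^-1)) by rewrite /Pp; ring.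
  have ha0 : ord_ge v 0 (a * (x^-1 * x1^-1)) by apply: (@ord_geW _ v 0 1).
  have hR : ord_ge v 1 (a * (x^-1 * x1^-1) * (a * (x^-1 * x1^-1) - 2) - 4 * b * (x^-1 * x1^-1) * (x^-1 + x1^-1)).
    apply: ord_geB hb; rewrite -[1]addr0; apply: ord_geM ha _; by apply: ord_geB ha0 (ord_nat v 2).
  by have [] := ord_add_lt (oner_neq0 F) _ hR; rewrite ?Defs.ord1.
have xx0 : (x * x1) ^+ 2 != 0 by rewrite expf_neq0 // mulf_neq0.
rewrite {}dE in hd; rewrite {}pE in hp; rewrite {}sE in hs.
have kw : k * (w.1 * z.1) != 0 by rewrite -hp mulf_neq0.
move: (kw); rewrite !mulf_eq0 !negb_or => /and3P[_ w10 z10].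
have sum : (z.2 / z.1) + (w.2 / w.1) = 2 * ((x^-1 + x1^-1) * (1 + a * (x^-1 * x1^-1)) + 2 * b * (x^-1 * x1^-1) ^+ 2) / Pp.
  apply: (mulfI kw); rewrite -{2}hp; transitivity (k * (w.1 * z.2 + z.1 * w.2)); first by field; rewrite w10 z10.
  by rewrite -hs -[RHS]mulrA [Pp * _]mulrC divfK.
have prod : (z.2 / z.1) * (w.2 / w.1) = (x^-1 - x1^-1) ^+ 2 / Pp.
  apply: (mulfI kw); rewrite -{2}hp; transitivity (k * (w.2 * z.2)); first by field; rewrite w10 z10.
  by rewrite -hd -[RHS]mulrA [Pp * _]mulrC divfK.
have PV : ord_ge v 0 Pp^-1 by rewrite -oppr0; apply: ord_geV; rewrite ?vPp.
have m0 : 0 <= m by move: mm; clear; lia.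
have hw : ord_ge v m (z.2 / z.1).
  apply: (@ord_ge_quad m _ (w.2 / w.1)).
    rewrite sum -[m]addr0; apply: ord_geM _ PV; rewrite -[m]add0r; apply: ord_geM (ord_nat v 2) _. apply: ord_geD.
      rewrite -[m]addr0; apply: ord_geM (ord_geD vu vu1) (ord_geD (ord_ge1 v) _). exact: ord_geW ha.
    by apply: ord_geW (ord_geM (hnB 2) (ord_geX 2 h2)); move: mm; clear; lia.
  rewrite prod -[_ *+ 2]addr0; apply: ord_geM _ PV; apply: ord_geX; exact: ord_geB.
move: hw z10; rewrite /z /unitX /deep; case: (val (Q + P)) => [[x3 y3]|] //= + x30.
by rewrite x30 mul1r ord_geE ?invr_eq0 // ordV // lerNr.
Qed.

Lemma lead_dominates (q : {poly F}) n (D : int) : (size q <= n.+1)%N -> exists2 C : nat, (0 < C)%N & forall x, x != 0 -> v x <= - C%:Z ->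
  ord_ge v (v x *+ n + D) (q.[x] - q`_n * x ^+ n).
Proof.
move=> sq; have [C hC] : exists C : nat, forall i, (i < n)%N -> ord_ge v (- C%:Z) q`_i.
  elim: (n) => [|k [C hC]]; first by exists 0%N.
  have [C' hC'] := ord_low q`_k; exists (maxn C C') => i; rewrite ltnS leq_eqVlt => /orP[/eqP->|/hC h].
    by apply: ord_geW hC'; rewrite lerN2 lez_nat leq_maxr.
  by apply: ord_geW h; rewrite lerN2 lez_nat leq_maxl.
exists (C + absz D).+1 => // x x0 vx; rewrite (horner_coef_wide x sq) big_ord_recr /= addrK.
apply: ord_ge_sum => i _; have xi : ord_ge v (v x *+ i) (x ^+ i) by apply: ord_geX; rewrite ord_geE.
apply: ord_geW (ord_geM (hC i (ltn_ord i)) xi).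
move: (nat_of_ord i) (ltn_ord i) => t tn {xi}.
have [k ->] : exists k, n = (t + k.+1)%N by exists (n - t.+1)%N; lia.
rewrite mulrnDr -addrA addrC lerD2r mulrSr.
have : v x *+ k <= 0 by rewrite mulrn_wle0 //; move: vx; clear; lia.
move: vx; clear; move: (v x *+ k) => u; lia.
Qed.

(** For a deep point the leading terms of A_p and B_p dominate, so x(pP) has the order of x / p^2,
    which is strictly smaller. *)
Lemma deep_mulp : exists m1 : nat, forall P m, m1%:Z <= m -> P != 0 -> deep m P ->
  P *+ p != 0 /\ deep (m + 1) (P *+ p).
Proof.
have [[mA sA sB lB _] _ _] := spec (prime_gt0 pp).
have p21 : (0 < p ^ 2)%N by rewrite expn_gt0 prime_gt0.
have [N NE] : exists N, (p ^ 2)%N = N.+1 by exists (p ^ 2).-1; rewrite prednK.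
have p0 : p%:R != 0 :> F by case: (p) (prime_gt0 pp) => // k _; exact: char0.
have vp2 : v (p ^ 2)%:R = v p%:R *+ 2 by rewrite natrX ordX.
have [CA CA0 hA] := lead_dominates 1 (eq_leq sA).
have [CB CB0 hB] : exists2 C : nat, (0 < C)%N & forall x, x != 0 -> v x <= - C%:Z ->
  ord_ge v (v x *+ N + (v p%:R *+ 2 + 1)) ((mulB a b p).[x] - (mulB a b p)`_N * x ^+ N).
  by apply: lead_dominates; rewrite sB NE.
exists (CA + CB)%N => P m mm P0 dP; have [x [y eP]] := point_xyP P0.
move: dP; rewrite /deep eP => /andP[x0 vx].
have /(hA x x0) rA : v x <= - CA%:Z by move: vx mm; clear; lia.
have /(hB x x0) rB : v x <= - CB%:Z by move: vx mm; clear; lia.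
have lA : (mulA a b p)`_(p ^ 2) = 1 by move: mA => /monicP; rewrite lead_coefE sA.
have lB' : (mulB a b p)`_N = (p ^ 2)%:R by move: lB; rewrite lead_coefE sB NE.
rewrite lA mul1r in rA; rewrite lB' in rB.
have [A0 vA] : (mulA a b p).[x] != 0 /\ v (mulA a b p).[x] = v x *+ (p ^ 2).
  have h : v (x ^+ (p ^ 2)) < v x *+ (p ^ 2) + 1 by rewrite ordX // ltrDl.
  by have := ord_add_lt (expf_neq0 (p ^ 2) x0) h rA; rewrite addrC subrK ordX.
have [B0 vB] : (mulB a b p).[x] != 0 /\ v (mulB a b p).[x] = v x *+ N + v p%:R *+ 2.
  have n0 : (p ^ 2)%:R * x ^+ N != 0 by rewrite mulf_neq0 ?expf_neq0 // natrX expf_neq0.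
  have e : v ((p ^ 2)%:R * x ^+ N) = v x *+ N + v p%:R *+ 2.
    by rewrite ordM ?ordX ?expf_neq0 // ?vp2 ?natrX ?expf_neq0 // addrC.
  have h : v ((p ^ 2)%:R * x ^+ N) < v x *+ N + (v p%:R *+ 2 + 1) by rewrite e ltrD2l ltrDl.
  by have := ord_add_lt n0 h rB; rewrite addrC subrK e.
have [_] := mul_x spec eP (prime_gt0 pp); rewrite point_eq0.
case: (val (P *+ p)) => [[x' y']|] /= e; last by rewrite e eqxx in B0.
have x'0 : x' != 0 by apply: contra A0 => /eqP x'0; rewrite e x'0 mul0r.
split=> //; rewrite x'0 /=; move: vA; rewrite e ordM // vB NE (mulrS (v x)) mulr2n.
by move: vx vp; clear; move: (v x *+ N) => t; lia.
Qed.

(** One reduces to a multiple P' with q P' = 0, q prime. For q = p this contradicts [deep_mulp]. For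
    q != p, P' is a multiple of p P' and would be deeper than its own depth. *)
Lemma no_deep_torsion : exists M : nat, forall n P, (0 < n)%N -> deep M%:Z P -> P != 0 -> P *+ n != 0.
Proof.
have [m0 m00 dD] := deepD; have [m1 dp] := deep_mulp.
exists (absz m0 + m1)%N; set M := (absz m0 + m1)%N%:Z.
have M0 : m0 <= M by rewrite /M; move: m00; clear; lia.
have dMn m P n : M <= m -> deep m P -> deep m (P *+ n).
  move=> Mm dP; elim: n => [|n IH]; first by rewrite mulr0n. by rewrite mulrSr; apply: dD => //; apply: le_trans M0 Mm.
elim/ltn_ind => n IH P n0 dP P0; have [n1|n1] := leqP n 1.
  by rewrite (_ : n = 1%N) ?mulr1n //; apply/eqP; rewrite eqn_leq n1.
have qp := pdiv_prime n1; have := pdiv_dvd n; move: (pdiv n) qp => q qp /dvdnP[n' nE].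
have q1 := prime_gt1 qp.
have n'0 : (0 < n')%N by move: n0; rewrite nE muln_gt0 => /andP[].
have n'n : (n' < n)%N by rewrite nE ltn_Pmulr.
have P'0 := IH n' n'n P n'0 dP P0; have dP' := dMn M P n' (lexx _) dP.
rewrite nE mulrnA; move: (P *+ n') P'0 dP' => P' P'0 dP'.
have [x' [y' eP']] := point_xyP P'0; pose j := - v x'.
have [x'0 Mj] : x' != 0 /\ M <= j by move: dP'; rewrite /deep eP' lerNr => /andP[].
have dj : deep j P' by rewrite /deep eP' x'0 opprK lexx.
have m1j : m1%:Z <= j by apply: le_trans Mj; rewrite /M lez_nat leq_addl.
have [pP dpP] := dp P' j m1j P'0 dj.
apply/eqP => qP; have [qE|qnp] := eqVneq q p; first by rewrite qE in qP; rewrite qP eqxx in pP.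
have co : coprime q p by rewrite prime_coprime // dvdn_prime2.
have c1 : (chinese q p 1 0 %% q = 1)%N by rewrite chinese_modl // modn_small.
have /dvdnP[c' c'E] : (p %| chinese q p 1 0)%N by rewrite /dvdn chinese_modr // mod0n.
have : P' *+ chinese q p 1 0 = P'.
  by rewrite (divn_eq (chinese q p 1 0) q) c1 mulrnDr mulr1n [(_ * q)%N]mulnC mulrnA qP mul0rn add0r.
rewrite c'E mulnC mulrnA => e; have := dMn (j + 1) _ c' _ dpP; rewrite e.
move=> /(_ (le_trans Mj _)); rewrite lerDl ler01 => /(_ isT).
by rewrite /deep eP' x'0 /= /j; clear; move: (v x') => t; lia.
Qed.

Theorem finite_torsion : exists T : seq pt, forall P n, (0 < n)%N -> P *+ n = 0 -> P \in T.
Proof.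
have [M noM] := no_deep_torsion.
pose tors (P : pt) := exists2 n, (0 < n)%N & P *+ n = 0.
have low P x y : tors P -> val P = Some (x, y) -> ord_ge v (- M%:Z) x.
  move=> [n n0 nP] eP; have P0 : P != 0 by rewrite point_eq0 eP. apply: contraT; rewrite /ord_ge negb_or -ltNge => /andP[x0 vx].
  have := noM n P n0 _ P0; rewrite nP eqxx => /(_ _)/negP h; case: h => //. by rewrite /deep eP x0 ltW.
have torsD P Q : tors P -> tors Q -> tors (P + Q).
  move=> [n n0 nP] [m m0 mQ]; exists (n * m)%N; first by rewrite muln_gt0 n0.
  by rewrite mulrnDl mulrnA nP mul0rn mulnC mulrnA mQ mul0rn addr0.
have torsN P : tors P -> tors (- P) by move=> [n n0 nP]; exists n; rewrite // mulNrn nP oppr0.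
have [A hA] := ord_low a; have [B hB] := ord_low b.
have [[_ _ _ _ _] [_ _ _ _ /Bezout_eq1_coprimepP[[U V] /= UV]] _] := spec (ltn0Sn 0).
have [CU hU] := ord_horner v U (- M%:Z); have [CV hV] := ord_horner v V (- M%:Z).
pose m := (5 * M + A + B + absz CU + absz CV + 1)%N.
(* If x1 is close to x but different, Q - P and Q + P are nonzero torsion points with bounded
   x-coordinates. Then k = (x1 - x)^2 is small, and with it the other coefficients of the quadratic.
   This makes A_2(x) and B_2(x) small, against the Bezout relation of A_2 and B_2. So one point per
   ball of the finite cover suffices, up to sign. *)
have sep P Q x y x1 y1 : tors P -> tors Q -> val P = Some (x, y) -> val Q = Some (x1, y1) ->
    ord_ge v m%:Z (x1 - x) -> x1 = x.
  move=> tP tQ eP eQ hm; apply: contrapT => /eqP x1x. have hx := low P x y tP eP; have hx1 := low Q x1 y1 tQ eQ.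
  have pQ : projX Q x1 1 by rewrite /projX eQ mulr1 oner_eq0 andbF. have [k k0 [hd hp hs]] := add_sub_x eP pQ.
  have fin R : tors R -> R != 0 -> (unitX R).2 = 1 /\ ord_ge v (- M%:Z) (unitX R).1.
    move=> tR R0; have [x3 [y3 eR]] := point_xyP R0; rewrite /unitX eR /=; split=> //. exact: low tR eR.
  have d0 : Q - P != 0.
    by rewrite subr_eq0; apply: contra x1x => /eqP e; move: eQ; rewrite e eP => -[->].
  have s0 : Q + P != 0.
    by rewrite addr_eq0; apply: contra x1x => /eqP e; move: eQ; rewrite e val_opp eP => -[->].
  have [u2 hu] := fin _ (torsD _ _ tQ (torsN _ tP)) d0; have [w2 hw] := fin _ (torsD _ _ tQ tP) s0. rewrite u2 w2 !mulr1 in hd hs.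
  have hk : ord_ge v (m%:Z *+ 2) k by rewrite -hd /dx mulr1; apply: ord_geX.
  have hpx : ord_ge v (m%:Z *+ 2 + (- M%:Z - M%:Z)) (px E x x1 1).
    by rewrite hp; apply: ord_geM hk _; apply: ord_geM.
  have hsx : ord_ge v (m%:Z *+ 2 - M%:Z) (2 * sx E x x1 1).
    by rewrite hs; apply: ord_geM hk _; apply: ord_geD.
  have nat_ge n w q : ord_ge v q w -> ord_ge v q (n%:R * w) by move=> h; rewrite -[q]add0r; apply: ord_geM (ord_nat v n) h.
  pose D : int := - (3 * M + A + B)%N%:Z. have hxx : ord_ge v (- M%:Z - M%:Z) (x * x) by apply: ord_geM.
  have hxx1 : ord_ge v (- M%:Z - M%:Z) (x * x1) by apply: ord_geM. have hA2 : ord_ge v (m%:Z + D) (mulA a b 2).[x].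
    have -> : (mulA a b 2).[x] = px E x x1 1 - (x1 - x) * (x * (x * x1 + x * x - 2 * a) - 4 * b).
      by rewrite mulA2 /px !(hornerD, hornerN, hornerM, horner_exp, hornerX, hornerC, horner_nat); ring.
    apply: ord_geB; first by apply: ord_geW hpx; rewrite /D /m; clear; lia.
    apply: ord_geM hm _; apply: ord_geB; last by apply: ord_geW (nat_ge 4 b _ hB); rewrite /D; clear; lia.
    have h3 : ord_ge v (- (2 * M + A)%N%:Z) (x * x1 + x * x - 2 * a).
      apply: ord_geB; last by apply: ord_geW (nat_ge 2 a _ hA); clear; lia.
      by apply: ord_geD; [apply: ord_geW hxx1|apply: ord_geW hxx]; clear; lia.
    by apply: ord_geW (ord_geM hx h3); rewrite /D; clear; lia.
  have hB2 : ord_ge v (m%:Z + D) (mulB a b 2).[x].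
    have -> : (mulB a b 2).[x] = 2 * sx E x x1 1 - (x1 - x) * (2 * (x * x1 + 2 * (x * x) + a)).
      by rewrite mulB2 hornerM horner_nat cubicE /sx; ring.
    apply: ord_geB; first by apply: ord_geW hsx; rewrite /D /m; clear; lia.
    apply: ord_geM hm _; apply: (nat_ge); apply: ord_geD; last by apply: ord_geW hA; rewrite /D; clear; lia.
    by apply: ord_geD; [apply: ord_geW hxx1|apply: ord_geW (nat_ge 2 _ _ hxx)]; rewrite /D; clear; lia.
  have := congr1 (fun q => q.[x]) UV; rewrite hornerD hornerC (hornerM U) (hornerM V) => e1. have : ord_ge v 1 1.
    rewrite -[X in ord_ge v 1 X]e1; apply: ord_geD.
      by apply: ord_geW (ord_geM (hU x hx) hA2); rewrite /D /m; clear; lia.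
    by apply: ord_geW (ord_geM (hV x hx) hB2); rewrite /D /m; clear; lia.
  by rewrite ord_geE ?oner_eq0 // Defs.ord1.
have [R RP] := cover m%:Z (- M%:Z).
pose near (r : F) (P : pt) := tors P /\ exists x y, val P = Some (x, y) /\ ord_ge v m%:Z (x - r).
have ch r : exists P, (exists Q, near r Q) -> near r P.
  by case: (pselect (exists Q, near r Q)) => [[Q nQ]|no]; [exists Q | exists 0].
pose Q r := sval (cid (ch r)); have QP r : (exists Q, near r Q) -> near r (Q r) := svalP (cid (ch r)).
exists (0 :: flatten [seq [:: Q r; - Q r] | r <- R]) => P n n0 nP.
have [->|P0] := eqVneq P 0; first by rewrite mem_head.
have tP : tors P by exists n.
have [x [y eP]] := point_xyP P0; have [r rR xr] := RP x (low P x y tP eP).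
have [|tQ [x1 [y1 [eQ x1r]]]] := QP r; first by exists P; split=> //; exists x, y.
have xx : x1 = x.
  apply: (sep P (Q r) x y x1 y1 tP tQ eP eQ). by rewrite -(subrK r x1) -addrA; apply: ord_geD => //; rewrite -opprB ord_geN.
rewrite in_cons; apply/orP; right; apply/flatten_mapP; exists r => //; rewrite !inE.
have : y ^+ 2 == y1 ^+ 2 by rewrite (spoint_on eP) (spoint_on eQ) xx.
rewrite eqf_sqr => /orP[]/eqP yE; apply/orP; [left|right]; apply/eqP/val_inj.
  by rewrite eP eQ xx yE.
by rewrite val_opp eP eQ xx yE.
Qed.

End FiniteTorsion.

(** * Integral generators and evaluation homomorphisms *)

Local Notation pQC := (map_poly (ratr : rat -> algC)).
Local Notation pZQ := (map_poly (intr : int -> rat)).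

(** As z is algebraic, this says that x lies in the field Q(z). *)
Definition polyin (z x : algC) := exists w : {poly rat}, x = (pQC w).[z].

Lemma pet_int (s : seq algC) : exists z, [/\ z \in Aint,
  exists a : nat -> nat, z = \sum_(i < size s) s`_i *+ a i & forall x, x \in s -> polyin z x].
Proof.
have [z [a zE] [ps sE]] := algC_PET s; have [m m0 mz] := integral_multiple z.
exists (m%:R * z); split=> //.
  exists (fun i => if insub i is Some i' then (a i' * m)%N else 0%N).
  rewrite {1}zE mulr_sumr; apply: eq_bigr => i _; rewrite insubT //= => hi.
  by rewrite mulrC mulrnA -[RHS]mulr_natr; congr (_ *+ _ * _); congr (a _); apply: val_inj.
move=> x; rewrite {1}sE => /mapP[w _ ->]; exists (w \Po (m%:R^-1 *: 'X)).
rewrite map_comp_poly map_polyZ /= map_polyX horner_comp hornerZ hornerX.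
by rewrite fmorphV rmorph_nat mulKf // pnatr_eq0 -lt0n.
Qed.

(** f is the minimal polynomial of the algebraic integer z, with its degree n. *)
Definition minint (z : algC) (f : {poly int}) (n : nat) := [/\ f \is monic, size f = n.+1, (0 < n)%N &
  forall u : {poly rat}, root (pQC u) z = (pZQ f %| u)].

Lemma minint_exists z : z \in Aint -> exists f n, minint z f n.
Proof.
move=> zA; have [q [qE qm] qP] := minCpolyP z; pose f := map_poly numq q.
have cq i : q`_i = (numq q`_i)%:~R.
  have /polyOverP/(_ i) := zA; rewrite qE coef_map /= => /intrP[m e].
  have -> : q`_i = m%:~R by apply: (fmorph_inj (ratr : {rmorphism rat -> algC})); rewrite /= e ratr_int. by rewrite numq_int.
have fq : pZQ f = q by apply/polyP => i; rewrite coef_map coef_map_id0 /= ?numq0 // -cq.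
have sf : size f = size q by rewrite -fq [RHS]size_map_inj_poly //; exact: intr_inj.
have fm : f \is monic.
  by rewrite monicE lead_coefE sf coef_map_id0 /= ?numq0 // -lead_coefE (monicP qm).
have q1 : (1 < size q)%N.
  rewrite ltnNge; apply/negP => /size1_polyC qc. have q0 : q`_0 = 1 by move: qm; rewrite {1}qc monicE lead_coefC => /eqP.
  have qq : q = 1 by rewrite qc q0. by have := qP q; rewrite dvdpp qq rmorph1 rootE hornerC oner_eq0.
exists f, (size q).-1; split=> [//|||u]; first by rewrite sf prednK // ltnW.
  by rewrite -ltnS prednK // ltnW.
by rewrite fq qP.
Qed.

Lemma minint_bezout z f n (u : {poly int}) : minint z f n -> (pQC (pZQ u)).[z] != 0 ->
  exists a b (c : int), c != 0 /\ a * u + b * f = c%:P.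
Proof.
move=> [fm sf n0 fP] uz; have f0 : pZQ f != 0 by rewrite monic_neq0 ?monic_map.
have co : coprimep (pZQ u) (pZQ f).
  have /dvdpP[h hE] := dvdp_gcdr (pZQ u) (pZQ f). have : root (pQC (pZQ f)) z by rewrite fP.
  rewrite {1}hE rmorphM rootM !fP => /orP[fh|fg]; last first.
    by case/negP: uz; rewrite -rootE fP (dvdp_trans fg) // dvdp_gcdl.
  have [h0 g0] : h != 0 /\ gcdp (pZQ u) (pZQ f) != 0 by move: f0; rewrite {1}hE mulf_eq0 negb_or => /andP[].
  have := dvdp_leq h0 fh; rewrite {1}hE size_mul // /coprimep eqn_leq => le. rewrite [(0 < _)%N]lt0n size_poly_eq0 g0 andbT.
  by move: le; have : (0 < size h)%N; [rewrite lt0n size_poly_eq0 | move: (size _) (size _) => x y; lia].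
have /Bezout_eq1_coprimepP[[U V] /= UV] := co.
have [U' [a a0 UE]] := rat_poly_scale U; have [V' [b b0 VE]] := rat_poly_scale V.
exists (b *: U'), (a *: V'), (a * b); split; first by rewrite mulf_neq0.
apply: (map_inj_poly (f := intr : int -> rat)); [exact: intr_inj | exact: rmorph0 |].
rewrite [RHS]map_polyC /= intrM rmorphD !rmorphM /= !map_polyZ /=.
transitivity ((a%:~R * b%:~R : rat)%:P * (U * pZQ u + V * pZQ f)); last by rewrite UV mulr1 ?polyCM ?rmorphM.
rewrite UE VE -!mul_polyC !polyCM mulrDr; congr (_ + _).
  have e : (a%:~R : rat)%:P * (a%:~R^-1)%:P = 1 by rewrite -polyCM divff ?intr_eq0.
  by transitivity ((b%:~R)%:P * pZQ U' * pZQ u * ((a%:~R : rat)%:P * (a%:~R^-1)%:P)); [rewrite e mulr1 | ring].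
have e : (b%:~R : rat)%:P * (b%:~R^-1)%:P = 1 by rewrite -polyCM divff ?intr_eq0.
by transitivity ((a%:~R)%:P * pZQ V' * pZQ f * ((b%:~R : rat)%:P * (b%:~R^-1)%:P)); [rewrite e mulr1 | ring].
Qed.

Lemma pQC_int (u : {poly int}) z : (pQC (pZQ u)).[z] = (map_poly intr u).[z].
Proof. by rewrite -map_poly_comp; congr (_.[z]); apply: eq_map_poly => i /=; rewrite ratr_int. Qed.

Lemma minint_irr z f n : minint z f n -> forall u : {poly int}, u != 0 -> (size u <= n)%N ->
  exists a b (c : int), c != 0 /\ a * u + b * f = c%:P.
Proof.
move=> mz u u0 su; apply: (minint_bezout mz); have [fm sf n0 fP] := mz.
have q0 : pZQ u != 0 by rewrite map_poly_eq0_id0 ?intr_eq0 // lead_coef_eq0.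
rewrite -rootE fP; apply/negP => /(dvdp_leq q0).
by rewrite !size_map_inj_poly ?sf //; [rewrite ltnNge su | exact: intr_inj | exact: intr_inj].
Qed.

Lemma minint_sep z f n : minint z f n -> exists sa sb (sc : int), sc != 0 /\ sa * f + sb * f^`() = sc%:P.
Proof.
move=> mz; have [fm sf n0 fP] := mz; have irr := minint_irr mz.
have [||a [b [c [c0 e]]]] := irr f^`().
- rewrite -size_poly_eq0; apply/eqP => s0.
  have : f^`()`_n.-1 = 0 by rewrite nth_default // s0. have lc : f`_n = 1 by move: (fm) => /monicP; rewrite lead_coefE sf.
  by rewrite coef_deriv prednK // lc => /eqP; rewrite pnatr_eq0 gtn_eqF.
- by rewrite -ltnS -sf lt_size_deriv // monic_neq0.
by exists b, a, c; rewrite addrC.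
Qed.

Section EvalHom.
Variables (L : fieldType) (i : {rmorphism L -> algC}) (z : algC) (f : {poly int}) (n : nat).
Hypotheses (mz : minint z f n) (gen : forall x, polyin z (i x)).
Variables (F : fieldType) (j : {rmorphism rat -> F}) (r : F).
Hypothesis fr : root (map_poly j (pZQ f)) r.

Lemma eval_wd (w w' : {poly rat}) : (pQC w).[z] = (pQC w').[z] -> (map_poly j w).[r] = (map_poly j w').[r].
Proof.
have [_ _ _ fP] := mz => e; have : root (pQC (w - w')) z by rewrite rootE rmorphB hornerD hornerN e subrr.
rewrite fP -(dvdp_map j) => /dvdpP[q qE].
have := congr1 (fun p => p.[r]) qE; rewrite rmorphB hornerD hornerN hornerM (eqP fr) mulr0.
by move/eqP; rewrite subr_eq0 => /eqP.
Qed.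

(** A root r of the minimal polynomial of z in F yields an embedding of Q(z), given by z -> r, and L
    lies in Q(z). *)
Lemma eval_hom : exists phi : {rmorphism L -> F}, forall x (w : {poly rat}),
  i x = (pQC w).[z] -> phi x = (map_poly j w).[r].
Proof.
pose W x := sval (cid (gen x)); have WP x : i x = (pQC (W x)).[z] := svalP (cid (gen x)).
pose phi x := (map_poly j (W x)).[r].
have phiE x w : i x = (pQC w).[z] -> phi x = (map_poly j w).[r].
  by move=> e; apply: eval_wd; rewrite -WP.
have zm : zmod_morphism phi.
  move=> x y; have e : i (x - y) = (pQC (W x - W y)).[z].
    by rewrite rmorphB !WP rmorphB hornerD hornerN.
  by rewrite (phiE _ _ e) rmorphB hornerD hornerN.
have mm : monoid_morphism phi.
  split; first by rewrite (phiE 1 1) rmorph1 ?hornerC // rmorph1 hornerC. move=> x y; have e : i (x * y) = (pQC (W x * W y)).[z].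
    by rewrite rmorphM !WP rmorphM hornerM.
  by rewrite (phiE _ _ e) rmorphM hornerM.
pose m1 := GRing.isZmodMorphism.Build L F phi zm.
pose m2 := GRing.isMonoidMorphism.Build L F phi mm.
pose phiM : {rmorphism L -> F} := HB.pack phi m1 m2.
by exists phiM.
Qed.

End EvalHom.

Lemma gen_field z : exists (L : fieldExtType rat) (i : {rmorphism L -> algC}) (t : L),
  i t = z /\ forall x, polyin z (i x).
Proof.
have [L [i [s sE gen]]] := num_field_exists [:: z].
case: s sE gen => [|t [|]] //= [tz] gen; exists L, i, t; split=> // x.
have : x \in <<1; t>>%VS by rewrite -adjoin_seq1 gen memvf.
case/Fadjoin1_polyP => q ->; exists q.
by rewrite -tz horner_map /= map_in_alg || (rewrite -horner_map /= map_in_alg tz).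
Qed.

Lemma polyin_pull z (L : fieldExtType rat) (i : {rmorphism L -> algC}) t x : i t = z -> polyin z x -> exists y, x = i y.
Proof.
move=> tz [w ->]; exists (map_poly (in_alg L) w).[t].
by rewrite -horner_map /= map_in_alg tz.
Qed.

(** * The prime of K given by a simple root modulo p *)

Section PadicRat.
Variables (p : nat) (pp : prime p).

Definition padic (x : rat) : int := (logn p `|numq x|)%:Z - (logn p `|denq x|)%:Z.

Lemma padicE (a b : int) : a != 0 -> b != 0 -> padic (a%:~R / b%:~R) = (logn p `|a|)%:Z - (logn p `|b|)%:Z.
Proof.
move=> a0 b0; set x := _ / _; have x0 : x != 0 by rewrite mulf_neq0 ?invr_eq0 ?intr_eq0.
have e : numq x * b = a * denq x.
  apply/eqP; rewrite -(eqr_int rat) !rmorphM /= numqE mulrAC; apply/eqP; congr (_ * _). by rewrite /x divfK ?intr_eq0.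
have := congr1 (fun y : int => logn p `|y|) e; rewrite !abszM !lognM ?absz_gt0 ?numq_eq0 ?denq_neq0 //.
by rewrite /padic => h; move: h; move: (logn _ _) (logn _ _) (logn _ _) (logn _ _) => s t u w; lia.
Qed.

Lemma padic0 : padic 0 = 0. Proof. by rewrite /padic -[0]/(0%:~R : rat) numq_int denq_int logn0 logn1. Qed.

Lemma padicM x y : x != 0 -> y != 0 -> padic (x * y) = padic x + padic y.
Proof.
move=> x0 y0; have [nx ny dx dy] : [/\ numq x != 0, numq y != 0, denq x != 0 & denq y != 0].
  by rewrite !numq_eq0 !denq_neq0.
have -> : x * y = (numq x * numq y)%:~R / (denq x * denq y)%:~R.
  by rewrite -{1}(divq_num_den x) -{1}(divq_num_den y) !rmorphM /=; field; rewrite !intr_eq0 dx dy.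
rewrite padicE ?mulf_neq0 // !abszM !lognM ?absz_gt0 // /padic !PoszD.
by rewrite opprD addrACA.
Qed.

Lemma padicD x y : x != 0 -> y != 0 -> x + y != 0 -> Num.min (padic x) (padic y) <= padic (x + y).
Proof.
move=> x0 y0; have [nx ny dx dy] : [/\ numq x != 0, numq y != 0, denq x != 0 & denq y != 0].
  by rewrite !numq_eq0 !denq_neq0.
pose c := numq x * denq y + numq y * denq x.
have -> : x + y = c%:~R / (denq x * denq y)%:~R.
  rewrite /c -{1}(divq_num_den x) -{1}(divq_num_den y) rmorphD !rmorphM /=; field; rewrite !intr_eq0 ?dx ?dy //.
rewrite mulf_eq0 negb_or intr_eq0 => /andP[c0 _]; rewrite padicE ?mulf_neq0 //.
pose A := numq x * denq y; pose B := numq y * denq x; pose D := denq x * denq y.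
have xE : padic x = (logn p `|A|)%:Z - (logn p `|D|)%:Z.
  by rewrite /A /D !abszM !lognM ?absz_gt0 // /padic !PoszD opprD addrACA subrr addr0.
have yE : padic y = (logn p `|B|)%:Z - (logn p `|D|)%:Z.
  by rewrite /B /D !abszM !lognM ?absz_gt0 // /padic !PoszD opprD [- _ - _]addrC addrACA subrr addr0.
rewrite {}xE {}yE.
have A0 : A != 0 by rewrite mulf_neq0.
have B0 : B != 0 by rewrite mulf_neq0.
have : (minn (logn p `|A|) (logn p `|B|) <= logn p `|c|)%N.
  rewrite -pfactor_dvdn ?absz_gt0 //. have : ((p ^ minn (logn p `|A|) (logn p `|B|))%N%:Z %| c)%Z.
    by apply: rpredD; rewrite dvdzE /= pfactor_dvdn ?absz_gt0 // ?geq_minl ?geq_minr.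
  by rewrite dvdzE.
rewrite -/D; move: (logn p `|c|) (logn p `|A|) (logn p `|B|) (logn p `|D|) => u w s r.
by rewrite ge_min; clear; lia.
Qed.

Lemma padic_uniformizer : exists2 x, x != 0 & padic x = 1.
Proof.
exists p%:R; first by rewrite pnatr_eq0 -lt0n prime_gt0.
by rewrite /padic -[p%:R]/(p%:Z%:~R) numq_int denq_int /= logn_prime // eqxx logn1.
Qed.

Definition padic_prime : finite_prime rat := FinitePrime padic0 padicM padicD padic_uniformizer.

Lemma padic_int (n : nat) (x : int) : ord_ge padic_prime n%:Z x%:~R = ((p ^ n)%N%:Z %| x)%Z.
Proof.
rewrite /ord_ge /= intr_eq0; have [->|x0 /=] := eqVneq x 0; first by rewrite dvdz0.
by rewrite /padic numq_int denq_int logn1 subr0 lez_nat dvdzE /= pfactor_dvdn // absz_gt0.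
Qed.

End PadicRat.

Section Hensel.
Variables (p : nat) (pp : prime p) (f : {poly int}) (t e : int).
Hypotheses (ft : (p%:Z %| f.[t])%Z) (fe : (p%:Z %| e * f^`().[t] - 1)%Z).

(** Newton's iteration with the inverse e of the derivative at t kept fixed, so that all terms are
    integers. *)
Definition newton k : int := iter k (fun s => s - e * f.[s]) t.

Lemma horner_taylor (s d : int) : exists c, f.[s + d] = f.[s] + f^`().[s] * d + c * d ^+ 2.
Proof.
elim/poly_ind: f => [|q a [c h]]; first by exists 0; rewrite deriv0 !horner0; ring.
exists (f^`().[s] * 0 + q^`().[s] + c * (s + d)).
rewrite !hornerMXaddC h derivD derivM derivX derivC addr0 hornerD !hornerM hornerX hornerC.
by ring.
Qed.

Lemma newtonP k : ((p ^ k.+1)%N%:Z %| f.[newton k])%Z /\ (p%:Z %| newton k - t)%Z.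
Proof.
elim: k => [|k [IH1 IH2]]; first by rewrite expn1 subrr dvdz0.
set s := newton k in IH1 IH2.
have ps : (p%:Z %| f.[s])%Z by apply: dvdz_trans IH1; rewrite dvdzE /= dvdn_exp.
split; last first.
  by rewrite /newton /= -/(newton k) -/s addrAC rpredB // dvdz_mull.
rewrite /newton /= -/(newton k) -/s; have [c ->] := horner_taylor s (- (e * f.[s])).
have -> : f.[s] + f^`().[s] * - (e * f.[s]) + c * (- (e * f.[s])) ^+ 2 =
  - (f.[s] * (e * f^`().[s] - 1)) + c * e ^+ 2 * (f.[s] * f.[s]) by ring.
have fs : (p%:Z %| e * f^`().[s] - 1)%Z.
  have -> : e * f^`().[s] - 1 = e * (f^`().[s] - f^`().[t]) + (e * f^`().[t] - 1) by ring. rewrite rpredD // dvdz_mull //.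
  have : (p%:Z %| (f^`() - (f^`().[t])%:P).[s])%Z.
    by apply: dvdz_horner IH2 _; rewrite hornerD hornerN hornerC subrr dvdz0.
  by rewrite hornerD hornerN hornerC.
by apply: rpredD; [rewrite rpredN | rewrite dvdz_mull //]; rewrite expnSr PoszM dvdz_mul.
Qed.

Lemma newton_cauchy k m : (k <= m)%N -> ((p ^ k)%N%:Z %| newton m - newton k)%Z.
Proof.
move=> /subnKC <-; elim: (m - k)%N => [|i IH]; first by rewrite addn0 subrr dvdz0.
rewrite addnS /newton /= -/(newton (k + i)) addrAC rpredB //.
rewrite dvdz_mull //; apply: dvdz_trans (newtonP (k + i)).1.
by rewrite dvdzE /= dvdn_exp2l // (leq_trans (leq_addr i k)).
Qed.

Section Root.
Variables (K : fieldType) (P : finite_prime K).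
Hypothesis Pint : forall (n : nat) (x : int), ((p ^ n)%N%:Z %| x)%Z -> ord_ge P n%:Z x%:~R.

Lemma newton_seq : (fun k => (newton k)%:~R : K) \in cauchy P.
Proof.
apply/asboolP => n; exists `|n|%N => i j ni nj.
apply: (@ord_geW _ P n `|n|%N%:Z); first by rewrite abszE ler_norm.
rewrite -rmorphB /=; apply: Pint; have := rpredB (newton_cauchy ni) (newton_cauchy nj).
by congr (_ %| _)%Z; ring.
Qed.

Definition newton_cls : cauchy_seq P := CauchySeq newton_seq.
Definition newton_lim : completion P := (\pi_{ideal_quot (null_seq (p := P))} newton_cls)%qT.

Lemma ord_ge_all_eq0 (F : fieldType) (v : finite_prime F) (x : F) : (forall n : nat, ord_ge v n%:Z x) -> x = 0.
Proof.
move=> h; apply/eqP; apply: contraT => x0; have := h (`|v x|.+1)%N; rewrite ord_geE //.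
by move: (v x) => a; clear; lia.
Qed.

Lemma ord_int_horner (F : fieldType) (v : finite_prime F) (w : {poly int}) (x : F) :
  ord_ge v 0 x -> ord_ge v 0 (map_poly intr w).[x].
Proof.
move=> x0; elim/poly_ind: w => [|w c IH]; first by rewrite rmorph0 horner0 ord_ge0.
rewrite rmorphD rmorphM /= map_polyX map_polyC hornerMXaddC -[0]addr0.
apply: ord_geD; last by rewrite addr0; apply: ord_int.
exact: ord_geM.
Qed.

Lemma ord_int_horner_sub (F : fieldType) (v : finite_prime F) (w : {poly int}) n (x y : F) :
  ord_ge v 0 x -> ord_ge v 0 y -> ord_ge v n (x - y) ->
  ord_ge v n ((map_poly intr w).[x] - (map_poly intr w).[y]).
Proof.
move=> x0 y0 xy; elim/poly_ind: w => [|w c IH]; first by rewrite rmorph0 !horner0 subrr ord_ge0.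
rewrite rmorphD rmorphM /= map_polyX map_polyC !hornerMXaddC.
set wx := (map_poly _ w).[x] in IH *; set wy := (map_poly _ w).[y] in IH *.
have -> : wx * x + c%:~R - (wy * y + c%:~R) = (wx - wy) * x + wy * (x - y) by ring.
apply: ord_geD; first by rewrite -[n]addr0; apply: ord_geM.
by rewrite -[n]add0r; apply: ord_geM => //; apply: ord_int_horner.
Qed.

Lemma newton_lim_near n : ord_ge (cprime P) n%:Z (newton_lim - (newton n)%:~R).
Proof.
have [N hN] := cls_near newton_cls n%:Z; have := hN (maxn N n) (leq_maxl _ _).
rewrite -/newton_lim /= rmorph_int => h.
have -> : newton_lim - (newton n)%:~R = (newton_lim - (newton (maxn N n))%:~R) + ((newton (maxn N n))%:~R - (newton n)%:~R).
  by rewrite addrA subrK.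
apply: ord_geD => //; rewrite -rmorphB /= -(rmorph_int (to_completion P)) cprime_ge_const; apply: Pint.
by apply: newton_cauchy; apply: leq_maxr.
Qed.

Lemma newton_lim_int : ord_ge (cprime P) 0 newton_lim.
Proof.
by rewrite -[newton_lim](subrK ((newton 0)%:~R)) ord_geD ?ord_int //; exact: newton_lim_near 0%N.
Qed.

Lemma newton_lim_root : (map_poly intr f).[newton_lim] = 0.
Proof.
apply: (@ord_ge_all_eq0 _ (cprime P)) => n.
rewrite -[X in ord_ge _ _ X](subrK (map_poly intr f).[(newton n)%:~R]); apply: ord_geD.
  by apply: ord_int_horner_sub; rewrite ?ord_int ?newton_lim_int ?newton_lim_near.
rewrite horner_map /= -(rmorph_int (to_completion P)) cprime_ge_const; apply: Pint.
by apply: dvdz_trans (newtonP n).1; rewrite dvdzE /= dvdn_exp2l.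
Qed.

End Root.
End Hensel.

Section Pullback.
Variables (K F : fieldType) (phi : {rmorphism K -> F}) (v : finite_prime F).
Hypothesis unif : exists2 x, x != 0 & v (phi x) = 1.

Lemma pull0 : v (phi 0) = 0. Proof. by rewrite rmorph0 Defs.ord0. Qed.

Lemma pullM x y : x != 0 -> y != 0 -> v (phi (x * y)) = v (phi x) + v (phi y).
Proof. by move=> x0 y0; rewrite rmorphM ordM ?fmorph_eq0. Qed.

Lemma pullD x y : x != 0 -> y != 0 -> x + y != 0 -> Num.min (v (phi x)) (v (phi y)) <= v (phi (x + y)).
Proof. by move=> x0 y0 xy0; rewrite rmorphD ordD -?rmorphD ?fmorph_eq0. Qed.

Definition pull_prime : finite_prime K := FinitePrime pull0 pullM pullD unif.

Lemma pull_ge n x : ord_ge pull_prime n x = ord_ge v n (phi x).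
Proof. by rewrite /ord_ge fmorph_eq0. Qed.

End Pullback.

Section LocalField.
Variables (K : fieldExtType rat) (iota : {rmorphism K -> algC}) (z : algC) (f : {poly int}) (n : nat).
Hypotheses (mz : minint z f n) (gen : forall x, polyin z (iota x)).
Variables (p : nat) (t e : int).
Hypotheses (pp : prime p) (ft : (p%:Z %| f.[t])%Z) (fe : (p%:Z %| e * f^`().[t] - 1)%Z).

Lemma map_pZQ (F : fieldType) (j : {rmorphism rat -> F}) (u : {poly int}) : map_poly j (pZQ u) = map_poly intr u.
Proof. by rewrite -map_poly_comp; apply: eq_map_poly => i /=; rewrite rmorph_int. Qed.

(** K lies in Q(z), and the simple root t of f lifts to the p-adic numbers and embeds Q(z) there; P
    is the valuation pulled back to K. The integers of Newton's iteration also converge in K_P, to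
    tau, the image of z. Approximating elements of K by rational numbers shows that the residue
    field is F_p. *)
Theorem local_field : exists (P : finite_prime K) (tau : completion P), [/\
  forall (m : nat) (c : int), ord_ge P m%:Z c%:~R = ((p ^ m)%N%:Z %| c)%Z,
  ord_ge (cprime P) 1 (tau - t%:~R), (map_poly intr f).[tau] = 0,
  forall x (w : {poly rat}), iota x = (pQC w).[z] -> to_completion P x = (map_poly (to_completion P \o in_alg K) w).[tau] &
  forall y, ord_ge (cprime P) 0 y -> exists s : nat, ord_ge (cprime P) 1 (y - s%:R)].
Proof.
pose v := padic_prime pp; pose jp : {rmorphism rat -> completion v} := to_completion v.
have vint (m : nat) (x : int) : ((p ^ m)%N%:Z %| x)%Z -> ord_ge v m%:Z x%:~R by rewrite padic_int.
pose tp := newton_lim ft fe vint.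
have rp : root (map_poly jp (pZQ f)) tp by rewrite map_pZQ rootE newton_lim_root.
have [phi phiE] := eval_hom mz gen rp.
have vp1 : v p%:R = 1 by rewrite /= /padic -[p%:R]/(p%:Z%:~R) numq_int denq_int /= logn_prime // eqxx logn1.
have unif : exists2 x, x != 0 & cprime v (phi x) = 1.
  exists p%:R; first by case: (p) (prime_gt0 pp) => // k _; exact: natr_neq0. by rewrite rmorph_nat -(rmorph_nat jp) cprime_const.
pose P := pull_prime unif.
have Pge m x : ord_ge P m x = ord_ge (cprime v) m (phi x) by exact: pull_ge.
have Prat m (q : rat) : ord_ge P m (in_alg K q) = ord_ge v m q.
  rewrite Pge; have -> : phi (in_alg K q) = jp q.
    rewrite (phiE _ q%:P) map_polyC ?hornerC //=. by have := map_in_alg iota q%:P; rewrite !map_polyC => /polyC_inj.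
  exact: cprime_ge_const.
have Pint m (c : int) : ord_ge P m%:Z c%:~R = ((p ^ m)%N%:Z %| c)%Z.
  by rewrite -(rmorph_int (in_alg K)) Prat padic_int.
have Pint' (m : nat) (x : int) : ((p ^ m)%N%:Z %| x)%Z -> ord_ge P m%:Z x%:~R by rewrite Pint.
pose tau := newton_lim ft fe Pint'.
have near x w W (a : int) : iota x = (pQC w).[z] -> a != 0 -> w = a%:~R^-1 *: pZQ W ->
    forall m : nat, ord_ge (cprime P) m%:Z (to_completion P x *~ a - ((W.[newton f t e m])%:~R)).
  move=> xw a0 wE m; rewrite -rmorphMz -(rmorph_int (to_completion P)) -rmorphB cprime_ge_const Pge.
  rewrite rmorphB rmorphMz (phiE _ _ xw) wE rmorph_int. have -> : (map_poly jp (a%:~R^-1 *: pZQ W)).[tp] *~ a = (map_poly intr W).[tp].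
    rewrite map_polyZ map_pZQ hornerZ /= fmorphV rmorph_int -mulrzl mulrA divff ?mul1r //.
    by rewrite -(rmorph_int jp) fmorph_eq0 intr_eq0.
  rewrite -(horner_map (intr : {rmorphism int -> _})) /=; apply: ord_int_horner_sub; rewrite ?ord_int //.
    exact: newton_lim_int.
  exact: newton_lim_near.
exists P, tau; split=> //.
- have -> : tau - t%:~R = (tau - (newton f t e 1)%:~R) + ((newton f t e 1)%:~R - t%:~R) by rewrite addrA subrK.
  apply: ord_geD; first exact: newton_lim_near. rewrite -rmorphB /= -(rmorph_int (to_completion P)) cprime_ge_const Pint expn1.
  exact: (newtonP ft fe 1).2.
- exact: newton_lim_root.
- move=> x w xw; have [W [a a0 wE]] := rat_poly_scale w.
  have aK : a%:~R != 0 :> completion P by rewrite -(rmorph_int (to_completion P)) fmorph_eq0 intr_eq0K.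
  have jV : (to_completion P \o in_alg K) a%:~R^-1 = a%:~R^-1 by rewrite fmorphV rmorph_int.
  have e1 : (map_poly (to_completion P \o in_alg K) w).[tau] = a%:~R^-1 * (map_poly intr W).[tau].
    by rewrite wE map_polyZ map_pZQ hornerZ; congr (_ * _); exact: jV.
  apply: (mulfI aK); rewrite e1 mulrA divff // mul1r.
  apply/eqP; rewrite -subr_eq0 mulrzl; apply/eqP/(@ord_ge_all_eq0 _ (cprime P)) => m.
  have -> : to_completion P x *~ a - (map_poly intr W).[tau] = (to_completion P x *~ a - (W.[newton f t e m])%:~R)
     - ((map_poly intr W).[tau] - (W.[newton f t e m])%:~R) by ring.
  apply: ord_geB; first exact: near xw a0 wE m.
  rewrite -(horner_map (intr : {rmorphism int -> _})) /=; apply: ord_int_horner_sub; rewrite ?ord_int //.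
    exact: newton_lim_int.
  exact: newton_lim_near.
move=> y y0; have [x xy] := completion_dense y 1.
have [w xw] := gen x; have [W [a a0 wE]] := rat_poly_scale w.
(* A precision that survives the division by a. *)
pose N := (`|v a%:~R|.+1)%N; pose q : rat := (W.[newton f t e N])%:~R / a%:~R.
have qx : ord_ge (cprime P) 1 (to_completion P x - to_completion P (in_alg K q)).
  have aK : a%:~R != 0 :> completion P by rewrite -(rmorph_int (to_completion P)) fmorph_eq0 intr_eq0K.
  have -> : to_completion P x - to_completion P (in_alg K q) = (to_completion P x *~ a - ((W.[newton f t e N])%:~R)) / a%:~R.
    by rewrite /q (fmorph_div (in_alg K)) (fmorph_div (to_completion P)) !rmorph_int -(mulrzr (to_completion P x) a) mulrBl mulfK.
  have va : cprime P a%:~R <= `|v a%:~R|%N%:Z.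
    have := ord_geE (cprime P) (cprime P a%:~R) aK; rewrite lexx -(rmorph_int (to_completion P)) cprime_ge_const.
    rewrite -(rmorph_int (in_alg K)) Prat ord_geE ?intr_eq0 // => h. by apply: le_trans h _; rewrite abszE ler_norm.
  apply: ord_geW (ord_geM (near x w W a xw a0 wE N) (ord_geV aK va)). by rewrite /N; move: (absz _) => s; clear; lia.
have q0 : ord_ge v 0 q.
  rewrite -Prat -cprime_ge_const -[X in ord_ge _ _ X](subrK y) -[X in X + y]opprB; apply: ord_geD y0; rewrite ord_geN.
  have -> : y - to_completion P (in_alg K q) = (y - to_completion P x) + (to_completion P x - to_completion P (in_alg K q)) by ring.
  by apply: (@ord_geW _ _ 0 1) => //; apply: ord_geD.
have [s hs] : exists s : nat, ord_ge v 1 (q - s%:R).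
  have den : ~~ (p%:Z %| denq q)%Z.
    have [qq|qq] := eqVneq q 0; first by rewrite qq -[0]/(0%:~R : rat) denq_int dvdz1 /= gtn_eqF ?prime_gt1.
    apply/negP => pd; move: q0; rewrite ord_geE //= /padic subr_ge0 lez_nat.
    have : (0 < logn p `|denq q|)%N by rewrite logn_gt0 mem_primes pp absz_gt0 denq_neq0 -[p]/`|p%:Z|%N -dvdzE.
    move=> l0 /(leq_trans l0); rewrite logn_gt0 mem_primes => /and3P[_ _ pn].
    have := coprime_num_den q; apply/negP; rewrite /coprime; apply/eqP => g1.
    have : (p %| gcdn `|numq q| `|denq q|)%N by rewrite dvdn_gcd pn -[p]/`|p%:Z|%N -dvdzE. by rewrite g1 dvdn1 gtn_eqF // prime_gt1.
  have : coprimez (denq q) p%:Z by rewrite coprimez_sym coprimezE /= prime_coprime // -dvdzE.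
  move=> /coprimezP[[b c] /= bc]; pose s := `|(b * numq q %% p%:Z)%Z|%N; exists s. have sE : (p%:Z %| denq q * s%:Z - numq q)%Z.
    rewrite /s abszE ger0_norm ?modz_ge0 ?eqz_nat -?lt0n ?prime_gt0 //.
    have d1 : (p%:Z %| (b * numq q %% p%:Z)%Z - b * numq q)%Z by rewrite -eqz_mod_dvd modz_mod.
    have -> : denq q * (b * numq q %% p%:Z)%Z - numq q =
       denq q * ((b * numq q %% p%:Z)%Z - b * numq q) + ((b * denq q + c * p%:Z - 1) * numq q - c * numq q * p%:Z) by ring.
    by rewrite bc subrr mul0r add0r rpredD ?rpredN ?dvdz_mull.
  have dq0 : (denq q)%:~R != 0 :> rat by rewrite intr_eq0 denq_neq0.
  have -> : q - s%:R = - ((denq q * s%:Z - numq q)%:~R / (denq q)%:~R).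
    by rewrite -{1}(divq_num_den q) rmorphB rmorphM /=; field.
  rewrite ord_geN -[1]addr0; apply: ord_geM.
    by have := padic_int pp 1 (denq q * s%:Z - numq q); rewrite expn1 sE => ->.
  rewrite -oppr0; apply: ord_geV => //=; rewrite /padic numq_int denq_int logn1 subr0 lez_nat leqn0.
  by rewrite lognE (negPf (_ : ~~ (p %| `|denq q|)%N)) ?andbF // -[p in (p %| _)%N]/`|p%:Z|%N -dvdzE.
exists s; have -> : y - s%:R = (y - to_completion P x) + (to_completion P x - to_completion P (in_alg K q))
   + to_completion P (in_alg K (q - s%:R)) by rewrite !rmorphB !rmorph_nat; ring.
by apply: ord_geD; [apply: ord_geD | rewrite cprime_ge_const Prat].
Qed.

End LocalField.

Lemma polyin_comp z y (q : {poly rat}) : polyin z y -> polyin z (pQC q).[y].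
Proof. by move=> [w ->]; exists (q \Po w); rewrite map_comp_poly horner_comp. Qed.

Lemma polyin_sum z m (G : 'I_m -> algC) (a : nat -> nat) : (forall i, polyin z (G i)) ->
  polyin z (\sum_(i < m) G i *+ a i).
Proof.
move=> h; apply: (big_ind (polyin z)).
- by exists 0; rewrite rmorph0 horner0.
- by move=> x y [w ->] [w' ->]; exists (w + w'); rewrite rmorphD hornerD.
move=> i _; have [w ->] := h i.
by exists (w *+ a i); rewrite rmorphMn hornerMn.
Qed.

Lemma polyin_int z x : polyin z x -> exists (h : {poly int}) (d : nat), (0 < d)%N /\ (map_poly intr h).[z] = d%:R * x.
Proof.
move=> [w ->]; have [W [a a0 ->]] := rat_poly_scale w.
exists (Num.sg a *: W), `|a|%N; split; first by rewrite absz_gt0.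
rewrite map_polyZ hornerZ /= map_polyZ hornerZ /= fmorphV /= ratr_int pQC_int.
have -> : (`|a|%N)%:R = (Num.sg a)%:~R * a%:~R :> algC.
  by rewrite -intrM -normrEsg -abszE.
by rewrite -mulrA mulVKf // intr_eq0.
Qed.

Lemma irr_factor (F : fieldType) (q : {poly F}) : (1 < size q)%N -> exists2 r, irreducible_poly r & r %| q.
Proof.
move=> q1; pose A n := `[< exists r : {poly F}, [/\ (1 < size r)%N, r %| q & size r = n] >].
have exA : exists n, A n by exists (size q); apply/asboolP; exists q.
have [n /asboolP[r [r1 rq rn]] minn] := ex_minnP exA.
exists r => //; split=> // d d1 dr.
have r0 : r != 0 by rewrite -size_poly_gt0 ltnW.
have d2 : (1 < size d)%N by rewrite ltn_neqAle eq_sym d1 size_poly_gt0 (dvdpN0 dr).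
rewrite -dvdp_size_eqp // eqn_leq dvdp_leq //= rn; apply: minn.
by apply/asboolP; exists d; split=> //; apply: dvdp_trans dr rq.
Qed.

Lemma ord_monic_root (F : fieldType) (v : finite_prime F) (g : {poly int}) N (x : F) : g \is monic -> size g = N.+1 ->
  (0 < N)%N -> (map_poly intr g).[x] = 0 -> ord_ge v 0 x.
Proof.
move=> gm sg N0 gx; apply: contraT; rewrite /ord_ge negb_or -ltNge => /andP[x0 vx].
have sG : (size (map_poly (intr : int -> F) g) <= N.+1)%N by rewrite -sg size_poly.
move: gx; rewrite (horner_coef_wide x sG) big_ord_recr /= coef_map /=.
have -> : g`_N = 1 by move: gm => /monicP; rewrite lead_coefE sg.
rewrite mul1r addrC => /eqP; rewrite addr_eq0 => /eqP e.
have : ord_ge v (v x *+ N.-1) (x ^+ N).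
  rewrite e ord_geN; apply: ord_ge_sum => i _; rewrite coef_map -[_ *+ _]add0r. apply: ord_geM; first exact: ord_int.
  rewrite ord_geE ?expf_neq0 // ordX // -(subnK (_ : (i <= N.-1)%N)) ?mulrnDr ?gerDr ?mulrn_wle0 ?ltW //. by rewrite -ltnS prednK.
rewrite ord_geE ?expf_neq0 // ordX // -[in X in _ <= X](prednK N0) mulrSr lerDl leNgt vx //.
Qed.

(** * Primes at which a cyclic factor of order l^k occurs *)

Section PullCurve.
Variables (F L : fieldType) (f : {rmorphism F -> L}) (E : scurve L) (a b : F).
Hypotheses (ea : sa E = f a) (eb : sb E = f b).

Lemma pull_char : 2 != 0 :> F. Proof. by rewrite -(fmorph_eq0 f) rmorph_nat s_char. Qed.
Lemma pull_disc : 4 * a ^+ 3 + 27 * b ^+ 2 != 0.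
Proof. by rewrite -(fmorph_eq0 f) rmorphD (rmorphM f 4) (rmorphM f 27) !rmorphXn !rmorph_nat -ea -eb s_disc. Qed.
Definition pull_curve := SCurve pull_char pull_disc.
End PullCurve.

Section PushCurve.
Variables (F L : fieldType) (f : {rmorphism F -> L}) (E : scurve F).

Lemma push_char : 2 != 0 :> L. Proof. by rewrite -(rmorph_nat f) fmorph_eq0 s_char. Qed.
Lemma push_disc : 4 * f (sa E) ^+ 3 + 27 * f (sb E) ^+ 2 != 0.
Proof. by rewrite -!rmorphXn -(rmorph_nat f 4) -(rmorph_nat f 27) -!rmorphM -rmorphD fmorph_eq0 s_disc. Qed.
Definition push_curve := SCurve push_char push_disc.
End PushCurve.

Definition coords_of (E : scurve algC) (s : seq (spoint E)) : seq algC :=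
  flatten [seq if val P is Some (x, y) then [:: x; y] else [::] | P <- s].

Lemma coords_ofP (E : scurve algC) (s : seq (spoint E)) c : reflect
  (exists P x y, [/\ P \in s, val P = Some (x, y) & c = x \/ c = y]) (c \in coords_of s).
Proof.
apply: (iffP flatten_mapP) => [[P Ps]|[P [x [y [Ps eP cE]]]]].
  case eP : (val P) => [[x y]|] //; rewrite !inE => /orP[]/eqP->; exists P, x, y; split=> //; by [left|right].
by exists P; rewrite ?eP // !inE; case: cE => ->; rewrite eqxx ?orbT.
Qed.

Section Distinguish.
Variables (K : fieldExtType rat) (P : finite_prime K) (g h r : {poly int}) (N d e : nat) (zM zL : algC).
Variables (s : {rmorphism algC -> algC}) (p t : nat) (tau s0 : completion P).
Hypotheses (mz : minint zM g N) (e0 : (0 < e)%N).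
Hypotheses (hz : (map_poly intr h).[zM] = d%:R * zL) (rz : (map_poly intr r).[zM] = e%:R * s zM) (szL : s zL = zL).
Hypothesis Pint : forall (m : nat) (c : int), ord_ge P m%:Z c%:~R = ((p ^ m)%N%:Z %| c)%Z.
Hypothesis res : forall y, ord_ge (cprime P) 0 y -> exists s : nat, ord_ge (cprime P) 1 (y - s%:R).
Hypotheses (tt : ord_ge (cprime P) 1 (tau - t%:R)).
Hypotheses (gs : (map_poly intr g).[s0] = 0) (hs : (map_poly intr h).[s0] = d%:R * tau).
Hypothesis uniq_above : forall s1 s2 : nat, (p%:Z %| g.[s1%:Z])%Z -> (p%:Z %| g.[s2%:Z])%Z ->
   (p%:Z %| h.[s1%:Z] - d%:Z * t%:Z)%Z -> (p%:Z %| h.[s2%:Z] - d%:Z * t%:Z)%Z -> (p%:Z %| s1%:Z - s2%:Z)%Z.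
Variables (A C : {poly int}) (c : int).
Hypotheses (Bz : A * (r - e%:Z *: 'X) + C * g = c%:P) (c0 : c != 0) (cp : (`|c| < p)%N).

(** s0 is an image of zM and s0' the corresponding image of s(zM); both lie above tau, because s
    fixes zL. By uniqueness they agree modulo p, so r - e X takes a value divisible by p at s0, and
    the Bezout relation makes p divide c, which is too small. *)
Lemma distinct_roots_above : False.
Proof.
have [gm sg N0 _] := mz; pose j : {rmorphism rat -> completion P} := to_completion P \o in_alg K.
have KPint (m : nat) (x : int) : ord_ge (cprime P) m%:Z x%:~R = ((p ^ m)%N%:Z %| x)%Z.
  by rewrite -(rmorph_int (to_completion P)) cprime_ge_const Pint.
have nz m : m.+1%:R != 0 :> completion P by rewrite -(rmorph_nat (to_completion P)) fmorph_eq0 natr_neq0.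
have eF : e%:R != 0 :> completion P by case: (e) e0.
have eC : e%:R != 0 :> algC by rewrite pnatr_eq0 -lt0n.
have fr : root (map_poly j (pZQ g)) s0 by rewrite map_pZQ rootE gs.
have conj w : (pQC ((pZQ w) \Po (e%:R^-1 *: pZQ r))).[zM] = s (map_poly intr w).[zM].
  rewrite map_comp_poly horner_comp map_polyZ hornerZ /= !pQC_int rz fmorphV rmorph_nat mulKf //.
  rewrite -horner_map /=; congr (_.[_]); rewrite -map_poly_comp; apply: eq_map_poly => i /=. by rewrite rmorph_int.
pose s0' := (map_poly intr r).[s0] / e%:R.
have conj' (w w' : {poly int}) : s (map_poly intr w).[zM] = (map_poly intr w').[zM] -> (map_poly intr w).[s0'] = (map_poly intr w').[s0].
  rewrite -conj -[RHS]pQC_int => /(eval_wd mz fr); rewrite map_pZQ map_comp_poly horner_comp map_pZQ => <-.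
  rewrite map_polyZ hornerZ map_pZQ /s0' mulrC; congr (_.[_ * _]).
  by rewrite -[LHS](fmorphV j) rmorph_nat || rewrite -(rmorph_nat j) fmorphV.
have zg : (map_poly intr g).[zM] = 0.
  have [_ _ _ gP] := mz; apply/eqP; have := gP (pZQ g); rewrite dvdpp rootE pQC_int => /eqP ->; by rewrite eqxx.
have gs' : (map_poly intr g).[s0'] = 0.
  by rewrite (conj' g 0) ?rmorph0 ?horner0 // zg rmorph0.
have hs' : (map_poly intr h).[s0'] = d%:R * tau.
  by rewrite (conj' h h) // hz rmorphM rmorph_nat szL.
have i0 := ord_monic_root (cprime P) gm sg N0 gs; have i0' := ord_monic_root (cprime P) gm sg N0 gs'.
have near y (q : nat) : ord_ge (cprime P) 0 y -> (map_poly intr g).[y] = 0 -> (map_poly intr h).[y] = d%:R * tau ->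
   ord_ge (cprime P) 1 (y - q%:R) -> (p%:Z %| g.[q%:Z])%Z /\ (p%:Z %| h.[q%:Z] - d%:Z * t%:Z)%Z.
  move=> iy gy hy yq; have iq : ord_ge (cprime P) 0 q%:R by exact: ord_nat. have sub w := ord_int_horner_sub w iy iq yq.
  have ev w : (map_poly intr w).[q%:R] = (w.[q%:Z])%:~R :> completion P by rewrite -[q%:R]/((q%:Z)%:~R) horner_map.
  split; rewrite -[p]expn1 -KPint.
    by rewrite -ev -[X in ord_ge _ _ X]opprK ord_geN -[X in ord_ge _ _ X]add0r -gy; exact: sub.
  rewrite rmorphB rmorphM /= -ev.
  have -> : (map_poly intr h).[q%:R] - d%:R * t%:R = - ((map_poly intr h).[y] - (map_poly intr h).[q%:R]) + d%:R * (tau - t%:R).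
    by rewrite hy; ring.
  apply: ord_geD; first by rewrite ord_geN; exact: sub. by have := ord_geM (ord_nat (cprime P) d) tt; rewrite add0r.
have [[s1 h1] [s2 h2]] := (res i0, res i0').
have [[g1 k1] [g2 k2]] := (near _ _ i0 gs hs h1, near _ _ i0' gs' hs' h2).
have ss := uniq_above g1 g2 k1 k2.
have d1 : ord_ge (cprime P) 1 (s0' - s0).
  have -> : s0' - s0 = (s0' - s2%:R) - (s0 - s1%:R) - (s1%:Z - s2%:Z)%:~R by rewrite rmorphB /=; ring.
  by apply: ord_geB; [apply: ord_geB | rewrite (KPint 1%N) expn1].
have e1 : (map_poly intr (r - e%:Z *: 'X)).[s0] = e%:R * (s0' - s0).
  rewrite rmorphB /= map_polyZ map_polyX hornerD hornerN hornerZ hornerX /= /s0'.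
  by rewrite mulrBr; congr (_ - _); rewrite mulrC divfK.
have : ord_ge (cprime P) 1 c%:~R.
  have := congr1 (fun q => (map_poly intr q).[s0]) Bz; rewrite rmorphD !rmorphM /= map_polyC hornerC /= => <-.
  rewrite hornerD !hornerM gs mulr0 addr0 e1. have := ord_geM (ord_int_horner A i0) (ord_geM (ord_nat (cprime P) e) d1).
  by rewrite !add0r.
rewrite (KPint 1%N) expn1 dvdzE /= => /dvdn_leq; rewrite absz_gt0 c0 => /(_ isT).
by rewrite leqNgt cp.
Qed.

End Distinguish.

Section LocalRank.
Variables (K : fieldExtType rat) (iota : {rmorphism K -> algC}) (l k : nat) (EC : scurve algC) (u v : K).
Hypotheses (lp : prime l) (k0 : (0 < k)%N) (eu : sa EC = iota u) (ev : sb EC = iota v).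
Variable s : {rmorphism algC -> algC}.
Hypotheses (sK : fixK iota s) (sfix : galois_fixes s EC (l ^ k)) (smove : ~ galois_fixes s EC (l ^ k.+1)).

Section Descent.
Variables (P : finite_prime K) (zL zM : algC) (f g : {poly int}) (n N : nat) (tau : completion P).
Variables (a : nat -> nat) (sM : seq algC) (h : {poly int}) (d : nat).
Let j : {rmorphism rat -> completion P} := to_completion P \o in_alg K.
Hypotheses (mL : minint zL f n) (mM : minint zM g N) (genK : forall x, polyin zL (iota x)).
Hypothesis torL : forall Q : spoint EC, Q *+ (l ^ k) = 0 -> forall x y, val Q = Some (x, y) -> polyin zL x /\ polyin zL y.
Hypothesis torM : forall c, c \in sM <-> c = zL \/ exists Q : spoint EC, Q *+ (l ^ k.+1) = 0 /\ exists x y, val Q = Some (x, y) /\ (c = x \/ c = y).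
Hypotheses (zME : zM = \sum_(i < size sM) sM`_i *+ a i) (inM : forall c, c \in sM -> polyin zM c).
Hypotheses (d0 : (0 < d)%N) (hz : (map_poly intr h).[zM] = d%:R * zL).
Hypotheses (ft : (map_poly intr f).[tau] = 0).
Hypothesis ct : forall x (w : {poly rat}), iota x = (pQC w).[zL] -> to_completion P x = (map_poly j w).[tau].
Variable EP : scurve (completion P).
Hypotheses (eua : sa EP = to_completion P u) (evb : sb EP = to_completion P v).
Hypothesis divisible : forall X : spoint EP, X *+ (l ^ k) = 0 -> exists Y : spoint EP, Y *+ (l ^ k) = X *+ (l ^ k.-1).

(** Adjoin to K_P a common root s1 of g and h - d tau, so that M embeds in the new field F. For R in
    E[l^(k+1)], X = l R is in E[l^k], which is defined over K_P. The hypothesis gives Y over K_P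
    with l^k Y = l^(k-1) X = l^k R, so R - Y is in E[l^k] and R is defined over K_P. As zM is a
    combination of zL and coordinates of such R, s1 already lies in K_P. *)
Lemma root_above : exists s0 : completion P, (map_poly intr g).[s0] = 0 /\ (map_poly intr h).[s0] = d%:R * tau.
Proof.
have [L [iL [tL [tLE genL]]]] := gen_field zL; have [M [iM [tM [tME genM]]]] := gen_field zM.
have [uL uLE] := polyin_pull tLE (genK u); have [vL vLE] := polyin_pull tLE (genK v).
have zLM : polyin zM zL by apply: inM; apply/torM; left.
have [w0 w0E] := zLM.
have genKM x : polyin zM (iota x) by have [w ->] := genK x; apply: polyin_comp.
have [uM uME] := polyin_pull tME (genKM u); have [vM vME] := polyin_pull tME (genKM v).
pose EL := pull_curve (etrans eu uLE) (etrans ev vLE); pose EM := pull_curve (etrans eu uME) (etrans ev vME).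
have iLa : sa EC = iL (sa EL) := etrans eu uLE; have iLb : sb EC = iL (sb EL) := etrans ev vLE.
have iMa : sa EC = iM (sa EM) := etrans eu uME; have iMb : sb EC = iM (sb EM) := etrans ev vME.
have frt : root (map_poly j (pZQ f)) tau by rewrite map_pZQ rootE ft.
have [phi phiE] := eval_hom mL genL frt.
have phi_t : phi tL = tau by rewrite (phiE _ 'X) map_polyX hornerX.
have phi_u : phi uL = to_completion P u.
  by have [w wE] := genK u; rewrite (ct wE) (phiE _ w) // -uLE wE.
have phi_v : phi vL = to_completion P v.
  by have [w wE] := genK v; rewrite (ct wE) (phiE _ w) // -vLE wE.
pose GL := map_poly (intr : int -> L) g; pose HL := map_poly (intr : int -> L) h - (d%:R * tL)%:P.
have mapint (F1 F2 : fieldType) (q : {rmorphism F1 -> F2}) (w : {poly int}) : map_poly q (map_poly intr w) = map_poly intr w.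
  by rewrite -map_poly_comp; apply: eq_map_poly => i /=; rewrite rmorph_int.
have nco : ~~ coprimep GL HL.
  rewrite -(coprimep_map iL); apply/negP => co. have rt : root (map_poly iL GL) zM.
    by have [_ _ _ gP] := mM; rewrite /GL mapint rootE -pQC_int -rootE gP dvdpp.
  have := coprimep_root co rt; rewrite rmorphB /= map_polyC /= rmorphM rmorph_nat tLE mapint.
  by rewrite hornerD hornerN hornerC hz subrr eqxx.
pose GP := map_poly (intr : int -> completion P) g; pose HP := map_poly (intr : int -> completion P) h - (d%:R * tau)%:P.
have [gm sg N0 _] := mM.
have GP0 : GP != 0 by rewrite monic_neq0 // monic_map.
have ncoP : ~~ coprimep GP HP.
  move: nco; rewrite -(coprimep_map phi) rmorphB /= map_polyC /= rmorphM rmorph_nat phi_t /GL !mapint //.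
have [q qirr qd] : exists2 q, irreducible_poly q & q %| gcdp GP HP.
  apply: irr_factor; rewrite ltn_neqAle eq_sym; move: ncoP; rewrite coprimep_def => -> /=.
  by rewrite lt0n size_poly_eq0 gcdp_eq0 negb_and GP0.
have [F [c [s1 s1q]]] : exists (F : fieldType) (c : {rmorphism completion P -> F}) (s1 : F), root (map_poly c q) s1.
  by have [F _ [s1 s1q _]] := irredp_FAdjoin qirr; exists F, (in_alg F), s1.
have qroot w : q %| w -> (map_poly c w).[s1] = 0.
  by move=> /dvdpP[w' ->]; rewrite rmorphM hornerM (eqP s1q) mulr0.
have gs1 : (map_poly intr g).[s1] = 0.
  by rewrite -(mapint _ _ c); apply: qroot; apply: dvdp_trans qd (dvdp_gcdl _ _).
have hs1 : (map_poly intr h).[s1] = d%:R * c tau.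
  have := qroot HP (dvdp_trans qd (dvdp_gcdr _ _)); rewrite rmorphB /= map_polyC /= mapint.
  by rewrite hornerD hornerN hornerC rmorphM rmorph_nat => /eqP; rewrite subr_eq0 => /eqP.
pose j' : {rmorphism rat -> F} := c \o j.
have grt : root (map_poly j' (pZQ g)) s1 by rewrite map_pZQ rootE gs1.
have [psi psiE] := eval_hom mM genM grt.
have psi_t : psi tM = s1 by rewrite (psiE _ 'X) map_polyX hornerX.
have dF : d%:R != 0 :> F.
  rewrite -(rmorph_nat c) fmorph_eq0 -(rmorph_nat (to_completion P)) fmorph_eq0. by case: (d) d0 => // m _; exact: natr_neq0.
have dC : d%:R != 0 :> algC by rewrite pnatr_eq0 -lt0n.
have psi_zL x (w : {poly rat}) : iM x = (pQC w).[zL] -> psi x = c (map_poly j w).[tau].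
  move=> xE; rewrite (psiE x (w \Po (d%:R^-1 *: pZQ h))).
    rewrite map_comp_poly horner_comp map_polyZ hornerZ map_pZQ hs1 -(horner_map c) /= -map_poly_comp; congr (_.[_]).
    have jV : j' d%:R^-1 = d%:R^-1 by rewrite fmorphV rmorph_nat. by rewrite [X in X * _](_ : _ = d%:R^-1) ?mulKf.
  rewrite xE map_comp_poly horner_comp map_polyZ hornerZ pQC_int hz /= fmorphV rmorph_nat mulKf //.
have psi_u : psi uM = c (to_completion P u).
  by have [w wE] := genK u; rewrite (ct wE) (psi_zL _ w) // -uME wE.
have psi_v : psi vM = c (to_completion P v).
  by have [w wE] := genK v; rewrite (ct wE) (psi_zL _ w) // -vME wE.
pose EF := push_curve c EP.
have ca : sa EF = c (sa EP) by []. have cb : sb EF = c (sb EP) by [].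
have pa : sa EP = phi (sa EL) by rewrite eua -phi_u. have pb : sb EP = phi (sb EL) by rewrite evb -phi_v.
have cpa : sa EF = (c \o phi) (sa EL) by rewrite ca pa. have cpb : sb EF = (c \o phi) (sb EL) by rewrite cb pb.
have sia : sa EF = psi (sa EM) by rewrite ca eua -psi_u. have sib : sb EF = psi (sb EM) by rewrite cb evb -psi_v.
have pullpt (z : algC) (L' : fieldExtType rat) (i' : {rmorphism L' -> algC}) t' (E' : scurve L')
   (ea : sa EC = i' (sa E')) (eb : sb EC = i' (sb E')) (Q : spoint EC) : i' t' = z ->
   (forall x y, val Q = Some (x, y) -> polyin z x /\ polyin z y) -> exists R : spoint E', Q = pmap ea eb R.
  move=> tz hQ; have [->|Q0] := eqVneq Q 0; first by exists 0; rewrite pmap0.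
  have [x [y eQ]] := point_xyP Q0; have [/(polyin_pull tz)[x' xE] /(polyin_pull tz)[y' yE]] := hQ x y eQ.
  have on : on_curve (short (sa E') (sb E')) (Some (x', y')).
    rewrite on_short -(inj_eq (fmorph_inj i')) rmorphXn /= -yE (spoint_on eQ) xE !cubicE ea eb.
    by rewrite !(rmorphD, rmorphM, rmorphXn).
  by exists (Point on); apply: val_inj; rewrite val_pmap eQ xE yE.
have fullL Q : Q *+ (l ^ k) = 0 -> exists R : spoint EL, Q = pmap iLa iLb R.
  by move=> Qk; apply: (pullpt zL _ _ tL) => //; apply: torL.
have lk0 : (0 < l ^ k)%N by rewrite expn_gt0 prime_gt0.
have full R : R *+ (l ^ k) = 0 -> exists2 Z : spoint EP, Z *+ (l ^ k) = 0 & R = pmap ca cb Z.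
  move=> Rk; have [Z Zk RE] := full_torsion cpa cpb lk0 fullL Rk. exists (pmap pa pb Z); first by rewrite -pmapMn Zk pmap0.
  by rewrite RE; apply: val_inj; rewrite !val_pmap; case: (val Z) => [[]|].
have down (R : spoint EM) : R *+ (l ^ k.+1) = 0 -> exists Z : spoint EP, pmap sia sib R = pmap ca cb Z.
  move=> Rk; set R' := pmap sia sib R. have R'k : R' *+ (l ^ k.+1) = 0 by rewrite -pmapMn Rk pmap0.
  have [X Xk XE] : exists2 X : spoint EP, X *+ (l ^ k) = 0 & R' *+ l = pmap ca cb X.
    by apply: full; rewrite -mulrnA -expnS.
  have [Y YE] := divisible Xk. have [Z _ ZE] : exists2 Z : spoint EP, Z *+ (l ^ k) = 0 & R' - pmap ca cb Y = pmap ca cb Z.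
    have e : pmap ca cb Y *+ (l ^ k) = R' *+ (l ^ k).
      by rewrite -pmapMn YE pmapMn -XE -mulrnA -expnS prednK.
    by apply: full; rewrite mulrnBl e subrr.
  by exists (Y + Z); rewrite pmapD -ZE addrC subrK.
have inc x : iM x \in sM -> exists y, psi x = c y.
  move=> /torM[xz|[Q [Qk [x1 [y1 [eQ xE]]]]]].
    by exists (map_poly j 'X).[tau]; apply: psi_zL; rewrite map_polyX hornerX.
  have [R QE] : exists R : spoint EM, Q = pmap iMa iMb R.
    apply: (pullpt zM _ _ tM) => // x2 y2 eQ2. have hc c' : c' = x2 \/ c' = y2 -> polyin zM c'.
      by move=> cE; apply: inM; apply/torM; right; exists Q; split=> //; exists x2, y2.
    by split; apply: hc; [left | right].
  have Rk : R *+ (l ^ k.+1) = 0 by apply: (pmap_inj (fa := iMa) (fb := iMb)); rewrite pmapMn -QE Qk pmap0.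
  have [Z ZE] := down R Rk; move: eQ; rewrite QE val_pmap; case eR : (val R) => [[x2 y2]|] //= [x2E y2E].
  have := congr1 (fun S => val S) ZE; rewrite !val_pmap eR; case: (val Z) => [[x3 y3]|] //= [x3E y3E].
  case: xE => xE; [exists x3; rewrite -x3E | exists y3; rewrite -y3E]; congr (psi _); apply: (fmorph_inj iM); by rewrite xE -?x2E -?y2E.
have : exists y, psi tM = c y.
  have pl i : exists x, i \in sM -> i = iM x.
    case iS : (i \in sM); last by exists 0. by have [x ->] := polyin_pull tME (inM iS); exists x.
  pose X i := sval (cid (pl i)); have XP i : i \in sM -> i = iM (X i) := svalP (cid (pl i)).
  have -> : tM = \sum_(i < size sM) X sM`_i *+ a i.
    apply: (fmorph_inj iM); rewrite tME {1}zME rmorph_sum; apply: eq_bigr => i _. by rewrite rmorphMn -XP // mem_nth.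
  rewrite rmorph_sum; apply: (big_ind (fun x => exists y, x = c y)).
  - by exists 0; rewrite rmorph0.
  - by move=> x y [x' ->] [y' ->]; exists (x' + y'); rewrite rmorphD.
  move=> i _; rewrite rmorphMn; have iS : sM`_i \in sM by rewrite mem_nth. have [|y ->] := inc (X sM`_i); first by rewrite -XP.
  by exists (y *+ a i); rewrite rmorphMn.
rewrite psi_t => -[s0 s0E]; exists s0; split; apply: (fmorph_inj c).
  by rewrite -horner_map /= mapint -s0E gs1 rmorph0.
by rewrite -horner_map /= mapint -s0E hs1 rmorphM rmorph_nat.
Qed.

End Descent.

(** zL generates the field L and is fixed by s; zM generates M and is moved by s. If no X existed at
    the prime of [good_prime], [root_above] would place an image of zM in K_P, against
    [distinct_roots_above]. *)
Theorem local_rank B : exists (P : finite_prime K) (p : nat), [/\ prime p, (B < p)%N, ord_ge P 1 p%:R &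
  forall EP : scurve (completion P), sa EP = to_completion P u -> sb EP = to_completion P v ->
  exists2 X : spoint EP, X *+ (l ^ k) = 0 & forall Y : spoint EP, Y *+ (l ^ k) != X *+ (l ^ k.-1)].
Proof.
have lk0 m : (0 < l ^ m)%N by rewrite expn_gt0 prime_gt0.
have [t0 prim] := primitive_element K.
have sfa : sa EC = s (sa EC) by rewrite eu sK.
have sfb : sb EC = s (sb EC) by rewrite ev sK.
have fixP (Q : spoint EC) x y : Q *+ (l ^ k) = 0 -> val Q = Some (x, y) -> s x = x /\ s y = y.
  by move=> Qk eQ; have := sfix Qk; rewrite eQ /= => -[].
have [T _ TP] : exists2 T : seq (spoint EC), true & forall Q, (Q \in T) = (Q *+ (l ^ k) == 0).
  by have [T [_ _ TP]] := torsion_count EC (lk0 k); exists T.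
have [T1 _ T1P] : exists2 T : seq (spoint EC), true & forall Q, (Q \in T) = (Q *+ (l ^ k.+1) == 0).
  by have [T1 [_ _ TP1]] := torsion_count EC (lk0 k.+1); exists T1.
have [zL [zLA [aL zLE] inL]] := pet_int (iota t0 :: coords_of T).
have szL : s zL = zL.
  rewrite zLE rmorph_sum; apply: eq_bigr => i _; rewrite rmorphMn; congr (_ *+ _).
  have : (iota t0 :: coords_of T)`_i \in iota t0 :: coords_of T by rewrite mem_nth.
  rewrite in_cons => /orP[/eqP->|/coords_ofP[Q [x [y [QT eQ cE]]]]]; first exact: sK.
  by have [] := fixP Q x y (eqP (etrans (esym (TP Q)) QT)) eQ; case: cE => ->.
have genK x : polyin zL (iota x).
  have [q ->] := prim x; rewrite -horner_map /= map_in_alg; apply: polyin_comp. by apply: inL; rewrite mem_head.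
have torL (Q : spoint EC) : Q *+ (l ^ k) = 0 -> forall x y, val Q = Some (x, y) -> polyin zL x /\ polyin zL y.
  move=> /eqP Qk x y eQ; have h c : c = x \/ c = y -> polyin zL c.
    by move=> cE; apply: inL; rewrite in_cons; apply/orP; right; apply/coords_ofP; exists Q, x, y; rewrite TP.
  by split; apply: h; [left | right].
pose sM := zL :: coords_of T1.
have [zM [zMA [aM zME] inM]] := pet_int sM.
have torM c : c \in sM <-> c = zL \/ exists Q : spoint EC, Q *+ (l ^ k.+1) = 0 /\ exists x y, val Q = Some (x, y) /\ (c = x \/ c = y).
  rewrite in_cons; split=> [/orP[/eqP->|/coords_ofP[Q [x [y [QT eQ cE]]]]]|[->|[Q [Qk [x [y [eQ cE]]]]]]].
  - by left.
  - by right; exists Q; split; [apply/eqP; rewrite -T1P | exists x, y].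
  - by rewrite eqxx.
  by apply/orP; right; apply/coords_ofP; exists Q, x, y; rewrite T1P; split=> //; apply/eqP.
have spoly : polyin zM (s zM).
  rewrite {2}zME rmorph_sum /= (eq_bigr (fun i : 'I_(size sM) => s sM`_i *+ aM i)) => [|i _]; last by rewrite rmorphMn.
  apply: polyin_sum => i; have /torM cM : sM`_i \in sM by rewrite mem_nth.
  apply: inM; case: cM => [->|[Q [Qk [x1 [y1 [eQ cE]]]]]]; first by rewrite szL mem_head.
  apply/torM; right; exists (pmap sfa sfb Q); split; first by rewrite -pmapMn Qk pmap0.
  by exists (s x1), (s y1); rewrite val_pmap eQ; split=> //; case: cE => ->; [left|right].
have smv : s zM != zM.
  apply/eqP => e; apply: smove => Q Qk; case eQ : (val Q) => [[x y]|] //=. have fixpoly c : c \in sM -> s c = c.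
    move=> /inM[w ->]; rewrite -horner_map /= e -map_poly_comp; congr (_.[_]). by apply: eq_map_poly => q /=; rewrite fmorph_rat.
  have h c : c = x \/ c = y -> s c = c.
    by move=> cE; apply: fixpoly; apply/torM; right; exists Q; split=> //; exists x, y.
  by rewrite !h; [| right | left].
have [f [n mL]] := minint_exists zLA; have [g [N mM]] := minint_exists zMA.
have [fm sf n0 _] := mL; have [gm sg N0 _] := mM.
have [h [d [d0 hz]]] := polyin_int (inM zL (mem_head _ _)).
have [r [e [e0 rz]]] := polyin_int spoly.
have nz : (pQC (pZQ (r - e%:Z *: 'X))).[zM] != 0.
  rewrite pQC_int rmorphB /= map_polyZ map_polyX hornerD hornerN hornerZ hornerX rz /= -mulrBr.
  by rewrite mulf_neq0 ?subr_eq0 // pnatr_eq0 -lt0n.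
have [A [C [c [c0 Bz]]]] := minint_bezout mM nz.
have [sa [sb [sc [sc0 sep]]]] := minint_sep mL.
(* p > |sc| makes t a simple root of f modulo p; p > |c| keeps the images of zM and s(zM) distinct
   modulo p. *)
have [p [t [pp pB pt uniq_above]]] := good_prime fm sf n0 (minint_irr mL) sc0 sep gm sg N0 (minint_irr mM) h d0 (B + `|sc| + `|c|)%N.
have [e1 fe] : exists e1 : int, (p%:Z %| e1 * f^`().[t%:Z] - 1)%Z.
  have co : coprimez f^`().[t%:Z] p%:Z.
    rewrite coprimez_sym coprimezE /= prime_coprime //; apply/negP => pf.
    have := congr1 (fun q => q.[t%:Z]) sep; rewrite hornerD !hornerM hornerC => e2.
    have : (p%:Z %| sc)%Z by rewrite -e2 rpredD // dvdz_mull.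
    by rewrite dvdzE /= => /dvdn_leq; rewrite absz_gt0 sc0 => /(_ isT); move: pB; clear; lia.
  have /coprimezP[[b b'] /= bb] := co; exists b; rewrite -bb opprD addrA subrr add0r. by rewrite rpredN dvdz_mull.
have [P [tau [Pint tt ft ct res]]] := local_field mL genK pp pt fe.
exists P, p; split=> //; first by move: pB; clear; lia.
  by have := Pint 1%N p%:Z; rewrite expn1 dvdzz.
move=> EP eua evb; apply: contrapT => no.
have [X Xk|s0 [gs hs]] := root_above mL mM genK torL torM zME inM d0 hz ft ct eua evb.
  apply: contrapT => noY; apply: no; exists X => // Y; apply/eqP => e3. by apply: noY; exists Y.
have cp : (`|c| < p)%N by move: pB; clear; lia.
exact: (distinct_roots_above mM e0 hz rz szL Pint res tt gs hs uniq_above Bz c0 cp).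
Qed.

End LocalRank.

(** * From the general Weierstrass equation to the short one *)

Section ShortModel.
Variables (F : fieldType) (W : weierstrass F).
Hypotheses (nz : forall n, n.+1%:R != 0 :> F) (dW : discriminant W != 0).
Local Notation a1 := (ca1 W).
Local Notation a2 := (ca2 W).
Local Notation a3 := (ca3 W).
Local Notation a4 := (ca4 W).
Local Notation a6 := (ca6 W).

Definition wb2 := a1 ^+ 2 + 4 * a2.
Definition wb4 := 2 * a4 + a1 * a3.
Definition wb6 := a3 ^+ 2 + 4 * a6.
(** In terms of the usual invariants, [short_a] is -c4 / 48 and [short_b] is -c6 / 864. *)
Definition short_a := wb4 / 2 - wb2 ^+ 2 / 48.
Definition short_b := wb6 / 4 - wb2 * wb4 / 24 + wb2 ^+ 3 / 864.

Let two0 : 2 != 0 :> F. Proof. exact: (nz 1). Qed.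

Lemma short_disc : 4 * short_a ^+ 3 + 27 * short_b ^+ 2 != 0.
Proof.
have -> : 4 * short_a ^+ 3 + 27 * short_b ^+ 2 = - discriminant W / 16.
  by rewrite /short_a /short_b /wb2 /wb4 /wb6 /discriminant; field; rewrite ?nz.
have -> : 16 = 2 ^+ 4 :> F by ring.
by rewrite mulf_neq0 ?oppr_eq0 // invr_eq0 expf_neq0.
Qed.

Definition short_curve : scurve F := SCurve two0 short_disc.

Definition to_short (P : option (F * F)) : option (F * F) :=
  omap (fun q => (q.1 + wb2 / 12, q.2 + (a1 * q.1 + a3) / 2)) P.

Definition of_short (P : option (F * F)) : option (F * F) :=
  omap (fun q => (q.1 - wb2 / 12, q.2 - (a1 * (q.1 - wb2 / 12) + a3) / 2)) P.

Lemma to_shortK : cancel to_short of_short.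
Proof. by case=> [[x y]|] //=; rewrite !addrK. Qed.

Lemma of_shortK : cancel of_short to_short.
Proof. by case=> [[x y]|] //=; rewrite !subrK. Qed.

Lemma on_to_short P : on_curve (short short_a short_b) (to_short P) = on_curve W P.
Proof.
case: P => [[x y]|] //=; rewrite /to_short /=; rewrite -subr_eq0 -[in RHS]subr_eq0; congr (_ == 0).
by rewrite /short_a /short_b /wb2 /wb4 /wb6; field; rewrite ?nz.
Qed.

Lemma to_short_add P Q : on_curve W P -> on_curve W Q ->
  to_short (add_coords W P Q) = add_coords (short short_a short_b) (to_short P) (to_short Q).
Proof.
case: P Q => [[x1 y1]|] [[x2 y2]|] //= /eqP e1 /eqP e2.
rewrite (inj_eq (addIr _)) !mul0r !addr0.
have -> : (x1 == x2) && (y1 + (a1 * x1 + a3) / 2 + (y2 + (a1 * x2 + a3) / 2) == 0) = (x1 == x2) && (y1 + y2 + a1 * x2 + a3 == 0).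
  by case: eqP => //= ->; congr (_ == 0); field; rewrite ?nz.
case: ifP => // nc; rewrite /to_short /=.
have lamE : slope (short short_a short_b) (x1 + wb2 / 12) (y1 + (a1 * x1 + a3) / 2) (x2 + wb2 / 12) (y2 + (a1 * x2 + a3) / 2) = slope W x1 y1 x2 y2 + a1 / 2.
  rewrite /slope (inj_eq (addIr _)); move: nc; case: eqP => [xx|/eqP xx] /= nc; last first.
    have d0 : x2 - x1 != 0 by rewrite subr_eq0 eq_sym. have -> : x2 + wb2 / 12 - (x1 + wb2 / 12) = x2 - x1 by ring.
    by field; rewrite ?d0 ?nz.
  subst x2; have yy : y2 = y1.
    have : (y2 - y1) * (y1 + y2 + a1 * x1 + a3) = 0.
      transitivity ((y2 ^+ 2 + a1 * x1 * y2 + a3 * y2) - (y1 ^+ 2 + a1 * x1 * y1 + a3 * y1)); first by ring.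
      by rewrite e1 e2 subrr.
    by move/eqP; rewrite mulf_eq0 nc orbF subr_eq0 => /eqP.
  have D0 : 2 * y1 + a1 * x1 + a3 != 0 by rewrite -[2 * y1]/(2%:R * y1) mulr_natl mulr2n; move: nc; rewrite yy => /negbT.
  have -> : 2 * (y1 + (a1 * x1 + a3) / 2) + 0 * (x1 + wb2 / 12) + 0 = 2 * y1 + a1 * x1 + a3 by field; rewrite ?nz.
  by rewrite /= /short_a /wb4 /wb2; field; rewrite ?nz ?D0.
rewrite lamE; move: (slope W x1 y1 x2 y2) => lam; rewrite /wb2.
by congr (Some (_, _)); field; rewrite ?nz.
Qed.

Lemma pt_to_short_subproof (P : point W) : on_curve (short short_a short_b) (to_short (val P)).
Proof. by rewrite on_to_short; case: P. Qed.
Definition pt_to_short (P : point W) : spoint short_curve := Point (pt_to_short_subproof P).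

Lemma pt_to_short_add P Q : pt_to_short (point_add P Q) = pt_to_short P + pt_to_short Q.
Proof. by apply: val_inj; exact: to_short_add (valP P) (valP Q). Qed.

Lemma pt_to_short_zero : pt_to_short (point_zero W) = 0.
Proof. exact: val_inj. Qed.

Lemma pt_to_short_inj : injective pt_to_short.
Proof. by move=> P Q /(congr1 val) /(can_inj to_shortK); exact: val_inj. Qed.

Lemma pt_to_short_surj Q : exists P, pt_to_short P = Q.
Proof.
have on : on_curve W (of_short (val Q)) by rewrite -on_to_short of_shortK; case: Q.
by exists (Point on); apply: val_inj; rewrite /= of_shortK.
Qed.

Lemma torsion_short P : point_torsion P <-> exists2 n, (0 < n)%N & pt_to_short P *+ n = 0.
Proof.
have e n : pt_to_short (iter n (point_add P) (point_zero W)) = pt_to_short P *+ n.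
  by elim: n => [|n IH]; rewrite ?mulr0n ?pt_to_short_zero //= pt_to_short_add IH mulrS.
split=> -[n n0 nP]; exists n => //; first by rewrite -e nP pt_to_short_zero.
by apply: pt_to_short_inj; rewrite e nP pt_to_short_zero.
Qed.

End ShortModel.

Section ShortMap.
Variables (F L : fieldType) (f : {rmorphism F -> L}) (W : weierstrass F).

Lemma short_a_map : short_a (map_weierstrass f W) = f (short_a W).
Proof.
rewrite /short_a /wb2 /wb4 /= rmorphB !fmorph_div (rmorph_nat f 2) (rmorph_nat f 48); congr (_ / _ - _ / _); ring.
Qed.

Lemma short_b_map : short_b (map_weierstrass f W) = f (short_b W).
Proof.
rewrite /short_b /wb2 /wb4 /wb6 /= rmorphD rmorphB !fmorph_div (rmorph_nat f 4) (rmorph_nat f 24) (rmorph_nat f 864).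
congr (_ / _ - _ / _ + _ / _); ring.
Qed.

Lemma discriminant_map : discriminant (map_weierstrass f W) = f (discriminant W).
Proof. by rewrite /discriminant /=; ring. Qed.

End ShortMap.

(* Coordinates on a finite torsion group *)
From mathcomp Require Import all_fingroup all_solvable.
Lemma crt_family n (r : nat -> nat) : (0 < n)%N -> exists c, forall l, prime l -> c = r l %[mod l ^ logn l n].
Proof.
move=> n0; pose M s := (\prod_(l <- s) l ^ logn l n)%N.
have crt s : all prime s -> uniq s -> exists c, forall l, l \in s -> c = r l %[mod l ^ logn l n].
  elim: s => [|p s IH] /=; first by exists 0%N. move=> /andP[pp ps] /andP[pns us]; have [c cP] := IH ps us.
  have co : coprime (p ^ logn p n) (M s).
    rewrite /M; elim: s ps pns {us cP IH} => [|q s IH] /=; first by rewrite big_nil coprimen1.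
    move=> /andP[pq ps]; rewrite inE negb_or big_cons coprimeMr => /andP[npq pns].
    by rewrite IH // andbT coprimeXl // coprimeXr // prime_coprime // dvdn_prime2.
  exists (chinese (p ^ logn p n) (M s) (r p) c) => l; rewrite inE => /predU1P[->|ls].
    exact: chinese_modl.
  have dv : (l ^ logn l n %| M s)%N by rewrite /M (big_rem l ls) /= dvdn_mulr.
  by rewrite -cP // -(modn_dvdm _ dv) (chinese_modr co) modn_dvdm.
have [c cP] := crt _ (all_prime_primes n) (primes_uniq n); exists c => l pl.
have [ln|ln] := boolP (l \in primes n); first exact: cP.
by rewrite lognE; move: ln; rewrite mem_primes pl n0 /= => /negPf->; rewrite expn0 !modn1.
Qed.

Definition tors (V : zmodType) (x : V) := exists2 j, (0 < j)%N & x *+ j = 0.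

(** An isomorphism from the torsion onto the product of the Z/n_i for i < m. It is written with
    natural numbers modulo n_i, so that the coordinates at all primes share one type. *)
Definition coordinate_system (V : zmodType) (m : nat) (n : nat -> nat) (c : V -> nat -> nat) :=
  [/\ forall i, (0 < n i)%N,
      forall x y, tors x -> tors y -> forall i, (i < m)%N -> c (x + y) i = c x i + c y i %[mod n i],
      forall x y, tors x -> tors y -> (forall i, (i < m)%N -> c x i = c y i %[mod n i]) -> x = y &
      forall r : nat -> nat, exists2 x, tors x & forall i, (i < m)%N -> c x i = r i %[mod n i]].

Section TorsionCoordinates.
Variables (V : zmodType) (T0 : seq V).
Hypothesis T0P : forall x j, (0 < j)%N -> x *+ j = 0 -> x \in T0.

Definition tor_seq := [seq x <- T0 | `[< tors x >]].

Lemma tor_seqP x : reflect (tors x) (x \in tor_seq).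
Proof.
rewrite mem_filter; apply: (iffP andP) => [[/asboolP]|h] //; split; first exact/asboolP.
by case: h => j; exact: T0P.
Qed.

Lemma torsB (x y : V) : tors x -> tors y -> tors (x - y).
Proof.
move=> [i i0 xi] [j j0 yj]; exists (i * j)%N; first by rewrite muln_gt0 i0.
by rewrite mulrnBl mulrnA xi mul0rn mulnC mulrnA yj mul0rn subrr.
Qed.

Lemma tors0 : tors (0 : V). Proof. by exists 1%N; rewrite ?mul0rn. Qed.
Lemma torsN (x : V) : tors x -> tors (- x). Proof. by rewrite -sub0r; apply: torsB; exact: tors0. Qed.
Lemma torsD (x y : V) : tors x -> tors y -> tors (x + y).
Proof. by move=> tx ty; rewrite -[y]opprK; apply: torsB => //; exact: torsN. Qed.

(** A multiplicative copy of the torsion as a finite group, to which [abelian_structure] applies. *)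
Definition tgrp := seq_sub tor_seq.
HB.instance Definition _ := Finite.on tgrp.
Implicit Types u v : tgrp.

Lemma tgrpP u : tors (val u). Proof. by apply/tor_seqP; case: u. Qed.
Definition tmul u v : tgrp := SeqSub (introT (tor_seqP _) (torsD (tgrpP u) (tgrpP v))).
Definition tone : tgrp := SeqSub (introT (tor_seqP _) tors0).
Definition tinv u : tgrp := SeqSub (introT (tor_seqP _) (torsN (tgrpP u))).

Lemma tmulA : associative tmul. Proof. by move=> u v w; apply: val_inj; exact: addrA. Qed.
Lemma tmul1 : left_id tone tmul. Proof. by move=> u; apply: val_inj; exact: add0r. Qed.
Lemma tmulV : left_inverse tone tinv tmul. Proof. by move=> u; apply: val_inj; exact: addNr. Qed.
HB.instance Definition _ := Finite_isGroup.Build tgrp tmulA tmul1 tmulV.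

Theorem torsion_coordinates : exists m n c, @coordinate_system V m n c.
Proof.
have ab : abelian [set: tgrp] by apply/centsP => u _ v _; apply: val_inj; exact: addrC.
have [b bG _] := abelian_structure ab; rewrite big_tnth in bG.
pose m := size b; pose g (i : nat) : tgrp := nth 1%g b i; pose n i := #[g i]%g.
have tE (i : 'I_m) : tnth (in_tuple b) i = g i by rewrite (tnth_nth 1%g).
have valM (I : finType) (F : I -> tgrp) : val (\prod_i F i)%g = \sum_i val (F i).
  by apply: (big_morph val) => [u v|].
have valX u k : val (u ^+ k)%g = val u *+ k.
  by elim: k => [|k IH]; rewrite ?mulr0n // expgS mulrS -IH.
have gn i : val (g i) *+ n i = 0 by rewrite -valX expg_order.
have sumn (d : nat -> nat) : \sum_(i < m) val (g i) *+ d i = val (\prod_(i < m) g i ^+ d i)%g.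
  by rewrite valM; apply: eq_bigr => i _; rewrite valX.
have gE (d : nat -> nat) : tors (\sum_(i < m) val (g i) *+ d i) by rewrite sumn; exact: tgrpP.
have uniq (d d' : nat -> nat) : \sum_(i < m) val (g i) *+ d i = \sum_(i < m) val (g i) *+ d' i ->
    forall i, (i < m)%N -> d i = d' i %[mod n i].
  rewrite !sumn => /val_inj e i im. have [f [_ _ fu]] := mem_bigdprod bG (in_setT (\prod_(i < m) g i ^+ d i)%g).
  have fd := fu (fun i : 'I_m => g i ^+ d i)%g _ erefl (Ordinal im) isT.
  have fd' := fu (fun i : 'I_m => g i ^+ d' i)%g _ e (Ordinal im) isT.
  apply/eqP; rewrite -eq_expg_mod_order /= in fd fd' *; apply/eqP; rewrite fd ?fd' // => j _;
    by rewrite tE mem_cycle.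
have ex x : exists d : nat -> nat, tors x -> x = \sum_(i < m) val (g i) *+ d i.
  have [/tor_seqP tx|ntx] := boolP (x \in tor_seq); last by exists id => /tor_seqP; rewrite (negPf ntx).
  have [f [fb xf _]] := mem_bigdprod bG (in_setT (SeqSub (introT (tor_seqP _) tx))).
  have k (i : nat) : exists k, forall im : (i < m)%N, f (Ordinal im) = (g i ^+ k)%g.
    case: (pselect (i < m)%N) => im; last by exists 0%N => h; case: (im h).
    have /cyclePmin[k _ kE] := fb (Ordinal im) isT; exists k => h. by rewrite tE /= in kE; rewrite -kE; congr f; exact: val_inj.
  have [d dP] := choice k; exists d => _; rewrite sumn -[LHS]/(val (SeqSub (introT (tor_seqP _) tx))).
  by rewrite xf; congr val; apply: eq_bigr => i _; rewrite -dP; congr f; exact: val_inj.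
have [c cP] := choice ex; exists m, n, c; split=> [i|x y tx ty|x y tx ty e|r].
- exact: order_gt0.
- apply: uniq; rewrite -cP; last exact: torsD.
  by rewrite {1}(cP x tx) {1}(cP y ty) -big_split; apply: eq_bigr => i _; rewrite mulrnDr.
- rewrite (cP x tx) (cP y ty); apply: eq_bigr => i _.
  rewrite (divn_eq (c x i) (n i)) (divn_eq (c y i) (n i)) e // !mulrnDr. by rewrite ![(_ * n i)%N]mulnC !mulrnA gn !mul0rn.
by exists (\sum_(i < m) val (g i) *+ r i) => //; apply: uniq; rewrite -cP.
Qed.

End TorsionCoordinates.

(* The hypothesis on X says that X generates a cyclic direct factor of order l^k of the torsion. *)
Lemma coordinate_of_order (V : zmodType) m n c l k (X : V) : @coordinate_system V m n c ->
  prime l -> (0 < k)%N -> X *+ (l ^ k) = 0 -> (forall Y, Y *+ (l ^ k) != X *+ (l ^ k.-1)) ->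
  exists2 i, (i < m)%N & logn l (n i) = k.
Proof.
move=> [n0 cD cI cS] pl k0 Xk noY; apply: contrapT => no.
have lk j : (0 < l ^ j)%N by rewrite expn_gt0 prime_gt0.
have tX : tors X by exists (l ^ k)%N.
have tM (x : V) j : tors x -> tors (x *+ j).
  by move=> tx; elim: j => [|j IH]; rewrite ?mulr0n ?mulrS; [exact: tors0 | exact: torsD].
have c00 i : (i < m)%N -> c 0 i = 0 %[mod n i].
  move=> im; have := cD _ _ (tors0 V) (tors0 V) i im; rewrite addr0 => /eqP.
  by rewrite -[in X in X == _](addn0 (c 0 i)) eqn_modDl eq_sym => /eqP.
have cM x j i : tors x -> (i < m)%N -> c (x *+ j) i = j * c x i %[mod n i].
  move=> tx im; elim: j => [|j IH]; first by rewrite mulr0n c00.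
  by rewrite mulrS cD //; [rewrite mulSn -modnDmr IH modnDmr | exact: tM].
(* In each coordinate one solves l^k y = l^(k-1) c(X) modulo n_i. If l^k does not divide n_i, the
   right side is 0, because the part of n_i prime to l divides c(X). If l^(k+1) divides n_i, then l
   divides c(X). The solutions form a point Y that the hypothesis excludes. *)
have ex i : exists y, (i < m)%N -> (l ^ k * y = l ^ k.-1 * c X i %[mod n i])%N.
  case: (ltnP i m) => im; last by exists 0%N. have dv : (n i %| l ^ k * c X i)%N.
    by rewrite /dvdn -cM // Xk c00 // mod0n.
  have [w ndw nE] := pfactor_coprime pl (n0 i). have /eqP vk : logn l (n i) != k by apply/eqP => e; apply: no; exists i.
  have [vl|vl] := ltnP (logn l (n i)) k.
    have wc : (w %| c X i)%N.
      rewrite -(@Gauss_dvdr w (l ^ k)); last by rewrite coprime_sym coprimeXl. by apply: dvdn_trans dv; rewrite nE dvdn_mulr.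
    have D : (n i %| l ^ k.-1 * c X i)%N.
      by rewrite nE mulnC dvdn_mul // dvdn_exp2l // -ltnS prednK.
    by exists 0%N => _; rewrite muln0 mod0n; apply/esym/eqP.
  have /dvdnP[z zE] : (l %| c X i)%N.
    have : (l ^ k.+1 %| l ^ k * c X i)%N.
      apply: dvdn_trans dv; rewrite nE dvdn_mull // dvdn_exp2l // ltn_neqAle vl andbT. by apply/eqP => e; apply: vk.
    by rewrite expnSr dvdn_pmul2l.
  by exists z => _; rewrite zE -{1}(prednK k0) expnSr -mulnA [(l * z)%N]mulnC.
have [y yP] := choice ex; have [Y tY YP] := cS y.
case/eqP: (noY Y); apply: cI; [exact: tM | exact: tM | move=> i im].
by rewrite !cM // -yP // -modnMmr YP // modnMmr.
Qed.

(* Countability of the primes of K *)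
From mathcomp Require Import finmap boolp classical_sets functions cardinality reals complex.
Section PrimesAbove.
Variable K : fieldExtType rat.
Implicit Type P Q : finite_prime K.

Lemma ordXz P x (n : int) : x != 0 -> P (x ^ n) = P x * n.
Proof.
move=> x0; case: n => n; first by rewrite -exprnP ordX // -mulr_natr natz.
by rewrite NegzE -exprnN ordV ?expf_neq0 // ordX // mulrN -mulr_natr natz.
Qed.

Lemma finite_prime_eq P Q : (P : K -> int) =1 Q -> P = Q.
Proof.
case: P Q => [P P0 PM PD PU] [Q Q0 QM QD QU] /= /funext e; subst Q.
by congr FinitePrime; exact: Prop_irrelevance.
Qed.

Lemma natK_neq0 n : prime n -> n%:R != 0 :> K.
Proof. by case: n => // n _; exact: natr_neq0. Qed.

(** The implication, applied to products of powers of x and p, forces the two valuations to be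
    proportional; normalization makes them equal. *)
Lemma primes_comparable P Q p : prime p -> 0 < P p%:R -> 0 < Q p%:R ->
  (forall x, x != 0 -> 0 < P x -> 0 <= Q x) -> P = Q.
Proof.
move=> pp Pp Qp PQ; have p0 := natK_neq0 pp.
set e := P p%:R in Pp *; set e' := Q p%:R in Qp *.
have half x : x != 0 -> P x * e' <= e * Q x.
  move=> x0; rewrite leNgt; apply/negP => lt.
  have y0 : x ^ (e * (e' + 1)) * p%:R ^ (- P x * (e' + 1) + 1) != 0 :> K by rewrite mulf_neq0 // expfz_neq0.
  have := PQ _ y0; rewrite !ordM ?expfz_neq0 // !ordXz // -/e -/e'.
  have -> : P x * (e * (e' + 1)) + e * (- P x * (e' + 1) + 1) = e by ring. move=> /(_ Pp).
  have -> : Q x * (e * (e' + 1)) + e' * (- P x * (e' + 1) + 1) = (e * Q x - P x * e') * (e' + 1) + e' by ring.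
  by apply/negP; rewrite -ltNge; nia.
have eqn x : x != 0 -> P x * e' = e * Q x.
  move=> x0; apply/eqP; rewrite eq_le half //=. by have := half x^-1; rewrite invr_eq0 !ordV // => /(_ x0); lia.
have [y y0 yP] := ord_uniformizer P; have [z z0 zQ] := ord_uniformizer Q.
have h1 := eqn y y0; have h2 := eqn z z0; rewrite yP mul1r in h1; rewrite zQ mulr1 in h2.
have Qy : Q y = 1.
  move: (P z) (Q y) h1 h2 => a b; clearbody e e' => h1 h2. have b0 : 0 < b by rewrite -(pmulr_rgt0 _ Pp) -h1.
  have a0 : 0 < a by rewrite -(pmulr_lgt0 _ Qp) h2. have /eqP : e * (a * b - 1) = 0 by rewrite mulrBr mulr1 mulrCA -h1 h2 subrr.
  by rewrite mulf_eq0 gt_eqF //= => /eqP; nia.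
apply: finite_prime_eq => x; have [->|x0] := eqVneq x 0; first by rewrite !Defs.ord0.
by have := eqn x x0; rewrite h1 Qy mulr1 mulrC => /(mulfI _)->//; lia.
Qed.

Lemma primes_separate p n (Ps : nat -> finite_prime K) Q : prime p -> 0 < Q p%:R ->
  (forall i, (i < n)%N -> 0 < Ps i p%:R /\ Ps i <> Q) ->
  exists x, [/\ x != 0, 0 < Q x & forall i, (i < n)%N -> Ps i x < 0].
Proof.
move=> pp Qp; elim: n => [|n IH] h.
  by have [x x0 x1] := ord_uniformizer Q; exists x; split=> //; rewrite x1.
have [|x [x0 xQ xP]] := IH; first by move=> i ni; apply: h; rewrite ltnW.
have [z [z0 zQ zP]] : exists z, [/\ z != 0, 0 < Q z & Ps n z < 0].
  have [Pp ne] := h n (ltnSn n); apply: contrapT => no; apply: ne; apply/esym.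
  by apply: (primes_comparable pp) => // y y0 yQ; rewrite leNgt; apply/negP => yP; apply: no; exists y.
pose N := (\sum_(i < n) `|Ps i z|).+1%N.
have big i : (i < n)%N -> Ps i z + Ps i x *+ N < 0.
  move=> ni; have := xP i ni; have : (`|Ps i z| < N)%N by rewrite ltnS (bigD1 (Ordinal ni)) //= leq_addr.
  by rewrite -mulr_natr; move: (N) => M; nia.
have xN0 : x ^+ N != 0 by rewrite expf_neq0.
(* If x already has a pole at the new prime it is kept. If x has a zero there, z is multiplied by 1
   + x^N, which has order 0 where x has a zero and behaves like x^N where x has a pole. If x has
   order 0 there, z is multiplied by x^N. *)
case: (ltgtP (Ps n x) 0) => [xn|xn|xn].
- by exists x; split=> // i; rewrite ltnS leq_eqVlt => /orP[/eqP->|/xP].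
- have one P : 0 < P x -> 1 + x ^+ N != 0 /\ P (1 + x ^+ N) = 0.
    move=> Px; have := @ord_add_lt _ P 1 1 (x ^+ N); rewrite Defs.ord1 oner_eq0 => -[] //.
    by rewrite ord_geE // ordX // -mulr_natr; nia.
  have [w0 wQ] := one Q xQ; have [_ wn] := one _ xn. exists (z * (1 + x ^+ N)); split; rewrite ?mulf_neq0 ?ordM ?wQ ?addr0 // => i.
  rewrite ltnS leq_eqVlt ordM // => /orP[/eqP->|ni]; first by rewrite wn addr0. rewrite addrC [1 + _]addrC.
  have [|_ ->] := @ord_add_lt _ (Ps i) 0 (x ^+ N) 1 xN0 _ (ord_ge1 _); last by rewrite addrC ordX // big.
  by rewrite ordX // -mulr_natr; have := xP i ni; nia.
exists (z * x ^+ N); split; rewrite ?mulf_neq0 //.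
  by rewrite ordM // ordX // addr_gt0 // pmulrn_lgt0.
move=> i; rewrite ltnS leq_eqVlt ordM // ordX // => /orP[/eqP->|/big//].
by rewrite xn mul0rn addr0.
Qed.

Lemma ord_prime_to P p (c : int) : prime p -> 0 < P p%:R -> ~~ (p%:Z %| c)%Z -> c%:~R != 0 :> K /\ P c%:~R = 0.
Proof.
move=> pp Pp ci; have ci0 : c%:~R != 0 :> K by rewrite intr_eq0K; apply: contra ci => /eqP->; rewrite dvdz0.
split=> //; have [u [v uv]] : exists u v, u * c + v * p%:Z = 1.
  have /coprimezP[[u v] /= e] : coprimez c p by rewrite coprimez_sym coprimezE /= prime_coprime // -dvdzE. by exists u, v.
apply/eqP; rewrite eq_le; have := ord_int P c; rewrite ord_geE // => ->; rewrite andbT leNgt; apply/negP => gt.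
have : ord_ge P 1 1.
  rewrite -[X in ord_ge _ _ X](_ : (u * c + v * p%:Z)%:~R = 1); last by rewrite uv.
  rewrite rmorphD !rmorphM; apply: ord_geD; rewrite -[1]add0r; apply: ord_geM; rewrite ?ord_int //.
    by rewrite ord_geE // -gtz0_ge1.
  by rewrite ord_geE ?natK_neq0 // -gtz0_ge1.
by rewrite ord_geE ?oner_eq0 // Defs.ord1.
Qed.

Lemma prime_below_unique P p p' : prime p -> prime p' -> 0 < P p%:R -> 0 < P p'%:R -> p = p'.
Proof.
move=> pp pp' Pp Pp'; apply/eqP; rewrite -dvdn_prime2 //; apply: contraLR Pp' => np.
by have [] := @ord_prime_to P p p' pp Pp np => _ e; rewrite -pmulrn in e; rewrite e.
Qed.

(** With more than dim K primes above p there would be elements y_i of order 0 at the i-th prime and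
    of positive order at the others. An integral relation between dim K + 1 of them with a
    coefficient prime to p contradicts the orders at the prime of that coefficient. *)
Lemma finite_primes_above p : prime p -> finite_set [set P : finite_prime K | 0 < P p%:R].
Proof.
move=> pp; apply: contrapT => /infiniteP /card_leP /unsquash f.
pose Ps i := sval (f (to_setT i)).
have Pp i : 0 < Ps i p%:R by have := svalP (f (to_setT i)); rewrite inE.
have Pinj i j : Ps i = Ps j -> i = j.
  move=> e; have : f (to_setT i) = f (to_setT j) by apply: val_inj. by move/(@inj _ _ _ f); rewrite !inE => /(_ I I) /(congr1 val).
pose d := \dim {:K}.
have ex i : exists y, (i <= d)%N -> [/\ y != 0, Ps i y = 0 & forall j, (j <= d)%N -> j != i -> 0 < Ps j y].
  have [|x [x0 xi xj]] := @primes_separate p (d.+1 + i) (fun j => if j == i then Ps (d.+1 + i).+1%N else Ps j) (Ps i) pp (Pp i).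
    move=> j jd; case: ifP => [_|/eqP ne]; split=> // /Pinj; last by []. by clearbody d; lia.
  have [w0 wi] : 1 + x != 0 /\ Ps i (1 + x) = 0.
    have := @ord_add_lt _ (Ps i) 1 1 x; rewrite Defs.ord1 oner_eq0 => -[] //. by rewrite ord_geE // -gtz0_ge1.
  exists (1 + x)^-1 => id; split; [by rewrite invr_eq0 | by rewrite ordV // wi oppr0 | move=> j jd ji].
  rewrite ordV // oppr_gt0; have := xj j; rewrite (negPf ji) => xj'.
  have xj0 : Ps j x < 0 by apply: xj'; rewrite addSn ltnS (leq_trans jd) // leq_addr.
  by rewrite addrC; have [_ ->] := @ord_add_lt _ (Ps j) 0 x 1 x0 xj0 (ord_ge1 _).
have [y yP] := choice ex.
have [|c [[i si ci] c0]] := @dep_int_prim K (mkseq y d.+1) p pp; first by rewrite size_mkseq.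
rewrite size_mkseq in c0 si.
have [ci0 cp] := ord_prime_to pp (Pp i) ci.
have [yi0 yi1 _] := yP i si.
have : y i *~ c i = - \sum_(j < d.+1 | j != i :> nat) (y j *~ c j).
  apply/eqP; rewrite -addr_eq0 -[X in _ == X]c0 [X in _ == X](bigD1 (Ordinal si)) //= nth_mkseq //.
  by apply/eqP; congr (_ + _); apply: eq_bigr => j _; rewrite nth_mkseq.
move=> /(congr1 (ord_ge (Ps i) 1)); rewrite ord_geN ord_ge_sum.
  by rewrite -mulrzl ord_geE ?mulf_neq0 // ordM // cp yi1.
move=> j ji; have [yj0 _ yj] := yP j (ltn_ord j).
by apply: ord_geZ; rewrite ord_geE // -gtz0_ge1 yj // eq_sym.
Qed.

(** In an integral relation between powers of a uniformizer the first nonzero coefficient has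
    positive order, hence so has one of its prime factors. *)
Lemma prime_below P : exists2 p, prime p & 0 < P p%:R.
Proof.
have [n0 [n0g nP]] : exists n, (0 < n)%N /\ 0 < P n%:R.
  have [x x0 x1] := ord_uniformizer P. have [|c [[i si ci] c0]] := @dep_int K [seq x ^+ j | j <- iota 0 (\dim {:K}).+1].
    by rewrite size_map size_iota.
  rewrite size_map size_iota in c0 si. pose Z j := `[< (j <= \dim {:K})%N /\ c j != 0 >].
  have exZ : exists j, Z j by exists i; apply/asboolP. have [j /asboolP[jd cj] minj] := ex_minnP exZ.
  have nthE (t : 'I_(\dim {:K}).+1) : [seq x ^+ j | j <- iota 0 (\dim {:K}).+1]`_t = x ^+ t.
    by rewrite (nth_map 0%N) ?size_iota // nth_iota.
  have {}c0 : \sum_(t < (\dim {:K}).+1) x ^+ t *~ c t = 0.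
    by rewrite -[RHS]c0; apply: eq_bigr => t _; rewrite nthE.
  have cj0 : (c j)%:~R != 0 :> K by rewrite intr_eq0K. suff : ord_ge P (j%:Z + 1) (x ^+ j *~ c j).
    rewrite -mulrzl ord_geE ?mulf_neq0 ?expf_neq0 // ordM ?expf_neq0 // ordX // x1.
    rewrite (natz j) [P _ + _]addrC lerD2l => h; exists `|c j|%N; rewrite absz_gt0; split=> //.
    by move: h; case: (c j) => m; rewrite ?NegzE ?mulrNz ?ordN -gtz0_ge1.
  have -> : x ^+ j *~ c j = - \sum_(t < (\dim {:K}).+1 | t != j :> nat) (x ^+ t *~ c t).
    apply/eqP; rewrite -addr_eq0 -[X in _ == X]c0 [X in _ == X](bigD1 (Ordinal (jd : (j < (\dim {:K}).+1)%N))) /=; exact/eqP.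
  rewrite ord_geN; apply: ord_ge_sum => t tj. have [tj'|jt] := ltnP t j.
    have [->|ct] := eqVneq (c t) 0; first by rewrite mulr0z ord_ge0. have : Z t by apply/asboolP; rewrite -ltnS.
    by move/minj; rewrite leqNgt tj'.
  apply: ord_geZ; rewrite ord_geE ?expf_neq0 // ordX // x1 natz. by rewrite -PoszD addn1 lez_nat ltn_neqAle eq_sym tj.
apply: contrapT => no; have : P n0%:R <= 0.
  move: n0g {nP}; elim/ltn_ind: n0 => n IH n0. have [->|n1] := eqVneq n 1%N; first by rewrite Defs.ord1.
  have pd : prime (pdiv n) by rewrite pdiv_prime // ltn_neqAle eq_sym n1. rewrite -(divnK (pdiv_dvd n)) natrM.
  have q0 : (0 < n %/ pdiv n)%N by rewrite divn_gt0 ?pdiv_gt0 // dvdn_leq // pdiv_dvd.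
  have qn0 : (n %/ pdiv n)%:R != 0 :> K by case: (_ %/ _)%N q0 => // m _; exact: natr_neq0.
  have a : P (n %/ pdiv n)%:R <= 0 by rewrite IH // ltn_Pdiv // prime_gt1.
  have b : P (pdiv n)%:R <= 0 by rewrite leNgt; apply/negP => h; apply: no; exists (pdiv n).
  by rewrite ordM ?qn0 ?(natK_neq0 pd) // -oppr_ge0 opprD addr_ge0 ?oppr_ge0.
by rewrite leNgt nP.
Qed.

Lemma finite_primes_countable : countable [set: finite_prime K].
Proof.
pose B := (\bigcup_(p in [set p | prime p]) [set P : finite_prime K | 0 < P p%:R])%classic.
have sB : ([set: finite_prime K] `<=` B)%classic by move=> P _; have [p pp Pp] := prime_below P; exists p.
apply: sub_countable (subset_card_le sB) _.
by apply: bigcup_countable => // p pp; apply/finite_set_countable/finite_primes_above.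
Qed.

(** An embedding is determined by the image of a generator of K, which is among the roots of one
    polynomial. *)
Lemma infinite_primes_countable (R : realType) : countable [set: infinite_prime R K].
Proof.
have [t tP] := primitive_element K.
pose s := [seq t ^+ j | j <- iota 0 (\dim {:K}).+1].
have nthE j : (j < (\dim {:K}).+1)%N -> s`_j = t ^+ j.
  by move=> jd; rewrite (nth_map 0%N) ?size_iota // nth_iota.
have [|c [[i si ci] c0]] := @dep_int K s; first by rewrite size_map size_iota.
rewrite size_map size_iota in c0 si.
pose q : {poly R[i]} := \poly_(j < (\dim {:K}).+1) (c j)%:~R.
have q0 : q != 0.
  by apply/eqP => /(congr1 (fun r : {poly _} => r`_i)); rewrite coef_poly si coef0 => /eqP; rewrite intr_eq0 (negPf ci).
have [rs rsE] := closed_field_poly_normal q.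
pose sg (w : infinite_prime R K) := sval (cid (absvP w)).
have sgP (w : infinite_prime R K) x : w x = complex.Re `|sg w x| := svalP (cid (absvP w)) x.
have inr w : sg w t \in rs.
  rewrite -root_prod_XsubC -(rootZ _ _ (_ : lead_coef q != 0)) ?lead_coef_eq0 // -rsE rootE.
  have := congr1 (sg w) c0; rewrite rmorph0 rmorph_sum => e0.
  rewrite /q horner_poly -[X in _ == X]e0; apply/eqP; apply: eq_bigr => j _. by rewrite nthE // rmorphMz rmorphXn mulrzl.
apply/countable_injP; exists (fun w => index (sg w t) rs) => w w' _ _ e.
have {}e : sg w t = sg w' t by rewrite -(nth_index 0 (inr w)) e nth_index.
have : (w : K -> R) = w'.
  apply/funext => x; have [u ->] := tP x. by rewrite !sgP -!horner_map /= !map_in_alg e.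
case: w w' {e} => [a aP] [b bP] /= ab; subst b; congr InfinitePrime; exact: Prop_irrelevance.
Qed.

Lemma embedding_exists : exists iota : {rmorphism K -> algC}, True.
Proof.
have [t tP] := primitive_element K.
have /polyOver1P[q qE] := minPolyOver 1 t.
have [|z qz] := @closed_rootP algC (pQC q) _.
  rewrite size_map_poly -(size_map_poly (in_alg K)) -qE size_minPoly; exact/eqP.
pose W x := sval (cid (tP x)); have WP x : x = (map_poly (in_alg K) (W x)).[t] := svalP (cid (tP x)).
pose phi x := (pQC (W x)).[z].
have phiE x (w : {poly rat}) : x = (map_poly (in_alg K) w).[t] -> phi x = (pQC w).[z].
  rewrite {1}(WP x) => e; have : root (map_poly (in_alg K) (W x - w)) t.
    by rewrite rootE rmorphB hornerD hornerN e subrr.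
  move/(minPoly_dvdp (_ : _ \is a polyOver 1%VS)) => /(_ _)/wrap[|]; first by apply/polyOver1P; exists (W x - w).
  rewrite qE dvdp_map => /dvdpP[r rE]; apply/eqP; rewrite -subr_eq0 -hornerN -hornerD -rmorphB rE.
  by rewrite rmorphM hornerM (eqP qz) mulr0.
have zm : zmod_morphism phi.
  move=> x y; rewrite (phiE _ (W x - W y)) ?rmorphB ?hornerD ?hornerN //=. by rewrite -!WP.
have mm : GRing.monoid_morphism phi.
  split; first by rewrite (phiE 1 1) rmorph1 ?hornerC // rmorph1 hornerC.
  by move=> x y; rewrite (phiE _ (W x * W y)) ?rmorphM ?hornerM //= -!WP.
pose m1 := GRing.isZmodMorphism.Build K algC phi zm.
pose m2 := GRing.isMonoidMorphism.Build K algC phi mm.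
by exists (HB.pack phi m1 m2 : {rmorphism K -> algC}).
Qed.

End PrimesAbove.

(** * The standard representation of the torsion closure and the conclusion *)

Lemma eqmod_logn N a b : (0 < N)%N -> (forall l, prime l -> a = b %[mod l ^ logn l N]) -> a = b %[mod N].
Proof.
wlog ba : a b / (b <= a)%N => [wl N0 h|N0 h].
  by have [/wl->//|/ltnW/wl->//] := leqP b a => l pl; rewrite h.
apply/eqP; rewrite eqn_mod_dvd //; apply/(dvdn_partP _ N0) => l.
by rewrite mem_primes p_part -eqn_mod_dvd // => /andP[pl _]; apply/eqP/h.
Qed.

Lemma Zp_natP p a b : (1 < p)%N -> (a = b %[mod p] <-> a%:R = b%:R :> 'Z_p).
Proof. by move=> p1; split=> [e|/(congr1 val)]; [apply: val_inj|]; rewrite /= !val_Zp_nat. Qed.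

(** Each Z/N_j is split by the Chinese remainder theorem; its l-part belongs to the prime power q =
    (l, logn l (N j)). The map h enumerates the j that belong to q, by a finite ordinal or, as I is
    countable, by nat. *)
Lemma standard_of_coordinates (G I : Type) (add : G -> G -> G) (T : set G) (N : I -> nat) (C : G -> I -> nat) :
  countable [set: I] -> (forall j, (0 < N j)%N) ->
  (forall x y, T x -> T y -> T (add x y) /\ forall j, C (add x y) j = C x j + C y j %[mod N j]) ->
  (forall x y, T x -> T y -> (forall j, C x j = C y j %[mod N j]) -> x = y) ->
  (forall r : I -> nat, exists2 x, T x & forall j, C x j = r j %[mod N j]) ->
  exists2 e, standard_representation add T e &
    forall q, infinite_set [set j | logn (pp_prime q) (N j) = pp_exp q] -> e q = None.
Proof.
move=> cI N0 CD CI CS; pose J q := [set j | logn (pp_prime q) (N j) = pp_exp q]%classic.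
have q1 (q : prime_power) : (1 < pp_prime q ^ pp_exp q)%N.
  by have /andP[pl k0] := valP q; rewrite -(exp1n (pp_exp q)) ltn_exp2r // prime_gt1.
have ex q : exists e : Defs.exponent, exists h : exponent_index e -> I,
    [/\ injective h, forall j, J q j <-> exists i, h i = j & infinite_set (J q) -> e = None].
  have mk (e : Defs.exponent) (B : set nat) (u : exponent_index e -> nat) : injective u -> (forall k, B k <-> exists i, u i = k) ->
      (J q #= B)%card -> exists h : exponent_index e -> I, injective h /\ forall j, J q j <-> exists i, h i = j.
    move=> ui uB /card_set_bijP[f [fB /= fi fs]]. have pre i : exists j, J q j /\ f j = u i.
      by have [j Jj e1] := fs (u i) (proj2 (uB _) (ex_intro _ i erefl)); exists j.
    have [h hP] := choice pre; exists h; split.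
      by move=> i i' e1; apply: ui; rewrite -(hP i).2 -(hP i').2 e1.
    move=> j; split=> [Jj|[i <-]]; last by have [] := hP i. have [i iE] := proj1 (uB _) (fB j Jj); exists i.
    by apply: fi; rewrite ?inE; [have [] := hP i | | rewrite (hP i).2].
  case: (pselect (finite_set (J q))) => [fin|inf].
    have [n nJ] := fin. have uB k : (`I_n)%classic k <-> exists i : 'I_n, nat_of_ord i = k.
      by split=> [kn|[i <-]] /=; [exists (Ordinal kn) | exact: ltn_ord].
    by have [h [hi hJ]] := mk (Some n) _ (@nat_of_ord n) (@ord_inj n) uB nJ; exists (Some n), h.
  have cJ : countable (J q) by apply: sub_countable (subset_card_le (@subsetT _ _)) cI.
  have uB (k : nat) : [set: nat]%classic k <-> exists i : nat, i = k by split=> // _; exists k.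
  by have [h [hi hJ]] := mk None _ (fun k => k) (fun _ _ e => e) uB (eq_card_nat cJ inf); exists None, h.
have [e eP] := choice ex; pose h q := sval (cid (eP q)).
have hP q : [/\ injective (h q), forall j, J q j <-> exists i, h q i = j & infinite_set (J q) -> e q = None] := svalP (cid (eP q)).
have hJ q i : logn (pp_prime q) (N (h q i)) = pp_exp q by have [_ hq _] := hP q; apply/(hq (h q i)); exists i.
have hdv q i : (pp_prime q ^ pp_exp q %| N (h q i))%N by rewrite -(hJ q i) pfactor_dvdnn.
have modq q i a b : a = b %[mod N (h q i)] -> a = b %[mod pp_prime q ^ pp_exp q].
  by move=> ab; rewrite -(modn_dvdm a (hdv q i)) ab modn_dvdm.
exists e; last by move=> q; have [] := hP q.
exists (fun x q i => (C x (h q i))%:R); split; last first.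
  move=> x y Tx Ty; have [Txy Cxy] := CD x y Tx Ty; split=> // q i. by rewrite -natrD; apply/Zp_natP => //; apply: modq.
split=> // [x y /set_mem Tx /set_mem Ty exy|s _].
  apply: CI => // j; apply: eqmod_logn => // l pl. have [->|k0] := posnP (logn l (N j)); first by rewrite expn0 !modn1.
  have qP : prime (l, logn l (N j)).1 && (0 < (l, logn l (N j)).2)%N by rewrite /= pl.
  pose q : prime_power := exist _ (l, logn l (N j)) qP. have [_ hq _] := hP q; have [i <-] : exists i, h q i = j by apply/(hq j).
  have := congr1 (fun g : standard_group e => g q i) exy => /= /(Zp_natP _ _ (q1 q)). by rewrite (hJ q i).
(* The prescribed l-part at the index j; at most one pair (q, i) refers to it, so the value is well
   defined. *)
have exw (lj : nat * I) : exists v, forall q i, pp_prime q = lj.1 -> h q i = lj.2 -> v = s q i :> nat.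
  case: lj => l j /=; case: (pselect (exists q, exists i, pp_prime q = l /\ h q i = j)) => [[q [i [ql hj]]]|no]; last first.
    by exists 0%N => q i ql hj; case: no; exists q, i.
  exists (s q i) => q' i' q'l hj'; have qq : q' = q.
    apply: val_inj; rewrite [LHS]surjective_pairing [RHS]surjective_pairing.
    rewrite -[(val q').1]/(pp_prime q') -[(val q').2]/(pp_exp q') -(hJ _ i') -[(val q).1]/(pp_prime q) -[(val q).2]/(pp_exp q) -(hJ _ i).
    by rewrite hj hj' ql q'l.
  by subst q'; have [hi _ _] := hP q; rewrite -(hi i i') // hj'.
have [w wP] := choice exw.
have [r rP] := choice (fun j => crt_family (fun l => w (l, j)) (N0 j)).
have [x Tx xr] := CS r; exists x => //.
apply: functional_extensionality_dep => q; apply/funext => i; apply: val_inj; rewrite /= val_Zp_nat //.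
have /andP[pq _] := valP q.
have e1 := rP (h q i) _ pq; rewrite hJ in e1.
rewrite (modq _ _ _ _ (xr (h q i))) e1 (wP _ q i) // modn_small //.
by have := ltn_ord (s q i); rewrite [X in (_ < X)%N]Zp_cast.
Qed.

Section Adelic.
Variables (R : realType) (K : fieldExtType rat) (E : elliptic_curve K) (iota : {rmorphism K -> algC}).
Local Notation EK := (short_curve (@natr_neq0 K) (ec_smooth E)).
Local Notation EC := (push_curve iota EK).

Lemma completion_char0 (P : finite_prime K) n : n.+1%:R != 0 :> completion P.
Proof. by rewrite -(rmorph_nat (@to_completion K P)) fmorph_eq0 natr_neq0. Qed.

Lemma local_smooth (P : finite_prime K) : discriminant (map_weierstrass (@to_completion K P) E) != 0.
Proof. by rewrite (discriminant_map (@to_completion K P)) fmorph_eq0 ec_smooth. Qed.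

Definition local_curve P := short_curve (completion_char0 P) (local_smooth P).
Definition local_pt P : local_points E P -> spoint (local_curve P) := pt_to_short (completion_char0 P) (local_smooth P).

Lemma local_coordinates P : exists m n c, @coordinate_system (spoint (local_curve P)) m n c.
Proof.
have [p pp Pp] := prime_below P.
have sp n : (0 < n)%N -> mul_spec (local_curve P) n.
  apply: (@mul_spec_of_algC _ _ iota (@to_completion K P) EK EC (local_curve P)) => //.
    exact: short_a_map.
  exact: short_b_map.
have vp : 0 < cprime P p%:R by rewrite -(rmorph_nat (@to_completion K P)) cprime_const.
have [T TP] := finite_torsion sp (completion_char0 P) pp vp (residue_cover pp Pp).
by apply: (@torsion_coordinates _ T) => x j; exact: TP.
Qed.

Let m P := sval (cid (local_coordinates P)).
Let exn P := svalP (cid (local_coordinates P)).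
Let n P := sval (cid (exn P)).
Let exc P := svalP (cid (exn P)).
Let c P := sval (cid (exc P)).
Let cP P := svalP (cid (exc P)).

Let index := (finite_prime K * nat + infinite_prime R K)%type.

(** Order 1 fills the indices beyond the number of coordinates at P and the infinite primes with
    trivial factor, so that one index type serves all primes. *)
Let order (j : index) : nat := match j with
  | inl (P, i) => if (i < m P)%N then n P i else 1%N
  | inr w => if pselect (real_positive E w) then 2%N else 1%N end.

Let coord (x : adelic_product R E) (j : index) : nat := match j with
  | inl (P, i) => c (local_pt (x.1 P)) i
  | inr w => x.2 w end.

Lemma index_countable : countable [set: index].
Proof.
have /countable_injP[f fi] := finite_primes_countable K.
have /countable_injP[g gi] := infinite_primes_countable K R.
apply/countable_injP; exists (fun j : index => choice.pickle (match j with
  inl (P, i) => inl (f P, i) | inr w => inr (g w) end : (nat * nat + nat)%type)).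
by move=> [[P i]|w] [[P' i']|w'] _ _ /(pcan_inj choice.pickleK) // [];
  [rewrite -[f P]/(f P) => e1 ->; rewrite (fi P P') ?inE | move=> e1; rewrite (gi w w') ?inE].
Qed.

Lemma torsion_closure_standard : exists2 e, standard_representation (@adelic_add R K E) (@torsion_closure R K E) e &
  forall q, infinite_set [set j | logn (pp_prime q) (order j) = pp_exp q] -> e q = None.
Proof.
have tP (P : finite_prime K) (X : local_points E P) : point_torsion X <-> tors (local_pt X) by exact: torsion_short.
have pD (P : finite_prime K) (X Y : local_points E P) : local_pt (point_add X Y) = local_pt X + local_pt Y by exact: pt_to_short_add.
apply: (@standard_of_coordinates _ _ _ _ order coord).
- exact: index_countable.
- by move=> [[P i]|w] /=; [case: ifP => // _; case: (cP P) => n0 _ _ _; exact: n0 | case: pselect].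
- move=> x y [xt x0] [yt y0]; split.
    split=> [P|w nw] /=; last by rewrite x0 // y0 // addr0. by apply/tP; rewrite pD; apply: torsD; apply/tP.
  move=> [[P i]|w] /=; last by case: pselect => h; rewrite ?modn1 // modn_mod. case: ifP => im; last by rewrite !modn1.
  by have [_ cD _ _] := cP P; rewrite pD cD //; apply/tP.
- move=> [x1 x2] [y1 y2] [/= xt x0] [/= yt y0] exy; congr pair.
    apply: functional_extensionality_dep => P; apply: (pt_to_short_inj (nz := completion_char0 P) (dW := local_smooth P)).
    have [_ _ cI _] := cP P; apply: cI; [exact/tP | exact/tP | move=> i im]. by have := exy (inl (P, i)); rewrite /= im.
  apply/funext => w; have := exy (inr w); rewrite /=; case: pselect => h; last by rewrite x0 // y0.
  by rewrite !modn_small ?ltn_ord // => e; apply: val_inj.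
move=> r.
have ex1 P : exists X : local_points E P, point_torsion X /\ forall i, (i < m P)%N -> c (local_pt X) i = r (inl (P, i)) %[mod n P i].
  have [_ _ _ cS] := cP P; have [Y tY YP] := cS (fun i => r (inl (P, i))).
  have [X XY] := pt_to_short_surj (Y : spoint (short_curve (completion_char0 P) (local_smooth P))).
  by exists X; split; [apply/tP; rewrite /local_pt XY | rewrite /local_pt XY].
exists (fun P => sval (cid (ex1 P)), fun w => if pselect (real_positive E w) then (r (inr w))%:R else 0).
  split=> [P|w nw] /=; first by have [] := svalP (cid (ex1 P)). by case: pselect.
move=> [[P i]|w] /=.
  by case: ifP => im; rewrite ?modn1 //; have [_ ->] := svalP (cid (ex1 P)).
by case: pselect => h; rewrite ?modn1 // val_Zp_nat // modn_mod.
Qed.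

(** Finitely many indices would have finitely many residue characteristics, while [local_rank]
    supplies a prime above some p larger than their sum. *)
Lemma order_infinite l k (s : {rmorphism algC -> algC}) : prime l -> (0 < k)%N ->
  fixK iota s -> galois_fixes s EC (l ^ k) -> ~ galois_fixes s EC (l ^ k.+1) ->
  infinite_set [set j | logn l (order j) = k].
Proof.
move=> pl k0 sK sfix smove fin.
pose below (j : index) : nat := if j is inl (P, _) then xget 0%N [set p | prime p /\ 0 < P p%:R]%classic else 0%N.
have /finite_seqP[t tE] := finite_image below fin.
have [P [p [pp Bp Pp eP]]] := local_rank pl k0 (erefl : sa EC = iota (short_a E)) (erefl : sb EC = iota (short_b E)) sK sfix smove (\sum_(x <- t) x)%N.
have Pp0 : 0 < P p%:R by move: Pp; rewrite ord_geE ?natK_neq0 // gtz0_ge1.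
have [X Xk noY] := eP (local_curve P) (short_a_map _ _) (short_b_map _ _).
have [i im ik] := coordinate_of_order (cP P) pl k0 Xk noY.
have : (below @` [set j | logn l (order j) = k])%classic p.
  exists (inl (P, i)); first by rewrite /= im.
  rewrite /below; case: xgetP => [p' _ [pp' Pp']|/(_ p)]; first exact: (prime_below_unique pp' pp Pp' Pp0). by case.
rewrite tE /= => pt; move: Bp; rewrite (big_rem p) //= ltnNge leq_addr.
by [].
Qed.

End Adelic.

Theorem theorem5p4 (R : realType) (K : fieldExtType rat) :
  exists Sigma : {fset prime_power},
    (forall q : prime_power, q \in Sigma ->
       ((pp_prime q)%:Z %| 2 * disc K)%Z) /\
    (forall (E : elliptic_curve K) (q : prime_power), q \notin Sigma ->
       infinite_rank (@adelic_add R K E) (@torsion_closure R K E) q).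
Proof.
have [iota _] := embedding_exists K; have [T [[B TB] Tdv TP]] := galois_witness iota.
(* [T l] is 0 for l > B, so all pairs with k < T l occur in L; [insub] drops those that are not
   prime powers larger than 1. *)
pose L := [seq (l, k) | l <- seq.iota 0 B.+1, k <- seq.iota 0 (T l)].
exists [fset q in seq.pmap (insub : nat * nat -> option prime_power) L]%fset.
have SP (q : prime_power) : (q \in [fset q in seq.pmap (insub : nat * nat -> option prime_power) L]%fset) = (pp_exp q < T (pp_prime q))%N.
  rewrite !inE mem_pmap_sub; apply/allpairsPdep/idP => [[l [k [_ kT e]]]|h].
    by move: kT; rewrite mem_iota /pp_exp /pp_prime e.
  exists (pp_prime q), (pp_exp q); split; rewrite ?mem_iota ?add0n //; last exact: surjective_pairing.
  by rewrite ltnNge; apply/negP => /TB T0; rewrite T0 in h.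
split=> [q|E q]; rewrite SP.
  move=> h; apply: Tdv; first by have /andP[] := valP q. by apply/eqP => T0; rewrite T0 in h.
rewrite -leqNgt => Tk; have /andP[pl k0] := valP q.
have [s [sK sf sm]] := TP _ _ (push_curve iota (short_curve (@natr_neq0 K) (ec_smooth E))) _ _ pl k0 Tk erefl erefl.
have [e eS eI] := torsion_closure_standard R E iota; exists e => //.
exact/eI/(order_infinite pl k0 sK sf sm).
Qed.
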